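(* Let $\lambda\ge0$, $p_0=\frac{2\lambda}{2\lambda+1}$, $p_0\le p\le1$ (with $p>0$), $\alpha>0$, and $$m=\left[\frac{\alpha+2\lambda+1}{p}-2\lambda\right],$$ where $[\cdot]$ denotes the integer part. Then each $\mathcal{L}\in(A^{p}_{\lambda,\alpha}(\mathbb{D}))^*$ is uniquely determined by a $\lambda$-analytic function $g$ on $\mathbb{D}$, say $g(z)=\sum_{k=0}^{\infty}b_k\phi_k^\lambda(z)$, satisfying the condition $$\left|(D_z\circ z)^m g(z)\right|\lesssim\frac{|1-z^2|^{2\lambda(p^{-1}-1)}}{(1-|z|)^{m+1-(\alpha+1)/p}},\qquad z\in\mathbb{D},$$ under the pairing duality given by $$\mathcal{L}(f)=\sum_{k=0}^n a_kb_k$$ for all $\lambda$-analytic polynomials $f(z)=\sum_{k=0}^n a_k\phi_k^\lambda(z)$, $n=0,1,\dots$. (That is, for each $\mathcal{L}$ there is a unique such $g$ for which the pairing formula holds, and $g$ determines $\mathcal{L}$.)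
   Context: $\mathbb{D}$ is the open unit disk in $\mathbb{C}$. For $\lambda\ge0$ the Dunkl operators are $$D_zf(z)=\partial_zf+\lambda\frac{f(z)-f(\bar z)}{z-\bar z},\qquad D_{\bar z}f(z)=\partial_{\bar z}f-\lambda\frac{f(z)-f(\bar z)}{z-\bar z}$$ (the quotient being understood as its limit on the real axis). A $C^2$ function $f$ on $\mathbb{D}$ is $\lambda$-analytic if $D_{\bar z}f=0$. Equivalently, $f(z)=\sum_{n\ge0}c_n\phi_n^\lambda(z)$ for $|z|<1$, where $$\phi_n^{\lambda}(z)=\epsilon_n\sum_{j=0}^{n}\frac{(\lambda)_j(\lambda+1)_{n-j}}{j!(n-j)!}\bar z^{j}z^{n-j},\qquad \epsilon_n=\sqrt{n!/(2\lambda+1)_n},$$ and $(a)_j$ is the Pochhammer symbol. A $\lambda$-analytic polynomial is a finite linear combination of the $\phi_n^\lambda$, $n\ge0$. $D_z\circ z$ denotes the operator $g\mapsto D_z(zg(z))$, and $(D_z\circ z)^m$ is its $m$-fold iterate. Let $d\sigma_\lambda(z)=c_\lambda|y|^{2\lambda}\,dx\,dy$ ($z=x+iy$), $c_\lambda=\Gamma(\lambda+2)/(\Gamma(\lambda+1/2)\Gamma(1/2))$. For $\alpha>0$ and $0<p<\infty$, $A^p_{\lambda,\alpha}(\mathbb{D})$ is the set of $\lambda$-analytic functions $f$ on $\mathbb{D}$ with $\|f\|_{A^p_{\lambda,\alpha}}=\left(\int_{\mathbb{D}}|f(z)|^p(1-|z|)^{\alpha-1}d\sigma_\lambda(z)\right)^{1/p}<\infty$.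 Its dual space $(A^p_{\lambda,\alpha}(\mathbb{D}))^*$ consists of all continuous linear functionals on it, with norm $\|\mathcal{L}\|=\sup_{\|f\|_{A^p_{\lambda,\alpha}}=1}|\mathcal{L}(f)|$. $\mathcal{X}\lesssim\mathcal{Y}$ means $\mathcal{X}\le c\,\mathcal{Y}$ with a constant $c>0$ independent of $z$. *)

(* Defs.v *)
From HB Require Import structures.
From mathcomp Require Import all_boot all_order all_algebra.
From mathcomp Require Import complex.
From mathcomp Require Import all_classical all_reals all_analysis.

Set Implicit Arguments.
Unset Strict Implicit.
Unset Printing Implicit Defensive.

Import Order.TTheory GRing.Theory Num.Theory numFieldNormedType.Exports.
Import ComplexField.Normc.

Local Open Scope classical_set_scope.
Local Open Scope ring_scope.
Local Open Scope complex_scope.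

(* Functions on the unit disk are represented by total functions R[i] -> R[i]
   whose values off the disk are irrelevant.  [normc] is the real-valued
   modulus; topological notions on R[i] go through the regular module R[i]^o,
   which carries the topology of the modulus. *)

Section Dunkl.
Variable R : realType.

Definition disk : set R[i] := [set z | normc z < 1].

Definition partial_x (f : R[i] -> R[i]) (z : R[i]) : R[i] :=
  derive1 (fun t : R => complex.Re (f (t +i* complex.Im z))) (complex.Re z) +i*
  derive1 (fun t : R => complex.Im (f (t +i* complex.Im z))) (complex.Re z).

Definition partial_y (f : R[i] -> R[i]) (z : R[i]) : R[i] :=
  derive1 (fun t : R => complex.Re (f (complex.Re z +i* t))) (complex.Im z) +i*
  derive1 (fun t : R => complex.Im (f (complex.Re z +i* t))) (complex.Im z).

Definition has_partials (f : R[i] -> R[i]) (z : R[i]) : Prop :=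
  [/\ derivable (fun t : R => complex.Re (f (t +i* complex.Im z)))
        (complex.Re z) 1,
      derivable (fun t : R => complex.Im (f (t +i* complex.Im z)))
        (complex.Re z) 1,
      derivable (fun t : R => complex.Re (f (complex.Re z +i* t)))
        (complex.Im z) 1 &
      derivable (fun t : R => complex.Im (f (complex.Re z +i* t)))
        (complex.Im z) 1].

Definition continuous_on_disk (f : R[i] -> R[i]) : Prop :=
  forall z, disk z -> {for z, continuous (f : R[i]^o -> R[i]^o)}.

Fixpoint Ck_on_disk (k : nat) (f : R[i] -> R[i]) : Prop :=
  continuous_on_disk f /\
  if k is j.+1 then
    [/\ forall z, disk z -> has_partials f z,
        Ck_on_disk j (partial_x f) & Ck_on_disk j (partial_y f)]
  else True.

Definition d_z (f : R[i] -> R[i]) (z : R[i]) : R[i] :=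
  (partial_x f z - (0 +i* 1) * partial_y f z) / 2.

Definition d_zbar (f : R[i] -> R[i]) (z : R[i]) : R[i] :=
  (partial_x f z + (0 +i* 1) * partial_y f z) / 2.

Definition refl_quotient (f : R[i] -> R[i]) (z : R[i]) : R[i] :=
  (f z - f (conjc z)) / (z - conjc z).

(* On the real axis the quotient reads 0 / 0, so its value there is the limit
   along non-real points. *)
Definition refl_quotient_ext (f : R[i] -> R[i]) (z : R[i]) : R[i] :=
  if complex.Im z == 0
  then lim ((refl_quotient f : R[i]^o -> R[i]^o) @
            within [set w : R[i]^o | complex.Im w != 0] (nbhs (z : R[i]^o)))
  else refl_quotient f z.

Definition dunkl_z (lambda : R) (f : R[i] -> R[i]) (z : R[i]) : R[i] :=
  d_z f z + lambda%:C * refl_quotient_ext f z.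

Definition dunkl_zbar (lambda : R) (f : R[i] -> R[i]) (z : R[i]) : R[i] :=
  d_zbar f z - lambda%:C * refl_quotient_ext f z.

Definition dunkl_z_comp_z (lambda : R) (g : R[i] -> R[i]) : R[i] -> R[i] :=
  dunkl_z lambda (fun z => z * g z).

Definition lambda_analytic (lambda : R) (f : R[i] -> R[i]) : Prop :=
  Ck_on_disk 2 f /\ forall z, disk z -> dunkl_zbar lambda f z = 0.

Definition pochhammer (a : R) (n : nat) : R := \prod_(i < n) (a + i%:R).

Definition phi (lambda : R) (n : nat) (z : R[i]) : R[i] :=
  (Num.sqrt (n`!%:R / pochhammer (2 * lambda + 1) n))%:C *
  \sum_(j < n.+1)
    (pochhammer lambda j * pochhammer (lambda + 1) (n - j) /
       (j`!%:R * (n - j)`!%:R))%:C * conjc z ^+ j * z ^+ (n - j).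

(* The lambda-analytic polynomial with coefficients a_0, ..., a_n. *)
Definition phi_poly (lambda : R) (n : nat) (a : nat -> R[i]) (z : R[i]) : R[i] :=
  \sum_(k < n.+1) a k * phi lambda k z.

Definition phi_expansion (lambda : R) (g : R[i] -> R[i]) (b : nat -> R[i]) :
    Prop :=
  forall z, disk z ->
    (fun n => \sum_(0 <= k < n) b k * phi lambda k z : R[i]^o) @ \oo
      --> (g z : R[i]^o).

Definition Gamma (s : R) : R :=
  \int[@lebesgue_measure R]_(t in `]0, +oo[) (t `^ (s - 1) * expR (- t)).

Definition c_const (lambda : R) : R :=
  Gamma (lambda + 2) / (Gamma (lambda + 2^-1) * Gamma 2^-1).

(* Integral over the disk against c_lambda |y|^(2 lambda) dx dy. *)
Definition sigma_integral (lambda : R) (h : R[i] -> R) : \bar R :=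
  (\int[@lebesgue_measure R \x @lebesgue_measure R]_(w in
       [set w : R * R | disk (w.1 +i* w.2)])
     (h (w.1 +i* w.2) * (c_const lambda * `|w.2| `^ (2 * lambda)))%:E)%E.

Definition bergman_integral (p lambda alpha : R) (f : R[i] -> R[i]) : \bar R :=
  sigma_integral lambda
    (fun z => normc (f z) `^ p * (1 - normc z) `^ (alpha - 1)).

Definition bergman (p lambda alpha : R) : set (R[i] -> R[i]) :=
  [set f | lambda_analytic lambda f /\
           (bergman_integral p lambda alpha f < +oo)%E].

Definition bergman_norm (p lambda alpha : R) (f : R[i] -> R[i]) : R :=
  fine (bergman_integral p lambda alpha f) `^ p^-1.

(* Only the restriction of L to the space matters.  Functions that agree on the
   disk are at distance 0, so continuity forces L to identify them. *)
Definition bergman_dual (p lambda alpha : R) (L : (R[i] -> R[i]) -> R[i]) :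
    Prop :=
  (forall (a : R[i]) f g, bergman p lambda alpha f -> bergman p lambda alpha g ->
     L (fun z => a * f z + g z) = a * L f + L g) /\
  (forall f, bergman p lambda alpha f -> forall e : R, 0 < e ->
     exists2 d : R, 0 < d &
       forall g, bergman p lambda alpha g ->
         bergman_norm p lambda alpha (fun z => g z - f z) < d ->
         normc (L g - L f) < e).

Definition order_m (p lambda alpha : R) : nat :=
  Num.truncn ((alpha + 2 * lambda + 1) / p - 2 * lambda).

Definition growth_condition (p lambda alpha : R) (g : R[i] -> R[i]) : Prop :=
  let m := order_m p lambda alpha in
  exists2 c : R, 0 < c &
    forall z, disk z ->
      normc (iter m (dunkl_z_comp_z lambda) g z) <=
      c * (normc (1 - z ^+ 2) `^ (2 * lambda * (p^-1 - 1)) /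
           (1 - normc z) `^ (m%:R + 1 - (alpha + 1) / p)).

Definition represents (p lambda alpha : R) (L : (R[i] -> R[i]) -> R[i])
    (g : R[i] -> R[i]) : Prop :=
  [/\ lambda_analytic lambda g,
      growth_condition p lambda alpha g &
      exists2 b : nat -> R[i], phi_expansion lambda g b &
        forall n a, L (phi_poly lambda n a) = \sum_(k < n.+1) a k * b k].

End Dunkl.

(* Main.v *)
(* Existence.  L is bounded, so b_k = L(phi_k) grows at most polynomially and
   g = sum b_k phi_k is lambda-analytic.  Since D_z o z multiplies phi_k by k + lambda + 1,
   (D_z o z)^m g(w) = L(K_w) with K_w(z) = sum (k + lambda + 1)^m phi_k(w) phi_k(z).  The
   products phi_k(w) phi_k(z) are means, for the Beta(lambda + 1, lambda) law of u, of Taylor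
   coefficients of the power -lambda of a quadratic polynomial depending on u, whence
     |K_w(z)| <= C max(|A|, |B|)^(-2 lambda) min(|A|, |B|)^(-m-1),
   A = 1 - z w, B = 1 - conj(z) w.  The choice of m makes |K_w|^p integrable with the
   required bound.

   Determination.  For f lambda-analytic and chi_a = (s - |z|^2)_+^a, integration by parts
   against |y|^(2 lambda) gives
     int f chi_(a+1) D_zbar psi = (a+1) int f z psi chi_a.
   With psi = conj(z phi_k) this is a recursion in a for the moments int f conj(phi_k) chi_a,
   which makes them homogeneous in s and gives the orthogonality of the phi_k, hence
   candidates c_k independent of s for the coefficients of f.  All moments of
   f - sum c_k phi_k against polynomials then vanish, so f = sum c_k phi_k.  Averaging over r
   shows that some dilates f(r z), r -> 1, tend to f in A^p; on them L is given by the numbers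
   L(phi_k), which are the coefficients of g. *)
Require Import Defs.
From HB Require Import structures.
From mathcomp Require Import all_boot all_order all_algebra.
From mathcomp Require Import complex.
From mathcomp Require Import all_classical all_reals all_analysis.
From mathcomp Require Import measurable_realfun.
From mathcomp Require Import zify ring lra.

Set Implicit Arguments.
Unset Strict Implicit.
Unset Printing Implicit Defensive.

Import Order.TTheory GRing.Theory Num.Theory numFieldNormedType.Exports.
Import ComplexField.Normc.

Local Open Scope classical_set_scope.
Local Open Scope ring_scope.
Local Open Scope complex_scope.

(** * Complex numbers and geometric sums *)

Section ComplexModulus.
Variable R : realType.
Implicit Types x y z : R[i].

(** The weight |y|^(2 lambda) and the factor |1 - w^2| of the growth condition are linked by two
    inequalities. From conj(z) A - z B = conj(z) - z one gets |y| <= max(|A|, |B|), so the weight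
    times |K_w|^p leaves max(|A|, |B|)^(2 lambda (1 - p)), an exponent that p <= 1 makes
    nonnegative. From max(|A|, |B|) <= min(|A|, |B|) + |1 - w^2| the integral then splits into
    powers of |A| and |B| with exponents (m + 1) p and (m + 1) p - 2 lambda (1 - p); the integer
    part puts the smaller one above alpha + 1.

    Membership in the space gives only C^2 and D_zbar f = 0, with no control at the boundary and a
    weight that degenerates on the real axis. Cut-offs supported in |z|^2 <= s < 1 remove boundary
    terms and stand in for polar coordinates, so that orthogonality and homogeneity come from
    recursions. For p < 1 the norm is not subadditive; functionals are therefore handled through
    homogeneity, sup bounds and continuity. *)

Lemma ncD x y : normc (x + y) <= normc x + normc y.
Proof. exact: (@le_normcD R). Qed.

Lemma ncN x : normc (- x) = normc x.
Proof. exact: (@normcN R). Qed.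

Lemma ncB x y : normc (x - y) <= normc x + normc y.
Proof. by rewrite -[normc y]ncN ncD. Qed.

Lemma nc0 : normc (0 : R[i]) = 0.
Proof. exact: normc0. Qed.

Lemma nc1 : normc (1 : R[i]) = 1.
Proof. exact: normc1. Qed.

Lemma nc_ge0 x : 0 <= normc x.
Proof. by case: x => a b; rewrite /normc sqrtr_ge0. Qed.
Hint Resolve nc_ge0 : core.

Lemma ncX x n : normc (x ^+ n) = normc x ^+ n.
Proof. by elim: n => [|n IH]; rewrite ?expr0 ?nc1// !exprS normcM IH. Qed.

Lemma ncR (a : R) : normc a%:C = `|a|.
Proof. by rewrite /= expr0n addr0 sqrtr_sqr. Qed.

Lemma RCM (a b : R) : (a * b)%:C = a%:C * b%:C.
Proof. exact: rmorphM. Qed.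

Lemma RCX (a : R) n : (a ^+ n)%:C = a%:C ^+ n.
Proof. exact: rmorphXn. Qed.

Lemma RCnat n : (n%:R)%:C = n%:R :> R[i].
Proof. exact: rmorph_nat. Qed.

Lemma conjcR (a : R) : conjc a%:C = a%:C.
Proof. by rewrite /= oppr0. Qed.

Lemma ncJ x : normc (conjc x) = normc x.
Proof. by case: x => a b /=; rewrite sqrrN. Qed.

Lemma nc_distC x y : normc (x - y) = normc (y - x).
Proof. by rewrite -ncN opprB. Qed.

Lemma nc_sum (I : Type) (r : seq I) (P : pred I) (F : I -> R[i]) :
  normc (\sum_(i <- r | P i) F i) <= \sum_(i <- r | P i) normc (F i).
Proof.
elim/big_ind2 : _ => [|x1 x2 y1 y2 h1 h2|//]; first by rewrite nc0.
by rewrite (le_trans (ncD _ _))// lerD.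
Qed.

Lemma ncE z : normc z ^+ 2 = complex.Re z ^+ 2 + complex.Im z ^+ 2.
Proof. by case: z => a b /=; rewrite sqr_sqrtr// addr_ge0 ?sqr_ge0. Qed.

Lemma Re_le z : `|complex.Re z| <= normc z.
Proof.
by rewrite -(@ler_pXn2r _ 2) ?nnegrE// ncE real_normK ?num_real// lerDl sqr_ge0.
Qed.

Lemma Im_le z : `|complex.Im z| <= normc z.
Proof.
by rewrite -(@ler_pXn2r _ 2) ?nnegrE// ncE real_normK ?num_real// lerDr sqr_ge0.
Qed.

Lemma nc_le_ReIm z : normc z <= `|complex.Re z| + `|complex.Im z|.
Proof.
rewrite -(@ler_pXn2r _ 2) ?nnegrE ?addr_ge0// ncE sqrrD !real_normK ?num_real//.
by rewrite addrAC lerDl mulrn_wge0// mulr_ge0.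
Qed.

Lemma nc_eq0 x : (normc x == 0) = (x == 0).
Proof. by apply/eqP/eqP => [/eq0_normc//|->]; rewrite nc0. Qed.

Lemma nc_gt0 x : (0 < normc x) = (x != 0).
Proof. by rewrite lt_neqAle nc_ge0 andbT eq_sym nc_eq0. Qed.

Lemma nc_lerB x y : normc x - normc y <= normc (x - y).
Proof. by rewrite lerBlDr -{1}(subrK y x) ncD. Qed.

Lemma cReD x y : complex.Re (x + y) = complex.Re x + complex.Re y.
Proof. by case: x y => [a b] [c d]. Qed.

Lemma cImD x y : complex.Im (x + y) = complex.Im x + complex.Im y.
Proof. by case: x y => [a b] [c d]. Qed.

Lemma cReN x : complex.Re (- x) = - complex.Re x. Proof. by case: x. Qed.
Lemma cImN x : complex.Im (- x) = - complex.Im x. Proof. by case: x. Qed.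

Lemma cReM x y : complex.Re (x * y) =
  complex.Re x * complex.Re y - complex.Im x * complex.Im y.
Proof. by case: x y => [a b] [c d]. Qed.

Lemma cImM x y : complex.Im (x * y) =
  complex.Re x * complex.Im y + complex.Im x * complex.Re y.
Proof. by case: x y => [a b] [c d]. Qed.

Lemma Re_sum (I : Type) (r : seq I) (P : pred I) (F : I -> R[i]) :
  complex.Re (\sum_(i <- r | P i) F i) = \sum_(i <- r | P i) complex.Re (F i).
Proof. by elim/big_ind2 : _ => // x1 x2 y1 y2 <- <-; rewrite cReD. Qed.

Lemma Im_sum (I : Type) (r : seq I) (P : pred I) (F : I -> R[i]) :
  complex.Im (\sum_(i <- r | P i) F i) = \sum_(i <- r | P i) complex.Im (F i).
Proof. by elim/big_ind2 : _ => // x1 x2 y1 y2 <- <-; rewrite cImD. Qed.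

Lemma complexE z : z = (complex.Re z) +i* (complex.Im z).
Proof. by case: z. Qed.

Lemma complex_eq z w :
  complex.Re z = complex.Re w -> complex.Im z = complex.Im w -> z = w.
Proof. by case: z w => [a b] [c d] /= -> ->. Qed.

End ComplexModulus.
#[export] Hint Resolve nc_ge0 : core.

(** * Sequences of subexponential growth *)

Section Subexponential.
Variable R : realType.
Implicit Types (a b : nat -> R) (q r : R).

(** Says that the power series with coefficients [a] has radius of convergence at least 1. The class
    is stable under products, shifts and polynomial factors, which spares explicit growth rates. *)
Definition subexp a := forall q, 0 < q -> q < 1 ->
  exists2 K, 0 <= K & forall n, `|a n| * q ^+ n <= K.

Lemma between_lt1 r : 0 <= r -> r < 1 -> exists2 q, 0 < q < 1 & r < q.
Proof. by move=> r0 r1; exists ((r + 1) / 2); [apply/andP; split|]; lra. Qed.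

(** Half of the decay goes to each factor: q^n = (sqrt q)^n (sqrt q)^n. *)
Lemma subexpM a b : subexp a -> subexp b -> subexp (fun n => a n * b n).
Proof.
move=> ha hb q q0 q1.
have s0 : 0 < Num.sqrt q by rewrite sqrtr_gt0.
have s1 : Num.sqrt q < 1 by rewrite -sqrtr1 ltr_sqrt.
have [K K0 hK] := ha _ s0 s1; have [K' K'0 hK'] := hb _ s0 s1.
exists (K * K'); first by rewrite mulr_ge0.
move=> n; have -> : q ^+ n = Num.sqrt q ^+ n * Num.sqrt q ^+ n.
  by rewrite -exprMn -expr2 sqr_sqrtr// ltW.
by rewrite normrM mulrACA ler_pM// mulr_ge0// exprn_ge0// ltW.
Qed.

Lemma subexp_le a b : (forall n, `|a n| <= `|b n|) -> subexp b -> subexp a.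
Proof.
move=> ab hb q q0 q1; have [K K0 hK] := hb q q0 q1; exists K => // n.
by rewrite (le_trans _ (hK n))// ler_wpM2r// exprn_ge0// ltW.
Qed.

Lemma subexp_cst (c : R) : subexp (fun=> c).
Proof.
move=> q q0 q1; exists `|c| => // n.
by rewrite ler_piMr// exprn_ile1// ltW.
Qed.

Lemma subexpD a b : subexp a -> subexp b -> subexp (fun n => a n + b n).
Proof.
move=> ha hb q q0 q1.
have [K K0 hK] := ha _ q0 q1; have [K' K'0 hK'] := hb _ q0 q1.
exists (K + K'); first by rewrite addr_ge0.
move=> n; rewrite (le_trans _ (lerD (hK n) (hK' n)))// -mulrDl.
by rewrite ler_wpM2r ?ler_normD// exprn_ge0// ltW.
Qed.

Lemma subexp_nat : subexp (fun n => n.+1%:R).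
Proof.
move=> q q0 q1; exists (1 - q)^-1; first by rewrite invr_ge0 subr_ge0 ltW.
move=> n; rewrite ger0_norm// -[leRHS]mul1r ler_pdivlMr ?subr_gt0//.
(* (n + 1) q^n is at most 1 + q + ... + q^n, whose product with 1 - q is 1 - q^(n+1). *)
suff : n.+1%:R * q ^+ n * (1 - q) + q ^+ n.+1 <= 1.
  by apply: le_trans; rewrite lerDl exprn_ge0// ltW.
elim: n => [|n IH]; first by rewrite expr0 expr1 !mul1r subrK.
rewrite (le_trans _ IH)// [n.+2%:R]mulrS.
have -> : (1 + n.+1%:R) * q ^+ n.+1 * (1 - q) + q ^+ n.+2 =
    q * (n.+1%:R * q ^+ n * (1 - q)) + q ^+ n.+1 by rewrite !exprS; ring.
rewrite lerD2r ler_piMl ?(ltW q1)// mulr_ge0 ?subr_ge0 ?(ltW q1)//.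
by rewrite mulr_ge0// exprn_ge0// ltW.
Qed.

Lemma subexpX a k : subexp a -> subexp (fun n => a n ^+ k).
Proof.
move=> ha; elim: k => [|k IH].
  by apply: subexp_le (@subexp_cst 1) => n; rewrite expr0.
by apply: subexp_le (subexpM ha IH) => n; rewrite exprS.
Qed.

Lemma subexpS a : subexp a -> subexp (fun n => a n.+1).
Proof.
move=> ha q q0 q1; have [K K0 hK] := ha q q0 q1.
exists (K / q); first by rewrite divr_ge0// ltW.
by move=> n; rewrite ler_pdivlMr// -mulrA -exprSr.
Qed.

(** Identities between series are proved by applying this to the distance of the two sides, which
    partial sums of length n bound by K q^n. *)
Lemma geo_le0 x K q : 0 <= q -> q < 1 -> (forall n, x <= K * q ^+ n) -> x <= 0.
Proof.
move=> q0 q1 h.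
have c : (fun n => K * q ^+ n) @ \oo --> 0.
  have := cvgM (cvg_cst K) (cvg_expr (_ : `|q| < 1)).
  by rewrite mulr0; apply; rewrite ger0_norm.
rewrite -(cvg_lim (@Rhausdorff R) c); apply: limr_ge; first by apply/cvg_ex; exists 0.
exact: nearW.
Qed.

End Subexponential.

(** * Geometrically convergent series *)

Section GeometricSums.
Variable R : realType.
Implicit Types (u v : nat -> R[i]) (K q : R).

(** Domination by a geometric sequence passes to Cauchy products and derivatives and comes with
    explicit tails. *)
Definition geom_le u K q := [/\ 0 <= K, 0 <= q, q < 1 &
  forall n, normc (u n) <= K * q ^+ n].

Definition geom u := exists K q, geom_le u K q.

(** Assembled from the real limits of both parts; the value is meaningful for sequences satisfying
    [geom]. *)
Definition csum u : R[i] :=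
  limn (series (fun n => complex.Re (u n))) +i*
  limn (series (fun n => complex.Im (u n))).

Lemma geo_sum_le K q m n : 0 <= K -> 0 <= q -> q < 1 -> (m <= n)%N ->
  \sum_(m <= k < n) K * q ^+ k <= K * q ^+ m / (1 - q).
Proof.
move=> K0 q0 q1 mn; rewrite ler_pdivlMr ?subr_gt0//.
suff -> : (\sum_(m <= k < n) K * q ^+ k) * (1 - q) = K * q ^+ m - K * q ^+ n.
  by rewrite gerBl mulr_ge0// exprn_ge0.
rewrite -(subnKC mn); elim: (n - m)%N => [|k IH].
  by rewrite addn0 big_geq// mul0r subrr.
by rewrite addnS big_nat_recr ?leq_addr//= mulrDl IH exprS; ring.
Qed.

Lemma real_geo_cvg (a : nat -> R) K q : 0 <= q -> q < 1 ->
  (forall n, `|a n| <= K * q ^+ n) -> cvgn (series a).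
Proof.
move=> q0 q1 h; apply: normed_cvg.
apply: (@series_le_cvg _ _ (geometric K q)) => [n||n|].
- by rewrite /= normr_ge0.
- by move=> n; rewrite (le_trans _ (h n)).
- exact: h.
- by apply: is_cvg_geometric_series; rewrite ger0_norm.
Qed.

(** The factor 2 pays for bounding the real and the imaginary part separately by the full geometric
    tail. *)
Lemma csum_tail u K q N : geom_le u K q ->
  normc (csum u - \sum_(0 <= k < N) u k) <= 2 * K / (1 - q) * q ^+ N.
Proof.
case=> K0 q0 q1 h.
have hb n : (N <= n)%N -> normc (\sum_(0 <= k < n) u k - \sum_(0 <= k < N) u k)
    <= K * q ^+ N / (1 - q).
  move=> Nn; rewrite (@big_cat_nat _ _ _ N 0 n)//= addrAC subrr add0r.
  by apply: le_trans (nc_sum _ _ _) _; apply: le_trans (geo_sum_le K0 q0 q1 Nn); apply: ler_sum.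
have bnd (p : R[i] -> R) : (forall x y, p (x - y) = p x - p y) ->
    (forall z, `|p z| <= normc z) -> p 0 = 0 -> (forall x y, p (x + y) = p x + p y) ->
    `|limn (series (fun n => p (u n))) - p (\sum_(0 <= k < N) u k)|
       <= K * q ^+ N / (1 - q).
  move=> pB pn p0 pD.
  have psum n : p (\sum_(0 <= k < n) u k) = \sum_(0 <= k < n) p (u k).
    by elim/big_ind2 : _ => // ? ? ? ? <- <-; rewrite pD.
  have c : cvgn (series (fun n => p (u n))).
    by apply: (real_geo_cvg q0 q1) => n; apply: le_trans (h n); exact: pn.
  have c' : (fun n => `|series (fun n => p (u n)) n - p (\sum_(0 <= k < N) u k)|)
      @ \oo --> `|limn (series (fun n => p (u n))) - p (\sum_(0 <= k < N) u k)|.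
    by apply: cvg_norm; apply: cvgB => //; exact: cvg_cst.
  rewrite -(cvg_lim (@Rhausdorff R) c').
  apply: limr_le; first by apply/cvg_ex; eexists; exact: c'.
  near=> n; rewrite seriesEnat/= -psum -pB; apply: le_trans (pn _) _.
  by apply: hb; near: n; exact: nbhs_infty_ge.
have -> : 2 * K / (1 - q) * q ^+ N = K * q ^+ N / (1 - q) + K * q ^+ N / (1 - q).
  by rewrite -mulr2n -mulr_natl; ring.
apply: le_trans (nc_le_ReIm _) _; apply: lerD.
  rewrite cReD cReN /=; apply: bnd => //; [|exact: Re_le|exact: cReD].
  by move=> x y; rewrite cReD cReN.
rewrite cImD cImN /=; apply: bnd => //; [|exact: Im_le|exact: cImD].
by move=> x y; rewrite cImD cImN.
Unshelve. all: by end_near. Qed.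

Lemma csum_le u K q : geom_le u K q -> normc (csum u) <= 2 * K / (1 - q).
Proof. by move=> /(csum_tail 0); rewrite big_geq// subr0 expr0 mulr1. Qed.

Lemma geom_tail u : geom u -> exists K q, [/\ 0 <= K, 0 <= q, q < 1 &
  forall N, normc (csum u - \sum_(0 <= k < N) u k) <= K * q ^+ N].
Proof.
move=> [K [q hu]]; exists (2 * K / (1 - q)), q.
split; [|by case: hu..|by move=> N; exact: csum_tail].
by case: hu => K0 q0 q1 _; rewrite divr_ge0 ?mulr_ge0// subr_ge0 ltW.
Qed.

Lemma geo_max K q K' q' n : 0 <= K -> 0 <= K' -> 0 <= q -> 0 <= q' ->
  K * q ^+ n + K' * q' ^+ n <= (K + K') * Num.max q q' ^+ n.
Proof.
move=> K0 K'0 q0 q'0; rewrite mulrDl lerD// ler_wpM2l// lerXn2r// ?nnegrE// ?le_max ?lexx ?orbT ?q0//.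
Qed.

(** The way sums are computed below: a number approached geometrically by the partial sums is the
    value. *)
Lemma csum_unique u s K q : geom u -> 0 <= K -> 0 <= q -> q < 1 ->
  (forall N, normc (s - \sum_(0 <= k < N) u k) <= K * q ^+ N) -> csum u = s.
Proof.
move=> /geom_tail[K' [q' [K'0 q'0 q'1 hK']]] K0 q0 q1 hs.
apply/eqP; rewrite -subr_eq0 -nc_eq0 eq_le nc_ge0 andbT.
apply: (@geo_le0 _ _ (K' + K) (Num.max q' q)).
- by rewrite le_max q'0.
- by rewrite gt_max q'1.
move=> n; apply: le_trans (geo_max n K'0 K0 q'0 q0).
rewrite -(subrKA (\sum_(0 <= k < n) u k) (csum u)); apply: le_trans (ncD _ _) _.
by apply: lerD; rewrite // nc_distC.
Qed.

Lemma geomD u v : geom u -> geom v -> geom (fun n => u n + v n).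
Proof.
move=> [K [q [K0 q0 q1 h]]] [K' [q' [K'0 q'0 q'1 h']]].
exists (K + K'), (Num.max q q'); split.
- by rewrite addr_ge0.
- by rewrite le_max q0.
- by rewrite gt_max q1.
by move=> n; apply: le_trans (ncD _ _) _; apply: le_trans (geo_max n K0 K'0 q0 q'0); exact: lerD.
Qed.

Lemma geomZ (c : R[i]) u : geom u -> geom (fun n => c * u n).
Proof.
move=> [K [q [K0 q0 q1 h]]]; exists (normc c * K), q; split=> //.
  by rewrite mulr_ge0 ?nc_ge0.
by move=> n; rewrite normcM -mulrA ler_wpM2l.
Qed.

Lemma csumD u v : geom u -> geom v ->
  csum (fun n => u n + v n) = csum u + csum v.
Proof.
move=> gu gv; have [K [q [K0 q0 q1 h]]] := geom_tail gu.
have [K' [q' [K'0 q'0 q'1 h']]] := geom_tail gv.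
apply: (@csum_unique _ _ (K + K') (Num.max q q')).
- exact: geomD.
- by rewrite addr_ge0.
- by rewrite le_max q0.
- by rewrite gt_max q1.
move=> n; apply: le_trans (geo_max n K0 K'0 q0 q'0).
rewrite big_split/= opprD addrACA; apply: le_trans (ncD _ _) _; exact: lerD.
Qed.

Lemma csumZ (c : R[i]) u : geom u -> csum (fun n => c * u n) = c * csum u.
Proof.
move=> gu; have [K [q [K0 q0 q1 h]]] := geom_tail gu.
apply: (@csum_unique _ _ (normc c * K) q) => //; first exact: geomZ.
  by rewrite mulr_ge0 ?nc_ge0.
by move=> n; rewrite -mulr_sumr -mulrBr normcM -mulrA ler_wpM2l.
Qed.

Lemma geomB u v : geom u -> geom v -> geom (fun n => u n - v n).
Proof.
move=> gu gv; have [A [p [A0 p0 p1 hA]]] := geomD gu (geomZ (-1) gv).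
by exists A, p; split=> // n; have := hA n; rewrite mulN1r.
Qed.

Lemma csumB u v : geom u -> geom v ->
  csum (fun n => u n - v n) = csum u - csum v.
Proof.
move=> gu gv; rewrite -[- csum v]mulN1r -csumZ// -csumD//; last exact: geomZ.
by congr csum; apply/funext => n; rewrite mulN1r.
Qed.

Lemma geomS u : geom u -> geom (fun n => u n.+1).
Proof.
move=> [K [q [K0 q0 q1 h]]]; exists (K * q), q; split=> //; first by rewrite mulr_ge0.
by move=> n; rewrite -mulrA -exprS.
Qed.

Lemma csumS u : geom u -> csum u = u 0%N + csum (fun n => u n.+1).
Proof.
move=> gu; have [K [q [K0 q0 q1 h]]] := geom_tail (geomS gu).
have [K' [q' [K'0 q'0 q'1 h']]] := geom_tail gu.
apply/esym/eqP; rewrite -subr_eq0 -nc_eq0 eq_le nc_ge0 andbT.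
apply: (@geo_le0 _ _ (K + K' * q') (Num.max q q')).
- by rewrite le_max q0.
- by rewrite gt_max q1.
move=> n; apply: le_trans (geo_max n K0 (mulr_ge0 K'0 q'0) q0 q'0).
have := h' n.+1; rewrite big_nat_recl// nc_distC => h2.
set s := \sum_(0 <= k < n) _ in h2 *.
have -> : u 0%N + csum (fun n => u n.+1) - csum u =
  (csum (fun n => u n.+1) - s) + (u 0%N + s - csum u) by ring.
apply: le_trans (ncD _ _) _; apply: lerD; first exact: h.
by rewrite -mulrA -exprS.
Qed.

Lemma eq_csum u v : (forall n, u n = v n) -> csum u = csum v.
Proof. by move=> h; congr csum; apply/funext. Qed.

Lemma csum_cvg u : geom u -> forall e : R, 0 < e -> exists N, forall n, (N <= n)%N ->
  normc (csum u - \sum_(0 <= k < n) u k) < e.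
Proof.
move=> /geom_tail[K [q [K0 q0 q1 h]]] e e0.
have c : (fun n => K * q ^+ n) @ \oo --> 0.
  have := cvgM (cvg_cst K) (cvg_expr (_ : `|q| < 1)).
  by rewrite mulr0; apply; rewrite ger0_norm.
have [N _ hN] := (cvgr_lt 0 c) e e0.
by exists N => n Nn; apply: le_lt_trans (h n) _; exact: hN.
Qed.

End GeometricSums.

(** * Power series in z and its conjugate *)

Section Bridge.
Variable R : realType.
Implicit Types (f : R[i] -> R[i]) (z w : R[i]).

(** A quadratic remainder is what the estimates for power series and for cut-off powers deliver, so
    derivatives are obtained in this form. *)
Lemma quad_derive (F : R -> R) t L K d : 0 < d ->
  (forall h, `|h| < d -> `|F (t + h) - F t - h * L| <= K * h ^+ 2) ->
  is_derive t 1 F L.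
Proof.
move=> d0 H.
suff c : h^-1 *: ((F \o shift t) (h *: (1 : R)) - F t) @[h --> 0^'] --> L.
  by apply: DeriveDef; [apply/cvg_ex; exists L|apply: (cvg_lim (@Rhausdorff R))].
apply/cvgrPdist_le => e e0.
have e' : 0 < e / (`|K| + 1) by rewrite divr_gt0// ltr_pwDr.
near=> h.
have h0 : h != 0 by near: h; exact: nbhs_dnbhs_neq.
have hd : `|h| < d by near: h; exact: dnbhs0_lt.
have he : `|h| <= e / (`|K| + 1) by near: h; exact: dnbhs0_le.
have := H h hd; rewrite /= /GRing.scale/= mulr1 (addrC h) => Hh.
have -> : L - h^-1 * (F (t + h) - F t) = - (h^-1 * (F (t + h) - F t - h * L)).
  by field.
rewrite normrN normrM normfV mulrC ler_pdivrMr ?normr_gt0//.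
apply: le_trans Hh _; rewrite -real_normK ?num_real// expr2 mulrA.
rewrite ler_pM2r ?normr_gt0//.
rewrite (@le_trans _ _ ((`|K| + 1) * `|h|))//.
  by rewrite ler_wpM2r// (le_trans (ler_norm _))// lerDl.
by rewrite mulrC -ler_pdivlMr// ltr_pwDr.
Unshelve. all: by end_near. Qed.

Lemma gt0_complexP (e : R[i]) : 0 < e -> 0 < complex.Re e /\ e = (complex.Re e)%:C.
Proof. by rewrite ltcE => /andP[/eqP/= h h']; split=> //; case: e h h' => a b /= ->. Qed.

Lemma norm_complexE (z : R[i]) : `|z| = (normc z)%:C.
Proof. by []. Qed.

Lemma nbhs_complexP (z : R[i]) (P : set R[i]) :
  nbhs (z : R[i]^o) P <->
  exists2 d : R, 0 < d & forall w, normc (w - z) < d -> P w.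
Proof.
split.
  move=> /nbhs_normP[e /= e0 he]; have [r0 eE] := gt0_complexP e0.
  exists (complex.Re e) => // w wz; apply: he => /=.
  by rewrite norm_complexE eE ltcR nc_distC.
move=> [d d0 hd]; apply/(@nbhs_normP _ (R[i]^o)); exists (d%:C) => /=; first by rewrite ltcR.
by move=> w /=; rewrite norm_complexE ltcR nc_distC; exact: hd.
Qed.

Lemma continuous_complexP f z :
  {for z, continuous (f : R[i]^o -> R[i]^o)} <->
  forall e : R, 0 < e -> exists2 d : R, 0 < d &
    forall w, normc (w - z) < d -> normc (f w - f z) < e.
Proof.
split.
  move=> /cvgrPdist_lt h e e0.
  have /h/nbhs_complexP[d d0 hd] : 0 < e%:C by rewrite ltcR.
  by exists d => // w /hd; rewrite norm_complexE ltcR nc_distC.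
move=> h; have [_] := @cvgrPdist_lt R[i] R[i]^o R[i]^o (nbhs (z : R[i]^o)) _ f (f z).
apply=> e /gt0_complexP[e0 ->].
have [d d0 hd] := h _ e0; apply/nbhs_complexP; exists d => // w /hd.
by rewrite norm_complexE ltcR nc_distC.
Qed.

Lemma cvg_complexP (u : nat -> R[i]) (l : R[i]) :
  ((u : nat -> R[i]^o) @ \oo --> (l : R[i]^o)) <->
  forall e : R, 0 < e -> exists N, forall n, (N <= n)%N -> normc (l - u n) < e.
Proof.
split.
  move=> /cvgrPdist_lt h e e0.
  have /h[N _ hN] : 0 < e%:C by rewrite ltcR.
  by exists N => n Nn; have := hN n Nn; rewrite /= norm_complexE ltcR.
move=> h; apply/cvgrPdist_lt => e /gt0_complexP[e0 ->].
have [N hN] := h _ e0; exists N => // n /= Nn.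
by rewrite norm_complexE ltcR; exact: hN.
Qed.

Lemma disk_nbhs z : disk z -> exists2 d : R, 0 < d &
  forall w, normc (w - z) < d -> disk w.
Proof.
rewrite /disk /= => z1; exists (1 - normc z); first by rewrite subr_gt0.
move=> w h; rewrite -(subrK z w) (le_lt_trans (ncD _ _))// -ltrBrDr.
by [].
Qed.

Lemma disk_conj z : disk z -> disk (conjc z).
Proof. by rewrite /disk /= ncJ. Qed.

(** Evaluates the limit hidden in [refl_quotient_ext] on the real axis: a continuous formula valid
    off the axis gives its value there. The restricted filter is proper because z + i d / 2 is not
    real. *)
Lemma lim_refl_quotient (F : R[i] -> R[i]) f z :
  disk z -> complex.Im z = 0 ->
  (forall w, disk w -> complex.Im w != 0 -> refl_quotient f w = F w) ->
  {for z, continuous (F : R[i]^o -> R[i]^o)} ->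
  lim ((refl_quotient f : R[i]^o -> R[i]^o) @
    within [set w : R[i]^o | complex.Im w != 0] (nbhs (z : R[i]^o))) = F z.
Proof.
move=> Dz z0 hF /continuous_complexP cF.
have PF : ProperFilter (within [set w : R[i]^o | complex.Im w != 0] (nbhs (z : R[i]^o))).
  apply: within_nbhs_proper; rewrite /infer /closure /= => B /nbhs_complexP[d d0 hd].
  exists (z + (0 +i* (d / 2))); split => /=.
    by rewrite cImD z0 add0r/= gt_eqF// divr_gt0.
  apply: hd; rewrite addrAC subrr add0r /= expr0n add0r sqrtr_sqr.
  by rewrite gtr0_norm ?divr_gt0// ltr_pdivrMr// ltr_pMr// ltrDl.
apply: cvg_lim; first exact: norm_hausdorff.
apply/cvgrPdist_lt => e /gt0_complexP[e0 ->].
have [d d0 hd] := cF _ e0; have [d' d'0 hd'] := disk_nbhs Dz.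
rewrite /within; apply/nbhs_complexP; exists (Num.min d d'); first by rewrite lt_min d0.
move=> w; rewrite lt_min => /andP[h h'] /= Iw.
by rewrite hF ?norm_complexE ?ltcR 1?nc_distC; [exact: hd|exact: hd'|].
Qed.

End Bridge.

(** * Series of homogeneous polynomials *)

Section PowerSeries.
Variable R : realType.
Implicit Types (c : nat -> nat -> R[i]) (z h : R[i]).

(** Terms are grouped by total degree, which turns the double series in z and conj(z) into a single
    one, dominated by [cnorm c n] |z|^n. *)
Definition hterm c n z : R[i] :=
  \sum_(j < n.+1) c n j * conjc z ^+ j * z ^+ (n - j).

Definition cnorm c n : R := \sum_(j < n.+1) normc (c n j).

Definition PS c z : R[i] := csum (fun n => hterm c n z).

(** Coefficient arrays of the derivatives in z (here) and in conj(z) (next): degree n + 1 drops to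
    n, hence the index [n.+1] on the right. *)
Definition dzc c n j : R[i] := (n.+1 - j)%:R * c n.+1 j.
Definition dzbc c n j : R[i] := j.+1%:R * c n.+1 j.+1.

Definition subc c := subexp (cnorm c).

Lemma cnorm_ge0 c n : 0 <= cnorm c n.
Proof. by rewrite /cnorm sumr_ge0// => i _; exact: nc_ge0. Qed.

Lemma nc_nat n : normc (n%:R : R[i]) = n%:R.
Proof. by rewrite -(rmorph_nat (real_complex R)) ncR ger0_norm. Qed.

Lemma subexp_geom (a : nat -> R) r : subexp a -> 0 <= r -> r < 1 ->
  exists K q, [/\ 0 <= K, 0 <= q, q < 1 & forall n, `|a n| * r ^+ n <= K * q ^+ n].
Proof.
move=> ha r0 r1; have [q /andP[q0 q1] rq] := between_lt1 r0 r1.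
have [K K0 hK] := ha q q0 q1.
exists K, (r / q); split=> //; first by rewrite divr_ge0// ltW.
  by rewrite ltr_pdivrMr// mul1r.
move=> n; rewrite expr_div_n mulrA.
have qn : 0 < q ^+ n by rewrite exprn_gt0.
by rewrite ler_pdivlMr// mulrAC; apply: ler_wpM2r; rewrite ?exprn_ge0.
Qed.

Lemma hterm_le c n z r : normc z <= r -> normc (hterm c n z) <= cnorm c n * r ^+ n.
Proof.
move=> zr; rewrite /hterm /cnorm mulr_suml.
apply: le_trans (nc_sum _ _ _) _; apply: ler_sum => j _.
rewrite !normcM -mulrA ler_wpM2l ?nc_ge0// !ncX ncJ -exprD subnKC ?leq_ord//.
by rewrite lerXn2r// nnegrE ?nc_ge0// (le_trans _ zr) ?nc_ge0.
Qed.

Lemma subc_geom c r : subc c -> 0 <= r -> r < 1 ->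
  exists K q, [/\ 0 <= K, 0 <= q, q < 1 &
   forall n z, normc z <= r -> normc (hterm c n z) <= K * q ^+ n].
Proof.
move=> sc r0 r1; have [K [q [K0 q0 q1 h]]] := subexp_geom sc r0 r1.
exists K, q; split=> // n z zr; apply: le_trans (hterm_le c n zr) _.
by apply: le_trans (h n); rewrite ger0_norm ?cnorm_ge0.
Qed.

Lemma geom_hterm c z : subc c -> normc z < 1 -> geom (fun n => hterm c n z).
Proof.
move=> sc z1; have [K [q [K0 q0 q1 h]]] := subc_geom sc (nc_ge0 z) z1.
by exists K, q; split=> // n; exact: h.
Qed.

Lemma cnorm_dzc c n : cnorm (dzc c) n <= n.+1%:R * cnorm c n.+1.
Proof.
rewrite /cnorm [in leRHS]big_ord_recr/= mulrDr ler_wpDr//.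
  by rewrite mulr_ge0 ?nc_ge0.
rewrite mulr_sumr; apply: ler_sum => j _; rewrite normcM nc_nat.
by rewrite ler_wpM2r ?nc_ge0// ler_nat leq_subr.
Qed.

Lemma cnorm_dzbc c n : cnorm (dzbc c) n <= n.+1%:R * cnorm c n.+1.
Proof.
rewrite /cnorm [in leRHS]big_ord_recl/= mulrDr ler_wpDl//.
  by rewrite mulr_ge0 ?nc_ge0.
rewrite mulr_sumr; apply: ler_sum => j _; rewrite normcM nc_nat /=.
by rewrite ler_wpM2r ?nc_ge0// ler_nat.
Qed.

Lemma subexp_cnorm c (b : nat -> R) : subexp b -> (forall n, cnorm c n <= b n) -> subc c.
Proof.
move=> hb h; apply: subexp_le hb => n.
by rewrite ger0_norm ?cnorm_ge0// (le_trans (h n))// ler_norm.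
Qed.

Lemma subc_dzc c : subc c -> subc (dzc c).
Proof.
move=> hc; apply: subexp_cnorm (@cnorm_dzc c).
by apply: subexpM; [exact: subexp_nat|exact: subexpS].
Qed.

Lemma subc_dzbc c : subc c -> subc (dzbc c).
Proof.
move=> hc; apply: subexp_cnorm (@cnorm_dzbc c).
by apply: subexpM; [exact: subexp_nat|exact: subexpS].
Qed.

Definition addc c c' n j : R[i] := c n j + c' n j.
Definition scalec (a : R[i]) c n j : R[i] := a * c n j.

Lemma subc_add c c' : subc c -> subc c' -> subc (addc c c').
Proof.
move=> h h'; apply: subexp_cnorm (subexpD h h') _ => n.
by rewrite /cnorm -big_split/=; apply: ler_sum => j _; exact: ncD.
Qed.

Lemma subc_scale a c : subc c -> subc (scalec a c).
Proof.
move=> h; apply: subexp_cnorm (subexpM (subexp_cst (normc a)) h) _ => n.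
by rewrite /cnorm mulr_sumr; apply: ler_sum => j _; rewrite normcM.
Qed.

Lemma PS_add c c' z : subc c -> subc c' -> normc z < 1 ->
  PS (addc c c') z = PS c z + PS c' z.
Proof.
move=> h h' z1; rewrite /PS -csumD; [|exact: geom_hterm..].
apply: eq_csum => n; rewrite /hterm -big_split/=.
by apply: eq_bigr => j _; rewrite /addc !mulrDl.
Qed.

Lemma PS_scale a c z : subc c -> normc z < 1 -> PS (scalec a c) z = a * PS c z.
Proof.
move=> h z1; rewrite /PS -csumZ; last exact: geom_hterm.
apply: eq_csum => n; rewrite /hterm mulr_sumr.
by apply: eq_bigr => j _; rewrite /scalec !mulrA.
Qed.

(** First-order expansion of a product of n factors of modulus at most r: [a] and [a'] are its
    values before and after increments of size at most s r, and [D] is the linear part. The constant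
    n^2 survives induction because n^2 + n <= (n + 1)^2. *)
Let appr n r s (a a' D : R[i]) := [/\ normc a <= r ^+ n,
  normc D <= n%:R * r ^+ n * s & normc (a' - a - D) <= n%:R ^+ 2 * r ^+ n * s ^+ 2].

Let apprM n r s a a' D x x' : 0 <= r -> 0 <= s -> normc x <= r -> normc x' <= r ->
  normc (x' - x) <= s * r -> appr n r s a a' D ->
  appr n.+1 r s (a * x) (a' * x') (D * x + a * (x' - x)).
Proof.
move=> r0 s0 hx hx' hk [ha hD he].
have rn : 0 <= r ^+ n by rewrite exprn_ge0.
split.
- by rewrite normcM exprSr ler_pM ?nc_ge0.
- apply: le_trans (ncD _ _) _; rewrite !normcM -natr1 exprSr.
  have -> : (n%:R + 1) * (r ^+ n * r) * s = n%:R * r ^+ n * s * r + r ^+ n * (s * r).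
    by ring.
  by apply: lerD; rewrite ler_pM ?nc_ge0.
- have -> : a' * x' - a * x - (D * x + a * (x' - x)) =
    (a' - a - D) * x' + D * (x' - x) by ring.
  apply: le_trans (ncD _ _) _; rewrite !normcM.
  apply: le_trans (_ : n%:R ^+ 2 * r ^+ n * s ^+ 2 * r + n%:R * r ^+ n * s * (s * r) <= _).
    by apply: lerD; rewrite ler_pM ?nc_ge0.
  have -> : n%:R ^+ 2 * r ^+ n * s ^+ 2 * r + n%:R * r ^+ n * s * (s * r) =
    (n%:R ^+ 2 + n%:R) * r ^+ n.+1 * s ^+ 2 by rewrite [r ^+ n.+1]exprSr; ring.
  rewrite -natr1 ler_wpM2r ?sqr_ge0// ler_wpM2r ?exprn_ge0//.
  have n0 : 0 <= n%:R :> R by [].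
  by rewrite sqrrD mulr1 expr1n; lra.
Qed.

Lemma conjcB (x y : R[i]) : conjc (x - y) = conjc x - conjc y.
Proof. exact: rmorphB. Qed.

Let dmono j k z h : R[i] := conjc h * (j%:R * conjc z ^+ j.-1 * z ^+ k) +
   h * (k%:R * conjc z ^+ j * z ^+ k.-1).

Let appr_mono j k z h r s : 0 <= r -> 0 <= s -> normc z <= r -> normc (z + h) <= r ->
  normc h <= s * r ->
  appr (j + k) r s (conjc z ^+ j * z ^+ k) (conjc (z + h) ^+ j * (z + h) ^+ k)
    (dmono j k z h).
Proof.
move=> r0 s0 hz hz' hh; elim: k => [|k IH].
  rewrite addn0 !expr0 !mulr1 /dmono /= mul0r mul0r mulr0 addr0 mulr1.
  elim: j => [|j IH].
    by rewrite /= !expr0 mul0r mulr0; split; rewrite ?subrr ?subr0 ?nc0 ?nc1 ?mul0r// expr2 !mul0r.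
  have := @apprM _ _ _ _ _ _ (conjc z) (conjc (z + h)) r0 s0 _ _ _ IH.
  rewrite -!exprSr !ncJ -conjcB ncJ [z + h - z]addrC addKr => /(_ hz hz' hh).
  congr appr; case: j {IH} => [|j] /=; first by rewrite !expr0; ring.
  by rewrite -natr1 !exprSr; ring.
rewrite addnS; have := apprM r0 s0 hz hz' _ IH.
rewrite [z + h - z]addrC addKr => /(_ hh); rewrite -!mulrA -!exprSr.
congr appr; rewrite /dmono; case: k {IH} => [|k] /=.
  by rewrite expr0 expr1; ring.
by rewrite -[k.+2%:R]natr1 !exprSr; ring.
Qed.

Let dterm c n z h : R[i] := \sum_(j < n.+1) c n j * dmono j (n - j) z h.

Let hterm_appr c n z h r s : 0 <= r -> 0 <= s -> normc z <= r -> normc (z + h) <= r ->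
  normc h <= s * r ->
  normc (hterm c n (z + h) - hterm c n z - dterm c n z h) <=
    n%:R ^+ 2 * cnorm c n * r ^+ n * s ^+ 2.
Proof.
move=> r0 s0 hz hz' hh; rewrite /hterm /dterm /cnorm -!sumrB.
rewrite mulr_sumr !mulr_suml.
apply: le_trans (nc_sum _ _ _) _; apply: ler_sum => j _.
rewrite -2!mulrA -!mulrBr normcM.
have [_ _] := appr_mono j (n - j) r0 s0 hz hz' hh.
rewrite subnKC ?leq_ord// => h3.
rewrite [leRHS](_ : _ = normc (c n j) * (n%:R ^+ 2 * r ^+ n * s ^+ 2)); last by ring.
by rewrite ler_wpM2l ?nc_ge0.
Qed.

Let dterm0 c z h : dterm c 0 z h = 0.
Proof. by rewrite /dterm big_ord1 /dmono /= !mul0r !mulr0 addr0 mulr0. Qed.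

Let dtermS c n z h : dterm c n.+1 z h =
  h * hterm (dzc c) n z + conjc h * hterm (dzbc c) n z.
Proof.
rewrite /dterm /dmono.
under eq_bigr do rewrite mulrDr.
rewrite big_split/= addrC; congr (_ + _).
  rewrite big_ord_recr/= subnn mul0r mul0r !mulr0 addr0 /hterm mulr_sumr.
  apply: eq_bigr => j _; rewrite /dzc subSn ?leq_ord//=; ring.
rewrite big_ord_recl/= !mul0r !mulr0 add0r /hterm mulr_sumr.
by apply: eq_bigr => j _; rewrite /dzbc /bump /= add1n subSS add0n; ring.
Qed.

(** In degree n the remainder is at most n^2 [cnorm c n] r^n s^2 with s = |h| / r. A polynomial
    factor does not disturb subexponential growth, so the sum is a constant times |h|^2, uniformly
    on |z| <= r. *)
Lemma PS_diff c r : subc c -> 0 < r -> r < 1 -> exists2 K, 0 <= K &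
  forall z h, normc z <= r -> normc (z + h) <= r ->
    normc (PS c (z + h) - PS c z - (h * PS (dzc c) z + conjc h * PS (dzbc c) z))
      <= K * normc h ^+ 2.
Proof.
move=> sc r0 r1.
have se : subexp (fun n => n.+1%:R ^+ 2 * cnorm c n).
  by apply: subexpM => //; apply: subexpX; exact: subexp_nat.
have [K [q [K0 q0 q1 hK]]] := subexp_geom se (ltW r0) r1.
exists (2 * K / (1 - q) / r ^+ 2).
  by rewrite divr_ge0 ?sqr_ge0// divr_ge0 ?mulr_ge0// subr_ge0 ltW.
move=> z h hz hz'; pose s := normc h / r.
have hs : normc h <= s * r by rewrite /s divfK// gt_eqF.
have s0 : 0 <= s by rewrite divr_ge0 ?nc_ge0// ltW.
have z1 : normc z < 1 by exact: le_lt_trans r1.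
have z'1 : normc (z + h) < 1 by exact: le_lt_trans r1.
have g1 := geom_hterm sc z1; have g2 := geom_hterm sc z'1.
have gz := geom_hterm (subc_dzc sc) z1; have gzb := geom_hterm (subc_dzbc sc) z1.
have gd' : geom (fun n => dterm c n.+1 z h).
  have [A [p [A0 p0 p1 hA]]] := geomD (geomZ h gz) (geomZ (conjc h) gzb).
  by exists A, p; split=> // n; rewrite dtermS; exact: hA.
have gd : geom (fun n => dterm c n z h).
  have [A [p [A0 p0 p1 hA]]] := gd'.
  (* Shifting the index divides by the ratio, and p may be 0; (1 + p) / 2 is a larger ratio that is
     positive and below 1. *)
  have p1' : p < (1 + p) / 2 by lra.
  exists (A / ((1 + p) / 2)), ((1 + p) / 2); split; [|lra|lra|].
    by rewrite divr_ge0//; lra.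
  case=> [|n]; first by rewrite dterm0 nc0 expr0 mulr1 divr_ge0//; lra.
  apply: le_trans (hA n) _; rewrite exprS mulrA divfK; last by rewrite gt_eqF//; lra.
  by rewrite ler_wpM2l// lerXn2r ?nnegrE//; lra.
have eD : csum (fun n => dterm c n z h) = h * PS (dzc c) z + conjc h * PS (dzbc c) z.
  rewrite csumS// dterm0 add0r (eq_csum (fun n => dtermS c n z h)).
  by rewrite csumD ?csumZ//; exact: geomZ.
rewrite -eD /PS -csumB// -csumB//; last exact: geomB.
apply: le_trans (@csum_le _ _ (K * s ^+ 2) q _) _; last first.
  suff -> : 2 * (K * s ^+ 2) / (1 - q) = 2 * K / (1 - q) / r ^+ 2 * normc h ^+ 2 by [].
  by rewrite /s expr_div_n; ring.
split=> //; first by rewrite mulr_ge0 ?sqr_ge0.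
move=> n; apply: le_trans (hterm_appr c n (ltW r0) s0 hz hz' hs) _.
rewrite [leRHS]mulrAC; apply: ler_wpM2r; first exact: sqr_ge0.
apply: le_trans (hK n); rewrite ger0_norm ?mulr_ge0 ?cnorm_ge0 ?sqr_ge0//.
apply: ler_wpM2r; first by rewrite exprn_ge0// ltW.
apply: ler_wpM2r; first exact: cnorm_ge0.
by rewrite lerXn2r ?nnegrE ?ler0n// ler_nat.
Qed.

End PowerSeries.

(** * Wirtinger derivatives *)

Section Wirtinger.
Variable R : realType.
Implicit Types (f g : R[i] -> R[i]) (z w h L M : R[i]).

(** L and M are the derivatives in z and conj(z). Asking for a quadratic remainder, and not merely a
    small one, feeds [quad_derive] directly. *)
Definition wirt f z L M := exists K d, 0 < d /\ forall h, normc h < d ->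
  normc (f (z + h) - f z - (h * L + conjc h * M)) <= K * normc h ^+ 2.

Lemma wirt_continuous f z L M : wirt f z L M ->
  {for z, continuous (f : R[i]^o -> R[i]^o)}.
Proof.
move=> [K [d [d0 H]]]; apply/continuous_complexP => e e0.
pose B := `|K| * d + normc L + normc M + 1.
have B0 : 0 < B by rewrite /B ltr_wpDl// !addr_ge0 ?nc_ge0// mulr_ge0// ltW.
exists (Num.min d (e / B)); first by rewrite lt_min d0 divr_gt0.
move=> w; rewrite lt_min => /andP[hd he].
pose h := w - z; have -> : w = z + h by rewrite addrC subrK.
have := H _ hd; rewrite -/h => Hh.
rewrite -(subrK (h * L + conjc h * M) (f (z + h) - f z)).
apply: le_lt_trans (ncD _ _) _.
apply: le_lt_trans (_ : normc h * B < e); last by rewrite -ltr_pdivlMr.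
have h0 := nc_ge0 h.
have -> : normc h * B = normc h * (`|K| * d) + normc h * (normc L + normc M) + normc h.
  by rewrite /B; ring.
rewrite -[leRHS]addrA; apply: lerD.
  apply: le_trans Hh _; rewrite expr2 mulrCA; apply: ler_wpM2l => //.
  apply: le_trans (_ : `|K| * normc h <= _); first by apply: ler_wpM2r => //; exact: ler_norm.
  by apply: ler_wpM2l => //; exact: ltW.
rewrite ler_wpDr//; apply: le_trans (ncD _ _) _.
by rewrite !normcM ncJ mulrDr.
Qed.

Lemma wirt_mulz f z L M : wirt f z L M ->
  wirt (fun w => w * f w) z (f z + z * L) (z * M).
Proof.
move=> [K [d [d0 H]]].
exists ((normc z + d) * `|K| + (normc L + normc M)), d; split => // h hd.
have -> : (z + h) * f (z + h) - z * f z - (h * (f z + z * L) + conjc h * (z * M)) =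
  (z + h) * (f (z + h) - f z - (h * L + conjc h * M)) + h * (h * L + conjc h * M).
  by ring.
have h0 := nc_ge0 h.
apply: le_trans (ncD _ _) _; rewrite !normcM mulrDl; apply: lerD.
  rewrite -mulrA; apply: ler_pM; rewrite ?nc_ge0//.
    by apply: le_trans (ncD _ _) _; rewrite lerD2l ltW.
  apply: le_trans (H h hd) _.
  by apply: ler_wpM2r; [exact: sqr_ge0|exact: ler_norm].
rewrite mulrC expr2 mulrA; apply: ler_wpM2r => //.
apply: le_trans (ncD _ _) _; rewrite !normcM ncJ.
by rewrite mulrDl (mulrC (normc L)) (mulrC (normc M)).
Qed.

Lemma wirt_mulzb f z L M : wirt f z L M ->
  wirt (fun w => conjc w * f w) z (conjc z * L) (f z + conjc z * M).
Proof.
move=> [K [d [d0 H]]].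
exists ((normc z + d) * `|K| + (normc L + normc M)), d; split => // h hd.
have -> : conjc (z + h) * f (z + h) - conjc z * f z -
    (h * (conjc z * L) + conjc h * (f z + conjc z * M)) =
  conjc (z + h) * (f (z + h) - f z - (h * L + conjc h * M)) + conjc h * (h * L + conjc h * M).
  by rewrite rmorphD; ring.
have h0 := nc_ge0 h.
apply: le_trans (ncD _ _) _; rewrite !normcM !ncJ mulrDl; apply: lerD.
  rewrite -mulrA; apply: ler_pM; rewrite ?nc_ge0//.
    by apply: le_trans (ncD _ _) _; rewrite lerD2l ltW.
  apply: le_trans (H h hd) _.
  by apply: ler_wpM2r; [exact: sqr_ge0|exact: ler_norm].
rewrite mulrC expr2 mulrA; apply: ler_wpM2r => //.
apply: le_trans (ncD _ _) _; rewrite !normcM ncJ.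
by rewrite mulrDl (mulrC (normc L)) (mulrC (normc M)).
Qed.

Lemma wirtD f g z L M L' M' : wirt f z L M -> wirt g z L' M' ->
  wirt (fun w => f w + g w) z (L + L') (M + M').
Proof.
move=> [K [d [d0 H]]] [K' [d' [d'0 H']]].
exists (K + K'), (Num.min d d'); split; first by rewrite lt_min d0.
move=> h; rewrite lt_min => /andP[h1 h2].
have -> : f (z + h) + g (z + h) - (f z + g z) - (h * (L + L') + conjc h * (M + M')) =
 (f (z + h) - f z - (h * L + conjc h * M)) + (g (z + h) - g z - (h * L' + conjc h * M')) by ring.
by apply: le_trans (ncD _ _) _; rewrite mulrDl; apply: lerD; [exact: H|exact: H'].
Qed.

Lemma wirtZ (a : R[i]) f z L M : wirt f z L M ->
  wirt (fun w => a * f w) z (a * L) (a * M).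
Proof.
move=> [K [d [d0 H]]]; exists (normc a * K), d; split => // h hd.
have -> : a * f (z + h) - a * f z - (h * (a * L) + conjc h * (a * M)) =
  a * (f (z + h) - f z - (h * L + conjc h * M)) by ring.
by rewrite normcM -mulrA; apply: ler_wpM2l; [exact: nc_ge0|exact: H].
Qed.

Lemma wirt_PS (c : nat -> nat -> R[i]) z : subc c -> disk z ->
  wirt (PS c) z (PS (dzc c) z) (PS (dzbc c) z).
Proof.
rewrite /disk /= => sc z1.
have [r /andP[r0 r1] zr] := between_lt1 (nc_ge0 z) z1.
have [K K0 H] := PS_diff sc r0 r1.
exists K, (r - normc z); split; first by rewrite subr_gt0.
move=> h hd; apply: H; first exact: ltW.
by apply: le_trans (ncD _ _) _; rewrite addrC -lerBrDr ltW.
Qed.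

Section Partials.
Variables (f : R[i] -> R[i]) (z L M : R[i]).
Hypothesis W : wirt f z L M.

(** Common to the four real partial derivatives: [p] is Re or Im, and [u] is the direction 1 or
    i. *)
Let quad (p : R[i] -> R) (u : R[i]) (F : R -> R) t :
  (forall x y, p (x - y) = p x - p y) -> (forall x, `|p x| <= normc x) ->
  (forall (a : R) x, p (a%:C * x) = a * p x) ->
  normc u = 1 -> (forall h : R, F (t + h) = p (f (z + h%:C * u))) -> F t = p (f z) ->
  is_derive t 1 F (p (u * L + conjc u * M)).
Proof.
move=> pB pn pZ u1 FE Ft; have [K [d [d0 H]]] := W.
apply: (@quad_derive _ _ _ _ K d) => // h hd.
rewrite FE Ft -pB -pZ -pB; apply: le_trans (pn _) _.
have hu : normc (h%:C * u) = `|h| by rewrite normcM u1 mulr1 ncR.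
have := H (h%:C * u); rewrite hu => /(_ hd).
have -> : conjc (h%:C * u) = h%:C * conjc u.
  by rewrite rmorphM /=; congr (_ * _); rewrite /= oppr0.
by rewrite real_normK ?num_real// -!mulrA -mulrDr.
Qed.

Lemma wirt_x : is_derive (complex.Re z) 1 (fun t : R => complex.Re (f (t +i* complex.Im z)))
     (complex.Re (L + M)) /\
  is_derive (complex.Re z) 1 (fun t : R => complex.Im (f (t +i* complex.Im z)))
     (complex.Im (L + M)).
Proof.
have e (h : R) : (complex.Re z + h) +i* complex.Im z = z + h%:C * 1.
  by case: z => a b; rewrite mulr1; apply: complex_eq; rewrite /= ?addr0.
have e1 : 1 * L + conjc 1 * M = L + M.
  by rewrite (_ : conjc 1 = 1 :> R[i]) ?mul1r//; exact: rmorph1.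
rewrite -e1; split; apply: quad.
- by move=> x y; rewrite cReD cReN.
- exact: Re_le.
- by move=> a [x y]; rewrite /= mul0r subr0.
- exact: nc1.
- by move=> h; rewrite e.
- by case: z.
- by move=> x y; rewrite cImD cImN.
- exact: Im_le.
- by move=> a [x y]; rewrite /= mul0r addr0.
- exact: nc1.
- by move=> h; rewrite e.
- by case: z.
Qed.

Lemma wirt_y : is_derive (complex.Im z) 1 (fun t : R => complex.Re (f (complex.Re z +i* t)))
     (complex.Re ((0 +i* 1) * (L - M))) /\
  is_derive (complex.Im z) 1 (fun t : R => complex.Im (f (complex.Re z +i* t)))
     (complex.Im ((0 +i* 1) * (L - M))).
Proof.
have e (h : R) : complex.Re z +i* (complex.Im z + h) = z + h%:C * (0 +i* 1).
  by case: z => a b; apply: complex_eq; rewrite /=; ring.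
have e1 : (0 +i* 1) * L + conjc (0 +i* 1) * M = (0 +i* 1) * (L - M).
  have -> : conjc (0 +i* 1) = - (0 +i* 1) :> R[i] by apply: complex_eq; rewrite /= ?oppr0.
  by ring.
have u1 : normc (0 +i* 1 : R[i]) = 1 by rewrite /= expr0n add0r expr1n sqrtr1.
rewrite -e1; split; apply: quad => //.
- by move=> x y; rewrite cReD cReN.
- exact: Re_le.
- by move=> a [x y]; rewrite /= mul0r subr0.
- by move=> h; rewrite e.
- by case: z.
- by move=> x y; rewrite cImD cImN.
- exact: Im_le.
- by move=> a [x y]; rewrite /= mul0r addr0.
- by move=> h; rewrite e.
- by case: z.
Qed.

Lemma wirt_has_partials : has_partials f z.
Proof.
have [h1 h2] := wirt_x; have [h3 h4] := wirt_y.
by split; [exact: (@ex_derive _ _ _ _ _ _ _ h1)|exact: (@ex_derive _ _ _ _ _ _ _ h2)|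
 exact: (@ex_derive _ _ _ _ _ _ _ h3)|exact: (@ex_derive _ _ _ _ _ _ _ h4)].
Qed.

Lemma wirt_partial_x : partial_x f z = L + M.
Proof.
have [h1 h2] := wirt_x; rewrite /partial_x !derive1E.
by rewrite (@derive_val _ _ _ _ _ _ _ h1) (@derive_val _ _ _ _ _ _ _ h2) -complexE.
Qed.

Lemma wirt_partial_y : partial_y f z = (0 +i* 1) * (L - M).
Proof.
have [h1 h2] := wirt_y; rewrite /partial_y !derive1E.
by rewrite (@derive_val _ _ _ _ _ _ _ h1) (@derive_val _ _ _ _ _ _ _ h2) -complexE.
Qed.

Let ii : (0 +i* 1) * (0 +i* 1) = -1 :> R[i].
Proof. by apply: complex_eq; rewrite /=; ring. Qed.

Lemma wirt_d_z : d_z f z = L.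
Proof.
rewrite /d_z wirt_partial_x wirt_partial_y mulrA ii mulN1r opprK.
have -> : L + M + (L - M) = L * 2 by ring.
by rewrite mulfK// pnatr_eq0.
Qed.

Lemma wirt_d_zbar : d_zbar f z = M.
Proof.
rewrite /d_zbar wirt_partial_x wirt_partial_y mulrA ii mulN1r.
have -> : L + M - (L - M) = M * 2 by ring.
by rewrite mulfK// pnatr_eq0.
Qed.

End Partials.

(** * Dependence on the values in the disk alone *)

Section Locality.
Variables f g : R[i] -> R[i].
Hypothesis fg : forall w, disk w -> f w = g w.

Let nearx z (p : R[i] -> R) : disk z ->
  {near complex.Re z, (fun t => p (f (t +i* complex.Im z))) =1 (fun t => p (g (t +i* complex.Im z)))}.
Proof.
move=> Dz; have [d d0 hd] := disk_nbhs Dz.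
apply/nbhs_ballP; exists d => // t /= ht; congr p; apply: fg; apply: hd.
rewrite [X in _ - X]complexE /= subrr expr0n addr0 sqrtr_sqr distrC.
exact: ht.
Qed.

Let neary z (p : R[i] -> R) : disk z ->
  {near complex.Im z, (fun t => p (f (complex.Re z +i* t))) =1 (fun t => p (g (complex.Re z +i* t)))}.
Proof.
move=> Dz; have [d d0 hd] := disk_nbhs Dz.
apply/nbhs_ballP; exists d => // t /= ht; congr p; apply: fg; apply: hd.
rewrite [X in _ - X]complexE /= subrr expr0n add0r sqrtr_sqr distrC.
exact: ht.
Qed.

Lemma has_partials_eq z : disk z -> has_partials f z -> has_partials g z.
Proof.
by move=> Dz [h1 h2 h3 h4]; split; [move: h1|move: h2|move: h3|move: h4];
  apply: near_eq_derivable; [exact: nearx|exact: nearx|exact: neary|exact: neary].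
Qed.

Lemma partial_x_eq z : disk z -> partial_x f z = partial_x g z.
Proof.
by move=> Dz; rewrite /partial_x !derive1E; congr (_ +i* _); apply: near_eq_derive; exact: nearx.
Qed.

Lemma partial_y_eq z : disk z -> partial_y f z = partial_y g z.
Proof.
by move=> Dz; rewrite /partial_y !derive1E; congr (_ +i* _); apply: near_eq_derive; exact: neary.
Qed.

Lemma continuous_eq : continuous_on_disk f -> continuous_on_disk g.
Proof.
move=> cf z Dz; apply/continuous_complexP => e e0.
have /continuous_complexP/(_ e e0)[d d0 hd] := cf z Dz.
have [d' d'0 hd'] := disk_nbhs Dz.
exists (Num.min d d'); first by rewrite lt_min d0.
by move=> w; rewrite lt_min => /andP[h1 h2]; rewrite -!fg//; [exact: hd|exact: hd'].
Qed.

Lemma refl_quotient_eq z : disk z -> refl_quotient f z = refl_quotient g z.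
Proof. by move=> Dz; rewrite /refl_quotient !fg//; exact: disk_conj. Qed.

Lemma refl_quotient_ext_eq z : disk z -> refl_quotient_ext f z = refl_quotient_ext g z.
Proof.
move=> Dz; rewrite /refl_quotient_ext refl_quotient_eq//; case: ifP => // _.
have [d d0 hd] := disk_nbhs Dz.
have E : ((refl_quotient f : R[i]^o -> R[i]^o) @
    within [set w : R[i]^o | complex.Im w != 0] (nbhs (z : R[i]^o))) =
    ((refl_quotient g : R[i]^o -> R[i]^o) @
    within [set w : R[i]^o | complex.Im w != 0] (nbhs (z : R[i]^o))).
  rewrite eqEsubset; split; apply: near_eq_cvg; rewrite /within;
  by apply/nbhs_complexP; exists d => // w /hd Dw /= _; rewrite refl_quotient_eq.
by rewrite E.
Qed.

Lemma dunkl_z_eq lambda z : disk z -> dunkl_z lambda f z = dunkl_z lambda g z.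
Proof.
by move=> Dz; rewrite /dunkl_z /d_z partial_x_eq// partial_y_eq// refl_quotient_ext_eq.
Qed.

End Locality.

Lemma Ck_eq k : forall f g, (forall w, disk w -> f w = g w) ->
  Ck_on_disk k f -> Ck_on_disk k g.
Proof.
elim: k => [|k IH] f g fg [cf h]; split; try exact: continuous_eq cf.
  by [].
case: h => h1 h2 h3; split.
- by move=> z Dz; apply: has_partials_eq (h1 z Dz).
- by apply: IH h2 => z Dz; exact: partial_x_eq.
- by apply: IH h3 => z Dz; exact: partial_y_eq.
Qed.

Lemma PS_continuous (c : nat -> nat -> R[i]) : subc c -> continuous_on_disk (PS c).
Proof. by move=> sc z Dz; exact: wirt_continuous (wirt_PS sc Dz). Qed.

Lemma Ck_PS k : forall c : nat -> nat -> R[i], subc c -> Ck_on_disk k (PS c).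
Proof.
elim: k => [|k IH] c sc; split; try exact: PS_continuous; first by [].
have s1 := subc_dzc sc; have s2 := subc_dzbc sc.
split.
- by move=> z Dz; exact: wirt_has_partials (wirt_PS sc Dz).
- apply: (Ck_eq _ (IH (addc (dzc c) (dzbc c)) (subc_add s1 s2))) => z Dz.
  by rewrite (wirt_partial_x (wirt_PS sc Dz)) PS_add.
- apply: (Ck_eq _ (IH (scalec (0 +i* 1) (addc (dzc c) (scalec (-1) (dzbc c)))) _)).
    move=> z Dz; rewrite (wirt_partial_y (wirt_PS sc Dz)).
    rewrite PS_scale//; last by apply: subc_add => //; exact: subc_scale.
    rewrite PS_add ?PS_scale ?mulN1r//; exact: subc_scale.
  by apply: subc_scale; apply: subc_add => //; exact: subc_scale.
Qed.

End Wirtinger.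

(** * The functions phi_n *)

Section Pochhammer.
Variable R : realType.
Implicit Types (a b : R).

(** The Taylor coefficient of (1 - x)^(-a) at x^n. *)
Definition pf a n : R := pochhammer a n / n`!%:R.

Lemma pf0 a : pf a 0 = 1.
Proof. by rewrite /pf /pochhammer big_ord0 fact0 divr1. Qed.

Lemma pfS a n : n.+1%:R * pf a n.+1 = (a + n%:R) * pf a n.
Proof.
rewrite /pf /pochhammer big_ord_recr/= factS natrM.
by field; rewrite nat1r !pnatr_eq0 -lt0n fact_gt0.
Qed.

Lemma pfSE a n : pf a n.+1 = (a + n%:R) / n.+1%:R * pf a n.
Proof.
apply: (@mulfI _ (n.+1%:R)); first by rewrite pnatr_eq0.
by rewrite pfS; field; rewrite nat1r pnatr_eq0.
Qed.

Lemma pf_ge0 a n : 0 <= a -> 0 <= pf a n.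
Proof.
move=> a0; elim: n => [|n IH]; first by rewrite pf0.
by rewrite pfSE mulr_ge0// divr_ge0// addr_ge0.
Qed.

Lemma pf_gt0 a n : 0 < a -> 0 < pf a n.
Proof.
move=> a0; elim: n => [|n IH]; first by rewrite pf0.
by rewrite pfSE mulr_gt0// divr_gt0// ltr_pwDl.
Qed.

Lemma pf_ge1 a n : 1 <= a -> 1 <= pf a n.
Proof.
move=> a1; elim: n => [|n IH]; first by rewrite pf0.
rewrite pfSE -[leLHS]mul1r ler_pM// ler_pdivlMr// mul1r -natr1 addrC.
by rewrite lerD2r.
Qed.

Lemma pf_00 n : pf 0 n.+1 = 0 :> R.
Proof. by rewrite /pf /pochhammer big_ord_recl/= add0r !mul0r. Qed.

Lemma pf_shift a n : a * pf (a + 1) n = (a + n%:R) * pf a n.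
Proof.
rewrite /pf /pochhammer !mulrA; congr (_ / _).
rewrite -[RHS]mulrC -(big_ord_recr n (fun i => a + i%:R))/= big_ord_recl/= addr0.
by congr (_ * _); apply: eq_bigr => i _; rewrite /bump add1n -addrA nat1r.
Qed.

(** Compares coefficients in (1 - x)^(-a) (1 - x)^(-b) = (1 - x)^(-a-b). Writing n + 1 = j + (n + 1
    - j) makes the left side obey the recursion [pfS] of the right one. *)
Lemma vandermonde a b n : \sum_(j < n.+1) pf a j * pf b (n - j) = pf (a + b) n.
Proof.
elim: n => [|n IH]; first by rewrite big_ord1 subnn !pf0 mulr1.
apply: (@mulfI _ (n.+1%:R)); first by rewrite pnatr_eq0.
rewrite pfS -IH mulr_sumr.
transitivity (\sum_(j < n.+2) (j%:R * pf a j) * pf b (n.+1 - j) +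
  \sum_(j < n.+2) pf a j * ((n.+1 - j)%:R * pf b (n.+1 - j))).
  rewrite -big_split/=; apply: eq_bigr => j _.
  by rewrite natrB ?leq_ord//; ring.
rewrite big_ord_recl [X in _ + X]big_ord_recr/= !mul0r add0r subnn mul0r mulr0 addr0.
rewrite -big_split/= mulr_sumr; apply: eq_bigr => j _.
rewrite /bump add1n subSS subSn ?leq_ord// !pfS natrB ?leq_ord//; ring.
Qed.

Lemma bernoulli_le (x : R) M : 0 <= x -> 1 + M%:R * x <= (1 + x) ^+ M.
Proof.
move=> x0; elim: M => [|M IH]; first by rewrite mul0r addr0.
rewrite exprS -natr1; apply: le_trans (_ : (1 + x) * (1 + M%:R * x) <= _); last first.
  by rewrite ler_wpM2l// addr_ge0.
have : 0 <= M%:R * x * x by rewrite !mulr_ge0.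
by set y := M%:R; nra.
Qed.

(** If a <= M then [pf a n] <= (n + 1)^M, since by Bernoulli's inequality each ratio of consecutive
    coefficients is at most (1 + 1 / (n + 1))^M. *)
Lemma subexp_pf a : 1 <= a -> subexp (pf a).
Proof.
move=> a1; pose M := Num.bound a.
have aM : a <= M%:R by rewrite ltW// archi_boundP// (le_trans _ a1).
apply: subexp_le (subexpX M (@subexp_nat R)) => n.
rewrite ger0_norm ?pf_ge0 ?(le_trans _ a1)// ger0_norm ?exprn_ge0//.
elim: n => [|n IH]; first by rewrite pf0 expr1n.
rewrite pfSE.
have -> : n.+2%:R ^+ M = (1 + n.+1%:R^-1) ^+ M * n.+1%:R ^+ M :> R.
  by rewrite -exprMn mulrDl mul1r mulVf ?pnatr_eq0// -natr1.
apply: ler_pM => //; first by rewrite divr_ge0// addr_ge0// (le_trans _ a1).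
  by rewrite pf_ge0// (le_trans _ a1).
apply: le_trans (bernoulli_le _ _); last by rewrite invr_ge0.
rewrite ler_pdivrMr// mulrDl mul1r divfK ?pnatr_eq0// -natr1; lra.
Qed.

End Pochhammer.

(** * The functions phi_n and the Dunkl operators on their series *)

Section Phi.
Variables (R : realType) (lambda : R).
Hypothesis l0 : 0 <= lambda.
Implicit Types (b : nat -> R[i]) (z w : R[i]).

(** [SS n z] is phi_n without its normalisation: the coefficient of x^n in (1 - conj(z) x)^(-lambda)
    (1 - z x)^(-lambda-1), with [kap n j] its coefficients in conj(z)^j z^(n-j). [pn n] is its value
    at z = 1 and bounds it on the disk, and [eps n] is the power -1/2 of [pn n]. *)
Definition kap n j : R := pf lambda j * pf (lambda + 1) (n - j).
Definition pn n : R := pf (2 * lambda + 1) n.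
Definition eps n : R := Num.sqrt (n`!%:R / pochhammer (2 * lambda + 1) n).
Definition SS n z : R[i] := hterm (fun n j => (kap n j)%:C) n z.
Definition phic b n j : R[i] := b n * (eps n)%:C * (kap n j)%:C.

Let l1 : 0 <= lambda + 1. Proof. by rewrite addr_ge0. Qed.
Let l2 : 1 <= 2 * lambda + 1. Proof. by rewrite lerDr mulr_ge0. Qed.

Lemma pn_ge1 n : 1 <= pn n.
Proof. exact: pf_ge1. Qed.

Lemma pn_gt0 n : 0 < pn n.
Proof. exact: lt_le_trans (pn_ge1 n). Qed.

Lemma kap_ge0 n j : 0 <= kap n j.
Proof. by rewrite mulr_ge0 ?pf_ge0. Qed.

Lemma sum_kap n : \sum_(j < n.+1) kap n j = pn n.
Proof. by rewrite vandermonde addrA -mulr2n -mulr_natl. Qed.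

Lemma epsE n : eps n = Num.sqrt (pn n)^-1.
Proof. by rewrite /eps /pn /pf invf_div. Qed.

Lemma eps_gt0 n : 0 < eps n.
Proof. by rewrite epsE sqrtr_gt0 invr_gt0 pn_gt0. Qed.

Lemma eps_sqr n : eps n ^+ 2 * pn n = 1.
Proof.
rewrite epsE sqr_sqrtr ?invr_ge0 ?(ltW (pn_gt0 n))//.
by rewrite mulVf// gt_eqF// pn_gt0.
Qed.

Lemma eps_le1 n : eps n <= 1.
Proof. by rewrite epsE -sqrtr1 ler_sqrt// invf_le1 ?pn_gt0 ?pn_ge1. Qed.

Lemma phiE n z : phi lambda n z = (eps n)%:C * SS n z.
Proof.
rewrite /phi /SS /hterm; congr (_ * _); apply: eq_bigr => j _; congr (_%:C * _ * _).
by rewrite /kap /pf mulrACA -invfM.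
Qed.

Lemma hterm_phic b n z : hterm (phic b) n z = b n * phi lambda n z.
Proof.
rewrite phiE /SS /hterm !mulr_sumr; apply: eq_bigr => j _.
by rewrite /phic; ring.
Qed.

Lemma SS_real n (x : R) : SS n x%:C = (pn n * x ^+ n)%:C.
Proof.
rewrite /SS /hterm -sum_kap mulr_suml rmorph_sum; apply: eq_bigr => j _.
transitivity ((kap n j)%:C * (x ^+ n)%:C); last by rewrite -RCM.
by rewrite conjcR RCX -mulrA -exprD subnKC ?leq_ord.
Qed.

Lemma phi_real n (x : R) : phi lambda n x%:C = (eps n * pn n * x ^+ n)%:C.
Proof. by rewrite phiE SS_real -rmorphM/= mulrA. Qed.

Lemma SS_conj n z : SS n (conjc z) = conjc (SS n z).
Proof.
rewrite /SS /hterm rmorph_sum/=; apply: eq_bigr => j _.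
rewrite !rmorphM !rmorphXn /= conjcK oppr0; by [].
Qed.

Lemma cnorm_phic b n : cnorm (phic b) n = normc (b n) * eps n * pn n.
Proof.
rewrite -sum_kap mulr_sumr; apply: eq_bigr => j _.
by rewrite !normcM !ncR !ger0_norm ?kap_ge0// ltW// eps_gt0.
Qed.

Lemma subexp_pn : subexp pn.
Proof. exact: subexp_pf. Qed.

Lemma cnorm_phic_le b n : cnorm (phic b) n <= normc (b n) * pn n.
Proof.
rewrite cnorm_phic ler_wpM2r ?(ltW (pn_gt0 n))// ler_piMr ?nc_ge0//.
exact: eps_le1.
Qed.

Lemma subc_phic b : subexp (fun n => normc (b n)) -> subc (phic b).
Proof.
by move=> hb; apply: subexp_cnorm (subexpM hb subexp_pn) (@cnorm_phic_le b).
Qed.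

Lemma phi_le n z : normc (phi lambda n z) <= pn n * normc z ^+ n.
Proof.
have := @hterm_le _ (phic (fun=> 1)) n z _ (lexx _).
rewrite hterm_phic mul1r => /le_trans; apply.
rewrite ler_wpM2r ?exprn_ge0 ?nc_ge0//.
by apply: le_trans (cnorm_phic_le _ _) _; rewrite nc1 mul1r.
Qed.

(** The equation D_zbar phi = 0, cleared of its denominator z - conj(z), read on the coefficient of
    conj(z)^j z^(n+1-j). *)
Lemma kap_dzb n j : (j <= n)%N -> j.+1%:R * kap n.+1 j.+1 - j%:R * kap n.+1 j =
  lambda * (kap n.+1 j - kap n.+1 (n.+1 - j)).
Proof.
move=> jn; rewrite /kap subSS subKn ?(leq_trans jn)// subSn// mulrA pfS.
have e3 := pf_shift lambda j.
have e5 : pf (lambda + 1) (n - j).+1 = pf (lambda + 1) (n - j) + pf lambda (n - j).+1.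
  apply: (@mulfI _ ((n - j).+1%:R)); first by rewrite pnatr_eq0.
  by rewrite mulrDr !pfS -(pf_shift lambda) -natr1; ring.
by rewrite e5 mulrBr [lambda * (pf lambda (n - j).+1 * _)]mulrCA e3; ring.
Qed.

Lemma dzb_SS n z : (z - conjc z) * hterm (dzbc (fun n j => (kap n j)%:C)) n z =
  lambda%:C * (SS n.+1 z - SS n.+1 (conjc z)).
Proof.
set zb := conjc z.
have e1 : SS n.+1 zb = \sum_(j < n.+2) (kap n.+1 (n.+1 - j))%:C * zb ^+ j * z ^+ (n.+1 - j).
  rewrite /SS /hterm (reindex_inj rev_ord_inj)/=; apply: eq_bigr => j _.
  by rewrite /zb conjcK subSS subKn ?leq_ord// mulrAC.
rewrite e1 /SS /hterm -/zb -sumrB [RHS]mulr_sumr [LHS]mulr_sumr.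
(* Multiplication by z produces no term of index j = n + 1; the truth value removes it, and this top
   coefficient is checked apart. *)
transitivity (\sum_(j < n.+2) ((j <= n)%N%:R * j.+1%:R * (kap n.+1 j.+1)%:C - j%:R * (kap n.+1 j)%:C)
   * (zb ^+ j * z ^+ (n.+1 - j))).
  under eq_bigr do rewrite mulrBl; under [RHS]eq_bigr do rewrite mulrBl.
  rewrite !sumrB; congr (_ - _).
    rewrite [RHS]big_ord_recr/= ltnn !mul0r addr0; apply: eq_bigr => j _.
    by rewrite leq_ord mul1r /dzbc subSn ?leq_ord// exprS; ring.
  rewrite [RHS]big_ord_recl/= !mul0r add0r; apply: eq_bigr => j _.
  by rewrite /dzbc /bump add1n subSS exprS; ring.
apply: eq_bigr => j _.
have -> : (j <= n)%N%:R * j.+1%:R * (kap n.+1 j.+1)%:C - j%:R * (kap n.+1 j)%:C =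
   (lambda * (kap n.+1 j - kap n.+1 (n.+1 - j)))%:C :> R[i].
  have := leq_ord j; rewrite leq_eqVlt => /orP[/eqP ->|]; last first.
    rewrite ltnS => jn; rewrite -kap_dzb// jn mul1r rmorphB !rmorphM.
    by rewrite !rmorph_nat.
  rewrite ltnn !mul0r sub0r -(rmorph_nat (real_complex R)) -rmorphM -rmorphN; congr (_%:C).
  have := pf_shift lambda n.+1; rewrite /kap subnn !pf0 subn0 !mulr1 mul1r mulrBr => ->.
  by ring.
by rewrite rmorphM rmorphB /=; ring.
Qed.

Lemma dzb_phic b n z : (z - conjc z) * hterm (dzbc (phic b)) n z =
  lambda%:C * (hterm (phic b) n.+1 z - hterm (phic b) n.+1 (conjc z)).
Proof.
have -> : hterm (dzbc (phic b)) n z =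
   b n.+1 * (eps n.+1)%:C * hterm (dzbc (fun n j => (kap n j)%:C)) n z.
  by rewrite /hterm mulr_sumr; apply: eq_bigr => j _; rewrite /dzbc /phic; ring.
by rewrite mulrCA dzb_SS !hterm_phic !phiE; ring.
Qed.

Section Series.
Variable b : nat -> R[i].
Hypothesis hb : subexp (fun n => normc (b n)).
Let sb := subc_phic hb.

Lemma dzb_PS z : disk z -> (z - conjc z) * PS (dzbc (phic b)) z =
  lambda%:C * (PS (phic b) z - PS (phic b) (conjc z)).
Proof.
move=> Dz; have Dz' := disk_conj Dz.
have g1 := geom_hterm sb Dz; have g2 := geom_hterm sb Dz'.
rewrite /PS [X in _ = _ * (X - _)]csumS// [X in _ = _ * (_ - X)]csumS//.
have -> : hterm (phic b) 0 (conjc z) = hterm (phic b) 0 z by rewrite /hterm !big_ord1.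
rewrite opprD addrACA subrr add0r -(csumB (geomS g1) (geomS g2)).
rewrite -csumZ; last exact: geom_hterm (subc_dzbc sb) Dz.
rewrite -csumZ; last exact: (geomB (geomS g1) (geomS g2)).
by apply: eq_csum => n; exact: dzb_phic.
Qed.

Lemma dzb_PS_lambda0 z : lambda = 0 -> PS (dzbc (phic b)) z = 0.
Proof.
move=> l00; rewrite /PS (@csum_unique _ _ 0 0 0)//.
  exists 0, 0; split=> // n; rewrite /hterm big1 ?nc0 ?mul0r// => j _.
  by rewrite /dzbc /phic /kap l00 pf_00 mul0r !mulr0 !mul0r.
move=> N; rewrite big1 ?subrr ?nc0 ?mul0r// => n _.
rewrite /hterm big1// => j _.
by rewrite /dzbc /phic /kap l00 pf_00 mul0r !mulr0 !mul0r.
Qed.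

Let alg (v v' p p' l : R[i]) : l != 0 ->
  v * p - v' * p' = l^-1 * (v' * (l * (p - p'))) + p * (v - v').
Proof. by move=> ln0; field. Qed.

Let subN (x : R[i]) : complex.Im x != 0 -> x - conjc x != 0.
Proof.
move=> h; apply/eqP => /(congr1 (@complex.Im R)); rewrite cImD cImN /=; case: x h => a c /= h.
by rewrite opprK => /eqP; rewrite -mulr2n mulrn_eq0/=; exact/negP.
Qed.

(** Off the axis [dzb_PS] is divided by z - conj(z); on the axis the right side is the continuous
    extension required by [lim_refl_quotient]. The case lambda = 0 is separate because the quotient
    is expressed with 1 / lambda. *)
Lemma refl_ext_PS z : disk z ->
  lambda%:C * refl_quotient_ext (PS (phic b)) z = PS (dzbc (phic b)) z.
Proof.
move=> Dz; have [l00|ln0] := eqVneq lambda 0.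
  by rewrite dzb_PS_lambda0// l00 mul0r.
have lC : lambda%:C != 0 :> R[i] by rewrite -nc_eq0 ncR normr_eq0.
have H w : disk w -> complex.Im w != 0 ->
    refl_quotient (PS (phic b)) w = lambda%:C^-1 * PS (dzbc (phic b)) w.
  move=> Dw /subN Iw; rewrite /refl_quotient; apply: (mulIf Iw); rewrite divfK//.
  by apply: (mulfI lC); rewrite -[X in _ = _ * X]mulrA [RHS]mulrA divff// mul1r [RHS]mulrC dzb_PS.
rewrite /refl_quotient_ext; case: eqP => [I0|/eqP I0]; last by rewrite H// mulrA divff// mul1r.
rewrite (lim_refl_quotient Dz I0 H) ?mulrA ?divff ?mul1r//.
exact: wirt_continuous (wirtZ _ (wirt_PS (subc_dzbc sb) Dz)).
Qed.

Lemma lambda_analytic_PS : lambda_analytic lambda (PS (phic b)).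
Proof.
split; first exact: Ck_PS.
by move=> z Dz; rewrite /dunkl_zbar refl_ext_PS// (wirt_d_zbar (wirt_PS sb Dz)) subrr.
Qed.

Lemma euler_PS z : disk z -> z * PS (dzc (phic b)) z + conjc z * PS (dzbc (phic b)) z =
  PS (phic (fun n => n%:R * b n)) z.
Proof.
move=> Dz; have g1 := geom_hterm (subc_dzc sb) Dz; have g2 := geom_hterm (subc_dzbc sb) Dz.
rewrite /PS -!csumZ// -csumD; [|exact: geomZ..].
have hb' : subexp (fun n => normc (n%:R * b n)).
  apply: (@subexp_le _ _ (fun n => n.+1%:R * normc (b n))).
    move=> n; rewrite normcM !ger0_norm ?mulr_ge0 ?nc_ge0//.
    by rewrite ler_wpM2r ?nc_ge0// nc_nat ler_nat.
  by apply: subexpM => //; exact: subexp_nat.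
have g3 := geom_hterm (subc_phic hb') Dz.
rewrite [RHS]csumS// hterm_phic !mul0r add0r; apply: eq_csum => n.
rewrite hterm_phic -mulrA -hterm_phic /hterm !mulr_sumr.
transitivity (\sum_(j < n.+2) (n.+1 - j)%:R * (phic b n.+1 j * conjc z ^+ j * z ^+ (n.+1 - j)) +
  \sum_(j < n.+2) j%:R * (phic b n.+1 j * conjc z ^+ j * z ^+ (n.+1 - j))).
  congr (_ + _).
    rewrite [RHS]big_ord_recr/= subnn mul0r addr0; apply: eq_bigr => j _.
    by rewrite /dzc subSn ?leq_ord// exprS; ring.
  rewrite [RHS]big_ord_recl/= mul0r add0r; apply: eq_bigr => j _.
  by rewrite /dzbc /bump add1n subSS exprS; ring.
rewrite -big_split/=; apply: eq_bigr => j _.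
by rewrite -mulrDl natrB ?leq_ord// subrK.
Qed.

(** The difference quotient of z g equals conj(z) times that of g, plus g. With d_z (z g) = g + z
    d_z g the operator becomes the Euler operator z d_z + conj(z) d_zbar plus lambda + 1, hence
    diagonal on degrees. *)
Lemma dunkl_comp_PS z : disk z ->
  dunkl_z_comp_z lambda (PS (phic b)) z =
  PS (phic (fun n => (n%:R + (lambda + 1)%:C) * b n)) z.
Proof.
move=> Dz; have W := wirt_PS sb Dz.
rewrite /dunkl_z_comp_z /dunkl_z (wirt_d_z (wirt_mulz W)).
have E : lambda%:C * refl_quotient_ext (fun z => z * PS (phic b) z) z =
    conjc z * PS (dzbc (phic b)) z + lambda%:C * PS (phic b) z.
  have [l00|ln0] := eqVneq lambda 0.
    by rewrite dzb_PS_lambda0// l00 !mul0r mulr0 addr0.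
  have lC : lambda%:C != 0 :> R[i] by rewrite -nc_eq0 ncR normr_eq0.
  pose F w := lambda%:C^-1 * (conjc w * PS (dzbc (phic b)) w) + PS (phic b) w.
  have H w : disk w -> complex.Im w != 0 ->
      refl_quotient (fun z => z * PS (phic b) z) w = F w.
    move=> Dw /subN Iw; rewrite /refl_quotient; apply: (mulIf Iw); rewrite divfK//.
    rewrite /F mulrDl -!mulrA -(mulrC (w - conjc w)) dzb_PS//.
    exact: alg.
  have FE : lambda%:C * F z = conjc z * PS (dzbc (phic b)) z + lambda%:C * PS (phic b) z.
    by rewrite /F mulrDr mulrA divff// mul1r.
  rewrite -FE; congr (_ * _); rewrite /refl_quotient_ext; case: eqP => [I0|/eqP I0]; last exact: H.
  apply: lim_refl_quotient => //.
  apply: (@wirt_continuous _ F).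
  exact: wirtD (wirtZ _ (wirt_mulzb (wirt_PS (subc_dzbc sb) Dz))) W.
rewrite E.
have hb' : subexp (fun n => normc (n%:R * b n)).
  apply: (@subexp_le _ _ (fun n => n.+1%:R * normc (b n))).
    move=> n; rewrite normcM !ger0_norm ?mulr_ge0 ?nc_ge0//.
    by rewrite ler_wpM2r ?nc_ge0// nc_nat ler_nat.
  by apply: subexpM => //; exact: subexp_nat.
have -> : PS (phic b) z + z * PS (dzc (phic b)) z +
   (conjc z * PS (dzbc (phic b)) z + lambda%:C * PS (phic b) z) =
  (z * PS (dzc (phic b)) z + conjc z * PS (dzbc (phic b)) z) + (1 + lambda%:C) * PS (phic b) z.
  by ring.
rewrite euler_PS// -PS_scale// -PS_add//; [|exact: subc_phic|exact: subc_scale].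
apply: eq_csum => n; apply: eq_bigr => j _; congr (_ * _ * _).
by rewrite /addc /scalec /phic rmorphD /=; ring.
Qed.

End Series.

Lemma subexp_euler (b : nat -> R[i]) m : subexp (fun n => normc (b n)) ->
  subexp (fun n => normc ((n%:R + (lambda + 1)%:C) ^+ m * b n)).
Proof.
move=> hb; have h : subexp (fun n : nat => (n.+1%:R + lambda) ^+ m * normc (b n)).
  apply: subexpM => //; apply: subexpX; apply: subexpD; first exact: subexp_nat.
  exact: subexp_cst.
apply: subexp_le h => n; rewrite !ger0_norm ?nc_ge0//; last first.
  by rewrite mulr_ge0 ?nc_ge0// exprn_ge0// addr_ge0.
rewrite normcM ncX -(rmorph_nat (real_complex R)) -rmorphD ncR ger0_norm ?addr_ge0//.
by rewrite -natr1 [lambda + 1]addrC addrA.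
Qed.

Lemma iter_dunkl_PS b m z : subexp (fun n => normc (b n)) -> disk z ->
  iter m (dunkl_z_comp_z lambda) (PS (phic b)) z =
  PS (phic (fun n => (n%:R + (lambda + 1)%:C) ^+ m * b n)) z.
Proof.
move=> hb; elim: m z => [|m IH] z Dz /=.
  by rewrite (_ : (fun n => _ * b n) = b)//; apply/funext => n; rewrite expr0 mul1r.
rewrite {1}/dunkl_z_comp_z.
(* The induction hypothesis holds on the disk alone, which is enough for the Dunkl operator at z. *)
rewrite (@dunkl_z_eq _ _ (fun w => w * PS (phic (fun n => (n%:R + (lambda + 1)%:C) ^+ m * b n)) w))//.
  rewrite -/(dunkl_z_comp_z lambda (PS (phic (fun n => (n%:R + (lambda + 1)%:C) ^+ m * b n))) z).
  rewrite dunkl_comp_PS//; last exact: subexp_euler.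
  rewrite (_ : (fun n => _ * (_ * b n)) = (fun n => (n%:R + (lambda + 1)%:C) ^+ m.+1 * b n))//.
  by apply/funext => n; rewrite exprS mulrA.
by move=> w Dw; rewrite IH.
Qed.

Lemma phi_expansion_PS b : subexp (fun n => normc (b n)) ->
  phi_expansion lambda (PS (phic b)) b.
Proof.
move=> hb z Dz; apply/cvg_complexP => e e0.
have [N hN] := csum_cvg (geom_hterm (subc_phic hb) Dz) e0.
exists N => n /hN; rewrite -/(PS (phic b) z).
by under eq_bigr do rewrite hterm_phic.
Qed.

End Phi.

(** * Integrals of weights over the disk *)

Section LineIntegrals.
Variable R : realType.
Notation mu := (@lebesgue_measure R).
Implicit Types (f F : R -> R).

Lemma ftc_cont f F a b : a <= b ->
  (forall x, a <= x <= b -> {for x, continuous f}) ->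
  (forall x, a <= x <= b -> is_derive x 1 F (f x)) ->
  (\int[mu]_(x in `[a, b]) (f x)%:E = (F b - F a)%:E)%E.
Proof.
move=> ab cf dF; move: ab; rewrite le_eqVlt => /predU1P[->|ab].
  by rewrite set_itv1 integral_set1 subrr.
rewrite EFinB; apply: continuous_FTC2 => //.
- apply: continuous_in_subspaceT => x; rewrite inE/= in_itv/= => h; exact: cf.
- split.
  + move=> x /[!in_itv]/= /andP[h1 h2].
    by have [] := dF x (ltac:(by rewrite !ltW)).
  + have /derivable1_diffP/differentiable_continuous c : derivable F a 1.
      by have [] := dF a (ltac:(by rewrite lexx ltW)).
    exact: cvg_at_right_filter.
  + have /derivable1_diffP/differentiable_continuous c : derivable F b 1.
      by have [] := dF b (ltac:(by rewrite lexx ltW)).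
    exact: cvg_at_left_filter.
- move=> x /[!in_itv]/= /andP[h1 h2]; rewrite derive1E.
  by have [_ ->] := dF x (ltac:(by rewrite !ltW)).
Qed.

(** Closed intervals on which the fundamental theorem applies even if the integrand is singular at
    the ends; n + 2 keeps the left end below the right one. *)
Definition exhaust (a b : R) n : set R :=
  `[a + (b - a) / n.+2%:R, b - (b - a) / n.+2%:R]%classic.

Lemma exhaust_cvg (a b : R) (g : R -> \bar R) : a < b ->
  measurable_fun `]a, b[ g -> (forall x, a < x < b -> (0 <= g x)%E) ->
  (\int[mu]_(x in exhaust a b n) g x)%E @[n --> \oo] --> (\int[mu]_(x in `]a, b[) g x)%E.
Proof.
move=> ab mg g0.
have ba : 0 < b - a by rewrite subr_gt0.
have sub n : exhaust a b n `<=` `]a, b[%classic.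
  move=> x; rewrite /exhaust /= !in_itv/= => /andP[h1 h2].
  have d0 : 0 < (b - a) / n.+2%:R by rewrite divr_gt0.
  by rewrite (lt_le_trans _ h1) ?ltrDl// (le_lt_trans h2)// gtrDl oppr_lt0.
have E : `]a, b[%classic = \bigcup_n exhaust a b n.
  apply/seteqP; split; last by move=> x [n _]; exact: sub.
  move=> x /=; rewrite in_itv/= => /andP[ax xb].
  pose e := Num.min (x - a) (b - x).
  have e0 : 0 < e by rewrite lt_min !subr_gt0 ax.
  exists (Num.bound ((b - a) / e)) => //=.
  rewrite /exhaust /= in_itv/=.
  have : (b - a) / (Num.bound ((b - a) / e)).+2%:R <= e.
    rewrite ler_pdivrMr// mulrC -ler_pdivrMr//.
    apply: le_trans (ltW (archi_boundP _)) _; first by rewrite divr_ge0// ltW.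
    by rewrite ler_nat leqW// leqnSn.
  move: (_ / _.+2%:R) => k; rewrite le_min => /andP[h1 h2]; apply/andP; split; lra.
rewrite E; apply: ge0_nondecreasing_set_cvg_integral.
- move=> m n mn; rewrite subsetEset; move=> x /=; rewrite /exhaust /= !in_itv/=.
  have h : (b - a) / n.+2%:R <= (b - a) / m.+2%:R.
    by rewrite ler_pM2l// lef_pV2 ?posrE// ler_nat !ltnS.
  move=> /andP[h1 h2]; rewrite (le_trans _ h1) ?lerD2l//=.
  by rewrite (le_trans h2)// lerD2l lerN2.
- by move=> n; exact: measurable_itv.
- by move=> n; apply: measurable_funS mg => //; exact: sub.
- by move=> n x /sub; rewrite /= in_itv/=; exact: g0.
Qed.

Lemma integral_exhaust_le (a b : R) (g : R -> \bar R) (B : \bar R) : a < b ->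
  measurable_fun `]a, b[ g -> (forall x, a < x < b -> (0 <= g x)%E) ->
  (forall c d, a < c -> c <= d -> d < b -> (\int[mu]_(x in `[c, d]) g x <= B)%E) ->
  (\int[mu]_(x in `]a, b[) g x <= B)%E.
Proof.
move=> ab mg g0 h; have c := exhaust_cvg ab mg g0.
rewrite -(cvg_lim _ c)//; apply: lime_le; first by apply/cvg_ex; eexists; exact: c.
have ba : 0 < b - a by rewrite subr_gt0.
apply: nearW => n; have d0 : 0 < (b - a) / n.+2%:R by rewrite divr_gt0.
apply: h; [by rewrite ltrDl| |by rewrite gtrDl oppr_lt0].
have : (b - a) / n.+2%:R <= (b - a) / 2 by rewrite ler_pM2l// lef_pV2 ?posrE// ler_nat.
by move: (_ / n.+2%:R) => k; lra.
Qed.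

Lemma powR_cont (a x : R) : 0 < x -> {for x, continuous (fun t : R => t `^ a)}.
Proof.
move=> x0; apply/differentiable_continuous/derivable1_diffP.
by have [] := is_derive1_powR a x0.
Qed.

Lemma int_powR_compact (a c d : R) : a != 0 -> 0 < c -> c <= d ->
  (\int[mu]_(t in `[c, d]) (t `^ (a - 1))%:E = ((d `^ a - c `^ a) / a)%:E)%E.
Proof.
move=> a0 c0 cd.
transitivity ((a^-1 * d `^ a - a^-1 * c `^ a)%:E); last by congr (_%:E); ring.
apply: (@ftc_cont (fun t => t `^ (a - 1)) (fun t => a^-1 * t `^ a)) => //.
- by move=> x /andP[cx _]; apply: powR_cont; exact: lt_le_trans cx.
move=> x /andP[cx _]; have x0 : 0 < x by exact: lt_le_trans cx.
have h := is_deriveM (is_derive_cst a^-1 x 1) (is_derive1_powR a x0).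
suff <- : cst a^-1 x *: (a * x `^ (a - 1)) + x `^ a *: (0 : R) = x `^ (a - 1) by exact: h.
by rewrite scaler0 addr0 /GRing.scale/= mulrA mulVf// mul1r.
Qed.

Lemma measurable_powRe D (a : R) : measurable_fun D (fun t : R => (t `^ a)%:E).
Proof.
apply/measurable_EFinP; apply: measurable_funTS; exact: measurable_powR.
Qed.

Lemma int_powR0 (a d : R) : 0 < a -> 0 < d ->
  (\int[mu]_(t in `]0%R, d[) (t `^ (a - 1))%:E <= (d `^ a / a)%:E)%E.
Proof.
move=> a0 d0; apply: integral_exhaust_le => //.
- exact: measurable_powRe.
- by move=> x _; rewrite lee_fin powR_ge0.
move=> c e c0 ce ed; rewrite int_powR_compact ?gt_eqF//; rewrite lee_fin ler_pM2r ?invr_gt0//.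
apply: le_trans (_ : e `^ a <= _); first by rewrite gerBl powR_ge0.
by rewrite ge0_ler_powR ?nnegrE ?ltW// (lt_le_trans c0).
Qed.

(** The image of Lebesgue measure under the affine map, scaled by a, has the right value on
    half-open intervals, and uniqueness of Lebesgue measure does the rest. *)
Lemma ge0_integral_affine (a b : R) (f : R -> \bar R) : 0 < a ->
  measurable_fun setT f -> (forall x, 0 <= f x)%E ->
  (\int[mu]_x f (a * x + b)%R = (a^-1)%:E * \int[mu]_x f x)%E.
Proof.
move=> a0 mf f0.
pose phi (x : measurableTypeR R) : measurableTypeR R := a * x + b.
have mphi : measurable_fun setT phi.
  by apply: measurable_funD => //; apply: measurable_funM.
pose M' : {measure set (measurableTypeR R) -> \bar R} := pushforward mu phi.
pose M := M' mphi.
pose A : {nonneg R} := NngNum (ltW a0).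
have E : forall X, measurable X -> lebesgue_measure X = mscale A M X.
  apply: lebesgue_measure_unique => _ [[x y] _ <-].
  transitivity (a%:E * mu (phi @^-1` `]x, y]%classic))%E; last by [].
  have -> : phi @^-1` `]x, y]%classic = `](x - b) / a, (y - b) / a]%classic.
    apply/seteqP; split => t; rewrite /= !in_itv/= ltr_pdivrMr// ler_pdivlMr//;
    by rewrite ltrBlDr lerBrDr /phi (mulrC t).
  rewrite !lebesgue_measure_itv/= !lte_fin ltr_pM2r ?invr_gt0// ltrD2r.
  case: ifPn => _; last by rewrite mule0.
  by rewrite -!EFinB -EFinM; congr (_%:E); field; rewrite gt_eqF.
have -> : (\int[mu]_x f x = a%:E * \int[mu]_x f (phi x))%E.
  rewrite -[in RHS](preimage_setT phi).
  rewrite -(@ge0_integral_pushforward _ _ _ _ _ phi)//.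
  rewrite -(@ge0_integral_mscale _ _ _ M _ _ A)//.
  by apply: eq_measure_integral => X mX _; exact: E.
by rewrite muleA -EFinM mulVf ?gt_eqF// mul1e.
Qed.

Lemma ge0_integral_opp (f : R -> \bar R) :
  measurable_fun setT f -> (forall x, 0 <= f x)%E ->
  (\int[mu]_x f (- x)%R = \int[mu]_x f x)%E.
Proof.
move=> mf f0.
rewrite [RHS](eq_measure_integral (pushforward mu (-%R : _ -> measurableTypeR R))).
  by rewrite ge0_integral_pushforward// preimage_setT.
by move=> X mX _; exact/esym/lebesgue_measureN.
Qed.

End LineIntegrals.

(** * Open sets and measurability in the plane *)

Section PlaneMeasurability.
Variable R : realType.
Implicit Types (D U : set (R * R)).

Definition opn U := forall q, U q -> exists2 d : R, 0 < d &
  forall q' : R * R, `|q'.1 - q.1| < d -> `|q'.2 - q.2| < d -> U q'.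

Definition cont_at (F : R * R -> R) (q : R * R) := forall e : R, 0 < e ->
  exists2 d : R, 0 < d &
    forall q' : R * R, `|q'.1 - q.1| < d -> `|q'.2 - q.2| < d -> `|F q' - F q| < e.

(** An open set is the countable union of the boxes with rational centre and side 2 / (n + 1) that
    it contains. *)
Lemma opn_measurable U : opn U -> measurable U.
Proof.
move=> oU.
pose box (i : rat * rat * nat) : set (R * R) :=
  `](ratr i.1.1 - i.2.+1%:R^-1 : R), (ratr i.1.1 + i.2.+1%:R^-1)[%classic `*`
  `](ratr i.1.2 - i.2.+1%:R^-1 : R), (ratr i.1.2 + i.2.+1%:R^-1)[%classic.
pose B i := if `[< box i `<=` U >] then box i else set0.
have -> : U = \bigcup_i B i.
  apply/seteqP; split; last first.
    by move=> q [i _]; rewrite /B; case: asboolP => // h; exact: h.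
  move=> [x y] /oU[d d0 hd]; pose n := Num.bound (2 / d).
  have n0 : 0 < n.+1%:R^-1 :> R by rewrite invr_gt0.
  have hn : 2 * n.+1%:R^-1 < d.
    rewrite ltr_pdivrMr// mulrC -ltr_pdivrMr//.
    apply: lt_le_trans (archi_boundP _) _; first by rewrite divr_ge0// ltW.
    by rewrite ler_nat leqnSn.
  have [k kE] : exists k, k = n.+1%:R^-1 :> R by eexists.
  rewrite -kE in n0 hn.
  have lt1 (t : R) : t - k < t + k by lra.
  have [r1 hr1] := rat_in_itvoo (lt1 x).
  have [r2 hr2] := rat_in_itvoo (lt1 y).
  move: hr1 hr2; rewrite !in_itv/= => /andP[h1 h2] /andP[h3 h4].
  exists (r1, r2, n) => //; rewrite /B; case: asboolP => [_|[]].
    by split; rewrite /= in_itv/= -kE; apply/andP; split; lra.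
  move=> [x' y'] [/=]; rewrite !in_itv/= -kE => /andP[k1 k2] /andP[k3 k4].
  by apply: hd => /=; rewrite ltr_norml; apply/andP; split; lra.
apply: countable_bigcupT_measurable; first exact: countableP.
move=> i; rewrite /B; case: ifP => // _.
by apply: measurableX; exact: measurable_itv.
Qed.

Lemma cont_measurable D (F : R * R -> R) : opn D ->
  (forall q, D q -> cont_at F q) -> measurable_fun D F.
Proof.
move=> oD cF; apply: (measurability _ (RGenOInfty.measurableE R)).
move=> _ [_ [a ->] <-]; apply: opn_measurable => q [Dq].
rewrite /= in_itv/= andbT => aF.
have [d d0 hd] := oD _ Dq.
have aF' : 0 < F q - a by rewrite subr_gt0.
have [d' d'0 hd'] := cF _ Dq _ aF'.
exists (Num.min d d'); first by rewrite lt_min d0.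
move=> q'; rewrite !lt_min => /andP[h1 h2] /andP[h3 h4]; split; first exact: hd.
rewrite /= in_itv/= andbT.
by have := hd' q' h2 h4; rewrite ltr_norml => /andP[]; lra.
Qed.

End PlaneMeasurability.

(** * Inequalities for real powers *)

Section PowerFunctions.
Variable R : realType.
Implicit Types (a x y k : R).

Lemma powR_add x a b : 0 < x -> x `^ (a + b) = x `^ a * x `^ b.
Proof. by move=> x0; apply: powRD; apply/implyP => _; rewrite gt_eqF. Qed.

Lemma powR_le a x y : 0 <= a -> 0 <= x -> x <= y -> x `^ a <= y `^ a.
Proof. by move=> a0 x0 xy; apply: ge0_ler_powR => //; rewrite nnegrE// (le_trans x0). Qed.

Lemma powR_anti a x y : 0 <= a -> 0 < x -> x <= y -> y `^ (- a) <= x `^ (- a).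
Proof.
move=> a0 x0 xy; rewrite !powRN lef_pV2 ?posrE ?powR_gt0// ?(lt_le_trans x0 xy)//.
by apply: powR_le => //; exact: ltW.
Qed.

Lemma powR_comparable a x y k : 1 <= k -> 0 < x -> x / k <= y -> y <= k * x ->
  y `^ a <= k `^ `|a| * x `^ a.
Proof.
move=> k1 x0 h1 h2.
have k0 : 0 < k by exact: lt_le_trans k1.
have xk : 0 < x / k by rewrite divr_gt0.
have [a0|/ltW a0] := leP 0 a.
  rewrite ger0_norm// -(powRM _ (ltW k0) (ltW x0)); apply: powR_le => //.
  by apply: le_trans h1; exact: ltW.
rewrite ler0_norm//; have := @powR_anti (- a) (x / k) y; rewrite opprK oppr_ge0.
move=> /(_ a0 xk h1) /le_trans; apply.
by rewrite powRM ?invr_ge0 ?(ltW x0) ?(ltW k0)// -powR_inv1 ?(ltW k0)// -powRrM mulN1r mulrC.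
Qed.

Lemma powR_scale_anti a x y k : 0 <= a -> 0 < k -> 0 < x -> x / k <= y ->
  y `^ (- a) <= k `^ a * x `^ (- a).
Proof.
move=> a0 k0 x0 h; apply: le_trans (powR_anti a0 _ h) _; first by rewrite divr_gt0.
rewrite powRM ?invr_ge0 ?(ltW x0) ?(ltW k0)// -[k^-1]powR_inv1 ?(ltW k0)//.
by rewrite -powRrM mulN1r opprK mulrC.
Qed.

End PowerFunctions.

(** * Integrals over slices *)

Section SliceBound.
Variable R : realType.
Notation mu := (@lebesgue_measure R).
Notation mu2 := (@lebesgue_measure R \x @lebesgue_measure R)%E.
Implicit Types (p r X : R -> R).

(** The integral is cut at t = d: below, (d + t)^(-s) <= d^(-s) and t^(a-1) is integrable; above, (d
    + t)^(-s) <= t^(-s) and t^(a-s-1) decays fast enough. The two constants 1 / a and 1 / (s - a)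
    come from these halves. *)
Lemma int_J (a s d M : R) : 0 < d -> 0 < a -> a < s -> 0 < M ->
  (\int[mu]_(t in `[0%R, M[) (t `^ (a - 1) * (d + t) `^ (- s))%:E <=
    ((a^-1 + (s - a)^-1) * d `^ (a - s))%:E)%E.
Proof.
move=> d0 a0 as_ M0.
have s0 : 0 < s by exact: lt_trans as_.
have mf (D : set R) : measurable_fun D (fun t : R => (t `^ (a - 1) * (d + t) `^ (- s))%:E).
  apply/measurable_EFinP; apply: measurable_funTS; apply: measurable_funM.
    exact: measurable_powR.
  apply: (@measurableT_comp _ _ _ _ _ _ (fun t : R => t `^ (- s))); first exact: measurable_powR.
  by apply: measurable_funD.
have f0 t : (0 <= (t `^ (a - 1) * (d + t) `^ (- s))%:E)%E.
  by rewrite lee_fin mulr_ge0 ?powR_ge0.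
rewrite -integral_itv_obnd_cbnd//.
apply: (@le_trans _ _ (\int[mu]_(t in `]0%R, d[%classic `|` `[d, (d + M)%R]%classic) (t `^ (a - 1) * (d + t) `^ (- s))%:E)%E).
  apply: ge0_subset_integral => //; [exact: measurableU|exact: mf|].
  move=> t /=; rewrite !in_itv/= => /andP[t0 tM].
  have [td|td] := ltP (t : R) d; [by left; apply/andP|right; apply/andP; split=> //].
  by rewrite (le_trans (ltW tM))// lerDr ltW.
rewrite ge0_integral_setU//; first last.
  rewrite disj_set2E; apply/eqP/seteqP; split => // t /= [].
  rewrite !in_itv/= => /andP[_ h1] /andP[h2 _].
  by have := lt_le_trans h1 h2; rewrite ltxx.
  exact: mf.
rewrite mulrDl EFinD; apply: leeD.
  apply: (@le_trans _ _ (\int[mu]_(t in `]0%R, d[) ((d `^ (- s))%:E * (t `^ (a - 1))%:E))%E).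
    apply: ge0_le_integral => //; [exact: mf| |].
      by apply: emeasurable_funM; [exact: measurable_cst|exact: measurable_powRe].
    move=> t; rewrite /= in_itv/= => /andP[t0 td]; rewrite -EFinM lee_fin mulrC.
    by apply: ler_wpM2r; rewrite ?powR_ge0//; apply: powR_anti; rewrite ?ltW// ltrDl.
  rewrite ge0_integralZl_EFin ?powR_ge0//; last 2 first.
  - by move=> t _; rewrite lee_fin powR_ge0.
  - exact: measurable_powRe.
  apply: (@le_trans _ _ ((d `^ (- s))%:E * (d `^ a / a)%:E)%E).
    by apply: lee_wpmul2l; rewrite ?lee_fin ?powR_ge0//; exact: int_powR0.
  by rewrite -EFinM lee_fin powR_add// le_eqVlt; apply/orP; left; apply/eqP; ring.
apply: (@le_trans _ _ (\int[mu]_(t in `[d, (d + M)%R]%classic) (t `^ (a - s - 1))%:E)%E).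
  apply: ge0_le_integral => //; [exact: mf|exact: measurable_powRe|].
  move=> t; rewrite /= in_itv/= => /andP[dt tM].
  have t0 : 0 < t by exact: lt_le_trans dt.
  rewrite lee_fin (_ : a - s - 1 = (a - 1) + - s); last by ring.
  rewrite (@powR_add _ t (a - 1) (- s) t0); apply: ler_wpM2l; first exact: powR_ge0.
  by apply: powR_anti => //; [exact: ltW|rewrite lerDr ltW].
rewrite int_powR_compact//; last 2 first.
- by rewrite subr_eq0 lt_eqF.
- by rewrite lerDl ltW.
rewrite lee_fin.
have -> : ((d + M) `^ (a - s) - d `^ (a - s)) / (a - s) =
  (d `^ (a - s) - (d + M) `^ (a - s)) / (s - a).
  by rewrite -[s - a]opprB invrN mulrN -mulNr opprB.
by rewrite mulrC ler_wpM2l ?invr_ge0 ?subr_ge0 ?(ltW as_)// gerBl powR_ge0.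
Qed.

(** [X] may depend on the outer variable in any measurable way: once that variable is fixed, a
    reflection and a translation bound the inner integral by 2 J. *)
Lemma slice_bound p r X (J P : R) :
  measurable_fun setT p -> measurable_fun setT r -> measurable_fun setT X ->
  (forall x, 0 <= p x) -> (forall x, 0 <= r x) ->
  (\int[mu]_x (r x)%:E <= J%:E)%E -> (\int[mu]_x (p x)%:E <= P%:E)%E ->
  (\int[mu2]_q (p q.2 * r (X q.2 - `|q.1|))%:E <= (2 * J * P)%:E)%E /\
  (\int[mu2]_q (p q.1 * r (X q.1 - `|q.2|))%:E <= (2 * J * P)%:E)%E.
Proof.
move=> mp mr mX p0 r0 hr hp.
have J0 : 0 <= J.
  by rewrite -lee_fin (le_trans _ hr)// integral_ge0// => x _; rewrite lee_fin.
have inner (c X0 : R) : 0 <= c ->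
    (\int[mu]_x (c * r (X0 - `|x|))%:E <= (2 * J)%:E * c%:E)%E.
  move=> c0.
  have mr1 : measurable_fun setT (fun x : R => (r (1 * x + X0))%:E).
    apply/measurable_EFinP; apply: (measurableT_comp mr); apply: measurable_funD => //.
  have mr2 : measurable_fun setT (fun x : R => (r (1 * (- x) + X0))%:E).
    exact: (measurableT_comp mr1 (@oppr_measurable R setT)).
  have mre : measurable_fun setT (fun x : R => (r x)%:E) by exact/measurable_EFinP.
  have re0 x : (0 <= (r x)%:E)%E by rewrite lee_fin.
  apply: (@le_trans _ _ (\int[mu]_x (c%:E * ((r (1 * x + X0))%:E + (r (1 * (- x) + X0))%:E)))%E).
    apply: ge0_le_integral => //.
    - by move=> x _; rewrite lee_fin mulr_ge0.
    - apply/measurable_EFinP; apply: measurable_funM => //; apply: measurableT_comp => //.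
      by apply: measurable_funB => //; exact: normr_measurable.
    - by apply: emeasurable_funM => //; exact: emeasurable_funD.
    move=> x _; rewrite -EFinD -EFinM lee_fin ler_wpM2l// !mul1r.
    have [x0|x0] := leP 0 x.
      by rewrite ger0_norm// [- x + X0]addrC lerDr.
    by rewrite ltr0_norm// opprK [X0 + x]addrC lerDl.
  rewrite ge0_integralZl_EFin//; last 2 first.
  - by move=> x _; rewrite adde_ge0.
  - exact: emeasurable_funD.
  rewrite ge0_integralD//.
  rewrite (@ge0_integral_opp R (fun x => (r (1 * x + X0))%:E))//.
  rewrite (@ge0_integral_affine R 1 X0 (fun x => (r x)%:E))// invr1 mul1e.
  rewrite muleC; apply: lee_wpmul2r; first by rewrite lee_fin.
  rewrite mulr_natl mulr2n EFinD; exact: leeD.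
have outer : (\int[mu]_y ((2 * J)%:E * (p y)%:E) <= (2 * J * P)%:E)%E.
  rewrite ge0_integralZl_EFin//; last 3 first.
  - by move=> x _; rewrite lee_fin.
  - exact/measurable_EFinP.
  - by rewrite mulr_ge0.
  by rewrite [(2 * J * P)%:E]EFinM; apply: lee_wpmul2l => //; rewrite lee_fin mulr_ge0.
have fst_ : measurable_fun setT (fst : R * R -> R) by exact: measurable_fst.
have snd_ : measurable_fun setT (snd : R * R -> R) by exact: measurable_snd.
have mg (u v : R * R -> R) : measurable_fun setT u -> measurable_fun setT v ->
    measurable_fun setT (fun q => (p (u q) * r (X (u q) - `|v q|))%:E).
  move=> mu_ mv; apply/measurable_EFinP; apply: measurable_funM.
    exact: measurableT_comp mu_.
  apply: measurableT_comp => //; apply: measurable_funB.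
    exact: measurableT_comp mu_.
  by apply: measurableT_comp => //; exact: normr_measurable.
have g0 x y : (0 <= (p x * r (X x - `|y|))%:E)%E by rewrite lee_fin mulr_ge0.
split.
  rewrite fubini_tonelli2//; last exact: mg.
  apply: le_trans outer; apply: ge0_le_integral => //.
  - by move=> y _; apply: integral_ge0.
  - by apply: measurable_fun_fubini_tonelli_G => //; exact: (mg snd fst).
  - by apply: emeasurable_funM => //; exact/measurable_EFinP.
  - by move=> y _; exact: (inner (p y) (X y) (p0 y)).
rewrite fubini_tonelli1//; last exact: mg.
apply: le_trans outer; apply: ge0_le_integral => //.
- by move=> y _; apply: integral_ge0.
- by apply: measurable_fun_fubini_tonelli_F => //; exact: (mg fst snd).
- by apply: emeasurable_funM => //; exact/measurable_EFinP.
- by move=> y _; exact: (inner (p y) (X y) (p0 y)).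
Qed.

End SliceBound.

(** * Distances in the disk *)

Section DiskGeometry.
Variable R : realType.
Implicit Types (z w : R[i]).

(** |1 - z w|^2 - |z - conj(w)|^2 = (1 - |z|^2) (1 - |w|^2). *)
Lemma nc_sub_le z w : disk z -> disk w -> normc (z - conjc w) <= normc (1 - z * w).
Proof.
rewrite /disk /= => z1 w1; rewrite -(@ler_pXn2r _ 2) ?nnegrE ?nc_ge0//.
have hz : normc z ^+ 2 < 1 by rewrite expr_lt1// nc_ge0.
have hw : normc w ^+ 2 < 1 by rewrite expr_lt1// nc_ge0.
move: hz hw; rewrite !ncE !cReD !cImD !cReN !cImN !cReM !cImM.
case: z {z1} => x y; case: w {w1} => u v /= hz hw; rewrite opprK -subr_ge0.
have -> : (1 - (x * u - y * v)) ^+ 2 + (0 - (x * v + y * u)) ^+ 2 -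
   ((x - u) ^+ 2 + (y + v) ^+ 2) =
   (1 - (x ^+ 2 + y ^+ 2)) * (1 - (u ^+ 2 + v ^+ 2)) by ring.
by rewrite mulr_ge0 ?subr_ge0 ?ltW.
Qed.

Lemma nc_1zw_ge z w : 1 - normc z * normc w <= normc (1 - z * w).
Proof. by rewrite -{1}(@nc1 R) -normcM nc_lerB. Qed.

Lemma nc_1zw_gew z w : disk z -> 1 - normc w <= normc (1 - z * w).
Proof.
move=> Dz; apply: le_trans (nc_1zw_ge z w); rewrite lerD2l lerN2.
by rewrite ler_piMl ?nc_ge0// ltW.
Qed.

Lemma nc_1zw_gez z w : disk w -> 1 - normc z <= normc (1 - z * w).
Proof.
move=> Dw; apply: le_trans (nc_1zw_ge z w); rewrite lerD2l lerN2.
by rewrite ler_piMr ?nc_ge0// ltW.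
Qed.

End DiskGeometry.

(** * Integrals of powers of |1 - z w| *)

Section WeightedIntegral.
Variable R : realType.
Notation mu := (@lebesgue_measure R).
Notation mu2 := (@lebesgue_measure R \x @lebesgue_measure R)%E.

Definition diskR : set (R * R) := [set q | disk (q.1 +i* q.2)].

Lemma opn_diskR : opn diskR.
Proof.
move=> q Dq; have [d d0 hd] := disk_nbhs Dq.
exists (d / 2); first by rewrite divr_gt0.
move=> q' h1 h2; apply: hd; apply: le_lt_trans (nc_le_ReIm _) _ => /=.
by apply: lt_le_trans (ltrD h1 h2) _; rewrite -splitr.
Qed.

Lemma measurable_diskR : measurable diskR.
Proof. exact: opn_measurable opn_diskR. Qed.

Lemma measurable_disk_modulus (f : R[i] -> R[i]) : continuous_on_disk f ->
  measurable_fun diskR (fun q => normc (f (q.1 +i* q.2))).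
Proof.
move=> cf; apply: cont_measurable opn_diskR _ => q Dq e e0.
have /continuous_complexP/(_ e e0)[d d0 hd] := cf _ Dq.
exists (d / 2); first by rewrite divr_gt0.
move=> q' h1 h2; apply: le_lt_trans (_ : normc (f (q'.1 +i* q'.2) - f (q.1 +i* q.2)) < e).
  by rewrite ler_norml nc_lerB andbT lerNl opprB nc_distC nc_lerB.
apply: hd; apply: le_lt_trans (nc_le_ReIm _) _ => /=.
by apply: lt_le_trans (ltrD h1 h2) _; rewrite -splitr.
Qed.

(* With X = sqrt (1 - y^2), the distance of a point of the disk to its boundary is
   comparable to X - |x| as long as |y| <= |x|. *)
Let chord (x y : R) : x ^+ 2 + y ^+ 2 < 1 -> y ^+ 2 <= x ^+ 2 ->
  let t := (1 - y ^+ 2) `^ 2^-1 - `|x| in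
  [/\ 0 < t, t <= 1, t / 4 <= 1 - Num.sqrt (x ^+ 2 + y ^+ 2) &
      1 - Num.sqrt (x ^+ 2 + y ^+ 2) <= 4 * t].
Proof.
move=> xy1 yx /=.
have y1 : 0 < 1 - y ^+ 2 by have := sqr_ge0 x; move: (x ^+ 2) (y ^+ 2) xy1 => a b; lra.
rewrite powR12_sqrt ?(ltW y1)//.
set X := Num.sqrt (1 - y ^+ 2); set r := Num.sqrt (x ^+ 2 + y ^+ 2).
have X0 : 0 < X by rewrite sqrtr_gt0.
have X2 : X ^+ 2 = 1 - y ^+ 2 by rewrite sqr_sqrtr// ltW.
have r0 : 0 <= r by rewrite sqrtr_ge0.
have r2 : r ^+ 2 = x ^+ 2 + y ^+ 2 by rewrite sqr_sqrtr// addr_ge0 ?sqr_ge0.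
have x0 : 0 <= `|x| by [].
have x2 : `|x| ^+ 2 = x ^+ 2 by rewrite real_normK ?num_real.
have r1 : r < 1 by rewrite -(@ltr_pXn2r _ 2) ?nnegrE// expr1n r2.
have xX : `|x| < X by rewrite -(@ltr_pXn2r _ 2) ?nnegrE ?(ltW X0)// x2 X2; lra.
have X1 : X <= 1 by rewrite -(@ler_pXn2r _ 2) ?nnegrE ?(ltW X0)// expr1n X2 gerBl sqr_ge0.
have X12 : 1 / 2 <= X.
  rewrite -(@ler_pXn2r _ 2) ?nnegrE ?(ltW X0)// ?divr_ge0// X2.
  by rewrite expr_div_n expr1n; move: (x ^+ 2) (y ^+ 2) xy1 yx => a b; lra.
have key : (1 - r) * (1 + r) = (X - `|x|) * (X + `|x|).
  by rewrite -!subr_sqr expr1n X2 x2 r2; ring.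
move: X r `|x| X0 r0 x0 r1 xX X1 X12 key {X2 r2 x2} => X r a X0 r0 a0 r1 aX X1 X12 key.
split; [by rewrite subr_gt0|by lra| |].
  have h1 : (X - a) * (1 / 2) <= (X - a) * (X + a).
    by rewrite ler_wpM2l// ?subr_ge0 ?(ltW aX)//; lra.
  have h2 : (1 - r) * (1 + r) <= (1 - r) * 2.
    by rewrite ler_wpM2l// ?subr_ge0 ?(ltW r1)//; lra.
  by move: h1 h2; rewrite -key; lra.
have h1 : (X - a) * (X + a) <= (X - a) * 2.
  by rewrite ler_wpM2l// ?subr_ge0 ?(ltW aX)//; lra.
have h2 : (1 - r) * 1 <= (1 - r) * (1 + r).
  by rewrite ler_wpM2l// ?subr_ge0 ?(ltW r1)//; lra.
by move: h1 h2; rewrite -key; lra.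
Qed.

Section Is.
Variables (alpha s : R).
Hypotheses (a0 : 0 < alpha) (sa : alpha + 1 < s).

(** The excess of s over alpha + 1 is shared equally: [s1] > alpha serves [rr], the integrand in the
    distance X - |x| to the boundary, and [s2] > 1 serves [pp], the integrand in y - c. The
    indicators contain the values met on the disk, X - |x| <= 1 and |y - c| < 3. *)
Let e := (s - alpha - 1) / 2.
Let s1 := alpha + e.
Let s2 := 1 + e.
Let e0 : 0 < e. Proof. by rewrite divr_gt0//; move: sa; lra. Qed.
Let s12 : s = s1 + s2. Proof. by rewrite /s1 /s2 /e; field. Qed.
Let X (y : R) := (1 - y ^+ 2) `^ 2^-1.
Let rr (d t : R) := \1_(`[0%R, 2%R[%classic) t * (t `^ (alpha - 1) * (d + t) `^ (- s1)).
Let pp0 (d t : R) := \1_(`[0%R, 3%R[%classic) t * (t `^ (1 - 1) * (d + t) `^ (- s2)).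
Let pp (d c t : R) := pp0 d (t - c) + pp0 d (c - t).
Let C0 := 8 `^ s1 * 8 `^ s2 * 4 `^ `|alpha - 1|.

Let mJ (a b M d : R) :
  measurable_fun setT (fun t : R => \1_(`[0%R, M[%classic) t * (t `^ (a - 1) * (d + t) `^ (- b))).
Proof.
apply: measurable_funM; first by apply: measurable_indic; exact: measurable_itv.
apply: measurable_funM; first exact: measurable_powR.
apply: (@measurableT_comp _ _ _ _ _ _ (fun t : R => t `^ (- b))); first exact: measurable_powR.
exact: measurable_funD.
Qed.

Let J_le (a b M d : R) : 0 < d -> 0 < a -> a < b -> 0 < M ->
  (\int[mu]_t (\1_(`[0%R, M[%classic) t * (t `^ (a - 1) * (d + t) `^ (- b)))%:E
   <= ((a^-1 + (b - a)^-1) * d `^ (a - b))%:E)%E.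
Proof.
move=> d0 a0' ab M0; apply: le_trans (int_J d0 a0' ab M0).
rewrite [leRHS]integral_mkcond le_eqVlt; apply/orP; left; apply/eqP.
apply: eq_integral => t _; rewrite patchE indicE.
by case: (t \in _); rewrite ?mul1r// mul0r.
Qed.

Let J_ge0 (a b M d t : R) : 0 <= \1_(`[0%R, M[%classic) t * (t `^ (a - 1) * (d + t) `^ (- b)).
Proof. by rewrite !mulr_ge0 ?powR_ge0. Qed.

(* The kernel dominates |y - c|, the distance to the boundary and d, so its power
   splits as a product of a function of y and a function of X - |x|. *)
Let core (x y c d T : R) : 0 < d -> d <= T -> `|y - c| <= T -> `|y - c| < 3 ->
  1 - Num.sqrt (x ^+ 2 + y ^+ 2) <= T ->
  x ^+ 2 + y ^+ 2 < 1 -> y ^+ 2 <= x ^+ 2 ->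
  T `^ (- s) * (1 - Num.sqrt (x ^+ 2 + y ^+ 2)) `^ (alpha - 1) <=
  C0 * (pp d c y * rr d (X y - `|x|)).
Proof.
move=> d0 dT yT y3 rT xy1 yx; have [t0 t1 tl tu] := chord xy1 yx.
set r := 1 - Num.sqrt _ in rT tl tu *.
rewrite -/(X y) in t0 t1 tl tu; set t := X y - `|x| in t0 t1 tl tu *.
have T0 : 0 < T by exact: lt_le_trans dT.
have -> : rr d t = t `^ (alpha - 1) * (d + t) `^ (- s1).
  by rewrite /rr indicE mem_set ?mul1r//= in_itv/= (ltW t0)/=; lra.
have hp : (d + `|y - c|) `^ (- s2) <= pp d c y.
  have h u : 0 <= u -> u < 3 -> pp0 d u = (d + u) `^ (- s2).
    by move=> u0 u3; rewrite /pp0 indicE mem_set ?mul1r ?subrr ?powRr0 ?mul1r//= in_itv/= u0.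
  rewrite /pp; have [yc|yc] := leP 0 (y - c).
    by rewrite -h// ger0_norm// lerDl J_ge0.
  by rewrite -h// ltr0_norm// opprB lerDr J_ge0.
have h1 : T `^ (- s1) <= 8 `^ s1 * (d + t) `^ (- s1).
  apply: powR_scale_anti => //; [by rewrite /s1 ltW// addr_gt0|by rewrite addr_gt0|].
  by lra.
have h2 : T `^ (- s2) <= 8 `^ s2 * (d + `|y - c|) `^ (- s2).
  apply: powR_scale_anti => //; [by rewrite /s2 ltW// addr_gt0|by rewrite ltr_pwDl|].
  by lra.
have h3 : r `^ (alpha - 1) <= 4 `^ `|alpha - 1| * t `^ (alpha - 1).
  by apply: powR_comparable => //; lra.
have -> : T `^ (- s) = T `^ (- s1) * T `^ (- s2).
  by rewrite s12 opprD powR_add.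
apply: le_trans (_ : (8 `^ s1 * (d + t) `^ (- s1)) * (8 `^ s2 * pp d c y) *
   (4 `^ `|alpha - 1| * t `^ (alpha - 1)) <= _); last first.
  by rewrite /C0 le_eqVlt; apply/orP; left; apply/eqP; ring.
apply: ler_pM; rewrite ?mulr_ge0 ?powR_ge0//.
apply: ler_pM; rewrite ?powR_ge0//.
by apply: le_trans h2 _; rewrite ler_wpM2l ?powR_ge0.
Qed.

Let mkern (w : R[i]) : measurable_fun diskR (fun q : R * R =>
  (normc (1 - (q.1 +i* q.2) * w) `^ (- s) *
     (1 - normc (q.1 +i* q.2)) `^ (alpha - 1))%:E).
Proof.
apply/measurable_EFinP; apply: measurable_funM.
  apply: (@measurableT_comp _ _ _ _ _ _ (fun t : R => t `^ (- s))); first exact: measurable_powR.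
  apply: (@measurable_disk_modulus (fun z => 1 - z * w)) => z _.
  apply/continuous_complexP => d d0; exists (d / (normc w + 1)).
    by rewrite divr_gt0// ltr_wpDl// nc_ge0.
  move=> z'; rewrite ltr_pdivlMr ?ltr_wpDl ?nc_ge0// => h.
  have -> : 1 - z' * w - (1 - z * w) = - ((z' - z) * w) by ring.
  rewrite ncN normcM; apply: le_lt_trans h; rewrite ler_wpM2l ?nc_ge0//.
  by rewrite lerDl.
apply: (@measurableT_comp _ _ _ _ _ _ (fun t : R => t `^ (alpha - 1))); first exact: measurable_powR.
apply: measurable_funB => //; apply: (@measurable_disk_modulus id) => z _.
by apply/continuous_complexP => d d0; exists d.
Qed.

(** Cut along |x| = |y|. On each half [core] separates the variables and [slice_bound] applies; its
    two one-dimensional integrals contribute (1 - |w|)^(alpha - s1) and (1 - |w|)^(1 - s2). *)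
Lemma weighted_kernel_integral : exists2 C, 0 <= C & forall w : R[i], disk w ->
  (\int[mu2]_(q in diskR) (normc (1 - (q.1 +i* q.2) * w) `^ (- s) *
     (1 - normc (q.1 +i* q.2)) `^ (alpha - 1))%:E
   <= (C * (1 - normc w) `^ (alpha + 1 - s))%:E)%E.
Proof.
pose CJ := alpha^-1 + (s1 - alpha)^-1; pose CP := 2 * (1^-1 + (s2 - 1)^-1) : R.
have CJ0 : 0 <= CJ.
  by rewrite /CJ /s1 addrAC subrr add0r addr_ge0// invr_ge0 ltW.
have CP0 : 0 <= CP.
  by rewrite /CP /s2 addrAC subrr add0r mulr_ge0// addr_ge0// invr_ge0 ltW.
have C00 : 0 <= C0 by rewrite !mulr_ge0 ?powR_ge0.
exists (2 * C0 * (2 * CJ * CP)); first by apply: mulr_ge0; apply: mulr_ge0 => //; apply: mulr_ge0.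
move=> w Dw; set d := 1 - normc w.
have d0 : 0 < d by rewrite subr_gt0.
have hr : (\int[mu]_x (rr d x)%:E <= (CJ * d `^ (alpha - s1))%:E)%E.
  by apply: J_le => //; rewrite /s1 ltrDl.
have mpp0 : measurable_fun setT (fun x : R => (pp0 d x)%:E).
  by apply/measurable_EFinP; exact: mJ.
have mpp c : measurable_fun setT (pp d c).
  apply: measurable_funD.
    by apply: (measurableT_comp (mJ 1 s2 3 d)); exact: measurable_funB.
  by apply: (measurableT_comp (mJ 1 s2 3 d)); exact: measurable_funB.
have pp_ge0 c x : 0 <= pp d c x by rewrite addr_ge0// J_ge0.
have hp c : (\int[mu]_x (pp d c x)%:E <= (CP * d `^ (1 - s2))%:E)%E.
  have hp0 : (\int[mu]_x (pp0 d x)%:E <= ((1^-1 + (s2 - 1)^-1) * d `^ (1 - s2))%:E)%E.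
    by apply: J_le => //; rewrite /s2 ltrDl.
  have -> : (\int[mu]_x (pp d c x)%:E =
      \int[mu]_x ((pp0 d (1 * x + - c)%R)%:E + (pp0 d (1 * (- x) + c)%R)%:E))%E.
    by apply: eq_integral => x _; rewrite /pp EFinD !mul1r [- x + c]addrC.
  have m1 b : measurable_fun setT (fun x : R => (pp0 d (1 * x + b))%:E).
    apply: (measurableT_comp mpp0); apply: measurable_funD => //.
  have m2 b : measurable_fun setT (fun x : R => (pp0 d (1 * (- x) + b))%:E).
    exact: (measurableT_comp (m1 b) (@oppr_measurable R setT)).
  have z0 x : (0 <= (pp0 d x)%:E)%E by rewrite lee_fin J_ge0.
  rewrite ge0_integralD//; [|exact: m1|exact: m2].
  rewrite (@ge0_integral_opp R (fun x => (pp0 d (1 * x + c))%:E))//.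
  rewrite (@ge0_integral_affine R 1 c (fun x => (pp0 d x)%:E))// invr1 mul1e.
  rewrite (@ge0_integral_affine R 1 (- c) (fun x => (pp0 d x)%:E))// invr1 mul1e.
  rewrite /CP -mulrA mulr_natl mulr2n EFinD; exact: leeD.
have mX : measurable_fun setT X.
  apply: (@measurableT_comp _ _ _ _ _ _ (fun t : R => t `^ 2^-1)); first exact: measurable_powR.
  by apply: measurable_funB => //; exact: measurable_funX.
have mrr : measurable_fun setT (rr d) by exact: mJ.
have rr0 x : 0 <= rr d x by exact: J_ge0.
(* These are the coordinates of conj(w), the point near which 1 - z w can be small. *)
pose c1 := - complex.Im w; pose c2 := complex.Re w.
have [G1 _] := slice_bound (mpp c1) mrr mX (pp_ge0 c1) rr0 hr (hp c1).
have [_ G2] := slice_bound (mpp c2) mrr mX (pp_ge0 c2) rr0 hr (hp c2).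
have dd : d `^ (alpha + 1 - s) = d `^ (alpha - s1) * d `^ (1 - s2).
  by rewrite -powR_add//; congr (_ `^ _); rewrite s12; ring.
pose g1 (q : R * R) := pp d c1 q.2 * rr d (X q.2 - `|q.1|).
pose g2 (q : R * R) := pp d c2 q.1 * rr d (X q.1 - `|q.2|).
have mg (u v : R * R -> R) c : measurable_fun setT u -> measurable_fun setT v ->
    measurable_fun setT (fun q => (pp d c (u q) * rr d (X (u q) - `|v q|))%:E).
  move=> mu_ mv; apply/measurable_EFinP; apply: measurable_funM.
    exact: measurableT_comp (mpp c) mu_.
  apply: (measurableT_comp mrr); apply: measurable_funB.
    exact: measurableT_comp mu_.
  by apply: measurableT_comp => //; exact: normr_measurable.
have mg1 : measurable_fun setT (fun q => (g1 q)%:E) by apply: mg; [exact: measurable_snd|exact: measurable_fst].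
have mg2 : measurable_fun setT (fun q => (g2 q)%:E) by apply: mg; [exact: measurable_fst|exact: measurable_snd].
have g10 q : (0 <= (g1 q)%:E)%E by rewrite lee_fin mulr_ge0.
have g20 q : (0 <= (g2 q)%:E)%E by rewrite lee_fin mulr_ge0.
apply: (@le_trans _ _ (\int[mu2]_q (C0%:E * ((g1 q)%:E + (g2 q)%:E)))%E).
  rewrite [leLHS]integral_mkcond; apply: ge0_le_integral => //.
  - by move=> q _; rewrite patchE; case: ifP => // _; rewrite lee_fin mulr_ge0 ?powR_ge0.
  - apply/(measurable_restrictT _ measurable_diskR).
    exact: mkern.
  - by apply: emeasurable_funM => //; exact: emeasurable_funD.
  move=> [x y] _; rewrite patchE; case: ifPn => [|_]; last first.
    by apply: mule_ge0; [rewrite lee_fin|exact: adde_ge0].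
  rewrite inE /diskR /= => Dz; rewrite -EFinD -EFinM lee_fin mulrDr.
  have xy1 : x ^+ 2 + y ^+ 2 < 1.
    by have := Dz; rewrite /disk /= -(@ltr_pXn2r _ 2) ?nnegrE ?sqrtr_ge0// expr1n sqr_sqrtr// addr_ge0 ?sqr_ge0.
  have hT : d <= normc (1 - (x +i* y) * w) by exact: nc_1zw_gew.
  have hr' : 1 - Num.sqrt (x ^+ 2 + y ^+ 2) <= normc (1 - (x +i* y) * w).
    exact: (nc_1zw_gez (x +i* y) Dw).
  have hs := nc_sub_le Dz Dw.
  have lt3 : normc ((x +i* y) - conjc w) < 3.
    apply: le_lt_trans (ncB _ _) _; rewrite ncJ.
    by apply: lt_trans (ltrD (Dz : normc _ < 1) (Dw : normc _ < 1)) _; rewrite -(natrD _ 1 1) ltr_nat.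
  have hy : `|y - c1| <= normc ((x +i* y) - conjc w).
    by apply: le_trans (Im_le _); rewrite cImD cImN /= /c1; case: (w).
  have hx : `|x - c2| <= normc ((x +i* y) - conjc w).
    by apply: le_trans (Re_le _); rewrite cReD cReN /= /c2; case: (w).
  (* Horizontal chords where |y| <= |x|, vertical ones elsewhere; the majorant of the other half is
     simply added. *)
  have [yx|/ltW xy] := leP (y ^+ 2) (x ^+ 2).
    apply: le_trans (core d0 hT (le_trans hy hs) (le_lt_trans hy lt3) hr' xy1 yx) _.
    by rewrite lerDl mulr_ge0// -lee_fin.
  rewrite addrC in xy1; rewrite [x ^+ 2 + _]addrC in hr'.
  rewrite [x ^+ 2 + _]addrC.
  apply: le_trans (core d0 hT (le_trans hx hs) (le_lt_trans hx lt3) hr' xy1 xy) _.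
  by rewrite lerDr mulr_ge0// -lee_fin.
rewrite ge0_integralZl_EFin//; last 2 first.
- by move=> q _; rewrite adde_ge0.
- exact: emeasurable_funD.
rewrite ge0_integralD//.
apply: (@le_trans _ _ (C0%:E * ((2 * (CJ * d `^ (alpha - s1)) * (CP * d `^ (1 - s2)))%:E +
   (2 * (CJ * d `^ (alpha - s1)) * (CP * d `^ (1 - s2)))%:E))%E).
  by apply: lee_wpmul2l; [rewrite lee_fin|exact: leeD G1 G2].
by rewrite -EFinD -EFinM lee_fin dd le_eqVlt; apply/orP; left; apply/eqP; ring.
Qed.

End Is.

End WeightedIntegral.

(** * The reproducing kernel and its derivatives *)

Section FormalPowers.
Variable R : realType.
Notation C := R[i].
Implicit Types (p q f g h : {poly C}) (a : R).

(** Congruence modulo X^(N+1). Polynomials under this relation replace formal power series. *)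
Definition eqX N p q := forall k, (k <= N)%N -> p`_k = q`_k.

Lemma eqX_refl N p : eqX N p p. Proof. by []. Qed.
Lemma eqX_sym N p q : eqX N p q -> eqX N q p.
Proof. by move=> h k kN; rewrite h. Qed.
Lemma eqX_trans N p q r : eqX N p q -> eqX N q r -> eqX N p r.
Proof. by move=> h1 h2 k kN; rewrite h1// h2. Qed.

Lemma eqXM N p q p' q' : eqX N p p' -> eqX N q q' -> eqX N (p * q) (p' * q').
Proof.
move=> h1 h2 k kN; rewrite !coefM; apply: eq_bigr => i _.
rewrite h1; last by rewrite (leq_trans _ kN)// -ltnS.
by rewrite h2// (leq_trans (leq_subr _ _)).
Qed.

Lemma eqXZ N c p q : eqX N p q -> eqX N (c *: p) (c *: q).
Proof. by move=> h k kN; rewrite !coefZ h. Qed.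

Lemma eqXD N p q p' q' : eqX N p p' -> eqX N q q' -> eqX N (p + q) (p' + q').
Proof. by move=> h1 h2 k kN; rewrite !coefD h1// h2. Qed.

Lemma eqX_sum N n (F G : 'I_n -> {poly C}) :
  (forall i, eqX N (F i) (G i)) -> eqX N (\sum_(i < n) F i) (\sum_(i < n) G i).
Proof. by move=> h k kN; rewrite !coef_sum; apply: eq_bigr => i _; exact: h. Qed.

Lemma eqX0 N n p : (N < n)%N -> eqX N ('X^n * p) 0.
Proof. by move=> Nn k kN; rewrite coefXnM coef0 (leq_ltn_trans kN). Qed.

Definition pfc a n : C := (pf a n)%:C.

(* The formal power (1 - f)^(-a), truncated at order N. *)
Definition pw N a f : {poly C} := \sum_(n < N.+1) pfc a n *: f ^+ n.

Lemma pf_binomial a i k : pf a (i + k) *+ 'C(i + k, i) = pf a i * pf (a + i%:R) k.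
Proof.
elim: k => [|k IH]; first by rewrite addn0 binn pf0 mulr1.
apply: (@mulfI _ (k.+1%:R)); first by rewrite pnatr_eq0.
have e : 'C((i + k).+1, i)%:R * k.+1%:R = (i + k).+1%:R * 'C(i + k, i)%:R :> R.
  have := mul_bin_down (i + k).+1 i; rewrite subSn ?leq_addr// addKn/= => e0.
  by rewrite -!natrM e0 mulnC.
transitivity ((pf a (i + k).+1 * (i + k).+1%:R) * 'C(i + k, i)%:R).
  by rewrite addnS -(mulr_natr (pf a _)) -mulrA -e mulrCA [k.+1%:R * _]mulrC.
rewrite mulrCA pfS mulrCA -IH -(mulr_natr (pf a _)) [pf a _ * (i + k).+1%:R]mulrC pfS natrD.
by rewrite -mulrA addrA.
Qed.

Lemma triangle (V : zmodType) (F : nat -> nat -> V) N :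
  \sum_(0 <= n < N.+1) \sum_(0 <= i < n.+1) F i (n - i)%N =
  \sum_(0 <= i < N.+1) \sum_(0 <= k < (N - i).+1) F i k.
Proof.
elim: N => [|N IH]; first by rewrite !big_nat1.
rewrite big_nat_recr//= IH [RHS]big_nat_recr//= subnn big_nat1.
rewrite [X in _ + X]big_nat_recr//= subnn addrA; congr (_ + _).
rewrite -big_split/=; apply: eq_big_nat => i /andP[_ iN].
rewrite ltnS in iN.
by rewrite subSn// [RHS]big_nat_recr.
Qed.

(** Taylor expansion of (1 - F - G)^(-a) in powers of G. Both F and G carry a factor X, so the terms
    lost by truncation are multiples of X^(N+1). *)
Lemma pw_add N a (f1 g1 : {poly C}) : eqX N (pw N a ('X * f1 + 'X * g1))
  (\sum_(i < N.+1) pfc a i *: (('X * g1) ^+ i * pw N (a + i%:R) ('X * f1))).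
Proof.
have -> : pw N a ('X * f1 + 'X * g1) = \sum_(0 <= i < N.+1) \sum_(0 <= k < (N - i).+1)
    (pfc a i * pfc (a + i%:R) k) *: (('X * g1) ^+ i * ('X * f1) ^+ k).
  rewrite -(triangle (fun i k => (pfc a i * pfc (a + i%:R) k) *: (('X * g1) ^+ i * ('X * f1) ^+ k))).
  rewrite /pw big_mkord; apply: eq_bigr => n _; rewrite big_mkord exprDn scaler_sumr.
  apply: eq_bigr => i _; rewrite -scaler_nat scalerA mulrC; congr (_ *: _); last exact: mulrC.
  by rewrite /pfc -RCM -pf_binomial subnKC ?leq_ord// -(mulr_natr (pf a n)) RCM RCnat mulrC.
rewrite big_mkord; apply: eqX_sum => i.
rewrite /pw mulr_sumr scaler_sumr.
rewrite -(big_mkord xpredT (fun k => pfc a i *: (('X * g1) ^+ i * (pfc (a + i%:R) k *: ('X * f1) ^+ k)))).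
rewrite (@big_cat_nat _ _ _ (N - i).+1 0 N.+1)//=; last by rewrite ltnS leq_subr.
rewrite -[X in eqX N X _]addr0; apply: eqXD.
  rewrite [X in eqX N _ X](_ : _ = \sum_(0 <= k < (N - i).+1)
    (pfc a i * pfc (a + i%:R) k) *: (('X * g1) ^+ i * ('X * f1) ^+ k)); first exact: eqX_refl.
  by apply: eq_bigr => k _; rewrite -scalerAr scalerA.
move=> k kN; rewrite coef0 coef_sum big_nat big1// => m /andP[h1 h2].
rewrite -scalerAr scalerA coefZ.
have -> : ('X * g1) ^+ i * ('X * f1) ^+ m = 'X^(i + m) * (g1 ^+ i * f1 ^+ m).
  by rewrite !exprMn exprD; ring.
rewrite coefXnM (leq_ltn_trans kN) ?mulr0//.
by rewrite -ltn_subLR // -ltnS.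
Qed.

(** (1 - F) (1 - F)^(-a-1) = (1 - F)^(-a): by Pascal's rule for [pf] the sums telescope up to the
    last term, a multiple of X^(N+1). *)
Lemma pw_step N a (f1 : {poly C}) :
  eqX N ((1 - 'X * f1) * pw N (a + 1) ('X * f1)) (pw N a ('X * f1)).
Proof.
set f := 'X * f1.
have -> : (1 - f) * pw N (a + 1) f =
   pw N a f - 'X^(N.+1) * (pfc (a + 1) N *: f1 ^+ N.+1).
  rewrite mulrBl mul1r /pw mulr_sumr.
  rewrite [X in X - _]big_ord_recl [X in _ - X]big_ord_recr/= [X in _ = X - _]big_ord_recl/=.
  have -> : pfc (a + 1) 0 = pfc a 0 by rewrite /pfc !pf0.
  have -> : f * (pfc (a + 1) N *: f ^+ N) = 'X^(N.+1) * (pfc (a + 1) N *: f1 ^+ N.+1).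
    by rewrite -!scalerAr -exprS /f exprMn.
  rewrite opprD !addrA; congr (_ - _); rewrite -!addrA; congr (_ + _).
  rewrite -sumrB; apply: eq_bigr => i _.
  rewrite /bump add1n -scalerAr -exprS -scalerBl; congr (_ *: _).
  rewrite /pfc -rmorphB; congr (_%:C).
  apply: (@mulfI _ (i.+1%:R)); first by rewrite pnatr_eq0.
  by rewrite mulrBr !pfS -[in RHS]pf_shift -natr1; ring.
rewrite -[X in eqX N _ X]addr0; apply: eqXD; first exact: eqX_refl.
by rewrite -mulrN; exact: eqX0.
Qed.

Lemma pw_stepn N a (f1 : {poly C}) i :
  eqX N ((1 - 'X * f1) ^+ i * pw N (a + i%:R) ('X * f1)) (pw N a ('X * f1)).
Proof.
elim: i a => [|i IH] a; first by rewrite expr0 mul1r addr0; exact: eqX_refl.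
rewrite exprSr -mulrA -natr1 [i%:R + 1]addrC addrA.
apply: (eqX_trans _ (IH a)); apply: eqXM; first exact: eqX_refl.
have -> : a + 1 + i%:R = (a + i%:R) + 1 by ring.
exact: pw_step.
Qed.

(** The third series is F + (1 - F) G with F = X f1 and G = X g1; expanding in (1 - F) G by
    [pw_add], each factor (1 - F)^i cancels against the shifted exponent a + i. *)
Lemma pw_mul N a (f1 g1 h1 : {poly C}) : 1 - 'X * h1 = (1 - 'X * f1) * (1 - 'X * g1) ->
  eqX N (pw N a ('X * h1)) (pw N a ('X * f1) * pw N a ('X * g1)).
Proof.
move=> E; have -> : 'X * h1 = 'X * f1 + 'X * ((1 - 'X * f1) * g1).
  have -> : 'X * h1 = 1 - (1 - 'X * h1) by ring.
  by rewrite E; ring.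
apply: (eqX_trans (@pw_add N a f1 ((1 - 'X * f1) * g1))).
rewrite [pw N a ('X * g1)]/pw mulr_sumr.
apply: eqX_sum => i; rewrite -scalerAr; apply: eqXZ.
have -> : ('X * ((1 - 'X * f1) * g1)) ^+ i * pw N (a + i%:R) ('X * f1) =
  ('X * g1) ^+ i * ((1 - 'X * f1) ^+ i * pw N (a + i%:R) ('X * f1)).
  by rewrite !exprMn; ring.
rewrite mulrC; apply: eqXM; last exact: eqX_refl.
exact: pw_stepn.
Qed.

Lemma pw1_mul N a (f1 : {poly C}) :
  eqX N (pw N a ('X * f1) * pw N 1 ('X * f1)) (pw N (a + 1) ('X * f1)).
Proof.
have h0 : eqX N ((1 - 'X * f1) * pw N 1 ('X * f1)) 1.
  have := @pw_step N 0 f1; rewrite add0r => /eqX_trans; apply.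
  rewrite /pw big_ord_recl/= big1 ?addr0 ?expr0; last first.
    by move=> i _; rewrite /pfc /bump add1n pf_00 scale0r.
  by rewrite /pfc pf0 scale1r; exact: eqX_refl.
apply: (@eqX_trans _ _ (((1 - 'X * f1) * pw N (a + 1) ('X * f1)) * pw N 1 ('X * f1))).
  by apply: eqXM; [apply: eqX_sym; exact: pw_step|exact: eqX_refl].
rewrite mulrAC -[X in eqX N _ X]mul1r; apply: eqXM => //; exact: eqX_refl.
Qed.

Lemma coef_pwX N a c k : (k <= N)%N -> (pw N a ('X * c%:P))`_k = pfc a k * c ^+ k.
Proof.
move=> kN; rewrite /pw coef_sum (bigD1 (Ordinal (kN : (k < N.+1)%N)))//= big1 ?addr0.
  by rewrite coefZ exprMn -rmorphXn coefMC coefXn eqxx mul1r.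
move=> i ik; rewrite coefZ exprMn -rmorphXn coefMC coefXn.
by rewrite eq_sym -(inj_eq val_inj)/= in ik *; rewrite (negbTE ik) mul0r mulr0.
Qed.

End FormalPowers.

(** * The product formula for phi_n(z) phi_n(w) *)

Section KernelAlgebra.
Variable R : realType.
Notation C := R[i].

(** The perturbation of (1 - X f1) (1 - X g1) is a combination of its own two factors, so the n-th
    power of the perturbation lowers one exponent a + n to a + i and the other to a + (n - i). *)
Lemma pw_bilinear N a (f1 g1 h : {poly C}) (x y : C) :
  1 - 'X * h = (1 - 'X * f1) * (1 - 'X * g1) -
    'X * (x *: (1 - 'X * g1) + y *: (1 - 'X * f1)) ->
  eqX N (pw N a ('X * h)) (\sum_(n < N.+1) \sum_(i < n.+1)
    (pfc a n * 'C(n, i)%:R * x ^+ i * y ^+ (n - i)) *: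
    ('X^n * (pw N (a + i%:R) ('X * f1) * pw N (a + (n - i)%:R) ('X * g1)))).
Proof.
set D := (x *: _ + y *: _) => E.
pose h0 := f1 + g1 - 'X * (f1 * g1).
have E0 : 1 - 'X * h0 = (1 - 'X * f1) * (1 - 'X * g1) by rewrite /h0; ring.
have -> : h = h0 + D.
  have e : 'X * h = 'X * (h0 + D).
    have -> : 'X * h = 1 - (1 - 'X * h) by ring.
    by rewrite E -E0; ring.
  by apply: (@mulfI _ 'X _ _ _ e); rewrite polyX_eq0.
rewrite mulrDr; apply: (eqX_trans (@pw_add R N a h0 D)).
apply: eqX_sum => n; rewrite exprMn.
have -> : D ^+ n = \sum_(i < n.+1) ('C(n, i)%:R * x ^+ i * y ^+ (n - i)) *:
   ((1 - 'X * g1) ^+ i * (1 - 'X * f1) ^+ (n - i)).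
  rewrite /D addrC exprDn; apply: eq_bigr => i _.
  rewrite !exprZn -scalerAl -scalerAr scalerA -scaler_nat scalerA; congr (_ *: _); last exact: mulrC.
  by move: (x ^+ _) (y ^+ _) => x1 x2; ring.
rewrite -mulrA [X in 'X^n * X]mulr_suml [X in _ *: X]mulr_sumr scaler_sumr; apply: eqX_sum => i.
rewrite -[X in 'X^n * X]scalerAl -['X^n * _]scalerAr scalerA !mulrA; apply: eqXZ.
rewrite -!mulrA; apply: eqXM; first exact: eqX_refl.
have e1 : a + n%:R = a + (n - i)%:R + i%:R.
  by rewrite -addrA -natrD subnK// -ltnS.
have e2 : a + n%:R = a + i%:R + (n - i)%:R.
  by rewrite -addrA -natrD subnKC// -ltnS.
apply: (@eqX_trans _ _ _ ((1 - 'X * g1) ^+ i * ((1 - 'X * f1) ^+ (n - i) *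
   (pw N (a + n%:R) ('X * f1) * pw N (a + n%:R) ('X * g1))))).
  apply: eqXM; first exact: eqX_refl.
  apply: eqXM; first exact: eqX_refl.
  exact: pw_mul.
have -> : (1 - 'X * g1) ^+ i * ((1 - 'X * f1) ^+ (n - i) *
   (pw N (a + n%:R) ('X * f1) * pw N (a + n%:R) ('X * g1))) =
  ((1 - 'X * f1) ^+ (n - i) * pw N (a + n%:R) ('X * f1)) *
  ((1 - 'X * g1) ^+ i * pw N (a + n%:R) ('X * g1)) by ring.
apply: eqXM; first by rewrite e2; exact: pw_stepn.
by rewrite e1; exact: pw_stepn.
Qed.

Lemma pw_addC N a (f1 : {poly C}) (x : C) :
  eqX N (pw N a ('X * f1 + 'X * x%:P))
    (\sum_(i < N.+1) (pfc a i * x ^+ i) *: ('X^i * pw N (a + i%:R) ('X * f1))).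
Proof.
apply: (eqX_trans (@pw_add R N a f1 x%:P)); apply: eqX_sum => i.
rewrite exprMn -rmorphXn -mulrA mul_polyC -scalerAr scalerA; exact: eqX_refl.
Qed.

Lemma pf_1 n : pf 1 n = 1 :> R.
Proof.
elim: n => [|n IH]; first by rewrite pf0.
apply: (@mulfI _ (n.+1%:R)); first by rewrite pnatr_eq0.
by rewrite pfS IH !mulr1 -natr1 addrC.
Qed.

Lemma pw_coef_stable N k a (h : {poly C}) : (k <= N)%N ->
  (pw N a ('X * h))`_k = (pw k a ('X * h))`_k.
Proof.
move=> kN; rewrite /pw -(big_mkord xpredT (fun n => pfc a n *: ('X * h) ^+ n)).
rewrite (@big_cat_nat _ _ _ k.+1 0 N.+1)//= coefD big_mkord -[RHS]addr0; congr (_ + _).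
rewrite coef_sum big_nat big1// => n /andP[kn _].
by rewrite coefZ exprMn coefXnM kn mulr0.
Qed.

Lemma pw_roots n a (h : {poly C}) (r r' : C) :
  1 - 'X * h = (1 - 'X * r%:P) * (1 - 'X * r'%:P) ->
  (pw n a ('X * h))`_n = \sum_(i < n.+1) (pfc a i * r ^+ i) * (pfc a (n - i) * r' ^+ (n - i)).
Proof.
move=> E; rewrite (@pw_mul _ n a _ _ _ E n (leqnn n)) coefM; apply: eq_bigr => i _.
by rewrite !coef_pwX ?leq_subr// -ltnS.
Qed.

Section Moments.
Variable lambda : R.
Hypothesis l0 : 0 <= lambda.

(* [MM i j] is the moment of u^i (1-u)^j for the Beta(lambda + 1, lambda) law. *)
Definition MM i j : R := pochhammer (lambda + 1) i * pochhammer lambda j /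
  pochhammer (2 * lambda + 1) (i + j).

Lemma pochhammer_gt0 a n : 0 < a -> 0 < pochhammer a n :> R.
Proof. by move=> a0; rewrite /pochhammer; apply: prodr_gt0 => i _; rewrite ltr_pwDl. Qed.

Lemma pochhammerS a n : pochhammer a n.+1 = pochhammer a n * (a + n%:R) :> R.
Proof. by rewrite /pochhammer big_ord_recr. Qed.

Lemma MM00 : MM 0 0 = 1.
Proof. by rewrite /MM /pochhammer !big_ord0 mulr1 invr1 mulr1. Qed.

Let nz n : pochhammer (2 * lambda + 1) n != 0 :> R.
Proof. by rewrite gt_eqF// pochhammer_gt0// ltr_wpDl// mulr_ge0. Qed.

Let nz2 n : 2 * lambda + 1 + n%:R != 0 :> R.
Proof. by rewrite gt_eqF// ltr_pwDl// ltr_wpDl// mulr_ge0. Qed.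

Lemma MMSl i j : MM i.+1 j = (lambda + 1 + i%:R) / (2 * lambda + 1 + (i + j)%:R) * MM i j.
Proof.
rewrite /MM addSn !pochhammerS invfM.
move: (pochhammer (2 * lambda + 1) (i + j))^-1 (2 * lambda + 1 + (i + j)%:R)^-1
  (pochhammer (lambda + 1) i) (pochhammer lambda j) => A B c d; ring.
Qed.

Lemma MMSr i j : MM i j.+1 = (lambda + j%:R) / (2 * lambda + 1 + (i + j)%:R) * MM i j.
Proof.
rewrite /MM addnS !pochhammerS invfM.
move: (pochhammer (2 * lambda + 1) (i + j))^-1 (2 * lambda + 1 + (i + j)%:R)^-1
  (pochhammer (lambda + 1) i) (pochhammer lambda j) => A B c d; ring.
Qed.

Lemma MM_split i j : MM i j = MM i.+1 j + MM i j.+1.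
Proof.
rewrite MMSl MMSr -mulrDl -mulrDl.
have -> : lambda + 1 + i%:R + (lambda + j%:R) = 2 * lambda + 1 + (i + j)%:R.
  by rewrite natrD; ring.
by rewrite divff// mul1r.
Qed.

Lemma binMM n i : (i <= n)%N ->
  'C(n, i)%:R * MM i (n - i) = pf (lambda + 1) i * pf lambda (n - i) / pn lambda n.
Proof.
move=> iN; rewrite /MM /pn /pf subnKC//.
have f0 k : k`!%:R != 0 :> R by rewrite pnatr_eq0 -lt0n fact_gt0.
have e : 'C(n, i)%:R = n`!%:R / (i`!%:R * (n - i)`!%:R) :> R.
  rewrite -(bin_fact iN) natrM natrM.
  by rewrite mulfK// mulf_neq0.
rewrite e; move: (nz n) (f0 n) (f0 i) (f0 (n - i)%N) => /=.
move: (pochhammer (2 * lambda + 1) n) (n`!%:R) (i`!%:R) ((n - i)`!%:R)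
  (pochhammer (lambda + 1) i) (pochhammer lambda (n - i)) => a b c d x y a0 b0 c0 d0.
by field; rewrite a0 b0 c0 d0.
Qed.

(** The mean of p(1 - u) under the same law, given through its moments: the variable X stands for 1
    - u. The moments keep their meaning for lambda = 0, where the law is the point mass at u = 1. *)
Definition Lam (p : {poly C}) : C := \sum_(j < size p) p`_j * (MM 0 j)%:C.

Lemma LamE n (p : {poly C}) : (size p <= n)%N -> Lam p = \sum_(j < n) p`_j * (MM 0 j)%:C.
Proof.
move=> pn; rewrite /Lam -!(big_mkord xpredT (fun j => p`_j * (MM 0 j)%:C)).
rewrite [RHS](@big_cat_nat _ _ _ (size p) 0 n)//= [X in _ + X]big_nat [X in _ + X]big1 ?addr0//.
by move=> j /andP[pj _]; rewrite nth_default ?mul0r.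
Qed.

Lemma LamD (p q : {poly C}) : Lam (p + q) = Lam p + Lam q.
Proof.
pose n := maxn (size p) (size q).
rewrite (@LamE n (p + q)) ?(@LamE n p) ?(@LamE n q) ?leq_maxl ?leq_maxr ?size_polyD//.
by rewrite -big_split; apply: eq_bigr => i _; rewrite coefD mulrDl.
Qed.

Lemma LamZ c (p : {poly C}) : Lam (c *: p) = c * Lam p.
Proof.
rewrite (@LamE (size p)) ?size_scale_leq// /Lam mulr_sumr.
by apply: eq_bigr => i _; rewrite coefZ mulrA.
Qed.

Lemma Lam0 : Lam 0 = 0. Proof. by rewrite -(scale0r 0) LamZ mul0r. Qed.

Lemma Lam_sum n (F : 'I_n -> {poly C}) : Lam (\sum_(i < n) F i) = \sum_(i < n) Lam (F i).
Proof. exact: (big_morph Lam LamD Lam0). Qed.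

Lemma LamX i j : Lam ((1 - 'X) ^+ i * 'X^j) = (MM i j)%:C.
Proof.
elim: i j => [|i IH] j.
  rewrite mul1r (@LamE j.+1) ?size_polyXn// (bigD1 ord_max)//= coefXn eqxx mul1r big1 ?addr0//.
  by move=> k kj; rewrite coefXn; move: kj; rewrite -(inj_eq val_inj)/= => /negbTE ->; rewrite mul0r.
have -> : (1 - 'X) ^+ i.+1 * 'X^j = (1 - 'X) ^+ i * 'X^j + (-1) *: ((1 - 'X) ^+ i * 'X^(j.+1)) :> {poly C}.
  by rewrite scaleN1r !exprSr; ring.
by rewrite LamD LamZ !IH (MM_split i j) mulN1r raddfD/= addrK.
Qed.

Lemma poly_eq_pointwise (p q : {poly C}) : (forall x, p.[x] = q.[x]) -> p = q.
Proof.
move=> h; apply/eqP; rewrite -subr_eq0; apply/eqP; apply/eqP/negPn/negP => pq0.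
have := max_poly_roots pq0 (rs := [seq k%:R | k <- iota 0 (size (p - q))]).
rewrite size_map size_iota ltnn => /(_ _ _)/negP; apply => //.
  by apply/allP => x _; rewrite rootE hornerD hornerN h subrr.
by rewrite map_inj_uniq ?iota_uniq// => a b /eqP; rewrite eqr_nat => /eqP.
Qed.

End Moments.

Lemma triangle_restrict (V : zmodType) (F : nat -> nat -> V) n :
  (forall i j, (n < i + j)%N -> F i j = 0) ->
  \sum_(i < n.+1) \sum_(j < n.+1) F i j = \sum_(m < n.+1) \sum_(i < m.+1) F i (m - i)%N.
Proof.
move=> F0; have := triangle F n.
rewrite !big_mkord => e; transitivity (\sum_(i < n.+1) \sum_(0 <= k < (n - i).+1) F i k).
  apply: eq_bigr => i _; rewrite -(big_mkord xpredT (fun j => F i j)).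
  rewrite (@big_cat_nat _ _ _ (n - i).+1 0 n.+1)//= ?ltnS ?leq_subr//.
  rewrite [X in _ + X]big_nat [X in _ + X]big1 ?addr0// => j /andP[nj _].
  by apply: F0; rewrite -ltn_subLR// -ltnS.
by rewrite -e; apply: eq_bigr => m _; rewrite big_mkord.
Qed.

Section Kernel.
Variables (lambda : R) (z w : C).
Hypothesis l0 : 0 <= lambda.

(** a1 + be = conj(z) w and b2 + ga = conj(z) conj(w): replacing z by (1 - x) z + x conj(z) adds x
    be to a1 and x ga to b2. *)
Let a1 := z * w.
Let b2 := z * conjc w.
Let be := conjc z * w - z * w.
Let ga := conjc z * conjc w - z * conjc w.

(** [Wp] is the term of [pw_bilinear] attached to u^i (1-u)^j, and [Cf k n i] the coefficient of u^i
    (1-u)^(n-i) in the k-th Taylor coefficient of the power -lambda of the quadratic polynomial. *)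
Definition Wp N i j : {poly C} := (be ^+ i * ga ^+ j) *: ('X^(i + j) *
  (pw N (lambda + i%:R) ('X * a1%:P) * pw N (lambda + j%:R) ('X * b2%:P))).

Definition Cf k n i : C := pfc lambda n * 'C(n, i)%:R * (Wp k i (n - i))`_k.

Lemma Wp_small N i j k : (k < i + j)%N -> (Wp N i j)`_k = 0.
Proof. by move=> h; rewrite coefZ coefXnM h mulr0. Qed.

Lemma Wp_stable N i j k : (k <= N)%N -> (Wp N i j)`_k = (Wp k i j)`_k.
Proof.
move=> kN; rewrite !coefZ; congr (_ * _).
apply: (@eqXM _ k) => //; apply: eqXM => l lk.
  by rewrite (@pw_coef_stable N l) ?(leq_trans lk)// (@pw_coef_stable k l).
by rewrite (@pw_coef_stable N l) ?(leq_trans lk)// (@pw_coef_stable k l).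
Qed.

(** r and r' are the reciprocal roots of the quadratic polynomial attached to u. Its power -lambda
    is computed once from the roots and once by [pw_bilinear], where u enters polynomially. *)
Lemma Cf_expand k (u r r' : C) :
  r + r' = (1 - u) * (z * w + conjc z * conjc w) + u * (conjc z * w + z * conjc w) ->
  r * r' = z * w * (conjc z * conjc w) ->
  \sum_(n < k.+1) \sum_(i < n.+1) Cf k n i * (u ^+ i * (1 - u) ^+ (n - i)) =
  \sum_(i < k.+1) (pfc lambda i * r ^+ i) * (pfc lambda (k - i) * r' ^+ (k - i)).
Proof.
move=> hs hp; pose h : {poly C} := r%:P + r'%:P - 'X * (r%:P * r'%:P).
have E1 : 1 - 'X * h = (1 - 'X * r%:P) * (1 - 'X * r'%:P) by rewrite /h; ring.
rewrite -(@pw_roots k _ _ _ _ E1).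
have E2 : 1 - 'X * h = (1 - 'X * a1%:P) * (1 - 'X * b2%:P) -
  'X * ((u * be) *: (1 - 'X * b2%:P) + ((1 - u) * ga) *: (1 - 'X * a1%:P)).
  rewrite -!mul_polyC /h; have := congr1 polyC hs; have := congr1 polyC hp.
  rewrite /a1 /b2 /be /ga !(rmorphM, rmorphD, rmorphN, rmorph1)/=.
  move: (z%:P) (w%:P) ((conjc z)%:P) ((conjc w)%:P) (r%:P) (r'%:P) (u%:P) 'X
    => Z W Zb Wb r1 r2 U X e1 e2.
  by rewrite e1 e2; ring.
rewrite (@pw_bilinear k lambda _ _ _ _ _ E2 k (leqnn k)) coef_sum.
apply: eq_bigr => n _; rewrite coef_sum; apply: eq_bigr => i _.
have e : (i + (n - i) = n)%N by rewrite subnKC// -ltnS.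
rewrite /Cf /Wp e !coefZ !exprMn.
move: (u ^+ i) ((1 - u) ^+ (n - i)) (be ^+ i) (ga ^+ (n - i)) (_`_k) => x1 x2 x3 x4 x5.
by ring.
Qed.

Let T n i j := pfc (lambda + 1) i * pfc lambda j * (Wp n i j * pw n 1 ('X * a1%:P))`_n.

(** With zeta = (1 - x) z + x conj(z), the left side is the n-th coefficient of (1 - zeta w
    X)^(-lambda-1) (1 - zeta conj(w) X)^(-lambda), and both powers are expanded in x. The factor
    [pw n 1] inside [T] lowers the first exponent from lambda + 1 to lambda. *)
Lemma kernel_generating n x :
  ((1 - x) * z + x * conjc z) ^+ n * SS lambda n w =
  \sum_(i < n.+1) \sum_(j < n.+1) T n i j * x ^+ (i + j).
Proof.
set ze := (_ + _).
pose P := pw n (lambda + 1) ('X * a1%:P + 'X * (x * be)%:P).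
pose Q := pw n lambda ('X * b2%:P + 'X * (x * ga)%:P).
have <- : (P * Q)`_n = ze ^+ n * SS lambda n w.
  have -> : P = pw n (lambda + 1) ('X * (ze * w)%:P).
    rewrite /P -mulrDr -rmorphD/=; congr (pw _ _ (_ * _%:P)).
    by rewrite /a1 /be /ze; ring.
  have -> : Q = pw n lambda ('X * (ze * conjc w)%:P).
    rewrite /Q -mulrDr -rmorphD/=; congr (pw _ _ (_ * _%:P)).
    by rewrite /b2 /ga /ze; ring.
  rewrite coefM /SS /hterm mulr_sumr (reindex_inj rev_ord_inj)/=; apply: eq_bigr => i _.
  rewrite subSS !coef_pwX ?leq_subr// subKn ?leq_ord// /kap RCM /pfc !exprMn.
  rewrite -[in ze ^+ n](subnK (leq_ord i)) exprD.
  move: (ze ^+ _) (ze ^+ _) (_%:C) (_%:C) (w ^+ _) (conjc w ^+ _) => x1 x2 x3 x4 x5 x6.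
  by ring.
transitivity ((\sum_(i < n.+1) (pfc (lambda + 1) i * (x * be) ^+ i) *: ('X^i * pw n (lambda + 1 + i%:R) ('X * a1%:P)))
  * (\sum_(j < n.+1) (pfc lambda j * (x * ga) ^+ j) *: ('X^j * pw n (lambda + j%:R) ('X * b2%:P))))`_n.
  apply: (@eqXM _ n _ _ _ _ _ _ n (leqnn n)); exact: pw_addC.
rewrite mulr_suml coef_sum; apply: eq_bigr => i _.
rewrite mulr_sumr coef_sum; apply: eq_bigr => j _.
have scale2 (c d : C) (p q : {poly C}) : (c *: p) * (d *: q) = (c * d) *: (p * q).
  by rewrite -scalerAl -scalerAr scalerA.
rewrite scale2 coefZ /T /Wp -(scalerAl (be ^+ i * ga ^+ j)) coefZ.
have -> : ('X^i * pw n (lambda + 1 + i%:R) ('X * a1%:P) *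
    ('X^j * pw n (lambda + j%:R) ('X * b2%:P)))`_n =
    ('X^(i + j) * (pw n (lambda + i%:R) ('X * a1%:P) *
     pw n (lambda + j%:R) ('X * b2%:P)) * pw n 1 ('X * a1%:P))`_n.
  transitivity (('X^i * (pw n (lambda + i%:R) ('X * a1%:P) * pw n 1 ('X * a1%:P)) *
    ('X^j * pw n (lambda + j%:R) ('X * b2%:P)))`_n).
    apply: (@eqXM _ n _ _ _ _ _ _ n (leqnn n)); last exact: eqX_refl.
    apply: eqXM; first exact: eqX_refl.
    apply: eqX_sym; rewrite -addrA [1 + _]addrC addrA; exact: pw1_mul.
  have p6 (x1 x2 x3 x4 x5 : {poly C}) : x1 * (x3 * x5) * (x2 * x4) = x1 * x2 * (x3 * x4) * x5 by ring.
  by rewrite exprD p6.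
rewrite !exprMn [x ^+ (i + j)]exprD.
move: (_`_n) (x ^+ _) (x ^+ _) (be ^+ _) (ga ^+ _) => x1 x2 x3 x4 x5.
by ring.
Qed.

(** By [binMM], SS_n(z) / pn n is the mean of (u z + (1-u) conj(z))^n. Taking this mean in
    [kernel_generating], with x in the role of 1 - u, turns the power of zeta into the second
    function. *)
Lemma kernel_product n : phi lambda n z * phi lambda n w =
  \sum_(i < n.+1) \sum_(j < n.+1) T n i j * (MM lambda 0 (i + j))%:C.
Proof.
have := @poly_eq_pointwise
  (\sum_(k < n.+1) ('C(n, k)%:R * (z ^+ k * conjc z ^+ (n - k)) * SS lambda n w) *: ((1 - 'X) ^+ k * 'X^(n - k)))
  (\sum_(i < n.+1) \sum_(j < n.+1) T n i j *: 'X^(i + j)).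
move=> /(_ _)/wrap[].
  move=> x; rewrite !horner_sum; transitivity (((1 - x) * z + x * conjc z) ^+ n * SS lambda n w).
    rewrite [X in X ^+ n]addrC exprDn mulr_suml; apply: eq_bigr => k _.
    rewrite hornerZ hornerM !hornerXn horner_exp hornerD hornerN hornerX hornerC !exprMn -[in RHS]mulr_natl.
    move: (_%:R) (x ^+ _) (z ^+ _) (conjc z ^+ _) ((1 - x) ^+ _) (SS _ _ _) => x1 x2 x3 x4 x5 x6.
    by ring.
  rewrite kernel_generating; apply: eq_bigr => i _; rewrite horner_sum; apply: eq_bigr => j _.
  by rewrite hornerZ hornerXn.
move=> /(congr1 (Lam lambda)); rewrite !Lam_sum => E.
transitivity (\sum_(k < n.+1) 'C(n, k)%:R * (z ^+ k * conjc z ^+ (n - k)) * SS lambda n w * (MM lambda k (n - k))%:C).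
  rewrite !phiE mulrACA -RCM -expr2.
  have pn0 := pn_gt0 l0 n; have -> : eps lambda n ^+ 2 = (pn lambda n)^-1.
    by apply: (@mulIf _ (pn lambda n)); rewrite ?gt_eqF// (eps_sqr l0) mulVf// gt_eqF.
  rewrite mulrCA mulrA [SS lambda n z in LHS]/SS /hterm (reindex_inj rev_ord_inj)/= mulr_suml.
  rewrite mulr_suml; apply: eq_bigr => k _.
  rewrite subSS /kap subKn ?leq_ord//.
  have -> : ('C(n, k)%:R : C) * (z ^+ k * conjc z ^+ (n - k)) * SS lambda n w * (MM lambda k (n - k))%:C =
    ('C(n, k)%:R * MM lambda k (n - k))%:C * (z ^+ k * conjc z ^+ (n - k)) * SS lambda n w.
    by rewrite RCM RCnat; ring.
  rewrite (binMM l0 (leq_ord k)) !RCM; ring.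
transitivity (\sum_(k < n.+1) Lam lambda (('C(n, k)%:R * (z ^+ k * conjc z ^+ (n - k)) * SS lambda n w) *: ((1 - 'X) ^+ k * 'X^(n - k)))).
  by apply: eq_bigr => k _; rewrite LamZ LamX.
rewrite E; apply: eq_bigr => i _; rewrite Lam_sum; apply: eq_bigr => j _.
by rewrite LamZ -[in Lam _ _](mul1r 'X^(i+j)) -(expr0 (1 - 'X)) LamX.
Qed.

(** Splits off the geometric series of z w. What remains is a mean of [Cf] because two weights
    agree: the weight of [T] against the moment (0, m) and that of [Cf] against the moment (i, m -
    i) both equal pf lambda m pf (lambda + 1) i pf lambda (m - i) / pn m. *)
Lemma kernel_factor n : phi lambda n z * phi lambda n w =
  \sum_(k < n.+1) (z * w) ^+ (n - k) *
    \sum_(m < k.+1) \sum_(i < m.+1) Cf k m i * (MM lambda i (m - i))%:C.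
Proof.
rewrite kernel_product.
rewrite (@triangle_restrict _ (fun i j => T n i j * (MM lambda 0 (i + j))%:C)); last first.
  move=> i j nij; rewrite /T coefM big1 ?mulr0 ?mul0r// => k _.
  by rewrite Wp_small ?mul0r// (leq_ltn_trans (leq_ord k)).
transitivity (\sum_(m < n.+1) \sum_(k < n.+1) (z * w) ^+ (n - k) * \sum_(i < m.+1) Cf k m i * (MM lambda i (m - i))%:C).
  apply: eq_bigr => m _; under [RHS]eq_bigr do rewrite mulr_sumr.
  rewrite exchange_big/=; apply: eq_bigr => i _.
  rewrite subnKC ?leq_ord// /T coefM mulr_sumr mulr_suml; apply: eq_bigr => k _.
  rewrite coef_pwX ?leq_subr// (Wp_stable _ _ (leq_ord k)) /Cf.
  have -> : pfc (1 : R) (n - k) = 1.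
    by rewrite /pfc pf_1.
  have -> : (MM lambda 0 m)%:C = (pf lambda m / pn lambda m)%:C.
    by have := binMM l0 (leq0n m); rewrite bin0 mul1r subn0 pf0 mul1r => ->.
  have e := binMM l0 (leq_ord i).
  transitivity (a1 ^+ (n - k) * (Wp k i (m - i))`_k * (pf lambda m * (pf (lambda + 1) i * pf lambda (m - i) / pn lambda m))%:C).
    rewrite mul1r /pfc; move: (a1 ^+ _) (_`_k) (pf lambda (m - i)) (pf lambda m) (pf _ i) (pn lambda m)^-1 => x1 x2 x3 x4 x5 x6.
    by rewrite !RCM; ring.
  rewrite -e /pfc -/a1; move: (MM _ _ _) (pf lambda m) (_`_k) (a1 ^+ _) => x1 x2 x3 x4.
  by rewrite !RCM RCnat; ring.
rewrite exchange_big/=; apply: eq_bigr => k _; rewrite -mulr_sumr; congr (_ * _).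
rewrite -(big_mkord xpredT (fun m => \sum_(i < m.+1) Cf k m i * (MM lambda i (m - i))%:C)).
rewrite (@big_cat_nat _ _ _ k.+1 0 n.+1)//= [X in _ + X]big_nat [X in _ + X]big1 ?addr0 ?big_mkord//.
move=> m /andP[km _]; rewrite big1// => i _.
by rewrite /Cf Wp_small ?mulr0 ?mul0r// subnKC// -ltnS.
Qed.

End Kernel.
End KernelAlgebra.

(** * Means under the Beta law *)

Section BetaFunctional.
Variable R : realType.
Notation mu := (@lebesgue_measure R).
Notation D := (`]0%R, 1%R[%classic : set R).

Lemma powR_le1 (a x : R) : 0 <= a -> 0 <= x -> x <= 1 -> x `^ a <= 1.
Proof.
move=> a0 x0 x1; apply: (@le_trans _ _ (1 `^ a)); first exact: powR_le.
by rewrite powR1.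
Qed.

Lemma is_derive_powR1B (a x : R) : x < 1 ->
  is_derive x 1 (fun u : R => (1 - u) `^ a) (- (a * (1 - x) `^ (a - 1))).
Proof.
move=> x1; have d1 : is_derive x 1 (fun u : R => 1 - u) (-1).
  suff <- : 0 - 1 = -1 :> R by exact: is_deriveB.
  by rewrite sub0r.
have x10 : 0 < 1 - x by rewrite subr_gt0.
have d2 := is_derive1_powR a x10.
have := is_derive1_comp (f := fun t : R => t `^ a) (g := fun u : R => 1 - u) d2 d1.
by rewrite mulrN1.
Qed.

Lemma powR1B_cont (a x : R) : x < 1 -> {for x, continuous (fun t : R => (1 - t) `^ a)}.
Proof.
move=> x1; apply/differentiable_continuous/derivable1_diffP.
by have [] := is_derive_powR1B a x1.
Qed.

Lemma measurable_powR1B A (a : R) : measurable_fun A (fun t : R => (1 - t) `^ a).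
Proof.
apply: measurable_funTS.
apply: (@measurableT_comp _ _ _ _ _ _ (fun t : R => t `^ a)); first exact: measurable_powR.
by apply: measurable_funB.
Qed.

Lemma int_powR1B (a : R) : 0 < a ->
  (\int[mu]_(u in D) ((1 - u) `^ (a - 1))%:E <= (a^-1)%:E)%E.
Proof.
move=> a0; apply: integral_exhaust_le => //.
- apply/measurable_EFinP; exact: measurable_powR1B.
- by move=> x _; rewrite lee_fin powR_ge0.
move=> c d c0 cd d1.
have -> : (\int[mu]_(x in `[c, d]) ((1 - x) `^ (a - 1))%:E =
    (- a^-1 * (1 - d) `^ a - - a^-1 * (1 - c) `^ a)%:E)%E.
  apply: (@ftc_cont R (fun u => (1 - u) `^ (a - 1)) (fun u => - a^-1 * (1 - u) `^ a)) => //.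
  - by move=> x /andP[_ xd]; apply: powR1B_cont; exact: le_lt_trans d1.
  - move=> x /andP[_ xd].
    suff <- : - a^-1 * - (a * (1 - x) `^ (a - 1)) = (1 - x) `^ (a - 1).
      by apply: is_deriveZ; apply: is_derive_powR1B; exact: le_lt_trans d1.
    by rewrite mulrNN mulrA mulVf ?mul1r// gt_eqF.
rewrite lee_fin !mulNr opprK -[X in _ <= X]mulr1 addrC -mulrBr ler_pM2l ?invr_gt0//.
apply: le_trans (_ : (1 - c) `^ a <= _); first by rewrite gerBl powR_ge0.
by apply: powR_le1; [exact: ltW|lra|lra].
Qed.

Variable lambda : R.
Hypothesis l0 : 0 < lambda.

(** Left unnormalised: the density of the law is [om 0 0 / bm 0 0], and u^i (1-u)^j is absorbed in
    the exponents. *)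
Definition om i j (u : R) : R := u `^ (lambda + i%:R) * (1 - u) `^ (lambda + j%:R - 1).

Lemma om_ge0 i j u : 0 <= om i j u.
Proof. by rewrite mulr_ge0 ?powR_ge0. Qed.

Lemma measurable_om A i j : measurable_fun A (om i j).
Proof.
apply: measurable_funM; last exact: measurable_powR1B.
by apply: measurable_funTS; exact: measurable_powR.
Qed.

Lemma om_shift i j u : 0 < u < 1 -> om i j u = u ^+ i * (1 - u) ^+ j * om 0 0 u.
Proof.
move=> /andP[u0 u1]; rewrite /om.
have v0 : 0 < 1 - u by rewrite subr_gt0.
have -> : lambda + j%:R - 1 = lambda + 0%:R - 1 + j%:R by lra.
rewrite (powR_add lambda i%:R u0) (powR_add _ j%:R v0) !powR_mulrn ?ltW// addr0.
by move: (u `^ _) ((1 - u) `^ _) (u ^+ _) (_ ^+ j) => a b c d; ring.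
Qed.

Lemma om_le i j u : 0 < u < 1 -> om i j u <= (1 - u) `^ (lambda - 1).
Proof.
move=> /andP[u0 u1]; have v0 : 0 < 1 - u by rewrite subr_gt0.
rewrite om_shift ?u0// /om !addr0 -[leRHS]mul1r mulrA ler_wpM2r ?powR_ge0//.
have h1 : u ^+ i * (1 - u) ^+ j <= 1.
  by rewrite mulr_ile1 ?exprn_ge0 ?exprn_ile1 ?ltW//; lra.
have h2 : u `^ lambda <= 1 by apply: powR_le1; exact: ltW.
by rewrite mulr_ile1 ?powR_ge0// mulr_ge0 ?exprn_ge0 ?ltW.
Qed.

Lemma int_om_le i j : (\int[mu]_(u in D) (om i j u)%:E <= (lambda^-1)%:E)%E.
Proof.
apply: le_trans (int_powR1B l0); apply: ge0_le_integral.
- exact: measurable_itv.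
- by move=> x _; rewrite lee_fin om_ge0.
- by apply/measurable_EFinP; exact: measurable_om.
- by apply/measurable_EFinP; exact: measurable_powR1B.
- by move=> x; rewrite /= in_itv/= => h; rewrite lee_fin om_le.
Qed.

Lemma om_integrable i j : mu.-integrable D (EFin \o om i j).
Proof.
apply/integrableP; split; first by apply/measurable_EFinP; exact: measurable_om.
apply: le_lt_trans (_ : (lambda^-1)%:E < +oo)%E; last exact: ltry.
apply: le_trans (int_om_le i j).
by under eq_integral => x _ do rewrite /= ger0_norm ?om_ge0//.
Qed.

Definition bm i j : R := fine (\int[mu]_(u in D) (om i j u)%:E)%E.

Lemma bmE i j : (\int[mu]_(u in D) (om i j u)%:E)%E = (bm i j)%:E.
Proof.
rewrite fineK// ge0_fin_numE; first exact: le_lt_trans (int_om_le i j) (ltry _).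
by apply: integral_ge0 => x _; rewrite lee_fin om_ge0.
Qed.

(* [bmean f x]: f is integrable against u^lambda (1-u)^(lambda-1) on (0,1), with integral x. *)
Definition bmean (f : R -> R) (x : R) :=
  mu.-integrable D (EFin \o (fun u => f u * om 0 0 u)) /\
  (\int[mu]_(u in D) (f u * om 0 0 u)%:E)%E = x%:E.

Lemma eq_bmean f g x : (forall u, 0 < u < 1 -> f u = g u) -> bmean f x -> bmean g x.
Proof.
move=> fg [h1 h2]; split.
  apply: (eq_integrable _ _ _ _ h1) => // u /[!inE]/= /[!in_itv]/= h.
  by rewrite fg.
rewrite -h2; apply: eq_integral => u /[!inE]/= /[!in_itv]/= h.
by rewrite fg.
Qed.

Lemma bmeanD f g x y : bmean f x -> bmean g y -> bmean (fun u => f u + g u) (x + y).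
Proof.
move=> [f1 f2] [g1 g2]; have e : (EFin \o (fun u => (f u + g u) * om 0 0 u)) =
   (EFin \o (fun u => f u * om 0 0 u)) \+ (EFin \o (fun u => g u * om 0 0 u)).
  by apply/funext => u /=; rewrite mulrDl.
split; first by rewrite e; exact: integrableD.
under eq_integral => u _ do rewrite mulrDl EFinD.
by rewrite integralD//= f2 g2.
Qed.

Lemma bmeanZ c f x : bmean f x -> bmean (fun u => c * f u) (c * x).
Proof.
move=> [f1 f2]; have e : (EFin \o (fun u => (c * f u) * om 0 0 u)) =
   (fun u => c%:E * (EFin \o (fun u => f u * om 0 0 u)%R) u)%E.
  by apply/funext => u /=; rewrite -mulrA EFinM.
split; first by rewrite e; exact: integrableZl.
under eq_integral => u _ do rewrite -mulrA EFinM.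
by rewrite integralZl//= f2.
Qed.

Lemma bmean_moment i j : bmean (fun u => u ^+ i * (1 - u) ^+ j) (bm i j).
Proof.
split.
  apply: (eq_integrable _ _ _ _ (om_integrable i j)) => // u /[!inE]/= /[!in_itv]/= h.
  by rewrite om_shift.
rewrite -bmE; apply: eq_integral => u /[!inE]/= /[!in_itv]/= h.
by rewrite -om_shift.
Qed.

Lemma bmean_sum n (f : nat -> R -> R) (x : nat -> R) : (forall i, bmean (f i) (x i)) ->
  bmean (fun u => \sum_(i < n) f i u) (\sum_(i < n) x i).
Proof.
move=> h; elim: n => [|n IH].
  rewrite big_ord0; have := bmeanZ 0 (h 0%N); rewrite mul0r.
  by apply: eq_bmean => u _; rewrite big_ord0 mul0r.
rewrite big_ord_recr/=; have := bmeanD IH (h n).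
by apply: eq_bmean => u _; rewrite big_ord_recr.
Qed.

Lemma bmean_unique f x y : bmean f x -> bmean f y -> x = y.
Proof. by move=> [_ h1] [_ h2]; move: h1; rewrite h2 => -[]. Qed.

Lemma bm_split i j : bm i j = bm i.+1 j + bm i j.+1.
Proof.
apply: (@bmean_unique (fun u => u ^+ i * (1 - u) ^+ j)); first exact: bmean_moment.
have := bmeanD (bmean_moment i.+1 j) (bmean_moment i j.+1).
by apply: eq_bmean => u _; rewrite !exprS; ring.
Qed.

Let F i j (u : R) := u `^ (lambda + 1 + i%:R) * (1 - u) `^ (lambda + j%:R).

Lemma derive_betaF i j (u : R) : 0 < u -> u < 1 ->
  is_derive u 1 (F i j) ((lambda + 1 + i%:R) * om i j.+1 u - (lambda + j%:R) * om i.+1 j u).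
Proof.
move=> u0 u1.
have d1 := is_derive1_powR (lambda + 1 + i%:R) u0.
have d2 := is_derive_powR1B (lambda + j%:R) u1.
have := @is_deriveM R R^o _ _ u 1 _ _ d1 d2.
rewrite /om; congr is_derive; rewrite /GRing.scale/=.
have -> : lambda + 1 + i%:R - 1 = lambda + i%:R by ring.
have -> : lambda + j.+1%:R - 1 = lambda + j%:R by rewrite -natr1; ring.
have -> : lambda + i.+1%:R = lambda + 1 + i%:R by rewrite -natr1; ring.
by move: (u `^ _) (u `^ _) ((1 - u) `^ _) ((1 - u) `^ _) => a b c d; ring.
Qed.

(** The difference of the two sides integrates the derivative of u^(lambda+1+i) (1-u)^(lambda+j),
    which vanishes at both ends. As the integrand may be singular at 1, this is done on compact
    intervals and passed to the limit. *)
Lemma bm_parts i j : (lambda + 1 + i%:R) * bm i j.+1 = (lambda + j%:R) * bm i.+1 j.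
Proof.
set A := lambda + 1 + i%:R; set B := lambda + j%:R.
have A0 : 0 < A by rewrite /A ltr_wpDr ?ler0n// addr_gt0.
have B0 : 0 < B by rewrite /B ltr_wpDr ?ler0n.
pose g1 (u : R) := (A * om i j.+1 u)%:E; pose g2 (u : R) := (B * om i.+1 j u)%:E.
have i1 : mu.-integrable D g1.
  have -> : g1 = (fun u => A%:E * (EFin \o om i j.+1) u)%E by apply/funext => u; rewrite /= -EFinM.
  by apply: integrableZl => //; exact: om_integrable.
have i2 : mu.-integrable D g2.
  have -> : g2 = (fun u => B%:E * (EFin \o om i.+1 j) u)%E by apply/funext => u; rewrite /= -EFinM.
  by apply: integrableZl => //; exact: om_integrable.
have e1 : (\int[mu]_(u in D) g1 u = (A * bm i j.+1)%:E)%E.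
  rewrite /g1; under eq_integral => u _ do rewrite EFinM.
  by rewrite integralZl//= ?bmE//; exact: om_integrable.
have e2 : (\int[mu]_(u in D) g2 u = (B * bm i.+1 j)%:E)%E.
  rewrite /g2; under eq_integral => u _ do rewrite EFinM.
  by rewrite integralZl//= ?bmE//; exact: om_integrable.
have c1 : (\int[mu]_(u in exhaust 0 1 n) g1 u)%E @[n --> \oo] --> (A * bm i j.+1)%:E.
  rewrite -e1; apply: exhaust_cvg => //; first by case/integrableP: i1.
  by move=> x _; rewrite lee_fin mulr_ge0 ?om_ge0// ltW.
have c2 : (\int[mu]_(u in exhaust 0 1 n) g2 u)%E @[n --> \oo] --> (B * bm i.+1 j)%:E.
  rewrite -e2; apply: exhaust_cvg => //; first by case/integrableP: i2.
  by move=> x _; rewrite lee_fin mulr_ge0 ?om_ge0// ltW.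
pose r n : R := (F i j (1 - n.+2%:R^-1) - F i j (n.+2%:R^-1)).
have d01 n : 0 < n.+2%:R^-1 :> R /\ n.+2%:R^-1 <= 2^-1 :> R.
  by split; [rewrite invr_gt0|rewrite lef_pV2 ?posrE// ler_nat].
have eE n : (exhaust 0 1 n : set R) = `[n.+2%:R^-1, 1 - n.+2%:R^-1]%classic.
  by rewrite /exhaust subr0 add0r mul1r.
have sub n : exhaust 0 1 n `<=` D.
  move=> x; rewrite eE /= !in_itv/= => /andP[h1 h2]; have [k1 k2] := d01 n.
  by rewrite (lt_le_trans k1 h1)/= (le_lt_trans h2)// gtrDl oppr_lt0.
have E n : (\int[mu]_(u in exhaust 0 1 n) g1 u = \int[mu]_(u in exhaust 0 1 n) g2 u + (r n)%:E)%E.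
  have me : measurable (exhaust (0:R) 1 n) by rewrite eE; exact: measurable_itv.
  have j1 : mu.-integrable (exhaust 0 1 n) g1 by apply: integrableS i1.
  have j2 : mu.-integrable (exhaust 0 1 n) g2 by apply: integrableS i2.
  have <- : (\int[mu]_(u in exhaust 0 1 n) (g1 u - g2 u) = (r n)%:E)%E.
    rewrite eE; have [k1 k2] := d01 n.
    transitivity (\int[mu]_(u in `[(n.+2%:R^-1)%R, (1 - n.+2%:R^-1)%R]) (A * om i j.+1 u - B * om i.+1 j u)%:E)%E.
      by apply: eq_integral => u _; rewrite EFinB.
    apply: (@ftc_cont R (fun u => A * om i j.+1 u - B * om i.+1 j u) (F i j)).
    - by move: (n.+2%:R^-1) k1 k2 => k; lra.
    - move=> x /andP[x1 x2]; have x0 : 0 < x by exact: lt_le_trans x1.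
      have x3 : x < 1 by apply: le_lt_trans x2 _; rewrite gtrDl oppr_lt0.
      have co p q : {for x, continuous (om p q)}.
        by apply: continuousM; [exact: powR_cont|exact: powR1B_cont].
      by apply: continuousB; apply: continuousM; [exact: cst_continuous|exact: co|exact: cst_continuous|exact: co].
    - move=> x /andP[x1 x2]; have x0 : 0 < x by exact: lt_le_trans x1.
      have x3 : x < 1 by apply: le_lt_trans x2 _; rewrite gtrDl oppr_lt0.
      exact: derive_betaF.
  rewrite integralB// addeC subeK//.
  exact: integrable_fin_num.
(* At distance k = 1 / (n + 2) from the ends the boundary values are at most k^A at 0 and k^B at 1,
   with A and B positive. *)
have rc : (r n)%:E @[n --> \oo] --> 0%:E.
  have dc C : 0 < C -> (n.+2%:R^-1 : R) `^ C @[n --> \oo] --> (0 : R).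
    move=> C0 t nt; have [e e0 he] := powR_cvg0 C0 nt.
    have := near_infty_natSinv_lt (PosNum e0); apply: filterS => n /= hn.
    have [k1 k2] := d01 n; apply: he => //=; rewrite sub0r normrN gtr0_norm//.
    by apply: le_lt_trans hn; rewrite lef_pV2 ?posrE// ler_nat.
  apply: cvg_EFin; first by apply: nearW.
  apply/norm_cvg0P; apply: (@squeeze_cvgr _ _ _ _ (fun=> 0) (fun n => (n.+2%:R^-1 : R) `^ B + (n.+2%:R^-1 : R) `^ A)).
  - apply: nearW => n; rewrite normr_ge0/=; have [k1 k2] := d01 n.
    have k3 : 0 < 1 - n.+2%:R^-1 :> R by move: (n.+2%:R^-1) k1 k2 => k; lra.
    have k4 : 1 - n.+2%:R^-1 <= 1 :> R by move: (n.+2%:R^-1) k1 k2 => k; lra.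
    have P C (y : R) : 0 < C -> 0 < y -> y <= 1 -> y `^ C <= 1.
      by move=> /ltW C0 /ltW y0; exact: powR_le1.
    apply: le_trans (ler_normB _ _) _; rewrite !ger0_norm ?mulr_ge0 ?powR_ge0//.
    apply: lerD.
      rewrite /F subKr -/B -[leRHS]mul1r ler_wpM2r ?powR_ge0// P//.
    rewrite /F -/A -[leRHS]mulr1 ler_wpM2l ?powR_ge0// P//.
  - exact: cvg_cst.
  - by rewrite -[X in _ --> X]addr0; apply: cvgD; exact: dc.
have c3 : (\int[mu]_(u in exhaust 0 1 n) g2 u + (r n)%:E)%E @[n --> \oo] --> ((B * bm i.+1 j)%:E + 0%:E)%E.
  by apply: cvgeD => //.
have := c1; rewrite (_ : (fun n => _) = (fun n => (\int[mu]_(u in exhaust 0 1 n) g2 u + (r n)%:E)%E)); last first.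
  by apply/funext.
move=> c4; have : (A * bm i j.+1)%:E = ((B * bm i.+1 j)%:E + 0%:E)%E.
  by rewrite -(cvg_lim _ c3)// -(cvg_lim _ c4).
by rewrite adde0 => -[].
Qed.

Lemma bmE_MM i j : bm i j = MM lambda i j * bm 0 0.
Proof.
have nz k : 2 * lambda + 1 + k%:R != 0 :> R.
  by rewrite gt_eqF// ltr_wpDr ?ler0n// addr_gt0// mulr_gt0.
have S p q : (2 * lambda + 1 + (p + q)%:R) * bm p.+1 q = (lambda + 1 + p%:R) * bm p q.
  by rewrite (bm_split p q) mulrDr bm_parts natrD; ring.
have T p q : (2 * lambda + 1 + (p + q)%:R) * bm p q.+1 = (lambda + q%:R) * bm p q.
  by rewrite [in RHS](bm_split p q) mulrDr -bm_parts natrD; ring.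
elim: i => [|i IH].
  elim: j => [|j IH]; first by rewrite MM00 mul1r.
  apply: (mulfI (nz (0 + j)%N)); rewrite T IH MMSr; have := nz (0 + j)%N.
  by move: (2 * lambda + 1 + _) (MM _ _ _) (bm 0 0) => x y z x0; field.
apply: (mulfI (nz (i + j)%N)); rewrite S IH MMSl; have := nz (i + j)%N.
by move: (2 * lambda + 1 + _) (MM _ _ _) (bm 0 0) => x y z x0; field.
Qed.

Lemma bm00_gt0 : 0 < bm 0 0.
Proof.
rewrite lt0r; apply/andP; split; last first.
  by rewrite -lee_fin -bmE; apply: integral_ge0 => x _; rewrite lee_fin om_ge0.
apply/eqP => b0.
have h : (\int[mu]_(u in D) (om 0 0 u)%:E)%E = 0%E by rewrite bmE b0.
have l1 : (\int[mu]_(u in `[(4^-1)%R, (2^-1)%R]) (om 0 0 u)%:E <= 0)%E.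
  rewrite -h; apply: ge0_subset_integral => //.
  - by apply/measurable_EFinP; exact: measurable_om.
  - by move=> x _; rewrite lee_fin om_ge0.
  - by move=> x; rewrite /= !in_itv/= => /andP[h1 h2]; apply/andP; split; lra.
pose k : R := 4^-1 `^ lambda * Num.min (2^-1 `^ (lambda - 1)) 1.
have k0 : 0 < k by rewrite mulr_gt0 ?powR_gt0// lt_min powR_gt0//= ltr01.
have : (\int[mu]_(u in `[(4^-1)%R, (2^-1)%R]) k%:E <= 0)%E.
  apply: le_trans l1; apply: ge0_le_integral => //.
  - by move=> x _; rewrite lee_fin ltW.
  - by apply/measurable_EFinP; exact: measurable_om.
  - move=> x; rewrite /= in_itv/= => /andP[h1 h2]; rewrite lee_fin /om !addr0.
    apply: ler_pM; rewrite ?powR_ge0//.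
    + by apply: powR_le => //; exact: ltW.
    + have v1 : 2^-1 <= 1 - x by lra.
      have v2 : 1 - x <= 1 by lra.
      case: (lerP 0 (lambda - 1)) => s; rewrite ge_min; apply/orP.
        by left; apply: powR_le.
      right; rewrite -(opprK (lambda - 1)); apply: (@le_trans _ _ (1 `^ (- - (lambda - 1)))).
        by rewrite powR1.
      by apply: powR_anti => //; [rewrite oppr_ge0 ltW|lra].
rewrite integral_cst//= lebesgue_measure_itv/= lte_fin.
have -> : (4^-1 < 2^-1 :> R) by rewrite ltf_pV2 ?posrE// ltr_nat.
by rewrite -EFinB -EFinM lee_fin leNgt mulr_gt0// subr_gt0 ltf_pV2 ?posrE// ltr_nat.
Qed.

(** If a <= b, the factor u^lambda absorbs (u b)^(-lambda). If a > b, the exponent is shared as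
    (lambda - e) + e between the lower bounds (1-u) a and b of the mean: this leaves (1-u)^(e-1),
    integrable since e > 0, and (a/b)^e, at most the square root since e <= 1/2. *)
Lemma beta_kernel_pointwise (a b u : R) : 0 < a -> 0 < b -> 0 < u < 1 ->
  ((1 - u) * a + u * b) `^ (- lambda) * om 0 0 u <=
  Num.max a b `^ (- lambda) * Num.sqrt (a / Num.min a b) * (1 - u) `^ (Num.min lambda 2^-1 - 1).
Proof.
move=> a0 b0 /andP[u0 u1]; set v := 1 - u; set e := Num.min lambda 2^-1.
have v0 : 0 < v by rewrite subr_gt0.
have v1 : v <= 1 by rewrite /v lerBlDr lerDl ltW.
have e0 : 0 < e by rewrite lt_min l0/= invr_gt0.
have el : e <= lambda by rewrite ge_min lexx.
have e2 : e <= 2^-1 by rewrite ge_min lexx orbT.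
have Q0 : 0 < v * a + u * b by rewrite addr_gt0// mulr_gt0.
rewrite /om !addr0 -/v.
have ul : u `^ lambda <= 1.
  by apply: powR_le1; exact: ltW.
have vle : v `^ (lambda - 1) <= v `^ (e - 1).
  have -> : lambda - 1 = (lambda - e) + (e - 1) by ring.
  rewrite powR_add// -[leRHS]mul1r ler_wpM2r ?powR_ge0//.
  by apply: powR_le1 => //; [rewrite subr_ge0|exact: ltW].
have [ab|ba] := lerP a b.
  rewrite divff ?gt_eqF// sqrtr1 mulr1.
  have h : (v * a + u * b) `^ (- lambda) * u `^ lambda <= b `^ (- lambda).
    apply: (@le_trans _ _ ((u * b) `^ (- lambda) * u `^ lambda)).
      rewrite ler_wpM2r ?powR_ge0//; apply: powR_anti; [exact: ltW|exact: mulr_gt0|].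
      by rewrite lerDr mulr_ge0 ?ltW.
    by rewrite powRM ?(ltW u0) ?(ltW b0)// mulrAC -powR_add// addNr powRr0 mul1r.
  by rewrite mulrA; apply: ler_pM; rewrite ?mulr_ge0 ?powR_ge0.
have h : (v * a + u * b) `^ (- lambda) <= (v * a) `^ (- (lambda - e)) * b `^ (- e).
  have -> : - lambda = - (lambda - e) + - e by ring.
  rewrite powR_add//; apply: ler_pM; rewrite ?powR_ge0//.
    by apply: powR_anti; [rewrite subr_ge0|exact: mulr_gt0|rewrite lerDl mulr_ge0 ?ltW].
  apply: powR_anti => //; [exact: ltW|].
  have -> : v * a + u * b = b + v * (a - b) by rewrite /v; ring.
  by rewrite lerDl mulr_ge0 ?subr_ge0 ?ltW.
apply: (@le_trans _ _ ((v * a) `^ (- (lambda - e)) * b `^ (- e) * (1 * v `^ (lambda - 1)))).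
  by apply: ler_pM; rewrite ?powR_ge0 ?mulr_ge0 ?powR_ge0// ler_wpM2r ?powR_ge0.
have -> : (v * a) `^ (- (lambda - e)) * b `^ (- e) * (1 * v `^ (lambda - 1)) =
   a `^ (- lambda) * (a / b) `^ e * v `^ (e - 1).
  rewrite mul1r !powRM ?ltW ?invr_gt0//.
  have -> : lambda - 1 = (lambda - e) + (e - 1) by ring.
  have -> : - (lambda - e) = - lambda + e by ring.
  rewrite !powR_add// -powR_inv1 ?ltW// -powRrM mulN1r.
  have : v `^ (- lambda) * v `^ e * (v `^ lambda * v `^ (- e)) = 1.
    by rewrite -!powR_add// (_ : _ + _ = 0) ?powRr0//; ring.
  move: (v `^ (- lambda)) (v `^ e) (v `^ lambda) (v `^ (- e)) (v `^ (-1)) (a `^ _) (a `^ _) (b `^ _)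
    => x1 x2 x3 x4 x5 x6 x7 x8 E.
  rewrite -[RHS]mul1r -E; ring.
rewrite ler_wpM2r ?powR_ge0// ler_wpM2l ?powR_ge0//.
rewrite -powR12_sqrt; last by rewrite divr_ge0 ?ltW.
by apply: ler_powR => //; rewrite ler_pdivlMr// mul1r ltW.
Qed.

(** Integrates a pointwise bound in u. The error e passes unchanged because the law has mass 1. The
    root of a / min(a, b) is an asymmetric loss that the factor 1 / (1 - z w) of the kernel will
    compensate. *)
Lemma beta_bound_pos : exists2 C, 0 <= C & forall (a b : R) N (c : nat -> nat -> R) K e,
  0 < a -> 0 < b -> 0 <= K -> 0 <= e ->
  (forall u, 0 <= u <= 1 ->
    `|\sum_(m < N) \sum_(i < m.+1) c m i * (u ^+ i * (1 - u) ^+ (m - i))| <=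
    K * ((1 - u) * a + u * b) `^ (- lambda) + e) ->
  `|\sum_(m < N) \sum_(i < m.+1) c m i * MM lambda i (m - i)| <=
  K * (C * (Num.max a b `^ (- lambda) * Num.sqrt (a / Num.min a b))) + e.
Proof.
set s := Num.min lambda 2^-1.
have s0 : 0 < s by rewrite lt_min l0/= invr_gt0.
have B0 := bm00_gt0.
exists (s^-1 / bm 0 0); first by rewrite mulr_ge0 ?invr_ge0 ?ltW.
move=> a b N c K e a0 b0 K0 e0 h.
set f := fun u : R => \sum_(m < N) \sum_(i < m.+1) c m i * (u ^+ i * (1 - u) ^+ (m - i)).
set X := \sum_(m < N) _.
set G := (_ * Num.sqrt _).
have G0 : 0 <= G by rewrite mulr_ge0 ?powR_ge0 ?sqrtr_ge0.
have [f1 f2] : bmean f (X * bm 0 0).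
  rewrite /X mulr_suml /f.
  apply: (@bmean_sum N (fun m u => \sum_(i < m.+1) c m i * (u ^+ i * (1 - u) ^+ (m - i)))
    (fun m => (\sum_(i < m.+1) c m i * MM lambda i (m - i)) * bm 0 0)) => m.
  rewrite mulr_suml.
  apply: (@bmean_sum m.+1 (fun i u => c m i * (u ^+ i * (1 - u) ^+ (m - i)))
    (fun i => c m i * MM lambda i (m - i) * bm 0 0)) => i.
  by rewrite -mulrA -bmE_MM; apply: bmeanZ; exact: bmean_moment.
have mp : measurable_fun D (fun u : R => ((1 - u) `^ (s - 1))%:E).
  by apply/measurable_EFinP; exact: measurable_powR1B.
have mo : measurable_fun D (fun u : R => (om 0 0 u)%:E).
  by apply/measurable_EFinP; exact: measurable_om.
have l1 : (`|(X * bm 0 0)%:E| <= (K * G)%:E * (s^-1)%:E + e%:E * (bm 0 0)%:E)%E.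
  rewrite -f2; apply: le_trans (le_abse_integral _ _ _) _ => //; first by case/integrableP: f1.
  apply: (@le_trans _ _ (\int[mu]_(u in D) ((K * G)%:E * ((1 - u) `^ (s - 1))%:E + e%:E * (om 0 0 u)%:E))%E).
    apply: ge0_le_integral => //.
    - by apply: measurableT_comp => //; case/integrableP: f1.
    - by apply: emeasurable_funD; apply: emeasurable_funM => //; exact: measurable_cst.
    move=> u; rewrite /= in_itv/= => u01; rewrite lee_fin normrM (ger0_norm (om_ge0 _ _ _)).
    have u01' : 0 <= u <= 1 by case/andP: u01 => p q; rewrite !ltW.
    apply: le_trans (ler_wpM2r (om_ge0 0 0 u) (h u u01')) _.
    rewrite mulrDl lerD2r -!mulrA ler_wpM2l// mulrA; exact: beta_kernel_pointwise.
  rewrite ge0_integralD//; last first.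
  - by apply: emeasurable_funM => //; exact: measurable_cst.
  - by move=> u _; rewrite -EFinM lee_fin mulr_ge0 ?om_ge0.
  - by apply: emeasurable_funM => //; exact: measurable_cst.
  - by move=> u _; rewrite -EFinM lee_fin !mulr_ge0 ?powR_ge0.
  rewrite !ge0_integralZl//; try by [move=> u _; rewrite lee_fin ?om_ge0 ?powR_ge0|rewrite lee_fin mulr_ge0].
  rewrite bmE; apply: leeD2r; apply: lee_wpmul2l; first by rewrite lee_fin mulr_ge0.
  exact: int_powR1B.
move: l1; rewrite -!EFinM -EFinD lee_fin normrM (gtr0_norm B0) -ler_pdivlMr// => l1.
apply: le_trans l1 _; rewrite mulrDl mulfK ?gt_eqF// lerD2r.
by move: (bm 0 0)^-1 s^-1 => x y; rewrite le_eqVlt; apply/orP; left; apply/eqP; ring.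
Qed.

End BetaFunctional.

Lemma beta_bound (R : realType) (lambda : R) : 0 <= lambda ->
  exists2 C, 0 <= C & forall (a b : R) N (c : nat -> nat -> R) K e,
  0 < a -> 0 < b -> 0 <= K -> 0 <= e ->
  (forall u, 0 <= u <= 1 ->
    `|\sum_(m < N) \sum_(i < m.+1) c m i * (u ^+ i * (1 - u) ^+ (m - i))| <=
    K * ((1 - u) * a + u * b) `^ (- lambda) + e) ->
  `|\sum_(m < N) \sum_(i < m.+1) c m i * MM lambda i (m - i)| <=
  K * (C * (Num.max a b `^ (- lambda) * Num.sqrt (a / Num.min a b))) + e.
Proof.
rewrite le_eqVlt => /predU1P[<-|]; last exact: beta_bound_pos.
(* For lambda = 0 the law is the point mass at u = 1, so the hypothesis is used at that point. *)
exists 1 => // a b N c K e a0 b0 K0 e0 /(_ 1); rewrite ler01 lexx => /(_ isT).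
rewrite oppr0 !powRr0 mulr1 !mul1r => h.
have -> : \sum_(m < N) \sum_(i < m.+1) c m i * MM 0 i (m - i) =
   \sum_(m < N) \sum_(i < m.+1) c m i * (1 ^+ i * (1 - 1) ^+ (m - i)).
  apply: eq_bigr => m _; apply: eq_bigr => i _; congr (_ * _).
  rewrite expr1n mul1r subrr /MM mulr0 add0r.
  have nz k : pochhammer (1 : R) k != 0 by rewrite gt_eqF// pochhammer_gt0.
  case: (m - i)%N => [|k]; first by rewrite addn0 [pochhammer 0 0]/pochhammer big_ord0 mulr1 divff ?expr0.
  by rewrite [pochhammer 0 _]/pochhammer big_ord_recl/= add0r mul0r mulr0 mul0r exprS mul0r.
apply: le_trans h _; rewrite lerD2r ler_peMr//.
rewrite -[X in X <= _]sqrtr1; apply: ler_wsqrtr.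
by rewrite ler_pdivlMr ?lt_min ?a0// mul1r ge_min lexx.
Qed.

(** * Cauchy products and binomial series *)

Section CauchyProducts.
Variable R : realType.
Notation C := R[i].
Implicit Types (u v : nat -> C).

Lemma geom_of_subexp u (a : nat -> R) r : subexp a -> 0 <= r -> r < 1 ->
  (forall n, normc (u n) <= a n * r ^+ n) -> geom u.
Proof.
move=> ha r0 r1 h; have [K [q [K0 q0 q1 hq]]] := subexp_geom ha r0 r1.
exists K, q; split=> // n; apply: le_trans (h n) (le_trans _ (hq n)).
by rewrite ler_wpM2r ?exprn_ge0// ler_norm.
Qed.

Lemma geom_weaken u K q L Q : K <= L -> q <= Q -> Q < 1 -> geom_le u K q -> geom_le u L Q.
Proof.
move=> KL qQ Q1 [K0 q0 q1 h]; split=> //; [exact: le_trans KL|exact: le_trans qQ|].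
move=> n; apply: le_trans (h n) _; apply: ler_pM => //; first exact: exprn_ge0.
by rewrite lerXn2r// nnegrE// (le_trans q0).
Qed.

Lemma geom_common u v : geom u -> geom v ->
  exists K q, geom_le u K q /\ geom_le v K q.
Proof.
move=> [K [q h]] [K' [q' h']]; exists (Num.max K K'), (Num.max q q').
have q1 : Num.max q q' < 1 by case: h => _ _ q1 _; case: h' => _ _ q'1 _; rewrite gt_max q1.
by split; [apply: geom_weaken h|apply: geom_weaken h'] => //; rewrite le_max lexx ?orbT.
Qed.

Definition conv u v n : C := \sum_(i < n.+1) u i * v (n - i)%N.

Lemma conv_le u v K q n : geom_le u K q -> geom_le v K q ->
  normc (conv u v n) <= n.+1%:R * K ^+ 2 * q ^+ n.
Proof.
move=> [K0 q0 q1 hu] [_ _ _ hv]; apply: le_trans (nc_sum _ _ _) _.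
apply: (@le_trans _ _ (\sum_(i < n.+1) K ^+ 2 * q ^+ n)).
  apply: ler_sum => i _; rewrite normcM.
  apply: le_trans (ler_pM (nc_ge0 _) (nc_ge0 _) (hu i) (hv (n - i)%N)) _.
  by rewrite mulrACA -expr2 -exprD subnKC// -ltnS.
by rewrite sumr_const card_ord -mulrA mulr_natl.
Qed.

Lemma geom_conv u v : geom u -> geom v -> geom (conv u v).
Proof.
move=> gu gv; have [K [q [hu hv]]] := geom_common gu gv; have [K0 q0 q1 _] := hu.
apply: (@geom_of_subexp _ (fun n => n.+1%:R * K ^+ 2) q) => //.
  by apply: subexpM; [exact: subexp_nat|exact: subexp_cst].
by move=> n; exact: conv_le.
Qed.

Lemma csum_conv u v : geom u -> geom v -> csum (conv u v) = csum u * csum v.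
Proof.
move=> gu gv; have [K [q [hu hv]]] := geom_common gu gv; have [K0 q0 q1 ku] := hu.
pose L := 2 * K / (1 - q).
have L0 : 0 <= L by rewrite divr_ge0 ?mulr_ge0// subr_ge0 ltW.
pose b n := (n.+1%:R * (K * L + L * normc (csum v)) : R).
have sb : subexp b by apply: subexpM; [exact: subexp_nat|exact: subexp_cst].
have [M [p [M0 p0 p1 hp]]] := subexp_geom sb q0 q1.
apply: (@csum_unique _ _ _ M p) => //; first exact: geom_conv.
move=> N; apply: le_trans (hp N); apply: (@le_trans _ _ (b N * q ^+ N)); last first.
  by rewrite ler_wpM2r ?exprn_ge0// ler_norm.
have -> : \sum_(0 <= k < N) conv u v k =
    \sum_(0 <= i < N) u i * \sum_(0 <= k < N - i) v k.
  case: N => [|N]; first by rewrite !big_geq.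
  have := triangle (fun i k => u i * v k) N => e.
  transitivity (\sum_(0 <= n < N.+1) \sum_(0 <= i < n.+1) u i * v (n - i)%N).
    by apply: eq_bigr => n _; rewrite big_mkord.
  rewrite e; apply: eq_big_nat => i /andP[_ iN].
  rewrite ltnS in iN; by rewrite subSn// mulr_sumr.
(* The partial sums of a Cauchy product fill a triangle; the defect is a tail of u times the sum of
   v, plus each u_i times the tail of v beyond N - i. Every such term is of order q^N. *)
have -> : csum u * csum v - \sum_(0 <= i < N) u i * \sum_(0 <= k < N - i) v k =
   (csum u - \sum_(0 <= i < N) u i) * csum v +
   \sum_(0 <= i < N) u i * (csum v - \sum_(0 <= k < N - i) v k).
  under [X in _ = _ + X]eq_bigr do rewrite mulrBr.
  by rewrite sumrB -mulr_suml mulrBl addrA subrK.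
apply: le_trans (ncD _ _) _; rewrite normcM.
have t1 := csum_tail N hu.
have t2 : normc (\sum_(0 <= i < N) u i * (csum v - \sum_(0 <= k < N - i) v k)) <= N%:R * (K * L * q ^+ N).
  apply: le_trans (nc_sum _ _ _) _.
  apply: (@le_trans _ _ (\sum_(0 <= i < N) K * L * q ^+ N)); last first.
    by rewrite sumr_const_nat subn0 mulr_natl.
  rewrite big_nat [leRHS]big_nat; apply: ler_sum => i /andP[_ iN]; rewrite normcM.
  apply: le_trans (ler_pM (nc_ge0 _) (nc_ge0 _) (ku i) (csum_tail (N - i) hv)) _.
  by rewrite -/L mulrACA -exprD subnKC// ltnW.
apply: le_trans (lerD (ler_wpM2r (nc_ge0 _) t1) t2) _.
rewrite -/L /b.
have qN : 0 <= q ^+ N by exact: exprn_ge0.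
have -> : L * q ^+ N * normc (csum v) + N%:R * (K * L * q ^+ N) =
   (L * normc (csum v) + N%:R * (K * L)) * q ^+ N by ring.
rewrite ler_wpM2r//.
have h0 : 0 <= L * normc (csum v) by rewrite mulr_ge0 ?nc_ge0.
have h1 : 0 <= K * L by rewrite mulr_ge0.
rewrite -natr1 mulrDr !mulrDl !mul1r.
have h2 : 0 <= N%:R * (L * normc (csum v)) by rewrite mulr_ge0.
by move: (N%:R * _) (N%:R * _) h2 => x y h2; lra.
Qed.

(** The sum of [DB j u] is the j-th derivative of the generating function of u at 1, divided by
    j!. *)
Definition DB j u n : C := 'C(n, j)%:R * u n.

Lemma bin_le_expn n j : ('C(n, j) <= n.+1 ^ j)%N.
Proof.
elim: j => [|j IH]; first by rewrite bin0.
rewrite expnS; have h : (j.+1 * 'C(n, j.+1) = (n - j) * 'C(n, j))%N by rewrite mul_bin_left.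
apply: (@leq_trans (j.+1 * 'C(n, j.+1))); first by rewrite leq_pmull.
by rewrite h leq_mul// (leq_trans (leq_subr _ _)).
Qed.

Lemma subexp_bin j : subexp (fun n => 'C(n, j)%:R : R).
Proof.
apply: (@subexp_le _ _ (fun n => n.+1%:R ^+ j)); last by apply: subexpX; exact: subexp_nat.
by move=> n; rewrite !ger0_norm ?exprn_ge0// -natrX ler_nat bin_le_expn.
Qed.

Lemma geom_DB j u : geom u -> geom (DB j u).
Proof.
move=> [K [q [K0 q0 q1 h]]].
apply: (@geom_of_subexp _ (fun n => 'C(n, j)%:R * K) q) => //.
  by apply: subexpM; [exact: subexp_bin|exact: subexp_cst].
by move=> n; rewrite /DB normcM nc_nat -mulrA ler_wpM2l.
Qed.

(** Leibniz's rule for divided derivatives, which on coefficients is Vandermonde's identity for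
    binomials. *)
Lemma DB_conv j u v n : DB j (conv u v) n = \sum_(i < j.+1) conv (DB i u) (DB (j - i) v) n.
Proof.
rewrite /DB /conv exchange_big/= mulr_sumr; apply: eq_bigr => k _.
have -> : 'C(n, j) = (\sum_(i < j.+1) 'C(k, i) * 'C(n - k, j - i))%N.
  by rewrite binomial.Vandermonde subnKC// -ltnS.
rewrite natr_sum mulr_suml; apply: eq_bigr => i _; rewrite natrM.
by move: (u _) (v _) => x y; ring.
Qed.

Lemma geom_sum n (F : nat -> nat -> C) : (forall i, geom (F i)) ->
  geom (fun k => \sum_(i < n) F i k).
Proof.
move=> h; elim: n => [|n IH].
  by exists 0, 0; split=> // n; rewrite big_ord0 nc0 mul0r.
have [K [q hq]] := geomD IH (h n); exists K, q; case: hq => K0 q0 q1 hq; split=> // k.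
by rewrite big_ord_recr/=; exact: hq.
Qed.

Lemma csum_sum n (F : nat -> nat -> C) : (forall i, geom (F i)) ->
  csum (fun k => \sum_(i < n) F i k) = \sum_(i < n) csum (F i).
Proof.
move=> h; elim: n => [|n IH].
  rewrite big_ord0; apply: (@csum_unique _ _ _ 0 0) => //.
    by exists 0, 0; split=> // n; rewrite big_ord0 nc0 mul0r.
  by move=> N; rewrite big1 ?subrr ?nc0 ?mul0r// => k _; rewrite big_ord0.
rewrite big_ord_recr/= -IH -csumD//; last exact: geom_sum.
by apply: eq_csum => k; rewrite big_ord_recr.
Qed.

Lemma csum_DB_conv j u v : geom u -> geom v ->
  csum (DB j (conv u v)) = \sum_(i < j.+1) csum (DB i u) * csum (DB (j - i) v).
Proof.
move=> gu gv; under eq_csum do rewrite DB_conv.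
rewrite (@csum_sum _ (fun i => conv (DB i u) (DB (j - i) v))); last first.
  by move=> i; apply: geom_conv; exact: geom_DB.
by apply: eq_bigr => i _; rewrite csum_conv//; exact: geom_DB.
Qed.

Lemma csum_shift u m : geom u -> (forall k, (k < m)%N -> u k = 0) ->
  csum u = csum (fun n => u (n + m)%N).
Proof.
elim: m u => [|m IH] u gu h; first by apply: eq_csum => n; rewrite addn0.
rewrite (csumS gu) h// add0r (IH _ (geomS gu)); last by move=> k km; exact: h.
by apply: eq_csum => n; rewrite addnS.
Qed.

(* [HH a x] is the binomial series of (1 - x)^(-a). *)
Definition hs (a : R) (x : C) n : C := pfc a n * x ^+ n.
Definition HH (a : R) (x : C) : C := csum (hs a x).

Lemma pf_le_succ (a : R) n : 0 <= a -> pf a n <= pf (a + 1) n.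
Proof.
move=> a0; elim: n => [|n IH]; first by rewrite !pf0.
rewrite !pfSE; apply: ler_pM => //; [|exact: pf_ge0|].
  by rewrite divr_ge0// addr_ge0.
by rewrite ler_wpM2r ?invr_ge0//; lra.
Qed.

Lemma subexp_pf0 (a : R) : 0 <= a -> subexp (pf a).
Proof.
move=> a0; apply: (@subexp_le _ _ (pf (a + 1))); last by apply: subexp_pf; rewrite lerDr.
by move=> n; rewrite !ger0_norm ?pf_ge0 ?addr_ge0// pf_le_succ.
Qed.

Lemma nc_hs (a : R) x n : 0 <= a -> normc (hs a x n) = pf a n * normc x ^+ n.
Proof. by move=> a0; rewrite normcM ncX /pfc ncR ger0_norm ?pf_ge0. Qed.

Lemma geom_hs (a : R) x : 0 <= a -> normc x < 1 -> geom (hs a x).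
Proof.
move=> a0 x1; apply: (@geom_of_subexp _ (pf a) (normc x)) => //; rewrite ?nc_ge0//.
  exact: subexp_pf0.
by move=> n; rewrite nc_hs.
Qed.

Lemma HH_mul (a b : R) x : 0 <= a -> 0 <= b -> normc x < 1 ->
  HH a x * HH b x = HH (a + b) x.
Proof.
move=> a0 b0 x1; rewrite /HH -csum_conv; [|exact: geom_hs..].
apply: eq_csum => n; rewrite /hs /pfc -vandermonde.
rewrite raddf_sum/= mulr_suml; apply: eq_bigr => i _.
have -> : x ^+ n = x ^+ i * x ^+ (n - i) by rewrite -exprD subnKC// -ltnS.
by move: (pf a i) (pf b _) (x ^+ _) (x ^+ _) => y1 y2 y3 y4; rewrite RCM; ring.
Qed.

Lemma HH1 x : normc x < 1 -> (1 - x) * HH 1 x = 1.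
Proof.
move=> x1; have g := geom_hs (@ler01 R) x1.
rewrite mulrBl mul1r {1}/HH (csumS g) /HH -csumZ//.
have -> : csum (fun n => x * hs 1 x n) = csum (fun n => hs 1 x n.+1).
  by apply: eq_csum => n; rewrite /hs /pfc !pf_1 !mul1r exprS.
by rewrite addrK /hs /pfc pf0 expr0 mulr1.
Qed.

Lemma nc_HH_le1 (a : R) x : 0 <= a <= 1 -> normc x < 1 ->
  normc (HH a x) <= 2 / (1 - normc x).
Proof.
move=> /andP[a0 a1] x1; rewrite -[X in X / _]mulr1; apply: csum_le; split=> //; rewrite ?nc_ge0// => n.
rewrite nc_hs// ler_wpM2r ?exprn_ge0 ?nc_ge0//.
elim: n => [|n IH]; first by rewrite pf0.
rewrite pfSE mulr_ile1// ?pf_ge0//; first by rewrite divr_ge0// addr_ge0.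
by rewrite ler_pdivrMr// mul1r -natr1 addrC lerD2l.
Qed.

Lemma HH_natmul (a : R) x n : 0 <= a -> normc x < 1 -> HH (n%:R * a) x = HH a x ^+ n.
Proof.
move=> a0 x1; elim: n => [|n IH].
  rewrite mul0r expr0 /HH (csumS (geom_hs (lexx 0) x1)) /hs /pfc pf0 expr0 mulr1.
  rewrite -[RHS]addr0; congr (_ + _); apply: (@csum_unique _ _ _ 0 0) => //.
    by exists 0, 0; split=> // k; rewrite pf_00 !mul0r nc0.
  by move=> N; rewrite big1 ?subrr ?nc0 ?mul0r// => k _; rewrite pf_00 mul0r.
by rewrite exprSr -IH HH_mul// ?mulr_ge0// -natr1 mulrDl mul1r.
Qed.

(* a |-> |HH a x| |1 - x|^a is multiplicative, and bounded on [0, 1] uniformly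
   under a |-> frac (n a); hence it is at most 1. *)
Lemma nc_HH_le (a : R) x : 0 <= a -> normc x < 1 ->
  normc (HH a x) <= normc (1 - x) `^ (- a).
Proof.
move=> a0 x1; set d := normc (1 - x).
have d0 : 0 < d.
  rewrite nc_gt0; apply/eqP => h; move: x1; rewrite -[x](subKr 1) h subr0 nc1.
  by rewrite ltxx.
have d2 : d <= 2.
  by apply: le_trans (ncB _ _) _; rewrite nc1; lra.
rewrite powRN -[leRHS]mul1r ler_pdivlMr ?powR_gt0//.
set X := normc (HH a x) * _.
have X0 : 0 <= X by rewrite mulr_ge0 ?nc_ge0 ?powR_ge0.
pose M := 2 / (1 - normc x) * 2.
have M0 : 0 <= M by rewrite mulr_ge0// divr_ge0// subr_ge0 ltW.
have key n : X ^+ n <= M.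
  have na0 : 0 <= n%:R * a by rewrite mulr_ge0.
  have -> : X ^+ n = normc (HH (n%:R * a) x) * d `^ (n%:R * a).
    have e : d `^ (n%:R * a) = (d `^ a) ^+ n by rewrite mulrC powRrM powR_mulrn ?powR_ge0.
    by rewrite HH_natmul// ncX /X exprMn e.
  have /andP[t1 t2] := Num.Theory.truncn_itv na0.
  set m := Num.truncn (n%:R * a) in t1 t2.
  pose th := n%:R * a - m%:R.
  have th0 : 0 <= th by rewrite subr_ge0.
  have th1 : th <= 1 by rewrite /th lerBlDl natr1 ltW.
  have -> : n%:R * a = m%:R * 1 + th by rewrite /th mulr1 addrC subrK.
  rewrite -HH_mul ?mulr_ge0// HH_natmul// powR_add// mulr1 powR_mulrn ?(ltW d0)// normcM ncX.
  have h1 : normc (HH 1 x) * d = 1 by rewrite mulrC -normcM HH1// nc1.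
  rewrite mulrACA -exprMn h1 expr1n mul1r.
  apply: ler_pM; rewrite ?nc_ge0 ?powR_ge0//; first by apply: nc_HH_le1; rewrite ?th0.
  case: (lerP d 1) => hd.
    by apply: le_trans (powR_le1 th0 (ltW d0) hd) _; rewrite ler1n.
  apply: le_trans d2; rewrite -[leRHS]powRr1 ?(ltW d0)//; apply: ler_powR => //.
  exact: ltW.
rewrite leNgt; apply/negP => X1.
pose y := X - 1; have y0 : 0 < y by rewrite subr_gt0.
have [N hN] : exists N : nat, M < N%:R * y.
  exists (Num.truncn (M / y)).+1; rewrite -ltr_pdivrMr//.
  by have /andP[_] := Num.Theory.truncn_itv (divr_ge0 M0 (ltW y0)).
have := bernoulli_le N (ltW y0); have -> : 1 + y = X by rewrite addrC subrK.
move=> /le_trans/(_ (key N)) h; have := le_lt_trans h hN.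
by rewrite gtrDr ltNge ler01.
Qed.

Lemma csum_DB_hs (a : R) x j : 0 <= a -> normc x < 1 ->
  csum (DB j (hs a x)) = pfc a j * x ^+ j * HH (a + j%:R) x.
Proof.
move=> a0 x1; have g := geom_hs a0 x1.
rewrite (@csum_shift _ j); [|exact: geom_DB|by move=> k kj; rewrite /DB bin_small// mul0r].
rewrite /HH -csumZ; last by apply: geom_hs => //; rewrite addr_ge0.
apply: eq_csum => n; rewrite /DB /hs exprD.
have -> : ('C(n + j, j)%:R : C) * (pfc a (n + j) * (x ^+ n * x ^+ j)) =
  (pfc a (n + j) * 'C(n + j, j)%:R) * (x ^+ n * x ^+ j) by ring.
have -> : pfc a (n + j) * 'C(n + j, j)%:R = pfc a j * pfc (a + j%:R) n.
  by rewrite /pfc -RCnat -!RCM mulr_natr addnC pf_binomial.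
by ring.
Qed.

Lemma nc_csum_DB_hs (a : R) x j : 0 <= a -> normc x < 1 ->
  normc (csum (DB j (hs a x))) <= pf a j * normc (1 - x) `^ (- (a + j%:R)).
Proof.
move=> a0 x1; rewrite csum_DB_hs// !normcM ncX /pfc ncR ger0_norm ?pf_ge0// -mulrA.
rewrite ler_wpM2l ?pf_ge0// -[leRHS]mul1r; apply: ler_pM; rewrite ?exprn_ge0 ?nc_ge0//.
  by rewrite exprn_ile1 ?nc_ge0 ?ltW.
by apply: nc_HH_le; rewrite ?addr_ge0.
Qed.

End CauchyProducts.

(** * Bounds for the kernel *)

Section KernelBound.
Variable R : realType.
Notation C := R[i].

Lemma beta_bound_complex (lambda : R) : 0 <= lambda ->
  exists2 B, 0 <= B & forall (a b : R) N (c : nat -> nat -> C) K e,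
  0 < a -> 0 < b -> 0 <= K -> 0 <= e ->
  (forall u : R, 0 <= u <= 1 ->
    normc (\sum_(m < N) \sum_(i < m.+1) c m i * (u%:C ^+ i * (1 - u%:C) ^+ (m - i))) <=
    K * ((1 - u) * a + u * b) `^ (- lambda) + e) ->
  normc (\sum_(m < N) \sum_(i < m.+1) c m i * (MM lambda i (m - i))%:C) <=
  2 * (K * (B * (Num.max a b `^ (- lambda) * Num.sqrt (a / Num.min a b))) + e).
Proof.
move=> l0; have [B B0 hB] := beta_bound l0; exists B => // a b N c K e a0 b0 K0 e0 h.
have reM (x : C) (y : R) : complex.Re (x * y%:C) = complex.Re x * y.
  by case: x => x1 x2 /=; rewrite mulr0 subr0.
have imM (x : C) (y : R) : complex.Im (x * y%:C) = complex.Im x * y.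
  by case: x => x1 x2 /=; rewrite mulr0 add0r mulrC.
have pE (u : R) m i : u%:C ^+ i * (1 - u%:C) ^+ (m - i) = (u ^+ i * (1 - u) ^+ (m - i))%:C.
  by rewrite RCM !RCX rmorphB rmorph1.
have hre := hB a b N (fun m i => complex.Re (c m i)) K e a0 b0 K0 e0.
have him := hB a b N (fun m i => complex.Im (c m i)) K e a0 b0 K0 e0.
apply: le_trans (nc_le_ReIm _) _; rewrite mulr_natl mulr2n; apply: lerD.
  rewrite Re_sum; under eq_bigr do (rewrite Re_sum; under eq_bigr do rewrite reM).
  apply: hre => u u01; apply: le_trans (h u u01); apply: le_trans (Re_le _).
  rewrite Re_sum [leRHS](_ : _ = `|\sum_(m < N) \sum_(i < m.+1) complex.Re (c m i) * (u ^+ i * (1 - u) ^+ (m - i))|)//.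
  by congr `|_|; apply: eq_bigr => m _; rewrite Re_sum; apply: eq_bigr => i _; rewrite pE reM.
rewrite Im_sum; under eq_bigr do (rewrite Im_sum; under eq_bigr do rewrite imM).
apply: him => u u01; apply: le_trans (h u u01); apply: le_trans (Im_le _).
rewrite Im_sum [leRHS](_ : _ = `|\sum_(m < N) \sum_(i < m.+1) complex.Im (c m i) * (u ^+ i * (1 - u) ^+ (m - i))|)//.
by congr `|_|; apply: eq_bigr => m _; rewrite Im_sum; apply: eq_bigr => i _; rewrite pE imM.
Qed.

(** Turns the multiplier (n + lambda + 1)^m into divided derivatives [DB], which obey Leibniz's
    rule. The induction step is (n + mu) C(n, j) = (j + 1) C(n, j + 1) + (j + mu) C(n, j). *)
Lemma natmul_binomial_basis (mu : R) m : exists s : nat -> R,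
  forall n, (n%:R + mu) ^+ m = \sum_(j < m.+1) s j * 'C(n, j)%:R.
Proof.
elim: m => [|m [s hs]].
  by exists (fun=> 1) => n; rewrite big_ord1 bin0 mulr1 expr0.
exists (fun j => (if j is j'.+1 then s j' * j'.+1%:R else 0) +
   (if (j <= m)%N then s j * (j%:R + mu) else 0)) => n.
rewrite exprS hs mulr_sumr.
have step j : (n%:R + mu) * 'C(n, j)%:R = j.+1%:R * 'C(n, j.+1)%:R + (j%:R + mu) * 'C(n, j)%:R :> R.
  have [jn|nj] := leqP j n.
    rewrite -[X in X = _]/((n%:R + mu) * 'C(n, j)%:R) -(natrM _ j.+1) mul_bin_left natrM natrB//.
    by ring.
  by rewrite !bin_small ?mulr0 ?addr0// ltnW.
under eq_bigr do rewrite mulrCA step mulrDr.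
rewrite big_split/=; under [RHS]eq_bigr do rewrite mulrDl.
rewrite [RHS]big_split/=; congr (_ + _).
  rewrite [RHS]big_ord_recl/= mul0r add0r; apply: eq_bigr => j _.
  by rewrite /bump add1n mulrA.
rewrite [RHS]big_ord_recr/= ltnn mul0r addr0; apply: eq_bigr => j _.
by rewrite -ltnS ltn_ord mulrA.
Qed.

Variables (lambda : R).
Hypothesis l0 : 0 <= lambda.

(** The mean over u of the n-th Taylor coefficient of (1 - r x)^(-lambda) (1 - r' x)^(-lambda),
    where r and r' are the reciprocal roots depending on u. *)
Definition NN (z w : C) n : C :=
  \sum_(m < n.+1) \sum_(i < m.+1) Cf lambda z w n m i * (MM lambda i (m - i))%:C.

Definition kc (z w : C) n : C := phi lambda n z * phi lambda n w.

Lemma kc_conv z w : kc z w = conv (NN z w) (hs 1 (z * w)).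
Proof.
apply/funext => n; rewrite /kc kernel_factor//; apply: eq_bigr => k _.
by rewrite mulrC /hs /pfc pf_1 mul1r.
Qed.

Section Fixed.
Variables (z w : C).
Hypotheses (Dz : disk z) (Dw : disk w).

Let s := normc z * normc w.
Let A := normc (1 - z * w).
Let B := normc (1 - conjc z * w).
Let d := Num.min A B.
Let QQ (u : R) := (1 - u) * A ^+ 2 + u * B ^+ 2.

Let s0 : 0 <= s. Proof. by rewrite mulr_ge0 ?nc_ge0. Qed.
Let s1 : s < 1.
Proof. by rewrite /s -[ltRHS]mulr1 ltr_pM ?nc_ge0. Qed.

Let p2 k : 0 <= pf (2 * lambda) k.
Proof. by apply: pf_ge0; rewrite mulr_ge0. Qed.

Let Dzb : disk (conjc z). Proof. exact: disk_conj. Qed.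

Let A0 : 0 < A.
Proof.
by apply: lt_le_trans (nc_1zw_gew w Dz); rewrite subr_gt0.
Qed.
Let B0 : 0 < B.
Proof.
by apply: lt_le_trans (nc_1zw_gew w Dzb); rewrite subr_gt0.
Qed.
Let d0 : 0 < d. Proof. by rewrite lt_min A0. Qed.

(** For u in [0, 1] the sum of the reciprocal roots is real, equal to 2 X with |X| <= s, and their
    product is s^2. They are therefore conjugate of modulus s, and the value of the polynomial at 1
    is |1 - r|^2. *)
Lemma exists_root (u : R) : 0 <= u <= 1 -> exists r : C,
  [/\ r + conjc r = (1 - u%:C) * (z * w + conjc z * conjc w) + u%:C * (conjc z * w + z * conjc w),
    r * conjc r = z * w * (conjc z * conjc w), normc r = s & normc (1 - r) ^+ 2 = QQ u].
Proof.
move=> /andP[u0 u1].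
pose p := complex.Re (z * w); pose q := complex.Re (conjc z * w).
pose X := (1 - u) * p + u * q.
have ps : `|p| <= s by apply: le_trans (Re_le _) _; rewrite normcM.
have qs : `|q| <= s by apply: le_trans (Re_le _) _; rewrite normcM ncJ.
have Xs : `|X| <= s.
  apply: le_trans (ler_normD _ _) _; rewrite !normrM (ger0_norm u0) ger0_norm ?subr_ge0//.
  apply: le_trans (lerD (ler_wpM2l _ ps) (ler_wpM2l u0 qs)) _; first by rewrite subr_ge0.
  by rewrite -mulrDl subrK mul1r.
have X2 : X ^+ 2 <= s ^+ 2 by rewrite -real_normK ?num_real// lerXn2r ?nnegrE.
pose Y := Num.sqrt (s ^+ 2 - X ^+ 2).
have Y2 : Y ^+ 2 = s ^+ 2 - X ^+ 2 by rewrite sqr_sqrtr// subr_ge0.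
exists (X +i* Y).
have zwb (x : C) : x + conjc x = (2 * complex.Re x)%:C.
  by case: x => a b; apply/eqP; rewrite eq_complex/= subrr eqxx andbT; apply/eqP; ring.
have e1 : z * w + conjc z * conjc w = (2 * p)%:C by rewrite -rmorphM zwb.
have e2 : conjc z * w + z * conjc w = (2 * q)%:C.
  by rewrite -zwb rmorphM/= conjcK.
have n2 : normc (X +i* Y) ^+ 2 = s ^+ 2 by rewrite ncE/= Y2 addrC subrK.
have sq (x y : R) : 0 <= x -> 0 <= y -> x ^+ 2 = y ^+ 2 -> x = y.
  by move=> x0 y0 h; apply/eqP; rewrite -(eqrXn2 (n := 2))// h.
have zz (x : C) : x * conjc x = (normc x ^+ 2)%:C.
  by rewrite ncE; case: x => a b; apply/eqP; rewrite eq_complex/=; apply/andP; split; apply/eqP; ring.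
split.
- rewrite zwb e1 e2 /= -[1 - u%:C](_ : (1 - u)%:C = _); last by rewrite rmorphB rmorph1.
  by rewrite -!RCM -rmorphD/=; congr _%:C; rewrite /X; ring.
- rewrite zz n2 mulrACA !zz -RCM; congr _%:C; rewrite /s; ring.
- by apply: sq; rewrite ?nc_ge0.
have n1 (x : C) : normc (1 - x) ^+ 2 = 1 - 2 * complex.Re x + normc x ^+ 2.
  by rewrite !ncE; case: x => a b /=; ring.
rewrite n1 n2 /QQ /A /B !n1 !normcM ncJ -/s -/p -/q /X /=; ring.
Qed.

Lemma nc_1Bconj (x : C) : normc (1 - conjc x) = normc (1 - x).
Proof. by rewrite -ncJ rmorphB rmorph1/= conjcK. Qed.

Lemma QQ_ge (u : R) : 0 <= u <= 1 -> d ^+ 2 <= QQ u.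
Proof.
move=> /andP[u0 u1]; have dA : d ^+ 2 <= A ^+ 2 by rewrite lerXn2r ?nnegrE ?ge_min ?lexx ?(ltW d0) ?(ltW A0).
have dB : d ^+ 2 <= B ^+ 2 by rewrite lerXn2r ?nnegrE ?ge_min ?lexx ?orbT ?(ltW d0) ?(ltW B0).
have -> : d ^+ 2 = (1 - u) * d ^+ 2 + u * d ^+ 2 by ring.
by apply: lerD; apply: ler_wpM2l => //; rewrite subr_ge0.
Qed.

Lemma qsum_le (u : R) (r : C) n : 0 <= u <= 1 -> normc r = s ->
  normc (conv (hs lambda r) (hs lambda (conjc r)) n) <= pf (2 * lambda) n * s ^+ n.
Proof.
move=> u01 rs; apply: le_trans (nc_sum _ _ _) _.
rewrite -[2 * lambda](_ : lambda + lambda = _); last by ring.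
rewrite -vandermonde mulr_suml; apply: ler_sum => i _.
rewrite normcM !nc_hs// ncJ rs mulrACA -exprD subnKC//; by rewrite -ltnS.
Qed.

(** By Leibniz's rule each of the j derivatives costs a factor 1 / |1 - r| <= 1 / d, beyond the
    undifferentiated size |1 - r|^(-2 lambda). The coefficients add up by [vandermonde]. *)
Lemma gegenbauer_DB_le (u : R) (r : C) j : 0 <= u <= 1 -> normc r = s ->
  normc (1 - r) ^+ 2 = QQ u ->
  normc (csum (DB j (conv (hs lambda r) (hs lambda (conjc r))))) <=
  pf (2 * lambda) j * d ^- j * QQ u `^ (- lambda).
Proof.
move=> u01 rs r1.
have rn1 : normc r < 1 by rewrite rs.
have rb1 : normc (conjc r) < 1 by rewrite ncJ.
rewrite csum_DB_conv; [|exact: geom_hs..].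
apply: le_trans (nc_sum _ _ _) _.
set t := normc (1 - r).
have td : d <= t.
  by rewrite -(@ler_pXn2r _ 2) ?nnegrE ?(ltW d0) ?nc_ge0// r1 QQ_ge.
have t0 : 0 < t by exact: lt_le_trans td.
rewrite -[2 * lambda](_ : lambda + lambda = _); last by ring.
rewrite -vandermonde -mulrA mulr_suml; apply: ler_sum => i _.
rewrite normcM.
apply: le_trans (ler_pM (nc_ge0 _) (nc_ge0 _) (nc_csum_DB_hs i l0 rn1) (nc_csum_DB_hs (j - i) l0 rb1)) _.
rewrite nc_1Bconj -/t mulrACA; apply: ler_wpM2l; first by apply: mulr_ge0; exact: pf_ge0.
rewrite -r1 -/t -[t ^+ 2]powR_mulrn ?(ltW t0)// -powRrM -powR_add//.
have -> : - (lambda + i%:R) + - (lambda + (j - i)%:R) = - j%:R + 2%:R * - lambda.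
  by rewrite natrB ?leq_ord//; ring.
rewrite powR_add// ler_wpM2r ?powR_ge0// powRN powR_mulrn ?(ltW t0)//.
by rewrite lef_pV2 ?posrE ?exprn_gt0// lerXn2r ?nnegrE ?(ltW d0) ?(ltW t0).
Qed.

(** Writes a partial sum as the mean of one polynomial in u, with the coefficients that
    [q_combination] evaluates pointwise; [hBB] compares the two. *)
Lemma NN_combination j M : \sum_(n < M) 'C(n, j)%:R * NN z w n =
  \sum_(m < M) \sum_(i < m.+1) (\sum_(n < M) 'C(n, j)%:R * Cf lambda z w n m i) * (MM lambda i (m - i))%:C.
Proof.
transitivity (\sum_(n < M) \sum_(m < M) \sum_(i < m.+1) 'C(n, j)%:R * Cf lambda z w n m i * (MM lambda i (m - i))%:C).
  apply: eq_bigr => n _; rewrite /NN mulr_sumr.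
  have nM : (n.+1 <= M)%N by [].
  rewrite -[RHS](big_mkord xpredT (fun m => \sum_(i < m.+1) 'C(n, j)%:R * Cf lambda z w n m i * (MM lambda i (m - i))%:C)).
  rewrite (@big_cat_nat _ _ _ n.+1 0 M)//= [X in _ = _ + X]big_nat [X in _ = _ + X]big1 ?addr0 ?big_mkord; last first.
    move=> m /andP[nm _]; rewrite big1// => i _.
    by rewrite /Cf Wp_small ?mulr0 ?mul0r// subnKC// -ltnS.
  by apply: eq_bigr => m _; rewrite mulr_sumr; apply: eq_bigr => i _; rewrite mulrA.
rewrite exchange_big/=; apply: eq_bigr => m _; rewrite exchange_big/=; apply: eq_bigr => i _.
by rewrite mulr_suml.
Qed.

Lemma q_combination j M (u : R) (r : C) :
  r + conjc r = (1 - u%:C) * (z * w + conjc z * conjc w) + u%:C * (conjc z * w + z * conjc w) ->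
  r * conjc r = z * w * (conjc z * conjc w) ->
  \sum_(m < M) \sum_(i < m.+1) (\sum_(n < M) 'C(n, j)%:R * Cf lambda z w n m i) * (u%:C ^+ i * (1 - u%:C) ^+ (m - i)) =
  \sum_(n < M) DB j (conv (hs lambda r) (hs lambda (conjc r))) n.
Proof.
move=> h1 h2.
transitivity (\sum_(n < M) \sum_(m < M) \sum_(i < m.+1) 'C(n, j)%:R * Cf lambda z w n m i * (u%:C ^+ i * (1 - u%:C) ^+ (m - i))).
  rewrite exchange_big/=; apply: eq_bigr => m _; rewrite exchange_big/=; apply: eq_bigr => i _.
  by rewrite mulr_suml.
apply: eq_bigr => n _; rewrite /DB /conv /hs -(@Cf_expand R lambda z w n _ _ _ h1 h2) mulr_sumr.
have nM : (n.+1 <= M)%N by [].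
rewrite -[LHS](big_mkord xpredT (fun m => \sum_(i < m.+1) 'C(n, j)%:R * Cf lambda z w n m i * (u%:C ^+ i * (1 - u%:C) ^+ (m - i)))).
rewrite (@big_cat_nat _ _ _ n.+1 0 M)//= [X in _ + X = _]big_nat [X in _ + X = _]big1 ?addr0 ?big_mkord; last first.
  move=> m /andP[nm _]; rewrite big1// => i _.
  by rewrite /Cf Wp_small ?mulr0 ?mul0r// subnKC// -ltnS.
by apply: eq_bigr => m _; rewrite mulr_sumr; apply: eq_bigr => i _; rewrite -mulrA.
Qed.

Variable BB : R.
Hypothesis BB0 : 0 <= BB.
Hypothesis hBB : forall (a b : R) N (c : nat -> nat -> C) K e,
  0 < a -> 0 < b -> 0 <= K -> 0 <= e ->
  (forall u : R, 0 <= u <= 1 ->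
    normc (\sum_(m < N) \sum_(i < m.+1) c m i * (u%:C ^+ i * (1 - u%:C) ^+ (m - i))) <=
    K * ((1 - u) * a + u * b) `^ (- lambda) + e) ->
  normc (\sum_(m < N) \sum_(i < m.+1) c m i * (MM lambda i (m - i))%:C) <=
  2 * (K * (BB * (Num.max a b `^ (- lambda) * Num.sqrt (a / Num.min a b))) + e).

Let G := Num.max A B `^ (- (2 * lambda)) * (A / d).

Lemma GE : Num.max (A ^+ 2) (B ^+ 2) `^ (- lambda) * Num.sqrt (A ^+ 2 / Num.min (A ^+ 2) (B ^+ 2)) = G.
Proof.
have mx : Num.max (A ^+ 2) (B ^+ 2) = Num.max A B ^+ 2.
  case: (leP A B) => h.
    by apply/max_idPr; rewrite lerXn2r ?nnegrE ?(ltW A0) ?(ltW B0).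
  by apply/max_idPl; rewrite lerXn2r ?nnegrE ?(ltW A0) ?(ltW B0)// ltW.
have mn : Num.min (A ^+ 2) (B ^+ 2) = d ^+ 2.
  rewrite /d; case: (leP A B) => h.
    by apply/min_idPl; rewrite lerXn2r ?nnegrE ?(ltW A0) ?(ltW B0).
  by apply/min_idPr; rewrite lerXn2r ?nnegrE ?(ltW A0) ?(ltW B0)// ltW.
have m0 : 0 <= Num.max A B by rewrite le_max (ltW A0).
rewrite mx mn -expr_div_n sqrtr_sqr ger0_norm ?divr_ge0 ?(ltW A0) ?(ltW d0)//.
by rewrite -powR_mulrn// -powRrM mulrN.
Qed.

Lemma NN_bound n : normc (NN z w n) <= 2 * (pf (2 * lambda) n * s ^+ n).
Proof.
have e0 : 0 <= pf (2 * lambda) n * s ^+ n by apply: mulr_ge0; [exact: p2|exact: exprn_ge0].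
(* The bound is used here with K = 0, through its error term alone. *)
have := @hBB (A ^+ 2) (B ^+ 2) n.+1 (Cf lambda z w n) 0 (pf (2 * lambda) n * s ^+ n).
rewrite !mul0r add0r; apply => //; rewrite ?exprn_gt0// => u u01.
rewrite mul0r add0r; have [r [h1 h2 rs r1]] := exists_root u01.
by rewrite (@Cf_expand R lambda z w n _ _ _ h1 h2); exact: (qsum_le _ u01 rs).
Qed.

Lemma geom_NN : geom (NN z w).
Proof.
apply: (@geom_of_subexp _ _ (fun n => 2 * pf (2 * lambda) n) s) => //.
  by apply: subexpM; [exact: subexp_cst|apply: subexp_pf0; rewrite mulr_ge0].
by move=> n; rewrite -mulrA; exact: NN_bound.
Qed.

(** The Beta bound concerns finite sums. It is applied to partial sums, with the tail L q^M, uniform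
    in u, as the error, and M then tends to infinity. *)
Lemma nu_bound j : normc (csum (DB j (NN z w))) <=
  2 * (pf (2 * lambda) j * d ^- j * (BB * G)).
Proof.
have gN := geom_DB j geom_NN.
have sb : subexp (fun n => 'C(n, j)%:R * pf (2 * lambda) n : R).
  by apply: subexpM; [exact: subexp_bin|apply: subexp_pf0; rewrite mulr_ge0].
have [K [q [K0 q0 q1 hq]]] := subexp_geom sb s0 s1.
pose L := 2 * K / (1 - q); have L0 : 0 <= L by rewrite divr_ge0 ?mulr_ge0// subr_ge0 ltW.
have P0 : 0 <= pf (2 * lambda) j * d ^- j.
  by rewrite mulr_ge0 ?invr_ge0 ?exprn_ge0 ?(ltW d0)// pf_ge0// mulr_ge0.
have part M : normc (\sum_(n < M) 'C(n, j)%:R * NN z w n) <=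
    2 * (pf (2 * lambda) j * d ^- j * (BB * G) + L * q ^+ M).
  rewrite NN_combination -GE.
  apply: (@hBB (A ^+ 2) (B ^+ 2) M (fun m i => \sum_(n < M) 'C(n, j)%:R * Cf lambda z w n m i)) => //.
  - exact: exprn_gt0.
  - exact: exprn_gt0.
  - by rewrite mulr_ge0 ?exprn_ge0.
  move=> u u01; have [r [h1 h2 rs r1]] := exists_root u01.
  rewrite (q_combination _ _ h1 h2).
  have gl : geom_le (DB j (conv (hs lambda r) (hs lambda (conjc r)))) K q.
    split=> // n; apply: le_trans (hq n); rewrite /DB normcM nc_nat.
    apply: (@le_trans _ _ ('C(n, j)%:R * pf (2 * lambda) n * s ^+ n)).
      rewrite -[leRHS]mulrA; apply: ler_wpM2l => //; exact: (qsum_le _ u01 rs).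
    by rewrite ler_wpM2r ?exprn_ge0// ler_norm.
  have t := csum_tail M gl; rewrite -/L in t.
  set S := csum _ in t; rewrite big_mkord in t; set T := \sum_(n < M) _ in t *; rewrite -(subKr S T).
  apply: le_trans (ncB _ _) _; apply: lerD => //.
  exact: gegenbauer_DB_le.
have [K' [q' [K'0 q'0 q'1 ht]]] := geom_tail gN.
have t' : normc (csum (DB j (NN z w))) - 2 * (pf (2 * lambda) j * d ^- j * (BB * G)) <= 0.
  apply: (@geo_le0 _ _ (K' + 2 * L) (Num.max q' q)); rewrite ?le_max ?q'0 ?gt_max ?q'1//.
  move=> M; apply: le_trans (geo_max M K'0 (_ : 0 <= 2 * L) q'0 q0); last by rewrite mulr_ge0.
  have := ht M; have := part M; rewrite big_mkord.
  set T := \sum_(n < M) _ => pT tT.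
  have := nc_lerB (csum (DB j (NN z w))) T.
  rewrite mulrDr in pT.
  rewrite -[2 * L * _]mulrA.
  move: (L * q ^+ M) (K' * q' ^+ M) (normc T) (2 * (_ / _ * _)) (normc (_ - _)) (normc _) pT tT.
  by move=> x1 x2 x3 x4 x5 x6; lra.
by rewrite subr_le0 in t'.
Qed.

(** In Leibniz's rule the geometric series contributes A^(-(j-i)-1), and one factor 1 / A cancels
    the A lost in [G]. All remaining factors are powers of 1 / d, of total order j + 1. *)
Lemma kc_DB_bound j : normc (csum (DB j (kc z w))) <=
  2 * BB * (\sum_(i < j.+1) pf (2 * lambda) i) * (Num.max A B `^ (- (2 * lambda)) * d ^- j.+1).
Proof.
have zw1 : normc (z * w) < 1 by rewrite normcM.
rewrite kc_conv csum_DB_conv; [|exact: geom_NN|exact: geom_hs].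
apply: le_trans (nc_sum _ _ _) _; rewrite mulr_sumr mulr_suml; apply: ler_sum => i _.
rewrite normcM.
apply: le_trans (ler_pM (nc_ge0 _) (nc_ge0 _) (nu_bound i) (nc_csum_DB_hs (j - i) ler01 zw1)) _.
rewrite -/A pf_1 mul1r.
have -> : 1 + (j - i)%:R = (j - i).+1%:R :> R by rewrite -natr1 addrC.
rewrite powRN powR_mulrn ?(ltW A0)// /G.
have Ad : (A ^+ (j - i).+1)^-1 <= A^-1 * d ^- (j - i).
  rewrite exprS invfM ler_wpM2l ?invr_ge0 ?(ltW A0)// lef_pV2 ?posrE ?exprn_gt0//.
  by rewrite lerXn2r ?nnegrE ?(ltW d0) ?(ltW A0)// ge_min lexx.
set P := pf _ i; set MX := Num.max A B `^ _.
have P0 : 0 <= P by rewrite pf_ge0// mulr_ge0.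
have D0 : 0 <= d ^- i by rewrite invr_ge0 exprn_ge0 ?(ltW d0).
apply: le_trans (ler_wpM2l _ Ad) _.
  by rewrite mulr_ge0// mulr_ge0//; [exact: mulr_ge0|rewrite !mulr_ge0 ?powR_ge0 ?invr_ge0 ?(ltW A0) ?(ltW d0)].
have -> : 2 * (P * d ^- i * (BB * (MX * (A / d)))) * (A^-1 * d ^- (j - i)) =
  2 * BB * P * (MX * ((A * A^-1) * (d^-1 * (d ^- i * d ^- (j - i))))) by ring.
rewrite divff ?gt_eqF// mul1r -invfM -exprD subnKC ?leq_ord// -invfM -exprS.
by [].
Qed.

Lemma geom_kc : geom (kc z w).
Proof. by rewrite kc_conv; apply: geom_conv; [exact: geom_NN|apply: geom_hs => //; rewrite normcM]. Qed.

End Fixed.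

Lemma kernel_bound m : exists2 K, 0 <= K & forall z w : C, disk z -> disk w ->
  geom (fun n => ((n%:R + (lambda + 1))%:C) ^+ m * kc z w n) /\
  normc (csum (fun n => ((n%:R + (lambda + 1))%:C) ^+ m * kc z w n)) <=
  K * (Num.max (normc (1 - z * w)) (normc (1 - conjc z * w)) `^ (- (2 * lambda)) *
       Num.min (normc (1 - z * w)) (normc (1 - conjc z * w)) ^- m.+1).
Proof.
have [BB BB0 hBB] := beta_bound_complex l0.
have [sc hsc] := natmul_binomial_basis (lambda + 1) m.
pose Kj j := 2 * BB * (\sum_(i < j.+1) pf (2 * lambda) i) * 2 ^+ (m - j).
have Kj0 j : 0 <= Kj j.
  by rewrite !mulr_ge0 ?exprn_ge0// sumr_ge0// => i _; rewrite pf_ge0// mulr_ge0.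
exists (\sum_(j < m.+1) `|sc j| * Kj j).
  by apply: sumr_ge0 => j _; rewrite mulr_ge0.
move=> z w Dz Dw; have gk := geom_kc Dz Dw hBB.
have E n : ((n%:R + (lambda + 1))%:C) ^+ m * kc z w n = \sum_(j < m.+1) (sc j)%:C * DB j (kc z w) n.
  rewrite -RCX hsc raddf_sum/= mulr_suml; apply: eq_bigr => j _.
  by rewrite RCM RCnat /DB mulrA.
have gj j : geom (fun n => (sc j)%:C * DB j (kc z w) n) by apply: geomZ; exact: geom_DB.
have -> : (fun n => ((n%:R + (lambda + 1))%:C) ^+ m * kc z w n) =
   (fun n => \sum_(j < m.+1) (sc j)%:C * DB j (kc z w) n) by apply/funext.
split; first exact: (@geom_sum _ _ (fun j n => (sc j)%:C * DB j (kc z w) n)).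
rewrite (@csum_sum _ _ (fun j n => (sc j)%:C * DB j (kc z w) n))//.
apply: le_trans (nc_sum _ _ _) _; rewrite mulr_suml; apply: ler_sum => j _.
rewrite csumZ; last exact: geom_DB.
rewrite normcM ncR -mulrA ler_wpM2l//.
apply: le_trans (kc_DB_bound Dz Dw BB0 hBB j) _.
rewrite /Kj -[leRHS]mulrA; apply: ler_wpM2l.
  by rewrite !mulr_ge0// sumr_ge0// => i _; rewrite pf_ge0// mulr_ge0.
rewrite mulrCA ler_wpM2l ?powR_ge0//.
set d := Num.min _ _.
have A0 : 0 < normc (1 - z * w) by apply: lt_le_trans (nc_1zw_gew w Dz); rewrite subr_gt0.
have B0 : 0 < normc (1 - conjc z * w).
  by apply: lt_le_trans (nc_1zw_gew w (disk_conj Dz)); rewrite subr_gt0.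
have d0 : 0 < d by rewrite lt_min A0.
have d2 : d <= 2.
  rewrite ge_min; apply/orP; left; apply: le_trans (ncB _ _) _.
  by rewrite nc1 normcM lerD2l mulr_ile1 ?nc_ge0// ltW.
(* Lower orders are absorbed in the highest one by d <= 2, whence the factor 2^(m - j) in [Kj]. *)
have -> : d ^- j.+1 = d ^+ (m - j) * d ^- m.+1.
  have jm : (j <= m)%N by rewrite -ltnS.
  have e : ((m - j) + j.+1 = m.+1)%N by rewrite addnS subnK.
  by rewrite -[in d ^- m.+1]e exprD invfM mulrA divff ?mul1r// expf_neq0// gt_eqF.
rewrite ler_wpM2r ?invr_ge0 ?exprn_ge0 ?(ltW d0)//.
by rewrite lerXn2r ?nnegrE ?(ltW d0).
Qed.

End KernelBound.

(** * Existence of the representing function *)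

Section BergmanIntegral.
Variable R : realType.
Notation C := R[i].
Notation mu := (@lebesgue_measure R).
Notation mu2 := (@lebesgue_measure R \x @lebesgue_measure R)%E.
Variables (p lambda alpha : R).
Hypotheses (l0 : 0 <= lambda) (p0 : 0 < p) (a0 : 0 < alpha).
Notation cc := (c_const lambda).
Notation BI := (bergman_integral p lambda alpha).

Lemma nc_kernel_conj (z w : C) : normc (1 - conjc z * w) = normc (1 - z * conjc w).
Proof. by rewrite -ncJ rmorphB rmorph1 rmorphM/= conjcK. Qed.

Lemma Gamma_ge0 (x : R) : 0 <= Gamma x.
Proof.
rewrite /Gamma /Rintegral fine_ge0//; apply: integral_ge0 => t _.
by rewrite lee_fin mulr_ge0 ?powR_ge0 ?expR_ge0.
Qed.

Lemma c_const_ge0 : 0 <= cc.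
Proof. by rewrite /c_const divr_ge0 ?mulr_ge0 ?Gamma_ge0. Qed.

Lemma lambda_analytic_eq (f g : C -> C) : (forall z, disk z -> f z = g z) ->
  lambda_analytic lambda f -> lambda_analytic lambda g.
Proof.
move=> fg [h1 h2]; split; first exact: Ck_eq fg h1.
move=> z Dz; rewrite -(h2 z Dz) /dunkl_zbar /d_zbar.
by rewrite (partial_x_eq fg Dz) (partial_y_eq fg Dz) (refl_quotient_ext_eq fg Dz).
Qed.

Lemma measurable_normZ : measurable_fun (@diskR R) (fun q : R * R => normc (q.1 +i* q.2)).
Proof.
apply: (@measurable_disk_modulus R id) => z _.
by apply/continuous_complexP => e e0; exists e.
Qed.

Lemma measurable_weight : measurable_fun (@diskR R)
  (fun q : R * R => (1 - normc (q.1 +i* q.2)) `^ (alpha - 1)).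
Proof.
apply: (@measurableT_comp _ _ _ _ _ _ (fun t : R => t `^ (alpha - 1))).
  exact: measurable_powR.
by apply: measurable_funB => //; exact: measurable_normZ.
Qed.

Lemma measurable_height a : measurable_fun (@diskR R) (fun q : R * R => `|q.2| `^ a).
Proof.
apply: measurable_funTS.
apply: (@measurableT_comp _ _ _ _ _ _ (fun t : R => t `^ a)); first exact: measurable_powR.
exact: measurableT_comp.
Qed.

Lemma measurable_modp (f : C -> C) : continuous_on_disk f ->
  measurable_fun (@diskR R) (fun q : R * R => normc (f (q.1 +i* q.2)) `^ p).
Proof.
move=> cf; apply: (@measurableT_comp _ _ _ _ _ _ (fun t : R => t `^ p)).
  exact: measurable_powR.
exact: measurable_disk_modulus.
Qed.

Definition bint (f : C -> C) (q : R * R) : R :=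
  normc (f (q.1 +i* q.2)) `^ p * (1 - normc (q.1 +i* q.2)) `^ (alpha - 1) *
  (cc * `|q.2| `^ (2 * lambda)).

Lemma BIE f : BI f = (\int[mu2]_(q in @diskR R) (bint f q)%:E)%E.
Proof. by []. Qed.

Lemma bint_ge0 f q : 0 <= bint f q.
Proof.
apply: mulr_ge0; first by apply: mulr_ge0; exact: powR_ge0.
by apply: mulr_ge0; [exact: c_const_ge0|exact: powR_ge0].
Qed.

Lemma BI_ge0 f : (0 <= BI f)%E.
Proof. by rewrite BIE; apply: integral_ge0 => q _; rewrite lee_fin bint_ge0. Qed.

Lemma measurable_bint f : continuous_on_disk f -> measurable_fun (@diskR R) (bint f).
Proof.
move=> cf; apply: measurable_funM; last first.
  by apply: measurable_funM => //; exact: measurable_height.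
by apply: measurable_funM; [exact: measurable_modp|exact: measurable_weight].
Qed.

Lemma BI_le_int f (h : R * R -> R) : continuous_on_disk f -> measurable_fun (@diskR R) h ->
  (forall q, diskR q -> bint f q <= h q) -> (BI f <= \int[mu2]_(q in @diskR R) (h q)%:E)%E.
Proof.
move=> cf mh fh; rewrite BIE; apply: ge0_le_integral.
- exact: measurable_diskR.
- by move=> q _; rewrite lee_fin bint_ge0.
- by apply/measurable_EFinP; exact: measurable_bint.
- exact/measurable_EFinP.
- by move=> q Dq; rewrite lee_fin fh.
Qed.

(** At w = 0 the kernel is identically 1, so the kernel integral with any exponent above alpha + 1
    gives the mass of the weight. *)
Lemma weight_integral_finite : exists2 W, 0 < W &
  (\int[mu2]_(q in @diskR R) ((1 - normc (q.1 +i* q.2)) `^ (alpha - 1))%:E <= W%:E)%E.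
Proof.
have h : alpha + 1 < alpha + 2 by lra.
have [C0 C00 hC] := weighted_kernel_integral a0 h.
have D0 : disk (0 : C) by rewrite /disk/mkset nc0 ltr01.
exists (C0 + 1); first by rewrite ltr_wpDl.
have := hC 0 D0; rewrite nc0 subr0 powR1 mulr1 => h1.
apply: (@le_trans _ _ C0%:E); last by rewrite lee_fin lerDl.
apply: le_trans h1; rewrite le_eqVlt; apply/orP; left; apply/eqP; apply: eq_integral => q _.
by rewrite mulr0 subr0 nc1 powR1 mul1r.
Qed.

Lemma BI_bounded : exists2 W, 0 < W & forall f M, continuous_on_disk f -> 0 <= M ->
  (forall z, disk z -> normc (f z) <= M) -> (BI f <= (M `^ p * W)%:E)%E.
Proof.
have [W W0 hW] := weight_integral_finite.
have c0 := c_const_ge0.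
have cW : 0 <= cc * W by apply: mulr_ge0 => //; exact: ltW.
exists (cc * W + 1); first by rewrite ltr_wpDl.
move=> f M cf M0 fM.
pose h (q : R * R) := (M `^ p * cc) * (1 - normc (q.1 +i* q.2)) `^ (alpha - 1).
apply: (@le_trans _ _ (\int[mu2]_(q in @diskR R) (h q)%:E)%E).
  apply: BI_le_int => //.
    by apply: measurable_funM => //; exact: measurable_weight.
  move=> q Dq; rewrite /bint /h -mulrA mulrCA [leRHS]mulrC; apply: ler_wpM2l; rewrite ?powR_ge0//.
  apply: ler_pM; [exact: powR_ge0|by apply: mulr_ge0 => //; exact: powR_ge0| |].
    by apply: powR_le; [exact: ltW|exact: nc_ge0|exact: fM].
  rewrite ler_piMr//; apply: powR_le1 => //; first by rewrite mulr_ge0.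
  by apply: le_trans (Im_le (q.1 +i* q.2)) _; exact: ltW.
rewrite /h; under eq_integral => q _ do rewrite EFinM.
rewrite ge0_integralZl//; last first.
- by rewrite lee_fin mulr_ge0 ?powR_ge0.
- by move=> q _; rewrite lee_fin powR_ge0.
- by apply/measurable_EFinP; exact: measurable_weight.
- exact: measurable_diskR.
apply: (@le_trans _ _ ((M `^ p * cc)%:E * W%:E)%E).
  by apply: lee_wpmul2l => //; rewrite lee_fin mulr_ge0 ?powR_ge0.
by rewrite -EFinM lee_fin -mulrA ler_wpM2l ?powR_ge0// lerDl.
Qed.

Lemma dint_add (f g : R * R -> R) : (forall q, 0 <= f q) -> (forall q, 0 <= g q) ->
  measurable_fun (@diskR R) f -> measurable_fun (@diskR R) g ->
  (\int[mu2]_(q in @diskR R) (f q + g q)%:E =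
   \int[mu2]_(q in @diskR R) (f q)%:E + \int[mu2]_(q in @diskR R) (g q)%:E)%E.
Proof.
move=> f0 g0 mf mg; under eq_integral => q _ do rewrite EFinD.
have mD := @measurable_diskR R.
by apply: ge0_integralD => //; by [move=> q _; rewrite lee_fin|exact/measurable_EFinP].
Qed.

Lemma dint_scale (c : R) (f : R * R -> R) : 0 <= c -> (forall q, 0 <= f q) ->
  measurable_fun (@diskR R) f ->
  (\int[mu2]_(q in @diskR R) (c * f q)%:E = c%:E * \int[mu2]_(q in @diskR R) (f q)%:E)%E.
Proof.
move=> c0 f0 mf; under eq_integral => q _ do rewrite EFinM.
have mD := @measurable_diskR R.
by apply: ge0_integralZl => //; by [move=> q _; rewrite lee_fin|exact/measurable_EFinP].
Qed.

(** With M = max and d = min of A and B: y <= M turns the weight into M^(2 lambda (1-p)), and M <= d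
    + E splits this power. Bounding d^t by A^t + B^t then leaves pure powers of A and of B. In the
    application E is |1 - w^2|. *)
Lemma kernel_pointwise (A B E y : R) (m : nat) : p <= 1 -> 0 < A -> 0 < B -> 0 <= E -> 0 <= y ->
  2 * y <= A + B -> A <= E + B -> B <= E + A ->
  (Num.max A B `^ (- (2 * lambda)) * Num.min A B ^- m.+1) `^ p * y `^ (2 * lambda) <=
  2 `^ (2 * lambda * (1 - p)) *
    (A `^ (- (m.+1%:R * p - 2 * lambda * (1 - p))) + B `^ (- (m.+1%:R * p - 2 * lambda * (1 - p))) +
     E `^ (2 * lambda * (1 - p)) * (A `^ (- (m.+1%:R * p)) + B `^ (- (m.+1%:R * p)))).
Proof.
move=> p1 A0 B0 E0 y0 yAB AE BE.
set M := Num.max A B; set d := Num.min A B.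
set g := 2 * lambda * (1 - p); set s := m.+1%:R * p.
have M0 : 0 < M by rewrite lt_max A0.
have d0 : 0 < d by rewrite lt_min A0.
have g0 : 0 <= g by rewrite /g !mulr_ge0// subr_ge0.
have yM : y <= M.
  have : A <= M by rewrite le_max lexx.
  have : B <= M by rewrite le_max lexx orbT.
  by move: M0; clearbody M => *; lra.
have MdE : M <= d + E.
  rewrite /M /d; case: (lerP A B) => h; rewrite addrC//.
have d_le t : d `^ t <= A `^ t + B `^ t.
  by rewrite /d; case: (lerP A B) => _; rewrite ?lerDl ?lerDr powR_ge0.
apply: (@le_trans _ _ (M `^ g * d `^ (- s))).
  rewrite powRM ?powR_ge0 ?invr_ge0 ?exprn_ge0 ?(ltW d0)//.
  have -> : d ^- m.+1 = d `^ (- m.+1%:R) by rewrite powRN powR_mulrn ?(ltW d0).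
  have e1 : (M `^ (- (2 * lambda))) `^ p = M `^ (- (2 * lambda) * p) by rewrite powRrM.
  have e2 : (d `^ (- m.+1%:R)) `^ p = d `^ (- s) by rewrite -powRrM mulNr.
  rewrite e1 e2 mulrAC ler_wpM2r ?powR_ge0//.
  apply: (@le_trans _ _ (M `^ (- (2 * lambda) * p) * M `^ (2 * lambda))).
    by rewrite ler_wpM2l ?powR_ge0// powR_le// mulr_ge0.
  by rewrite -powR_add// (_ : - (2 * lambda) * p + 2 * lambda = g)// /g; ring.
have Mg : M `^ g <= 2 `^ g * (d `^ g + E `^ g).
  have h : M <= 2 * Num.max d E.
    apply: le_trans MdE _; rewrite mulr_natl mulr2n lerD// le_max lexx ?orbT//.
  apply: (@le_trans _ _ ((2 * Num.max d E) `^ g)); first by apply: powR_le => //; exact: ltW.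
  rewrite powRM//; last by rewrite le_max (ltW d0).
  rewrite ler_wpM2l ?powR_ge0//; case: (lerP d E) => _; rewrite ?lerDl ?lerDr powR_ge0//.
apply: le_trans (ler_wpM2r (powR_ge0 _ _) Mg) _.
rewrite -mulrA ler_wpM2l ?powR_ge0// mulrDl; apply: lerD.
  rewrite -powR_add// (_ : g + - s = - (s - g)); last by ring.
  exact: d_le.
by rewrite ler_wpM2l ?powR_ge0.
Qed.

(** The exponents s and s - g both exceed alpha + 1, so each power of A or B integrates to a power
    of 1 - |w|; B is the kernel at conj(w). The two orders agree because (1 - |w|)^g <= |1 -
    w^2|^g. *)
Lemma kernel_integral_bound (m : nat) (s := m.+1%:R * p) (g := 2 * lambda * (1 - p)) :
  p <= 1 -> alpha + 1 + g < s ->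
  exists2 C1, 0 < C1 & forall (w : C) (f : C -> C) K, disk w -> 0 <= K -> continuous_on_disk f ->
  (forall z, disk z -> normc (f z) <= K *
    (Num.max (normc (1 - z * w)) (normc (1 - conjc z * w)) `^ (- (2 * lambda)) *
     Num.min (normc (1 - z * w)) (normc (1 - conjc z * w)) ^- m.+1)) ->
  (BI f <= (K `^ p * (C1 * (normc (1 - w ^+ 2) `^ g * (1 - normc w) `^ (alpha + 1 - s))))%:E)%E.
Proof.
move=> p1 hs.
have g0 : 0 <= g by rewrite /g !mulr_ge0// subr_ge0.
have hs1 : alpha + 1 < s by apply: le_lt_trans hs; rewrite lerDl.
have hs2 : alpha + 1 < s - g by rewrite ltrBrDr.
have [CA CA0 hCA] := weighted_kernel_integral a0 hs1.
have [CB CB0 hCB] := weighted_kernel_integral a0 hs2.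
have c0 := c_const_ge0.
pose C1 := cc * 2 `^ g * (2 * CB + 2 * CA).
have C10 : 0 <= C1.
  apply: mulr_ge0; first by apply: mulr_ge0 => //; exact: powR_ge0.
  by apply: addr_ge0; apply: mulr_ge0.
exists (C1 + 1); first by rewrite ltr_wpDl.
move=> w f K Dw K0 cf hf.
set E := normc (1 - w ^+ 2); set v := 1 - normc w.
have Dwb := disk_conj Dw.
have v0 : 0 < v by rewrite subr_gt0.
have vE : v <= E.
  have h := nc_1zw_gew w Dw; rewrite -expr2 in h; exact: h.
pose wt (q : R * R) := (1 - normc (q.1 +i* q.2)) `^ (alpha - 1).
pose kA t (q : R * R) := normc (1 - (q.1 +i* q.2) * w) `^ (- t) * wt q.
pose kB t (q : R * R) := normc (1 - (q.1 +i* q.2) * conjc w) `^ (- t) * wt q.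
have mk (w' : C) t : measurable_fun (@diskR R) (fun q : R * R => normc (1 - (q.1 +i* q.2) * w') `^ (- t) * wt q).
  apply: measurable_funM; last exact: measurable_weight.
  apply: (@measurableT_comp _ _ _ _ _ _ (fun x : R => x `^ (- t))); first exact: measurable_powR.
  apply: (@measurable_disk_modulus R (fun z => 1 - z * w')) => z _.
  apply/continuous_complexP => e e0; exists (e / (normc w' + 1)).
    by rewrite divr_gt0// ltr_wpDl ?nc_ge0.
  move=> z' hz; have -> : 1 - z' * w' - (1 - z * w') = - ((z' - z) * w') by ring.
  rewrite ncN normcM; rewrite ltr_pdivlMr ?ltr_wpDl ?nc_ge0// in hz.
  by apply: le_lt_trans hz; rewrite ler_wpM2l ?nc_ge0// lerDl.
pose h (q : R * R) := (K `^ p * (cc * 2 `^ g)) *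
  (kA (s - g) q + kB (s - g) q + E `^ g * (kA s q + kB s q)).
have mh : measurable_fun (@diskR R) h.
  apply: measurable_funM => //; apply: measurable_funD.
    by apply: measurable_funD; exact: mk.
  by apply: measurable_funM => //; apply: measurable_funD; exact: mk.
apply: (@le_trans _ _ (\int[mu2]_(q in @diskR R) (h q)%:E)%E).
  apply: BI_le_int => // q Dq; set z := q.1 +i* q.2.
  rewrite /bint /h /kA /kB -/z.
  have eB : normc (1 - conjc z * w) = normc (1 - z * conjc w).
    exact: nc_kernel_conj.
  set A := normc (1 - z * w); set B := normc (1 - z * conjc w).
  have A0 : 0 < A by apply: lt_le_trans (nc_1zw_gew w Dq); rewrite subr_gt0.
  have B0 : 0 < B by apply: lt_le_trans (nc_1zw_gew (conjc w) Dq); rewrite ncJ subr_gt0.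
  have hy : 2 * `|q.2| <= A + B.
    (* The terms in w cancel; what is left is conj(z) - z, of modulus 2 |y|. *)
    have e : conjc z * (1 - z * w) - z * (1 - conjc z * w) = 0 -i* (2 * q.2) by
      rewrite /z; case: (w) => w1 w2; apply/eqP; rewrite eq_complex/=; apply/andP; split; apply/eqP; ring.
    have : normc (0 -i* (2 * q.2) : C) = 2 * `|q.2|.
      by rewrite /= expr0n add0r sqrtr_sqr normrN normrM ger0_norm.
    rewrite -e => <-; apply: le_trans (ncB _ _) _; rewrite !normcM ncJ eB.
    by apply: lerD; rewrite ler_piMl ?nc_ge0// ltW.
  (* 1 - z w = (1 - w^2) + w (w - z), and |w - z| <= |1 - z conj(w)| in the disk. *)
  have hA : A <= E + B.
    have -> : A = normc ((1 - w ^+ 2) + w * (w - z)) by congr normc; ring.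
    apply: le_trans (ncD _ _) _; rewrite lerD2l normcM.
    apply: (@le_trans _ _ (normc (w - z))); first by rewrite ler_piMl ?nc_ge0// ltW.
    by rewrite nc_distC; have := nc_sub_le Dq Dwb; rewrite conjcK.
  have hB : B <= E + A.
    have -> : B = normc ((1 - w ^+ 2) + w * (w - conjc z)) by rewrite /B -eB; congr normc; ring.
    apply: le_trans (ncD _ _) _; rewrite lerD2l normcM.
    apply: (@le_trans _ _ (normc (w - conjc z))); first by rewrite ler_piMl ?nc_ge0// ltW.
    by rewrite /A mulrC; exact: nc_sub_le.
  have kp := kernel_pointwise m p1 A0 B0 (nc_ge0 _) (normr_ge0 q.2) hy hA hB.
  rewrite -/s -/g -/E in kp.
  have fp : normc (f z) `^ p <= K `^ p * (Num.max A B `^ (- (2 * lambda)) * Num.min A B ^- m.+1) `^ p.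
    rewrite -powRM//; last by rewrite mulr_ge0 ?powR_ge0 ?invr_ge0 ?exprn_ge0// le_min !ltW.
    by apply: powR_le; [exact: ltW|exact: nc_ge0|rewrite /A /B -eB; exact: hf].
  move: fp kp; rewrite -/(wt q).
  have w0 : 0 <= wt q by exact: powR_ge0.
  have Kp0 : 0 <= K `^ p by exact: powR_ge0.
  move: (normc (f z) `^ p) ((Num.max A B `^ _ * _) `^ p) (`|q.2| `^ _) (powR_ge0 `|q.2| (2 * lambda)) => F X Y Y0 hF.
  move: (K `^ p) (wt q) (2 `^ g) (A `^ _) (B `^ _) (E `^ _) (A `^ _) (B `^ _) hF Kp0 w0
    => k W t x1 x2 x3 x4 x5 hF k0 W0 kp.
  move: (c_const lambda) c0 => c c0.
  apply: (@le_trans _ _ ((k * c * W) * (X * Y))).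
    have -> : F * W * (c * Y) = (W * c * Y) * F by ring.
    have -> : k * c * W * (X * Y) = (W * c * Y) * (k * X) by ring.
    by rewrite ler_wpM2l// !mulr_ge0.
  apply: le_trans (ler_wpM2l _ kp) _; first by rewrite !mulr_ge0.
  by rewrite le_eqVlt; apply/orP; left; apply/eqP; ring.
have kc0 : 0 <= K `^ p * (cc * 2 `^ g).
  by apply: mulr_ge0; [exact: powR_ge0|apply: mulr_ge0 => //; exact: powR_ge0].
have k0 (w' : C) t q : 0 <= normc (1 - (q.1 +i* q.2) * w') `^ (- t) * wt q.
  by rewrite mulr_ge0 ?powR_ge0.
have iA t q : (0 <= (kA t q)%:E)%E by rewrite lee_fin k0.
have iB t q : (0 <= (kB t q)%:E)%E by rewrite lee_fin k0.
have mA t : measurable_fun (@diskR R) (fun q => (kA t q)%:E) by apply/measurable_EFinP; exact: mk.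
have mB t : measurable_fun (@diskR R) (fun q => (kB t q)%:E) by apply/measurable_EFinP; exact: mk.
have mD := @measurable_diskR R.
have -> : (\int[mu2]_(q in @diskR R) (h q)%:E =
  (K `^ p * (cc * 2 `^ g))%:E * (\int[mu2]_(q in @diskR R) (kA (s - g) q)%:E +
    \int[mu2]_(q in @diskR R) (kB (s - g) q)%:E + (E `^ g)%:E *
   (\int[mu2]_(q in @diskR R) (kA s q)%:E + \int[mu2]_(q in @diskR R) (kB s q)%:E)))%E.
  have m1 t : measurable_fun (@diskR R) (kA t) by exact: mk.
  have m2 t : measurable_fun (@diskR R) (kB t) by exact: mk.
  have k1 t q : 0 <= kA t q by exact: k0.
  have k2 t q : 0 <= kB t q by exact: k0.
  have m3 t : measurable_fun (@diskR R) (fun q => kA t q + kB t q) by exact: measurable_funD.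
  have k3 t q : 0 <= kA t q + kB t q by exact: addr_ge0.
  have m4 : measurable_fun (@diskR R) (fun q => E `^ g * (kA s q + kB s q)) by exact: measurable_funM.
  have k4 q : 0 <= E `^ g * (kA s q + kB s q) by rewrite mulr_ge0 ?powR_ge0.
  rewrite (dint_scale kc0 (fun q => addr_ge0 (k3 (s - g) q) (k4 q)) (measurable_funD (m3 _) m4)).
  rewrite (dint_add (k3 _) k4 (m3 _) m4) (dint_add (k1 _) (k2 _) (m1 _) (m2 _)).
  by rewrite (dint_scale (powR_ge0 _ _) (k3 _) (m3 _)) (dint_add (k1 _) (k2 _) (m1 _) (m2 _)).
apply: (@le_trans _ _ ((K `^ p * (cc * 2 `^ g))%:E *
  ((CB * v `^ (alpha + 1 - (s - g)))%:E + (CB * v `^ (alpha + 1 - (s - g)))%:E +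
   (E `^ g)%:E * ((CA * v `^ (alpha + 1 - s))%:E + (CA * v `^ (alpha + 1 - s))%:E)))%E).
  apply: lee_wpmul2l; first by rewrite lee_fin; exact: kc0.
  have hCA' := hCA _ Dwb; have hCB' := hCB _ Dwb; rewrite ncJ in hCA' hCB'.
  apply: leeD; first by apply: leeD; [exact: hCB|exact: hCB'].
  by apply: lee_wpmul2l; [rewrite lee_fin powR_ge0|apply: leeD; [exact: hCA|exact: hCA']].
have eE (a b c d : R) : (a%:E * ((b%:E + b%:E) + d%:E * (c%:E + c%:E)) = (a * ((b + b) + d * (c + c)))%:E)%E by [].
rewrite eE lee_fin -mulrA; apply: ler_wpM2l; first exact: powR_ge0.
have e : v `^ (alpha + 1 - (s - g)) = v `^ g * v `^ (alpha + 1 - s).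
  by rewrite -powR_add//; congr (_ `^ _); ring.
have vg : v `^ g <= E `^ g by apply: powR_le => //; exact: ltW.
rewrite e; move: (v `^ (alpha + 1 - s)) (powR_ge0 v (alpha + 1 - s)) => V V0.
apply: (@le_trans _ _ (C1 * (E `^ g * V))); last first.
  by rewrite ler_wpM2r ?lerDl// mulr_ge0 ?powR_ge0.
rewrite /C1; move: (c_const lambda) c0 => c c0.
have -> : c * 2 `^ g * (2 * CB + 2 * CA) * (E `^ g * V) = c * 2 `^ g * ((CB * V + CB * V) * E `^ g + E `^ g * (CA * V + CA * V)) by ring.
rewrite ler_wpM2l ?mulr_ge0 ?powR_ge0// lerD2r.
have -> : CB * (v `^ g * V) + CB * (v `^ g * V) = (CB * V + CB * V) * v `^ g by ring.
by rewrite ler_wpM2l// addr_ge0 ?mulr_ge0.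
Qed.

End BergmanIntegral.

(** * Functionals on series with geometric coefficients *)

Section Duality.
Variable R : realType.
Notation C := R[i].
Notation mu2 := (@lebesgue_measure R \x @lebesgue_measure R)%E.
Variables (p lambda alpha : R).
Hypotheses (l0 : 0 <= lambda) (p0 : 0 < p) (a0 : 0 < alpha).
Notation BI := (bergman_integral p lambda alpha).
Notation bergman := (bergman p lambda alpha).
Notation F b := (PS (phic lambda b)).

Let pn0 k : 0 <= pn lambda k. Proof. exact: ltW (pn_gt0 l0 k). Qed.

(** As [pn n] bounds phi_n on the disk, such series converge uniformly there, hence lie in the
    space. Polynomials, kernels and dilates are all of this form. *)
Definition geoB (b : nat -> C) K q :=
  [/\ 0 <= K, 0 <= q, q < 1 & forall n, normc (b n) * pn lambda n <= K * q ^+ n].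

Lemma geoB_subexp b K q : geoB b K q -> subexp (fun n => normc (b n)).
Proof.
case=> K0 q0 q1 h; apply: (@subexp_le _ _ (fun=> K)); last exact: subexp_cst.
move=> n; rewrite !ger0_norm ?nc_ge0//.
apply: (@le_trans _ _ (normc (b n) * pn lambda n)).
  by rewrite ler_peMr ?nc_ge0// pn_ge1.
by apply: le_trans (h n) _; rewrite ler_piMr// exprn_ile1// ltW.
Qed.

Lemma PS_phic b z : F b z = csum (fun n => b n * phi lambda n z).
Proof. by apply: eq_csum => n; exact: hterm_phic. Qed.

Lemma geoB_geom_le b K q z : geoB b K q -> disk z ->
  geom_le (fun n => b n * phi lambda n z) K q.
Proof.
case=> K0 q0 q1 h Dz; split=> // n; rewrite normcM; apply: le_trans (h n).
rewrite ler_wpM2l ?nc_ge0//; apply: le_trans (phi_le l0 n z) _.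
by rewrite ler_piMr ?(ltW (pn_gt0 _ _))// exprn_ile1 ?nc_ge0 ?ltW.
Qed.

Lemma PS_le_geoB b K q z : geoB b K q -> disk z -> normc (F b z) <= 2 * K / (1 - q).
Proof. by move=> hb Dz; rewrite PS_phic; exact: csum_le (geoB_geom_le hb Dz). Qed.

Lemma geoB_lin c b b' K q K' q' : geoB b K q -> geoB b' K' q' ->
  exists K2 q2, geoB (fun n => c * b n + b' n) K2 q2.
Proof.
case=> K0 q0 q1 h [K'0 q'0 q'1 h'].
exists (normc c * K + K'), (Num.max q q'); split.
- by rewrite addr_ge0// mulr_ge0 ?nc_ge0.
- by rewrite le_max q0.
- by rewrite gt_max q1.
move=> n; have := geo_max n (mulr_ge0 (nc_ge0 c) K0) K'0 q0 q'0; apply: le_trans.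
apply: (@le_trans _ _ (normc c * (normc (b n) * pn lambda n) + normc (b' n) * pn lambda n)).
  by rewrite mulrA -mulrDl ler_wpM2r ?(ltW (pn_gt0 _ _))// (le_trans (ncD _ _))// normcM.
by apply: lerD => //; rewrite -mulrA ler_wpM2l ?nc_ge0.
Qed.

Lemma PS_lin c b b' K q K' q' z : geoB b K q -> geoB b' K' q' -> disk z ->
  F (fun n => c * b n + b' n) z = c * F b z + F b' z.
Proof.
move=> h h' Dz; have g1 := geoB_geom_le h Dz; have g2 := geoB_geom_le h' Dz.
have e1 : geom (fun n => b n * phi lambda n z) by exists K, q.
have e2 : geom (fun n => b' n * phi lambda n z) by exists K', q'.
rewrite !PS_phic -csumZ// -csumD//; last exact: geomZ.
by apply: eq_csum => n; rewrite mulrDl mulrA.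
Qed.

Lemma PS_cont b K q : geoB b K q -> continuous_on_disk (F b).
Proof. by move=> h; apply: PS_continuous; apply: subc_phic => //; exact: geoB_subexp h. Qed.

Lemma BI_eq f g : (forall z, disk z -> f z = g z) -> BI f = BI g.
Proof.
move=> fg; rewrite !BIE; apply: eq_integral => q; rewrite inE => Dq.
by rewrite /bint fg.
Qed.

Lemma bergman_eq f g : (forall z, disk z -> f z = g z) -> bergman f -> bergman g.
Proof.
move=> fg [h1 h2]; split; first exact: lambda_analytic_eq fg h1.
by rewrite -(BI_eq fg).
Qed.

Lemma bergman_geoB b K q : geoB b K q -> bergman (F b).
Proof.
move=> hb; split; first by apply: lambda_analytic_PS => //; exact: geoB_subexp hb.
have [W W0 hW] := @BI_bounded R p lambda alpha l0 p0 a0.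
have := hW (F b) (2 * K / (1 - q)) (PS_cont hb); case: (hb) => K0 q0 q1 _.
move=> /(_ _ _)/le_lt_trans; apply; last exact: ltry.
  by rewrite divr_ge0 ?mulr_ge0// subr_ge0 ltW.
by move=> z Dz; exact: PS_le_geoB hb Dz.
Qed.

Lemma BI_zero f : (forall z, disk z -> f z = 0) -> BI f = 0%E.
Proof.
move=> f0; rewrite BIE integral0_eq// => q Dq; rewrite /bint f0// nc0 powR0 ?gt_eqF//.
by rewrite !mul0r.
Qed.

Lemma BI_scale f (c : R) : continuous_on_disk f -> 0 <= c ->
  BI (fun z => c%:C * f z) = ((c `^ p)%:E * BI f)%E.
Proof.
move=> cf c0; rewrite !BIE -(dint_scale (powR_ge0 _ _))//; last 2 first.
- by move=> q; exact: bint_ge0.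
- exact: measurable_bint.
apply: eq_integral => q _; congr (_%:E).
by rewrite /bint normcM ncR ger0_norm// powRM ?nc_ge0// !mulrA.
Qed.

Variable L : (C -> C) -> C.
Hypothesis hL : bergman_dual p lambda alpha L.

Lemma dual_ext f g : bergman f -> bergman g -> (forall z, disk z -> f z = g z) -> L f = L g.
Proof.
move=> bf bg fg; apply/esym/eqP; rewrite -subr_eq0 -nc_eq0; apply/eqP.
apply/eqP; rewrite eq_le nc_ge0 andbT; apply/ler_addgt0Pr => e e0; rewrite add0r.
have [d d0 hd] := hL.2 f bf e e0; apply: ltW; apply: hd => //.
rewrite /bergman_norm BI_zero ?powR0 ?invr_neq0 ?gt_eqF// => z Dz.
by rewrite fg ?subrr.
Qed.

Notation ell b := (L (F b)).

Lemma ell_lin c b b' K q K' q' : geoB b K q -> geoB b' K' q' ->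
  ell (fun n => c * b n + b' n) = c * ell b + ell b'.
Proof.
move=> h h'; have [K2 [q2 h2]] := geoB_lin c h h'.
rewrite -(hL.1 c _ _ (bergman_geoB h) (bergman_geoB h')).
have e z : disk z -> F (fun n => c * b n + b' n) z = c * F b z + F b' z.
  exact: PS_lin h h'.
apply: dual_ext => //; first exact: bergman_geoB h2.
exact: bergman_eq e (bergman_geoB h2).
Qed.

Lemma geoB0 : geoB (fun=> 0) 0 0.
Proof. by split=> // n; rewrite nc0 !mul0r. Qed.

Lemma ell0 : ell (fun=> 0) = 0.
Proof.
have := ell_lin 1 geoB0 geoB0.
rewrite (_ : (fun n : nat => 1 * 0 + 0) = (fun=> 0 : C)); last by apply/funext => n; rewrite mulr0 addr0.
rewrite mul1r.
by move/eqP; rewrite -subr_eq0 opprD addrA subrr sub0r oppr_eq0 => /eqP.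
Qed.

Lemma F_zero z : F (fun=> 0) z = 0.
Proof.
rewrite PS_phic; apply: (@csum_unique _ _ _ 0 0) => //.
  by exists 0, 0; split=> // n; rewrite !mul0r nc0.
by move=> N; rewrite big1 ?subrr ?nc0 ?mul0r// => k _; rewrite mul0r.
Qed.

(** Continuity at 0 and homogeneity alone give the bound, so no triangle inequality for the norm is
    involved. *)
Lemma ell_bounded : exists2 La, 0 <= La & forall b K q X, geoB b K q -> 0 < X ->
  (BI (F b) <= X%:E)%E -> normc (ell b) <= La * X `^ p^-1.
Proof.
have [d d0 hd] := hL.2 _ (bergman_geoB geoB0) 1 ltr01.
exists (2 / d); first by rewrite divr_ge0 ?ltW.
move=> b K q X hb X0 bX.
set Y := X `^ p^-1; have Y0 : 0 < Y by rewrite powR_gt0.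
(* Scaling by c brings the norm to at most d / 2. *)
pose c := d / (2 * Y); have c0 : 0 < c by rewrite divr_gt0 ?mulr_gt0.
have [K2 [q2 h2]] := geoB_lin c%:C hb geoB0.
have e := ell_lin c%:C hb geoB0; rewrite ell0 addr0 in e.
have := hd _ (bergman_geoB h2); rewrite ell0 subr0 e => /(_ _)/wrap[].
  rewrite /bergman_norm (@BI_eq _ (fun z => c%:C * F b z)); last first.
    by move=> z Dz; rewrite F_zero subr0 (PS_lin _ hb geoB0)// F_zero addr0.
  rewrite BI_scale ?(ltW c0)//; last exact: PS_cont hb.
  have h : ((c `^ p)%:E * BI (F b) <= ((d / 2) `^ p)%:E)%E.
    apply: (@le_trans _ _ ((c `^ p)%:E * X%:E)%E).
      by apply: lee_wpmul2l => //; rewrite lee_fin powR_ge0.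
    have -> : X = Y `^ p by rewrite /Y -powRrM mulVf ?gt_eqF// powRr1// ltW.
    rewrite -EFinM lee_fin -powRM ?(ltW c0) ?(ltW Y0)//.
    have -> : c * Y = d / 2 by rewrite /c; field; rewrite gt_eqF.
    by [].
  have f0 : (0 <= (c `^ p)%:E * BI (F b))%E by rewrite mule_ge0 ?lee_fin ?powR_ge0 ?BI_ge0.
  have h' : fine ((c `^ p)%:E * BI (F b))%E <= (d / 2) `^ p.
    rewrite -lee_fin fineK// ge0_fin_numE//; exact: le_lt_trans h (ltry _).
  apply: (@le_lt_trans _ _ (((d / 2) `^ p) `^ p^-1)).
    by apply: powR_le => //; [rewrite invr_ge0 ltW|rewrite fine_ge0].
  rewrite -powRrM mulfV ?gt_eqF// powRr1 ?divr_ge0 ?ltW//.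
  by rewrite ltr_pdivrMr// ltr_pMr// ltr1n.
rewrite normcM ncR gtr0_norm// => h.
have -> : 2 / d * Y = c^-1 by rewrite /c; field; rewrite !gt_eqF.
by rewrite -[leRHS]mul1r ler_pdivlMr// mulrC ltW.
Qed.

Lemma ell_sup_bounded : exists2 La, 0 <= La & forall b K q M, geoB b K q -> 0 < M ->
  (forall z, disk z -> normc (F b z) <= M) -> normc (ell b) <= La * M.
Proof.
have [La La0 hLa] := ell_bounded.
have [W W0 hW] := @BI_bounded R p lambda alpha l0 p0 a0.
exists (La * W `^ p^-1); first by rewrite mulr_ge0 ?powR_ge0.
move=> b K q M hb M0 hM.
have := hLa b K q (M `^ p * W) hb; rewrite mulr_gt0 ?powR_gt0// => /(_ isT).
move=> /(_ (hW _ _ (PS_cont hb) (ltW M0) hM)) /le_trans; apply.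
rewrite powRM ?powR_ge0 ?(ltW W0)// -powRrM mulfV ?gt_eqF// powRr1 ?(ltW M0)//.
by rewrite -mulrA ler_wpM2l// mulrC.
Qed.

(** The coefficient sequence of phi_k, so that [F (dlt k)] is phi_k written as a series of the class
    above. *)
Definition dlt (k n : nat) : C := (n == k)%:R.

Lemma geoB_trunc (b : nat -> C) N : exists K, geoB (fun n => if (n < N)%N then b n else 0) K 2^-1.
Proof.
pose K := \sum_(i < N) normc (b i) * pn lambda i * 2 ^+ i.
have t0 i : 0 <= normc (b i) * pn lambda i * 2 ^+ i.
  by apply: mulr_ge0; [apply: mulr_ge0; [exact: nc_ge0|exact: pn0]|exact: exprn_ge0].
have K0 : 0 <= K by apply: sumr_ge0 => i _.
exists K; split=> //; first by rewrite invf_lt1// ltr1n.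
move=> n; case: ifP => nN; last by rewrite nc0 mul0r mulr_ge0 ?exprn_ge0.
rewrite exprVn ler_pdivlMr ?exprn_gt0//.
by rewrite /K (bigD1 (Ordinal nN))//= lerDl sumr_ge0.
Qed.

Lemma geoB_dlt k : exists K, geoB (dlt k) K 2^-1.
Proof.
have [K h] := geoB_trunc (dlt k) k.+1; exists K.
rewrite (_ : dlt k = (fun n => if (n < k.+1)%N then dlt k n else 0))//.
apply/funext => n; case: ltnP => // nk.
by rewrite /dlt gtn_eqF.
Qed.

Lemma F_trunc (b : nat -> C) N z : F (fun n => if (n < N)%N then b n else 0) z =
  \sum_(k < N) b k * phi lambda k z.
Proof.
rewrite PS_phic.
pose u n := (if (n < N)%N then b n else 0) * phi lambda n z.
have uN n : (N <= n)%N -> u n = 0 by rewrite /u ltnNge => ->; rewrite mul0r.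
have su M : (N <= M)%N -> \sum_(0 <= k < M) u k = \sum_(k < N) b k * phi lambda k z.
  move=> NM; rewrite (@big_cat_nat _ _ _ N 0 M)//= [X in _ + X]big_nat [X in _ + X]big1; last first.
    by move=> i /andP[Ni _]; exact: uN.
  by rewrite addr0 big_mkord; apply: eq_bigr => i _; rewrite /u ltn_ord.
pose K := \sum_(i < N) (normc (u i) + normc (\sum_(k < N) b k * phi lambda k z - \sum_(0 <= k < i) u k)) * 2 ^+ i.
have t0 i : 0 <= (normc (u i) + normc (\sum_(k < N) b k * phi lambda k z - \sum_(0 <= k < i) u k)) * 2 ^+ i.
  by rewrite mulr_ge0 ?addr_ge0 ?nc_ge0 ?exprn_ge0.
have K0 : 0 <= K by apply: sumr_ge0 => i _.
have hK n x : (n < N)%N -> x <= normc (u n) + normc (\sum_(k < N) b k * phi lambda k z - \sum_(0 <= k < n) u k) -> x <= K * 2^-1 ^+ n.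
  move=> nN hx; rewrite exprVn ler_pdivlMr ?exprn_gt0//.
  apply: le_trans (ler_wpM2r _ hx) _; first exact: exprn_ge0.
  by rewrite /K [leRHS](bigD1 (Ordinal nN))//= lerDl sumr_ge0.
have hl : 2^-1 < 1 :> R by rewrite invf_lt1// ltr1n.
apply: (@csum_unique _ _ _ K 2^-1) => //.
  exists K, 2^-1; split=> // n; rewrite -/(u n); case: (ltnP n N) => nN.
    by apply: (hK n) => //; rewrite lerDl nc_ge0.
  by rewrite uN// nc0 mulr_ge0 ?exprn_ge0.
move=> n; case: (ltnP n N) => nN; first by apply: (hK n) => //; rewrite lerDr nc_ge0.
by rewrite -/u su// subrr nc0 mulr_ge0 ?exprn_ge0.
Qed.

Lemma F_dlt k z : F (dlt k) z = phi lambda k z.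
Proof.
rewrite (_ : dlt k = (fun n => if (n < k.+1)%N then dlt k n else 0)); last first.
  by apply/funext => n; case: ltnP => // nk; rewrite /dlt gtn_eqF.
rewrite F_trunc big_ord_recr/= /dlt eqxx mul1r big1 ?add0r// => i _.
by rewrite ltn_eqF// mul0r.
Qed.

Lemma phi_poly_F n a z : phi_poly lambda n a z = F (fun k => if (k < n.+1)%N then a k else 0) z.
Proof. by rewrite F_trunc. Qed.

Lemma ell_trunc (b : nat -> C) N : ell (fun n => if (n < N)%N then b n else 0) =
  \sum_(k < N) b k * ell (dlt k).
Proof.
elim: N => [|N IH]; first by rewrite big_ord0 -[RHS]ell0.
have [K1 h1] := geoB_dlt N; have [K2 h2] := geoB_trunc b N.
rewrite big_ord_recr/= -IH addrC -(ell_lin _ h1 h2); congr (L (F _)).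
apply/funext => n; rewrite ltnS leq_eqVlt /dlt.
by case: (ltngtP n N) => [nN|nN|->]/=; rewrite ?mulr0 ?mulr1 ?add0r ?addr0.
Qed.

Lemma ell_phi_poly n a : L (phi_poly lambda n a) = \sum_(k < n.+1) a k * ell (dlt k).
Proof.
have [K h] := geoB_trunc a n.+1.
rewrite -ell_trunc; apply: dual_ext => //; last by move=> z _; rewrite phi_poly_F.
  by apply: bergman_eq (bergman_geoB h) => z _; rewrite phi_poly_F.
exact: bergman_geoB h.
Qed.

Lemma ell_dlt_le : exists2 La, 0 <= La & forall k, normc (ell (dlt k)) <= La * pn lambda k.
Proof.
have [La La0 h] := ell_sup_bounded; exists La => // k.
have [K hk] := geoB_dlt k; apply: (h _ _ _ _ hk); first exact: pn_gt0.
move=> z Dz; rewrite F_dlt; apply: le_trans (phi_le l0 k z) _.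
by rewrite ler_piMr ?(ltW (pn_gt0 _ _))// exprn_ile1 ?nc_ge0 ?ltW.
Qed.

(** On the disk the tail after N terms is at most M Q^N, so [ell_sup_bounded] makes L of it small.
    Enlarging K to K + 1 and q to a positive Q keeps that bound positive. *)
Lemma ell_csum b K q : geoB b K q -> ell b = csum (fun n => b n * ell (dlt n)).
Proof.
move=> hb; have [La La0 hLa] := ell_dlt_le; have [Ls Ls0 hLs] := ell_sup_bounded.
case: (hb) => K0 q0 q1 bq.
have [Q /andP[Q0 Q1] qQ] := between_lt1 q0 q1.
pose M := 2 * (K + 1) / (1 - Q).
have M0 : 0 < M by rewrite divr_gt0 ?mulr_gt0 ?subr_gt0// ltr_wpDl.
apply/esym; apply: (@csum_unique _ _ _ (Ls * M) Q) => //.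
- exists (La * K), q; split=> //; first exact: mulr_ge0.
  move=> n; rewrite normcM; apply: le_trans (ler_wpM2l (nc_ge0 _) (hLa n)) _.
  by rewrite mulrCA -mulrA ler_wpM2l.
- by rewrite mulr_ge0 ?(ltW M0).
- exact: ltW.
move=> N; have [K1 h1] := geoB_trunc b N.
pose t n := if (n < N)%N then 0 else b n.
have ht : geoB t ((K + 1) * Q ^+ N / Q ^+ N) Q.
  rewrite mulfK ?expf_neq0 ?gt_eqF//.
  split=> //; [by rewrite addr_ge0|exact: ltW|].
  move=> n; rewrite /t; case: ifP => _.
    by rewrite nc0 mul0r mulr_ge0 ?addr_ge0// exprn_ge0// ltW.
  apply: le_trans (bq n) _; apply: ler_pM => //; [exact: exprn_ge0|by rewrite lerDl|].
  by rewrite lerXn2r ?nnegrE// ?(ltW Q0) ?(ltW qQ).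
rewrite mulfK ?expf_neq0 ?gt_eqF// in ht.
have e : b = (fun n => 1 * (if (n < N)%N then b n else 0) + t n).
  by apply/funext => n; rewrite /t mul1r; case: ifP => _; rewrite ?addr0 ?add0r.
rewrite {1}e (ell_lin 1 h1 ht) mul1r ell_trunc big_mkord addrAC subrr add0r.
rewrite -mulrA; apply: (hLs _ _ _ _ ht); first by rewrite mulr_gt0 ?exprn_gt0.
move=> z Dz; rewrite PS_phic.
have gl := geoB_geom_le ht Dz.
have := csum_tail N gl; rewrite big_nat big1 ?subr0; last first.
  by move=> i /andP[_ iN]; rewrite /t iN mul0r.
by rewrite /M.
Qed.

Hypothesis p1 : p <= 1.
Notation m := (order_m p lambda alpha).

(** The property of the integer part that matters: m + 1 strictly exceeds the number whose floor is
    m, which is the hypothesis of [kernel_integral_bound]. *)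
Lemma order_m_exponent : alpha + 1 + 2 * lambda * (1 - p) < m.+1%:R * p.
Proof.
have := truncnS_gt ((alpha + 2 * lambda + 1) / p - 2 * lambda); rewrite -/m => h.
have : ((alpha + 2 * lambda + 1) / p - 2 * lambda) * p < m.+1%:R * p by rewrite ltr_pM2r.
apply: le_lt_trans; rewrite mulrBl mulfVK ?gt_eqF//.
by rewrite le_eqVlt; apply/orP; left; apply/eqP; ring.
Qed.

Lemma dual_growth : growth_condition p lambda alpha (F (fun k => ell (dlt k))).
Proof.
have [Lb Lb0 hLb] := ell_dlt_le.
have sb : subexp (fun n => normc (ell (dlt n))).
  apply: (@subexp_le _ _ (fun n => Lb * pn lambda n)).
    by move=> n; rewrite (ger0_norm (nc_ge0 _)); exact: le_trans (hLb n) (ler_norm _).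
  by apply: subexpM; [exact: subexp_cst|exact: subexp_pn].
have [La La0 hLa] := ell_bounded.
have [C1 C10 hC1] := @kernel_integral_bound R p lambda alpha l0 p0 a0 m p1 order_m_exponent.
have [K K0 hK] := kernel_bound l0 m.
pose c := La * ((K + 1) * C1 `^ p^-1).
have c0 : 0 <= c by rewrite !mulr_ge0 ?powR_ge0// addr_ge0.
exists (c + 1); first by rewrite ltr_wpDl.
move=> w Dw; rewrite iter_dunkl_PS//.
pose a n := (n%:R + (lambda + 1)%:C) ^+ m * phi lambda n w.
have [K2 [q2 ha]] : exists K2 q2, geoB a K2 q2.
  have s1 : subexp (fun n => normc ((n%:R + (lambda + 1)%:C) ^+ m * (pn lambda n)%:C) * pn lambda n).
    apply: subexpM; last exact: subexp_pn.
    apply: subexp_euler => //.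
    by apply: subexp_le (subexp_pn l0) => n; rewrite ncR normr_id.
  have [K2 [q2 [K20 q20 q21 h2]]] := subexp_geom s1 (nc_ge0 w) Dw.
  exists K2, q2; split=> // n; apply: le_trans (h2 n).
  apply: le_trans (ler_wpM2r (exprn_ge0 n (nc_ge0 w)) (ler_norm _)).
  rewrite /a !(normcM (_ ^+ m)) ncR (ger0_norm (pn0 n)).
  have := phi_le l0 n w; move: (normc (_ ^+ m)) (nc_ge0 ((n%:R + (lambda + 1)%:C : C) ^+ m)) (pn0 n).
  move: (pn _ n) (normc (phi _ _ _)) (normc w ^+ n) => x y t k k0 x0 h.
  have -> : k * x * x * t = k * (x * t) * x by ring.
  by rewrite ler_wpM2r// ler_wpM2l.
have -> : F (fun n => (n%:R + (lambda + 1)%:C) ^+ m * ell (dlt n)) w = ell a.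
  rewrite (ell_csum ha) PS_phic; apply: eq_csum => n.
  by rewrite /a mulrAC.
have Fa z : disk z -> F a z = csum (fun n => ((n%:R + (lambda + 1))%:C) ^+ m * kc lambda z w n).
  move=> Dz; rewrite PS_phic; apply: eq_csum => n; rewrite /a /kc.
  have -> : (n%:R + (lambda + 1))%:C = n%:R + (lambda + 1)%:C :> C by rewrite -(rmorph_nat (real_complex R)) -rmorphD.
  by rewrite -mulrA [phi _ _ w * _]mulrC.
set E := normc (1 - w ^+ 2); set v := 1 - normc w.
have v0 : 0 < v by rewrite subr_gt0.
have E0 : 0 < E by apply: lt_le_trans v0 _; have := nc_1zw_gew w Dw; rewrite -expr2.
(* K + 1 makes X positive, as [ell_bounded] asks; the power 1/p of X carries the exponents of the
   growth condition. *)
pose X := (K + 1) `^ p * (C1 * (E `^ (2 * lambda * (1 - p)) * v `^ (alpha + 1 - m.+1%:R * p))).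
have K1 : 0 < K + 1 by rewrite ltr_wpDl.
have X0 : 0 < X by rewrite !mulr_gt0 ?powR_gt0.
have bX : (BI (F a) <= X%:E)%E.
  apply: hC1 => //; [exact: ltW|exact: PS_cont ha|].
  move=> z Dz; rewrite Fa//; have [_ h] := hK z w Dz Dw.
  apply: le_trans h _; rewrite ler_wpM2r ?lerDl// mulr_ge0 ?powR_ge0// invr_ge0 exprn_ge0//.
  by rewrite le_min !nc_ge0.
apply: le_trans (hLa _ _ _ _ ha X0 bX) _.
have -> : X `^ p^-1 = (K + 1) * C1 `^ p^-1 * (E `^ (2 * lambda * (p^-1 - 1)) / v `^ (m%:R + 1 - (alpha + 1) / p)).
  rewrite /X !powRM ?mulr_ge0 ?powR_ge0 ?(ltW C10)//.
  have r1 (x y : R) : (x `^ y) `^ p^-1 = x `^ (y / p) by rewrite -powRrM.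
  rewrite !r1 divff ?gt_eqF// powRr1 ?(ltW K1)// -[RHS]mulrA; congr (_ * (_ * (_ * _))).
    by congr (_ `^ _); field; rewrite gt_eqF.
  rewrite -powRN; congr (_ `^ _); rewrite -natr1; field; by rewrite gt_eqF.
rewrite [leLHS]mulrA -/c; apply: ler_wpM2r; first by apply: divr_ge0; exact: powR_ge0.
by rewrite lerDl.
Qed.

Lemma represents_dual : represents p lambda alpha L (F (fun k => ell (dlt k))).
Proof.
have [Lb Lb0 hLb] := ell_dlt_le.
have sb : subexp (fun n => normc (ell (dlt n))).
  apply: (@subexp_le _ _ (fun n => Lb * pn lambda n)).
    by move=> n; rewrite (ger0_norm (nc_ge0 _)); exact: le_trans (hLb n) (ler_norm _).
  by apply: subexpM; [exact: subexp_cst|exact: subexp_pn].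
split; [exact: lambda_analytic_PS|exact: dual_growth|].
exists (fun k => ell (dlt k)); first exact: phi_expansion_PS.
by move=> n a; exact: ell_phi_poly.
Qed.

Lemma represents_coef g b : phi_expansion lambda g b ->
  (forall n a, L (phi_poly lambda n a) = \sum_(k < n.+1) a k * b k) ->
  forall k, b k = ell (dlt k).
Proof.
move=> _ h k; have := h k (dlt k); rewrite ell_phi_poly !big_ord_recr/= /dlt eqxx !mul1r.
rewrite big1 ?add0r; last by move=> i _; rewrite ltn_eqF// mul0r.
by rewrite big1 ?add0r// => i _; rewrite ltn_eqF// mul0r.
Qed.

Lemma represents_unique h z : represents p lambda alpha L h -> disk z ->
  h z = F (fun k => ell (dlt k)) z.
Proof.
move=> [_ _ [b hb hp]] Dz; have [_ _ [b' hb' hp']] := represents_dual.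
have e : b = b'.
  by apply/funext => k; rewrite (represents_coef hb hp) (represents_coef hb' hp').
subst b'; apply/eqP; rewrite -subr_eq0 -nc_eq0 eq_le nc_ge0 andbT.
apply/ler_addgt0Pr => e e0; rewrite add0r.
have e2 : 0 < e / 2 by rewrite divr_gt0.
have /cvg_complexP/(_ _ e2)[N1 h1] := hb z Dz.
have /cvg_complexP/(_ _ e2)[N2 h2] := hb' z Dz.
have := h1 (maxn N1 N2) (leq_maxl _ _); have := h2 (maxn N1 N2) (leq_maxr _ _).
set S := \sum_(0 <= k < _) _; set g := PS _ _ => g2 g1.
have -> : h z - g = (h z - S) - (g - S) by ring.
by apply: le_trans (ncB _ _) _; rewrite [e]splitr lerD// ltW.
Qed.

End Duality.

(** * Integration by parts for the Dunkl operators *)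

Section WeightedMean.
Variable R : realType.
Notation mu := (@lebesgue_measure R).
Notation mu2 := (@lebesgue_measure R \x @lebesgue_measure R)%E.
Implicit Types (H K F G : R * R -> R) (M N : R).
Variable lambda : R.
Hypothesis l0 : 0 <= lambda.

(** The square is folded onto its upper half: the weight becomes a power of y > 0, and the pairing
    of z with conj(z) in the Dunkl operators is built into [jint]. *)
Definition hbox : set (R * R) := [set q | -1 < q.1 < 1 /\ 0 < q.2 < 1].
Definition qbox (q : R * R) := (-1 < q.1 < 1) /\ (-1 < q.2 < 1).

(** The bound is carried along with continuity; it yields integrability against the weight and
    explicit estimates of [J]. *)
Definition bc H (M : R) := 0 <= M /\ forall q, qbox q -> cont_at H q /\ `|H q| <= M.

Definition jint H (q : R * R) : R := (H q + H (q.1, - q.2)) * q.2 `^ (2 * lambda).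

(* The integral of H over the square (-1,1)^2 against |y|^(2 lambda). *)
Definition J H : R := fine (\int[mu2]_(q in hbox) (jint H q)%:E)%E.

Lemma opn_hbox : opn hbox.
Proof.
move=> [x y] [/= /andP[x1 x2] /andP[y1 y2]].
pose d := Num.min (Num.min (x + 1) (1 - x)) (Num.min y (1 - y)).
have d0 : 0 < d by rewrite !lt_min y1 !subr_gt0 x2 y2 -ltrBlDr sub0r x1.
exists d => // -[x' y'] /=; rewrite !ltr_norml !lt_min.
have h1 : d <= x + 1 by rewrite !ge_min lexx.
have h2 : d <= 1 - x by rewrite !ge_min lexx orbT.
have h3 : d <= y by rewrite !ge_min lexx !orbT.
have h4 : d <= 1 - y by rewrite !ge_min lexx !orbT.
clearbody d; move=> /andP[a b] /andP[c e]; split=> /=; apply/andP; split; lra.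
Qed.

Lemma measurable_hbox : measurable hbox. Proof. exact: opn_measurable opn_hbox. Qed.

Lemma hbox_qbox q : hbox q -> qbox q /\ qbox (q.1, - q.2).
Proof.
by case: q => x y [/= h /andP[y1 y2]]; split; split=> //=; apply/andP; split; lra.
Qed.

Lemma hbox_bounded H M q : bc H M -> hbox q -> `|jint H q| <= 2 * M.
Proof.
move=> [M0 h] hq; have [q1 q2] := hbox_qbox hq; have [_ /andP[y0 y1]] := hq.
rewrite /jint normrM (ger0_norm (powR_ge0 _ _)) -[leRHS]mulr1.
apply: ler_pM => //; first exact: powR_ge0.
  apply: le_trans (ler_normD _ _) _; rewrite mulr_natl mulr2n.
  by apply: lerD; [have [] := h _ q1|have [] := h _ q2].
by apply: powR_le1; rewrite ?mulr_ge0// ltW.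
Qed.

Lemma cont_atD F G q : cont_at F q -> cont_at G q -> cont_at (fun q => F q + G q : R) q.
Proof.
move=> hF hG e e0; have e2 : 0 < e / 2 by rewrite divr_gt0.
have [d d0 h] := hF _ e2; have [d' d'0 h'] := hG _ e2.
exists (Num.min d d'); first by rewrite lt_min d0.
move=> q'; rewrite !lt_min => /andP[a b] /andP[c f].
have -> : F q' + G q' - (F q + G q) = (F q' - F q) + (G q' - G q) by ring.
by apply: le_lt_trans (ler_normD _ _) _; rewrite [e]splitr ltrD ?h ?h'.
Qed.

Lemma cont_atM F G q : cont_at F q -> cont_at G q -> cont_at (fun q => F q * G q : R) q.
Proof.
move=> hF hG e e0.
pose B := `|F q| + `|G q| + 1.
have B0 : 0 < B by rewrite ltr_wpDl ?addr_ge0.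
pose n := Num.min (e / (2 * B)) 1.
have n0 : 0 < n by rewrite lt_min ltr01 divr_gt0 ?mulr_gt0.
have [d d0 h] := hF _ n0; have [d' d'0 h'] := hG _ n0.
exists (Num.min d d'); first by rewrite lt_min d0.
move=> q'; rewrite !lt_min => /andP[a b] /andP[c f].
have hf := h _ a c; have hg := h' _ b f.
have -> : F q' * G q' - F q * G q = (F q' - F q) * G q' + F q * (G q' - G q) by ring.
apply: le_lt_trans (ler_normD _ _) _; rewrite !normrM.
have gq : `|G q'| <= `|G q| + 1.
  have -> : G q' = (G q' - G q) + G q by ring.
  apply: le_trans (ler_normD _ _) _; rewrite addrC lerD2l ltW//.
  by apply: lt_le_trans hg _; rewrite ge_min lexx orbT.
have h1 : `|F q' - F q| * `|G q'| <= n * (`|G q| + 1) by apply: ler_pM => //; exact: ltW.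
have h2 : `|F q| * `|G q' - G q| <= `|F q| * n by rewrite ler_wpM2l// ltW.
apply: le_lt_trans (lerD h1 h2) _.
have -> : n * (`|G q| + 1) + `|F q| * n = n * B by rewrite /B; ring.
apply: (@le_lt_trans _ _ (e / (2 * B) * B)).
  by rewrite ler_wpM2r ?(ltW B0)// ge_min lexx.
by rewrite invfM mulrA mulfVK ?gt_eqF// ltr_pdivrMr// ltr_pMr// ltr1n.
Qed.

Lemma cont_at_cst (c : R) q : cont_at (fun=> c) q.
Proof. by move=> e e0; exists 1 => // q' _ _; rewrite subrr normr0. Qed.

Lemma cont_at_refl H q : cont_at H (q.1, - q.2) -> cont_at (fun q => H (q.1, - q.2)) q.
Proof.
move=> h e e0; have [d d0 hd] := h e e0; exists d => // q' h1 h2; apply: hd => //=.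
by rewrite -opprD normrN.
Qed.

Lemma cont_at_powR2 (a : R) (q : R * R) : 0 < q.2 -> cont_at (fun q : R * R => q.2 `^ a) q.
Proof.
move=> q0 e e0; have /cvgrPdist_lt/(_ e e0) := @powR_cont R a _ q0.
move=> /nbhs_ballP[d d0 hd]; exists d => // q' _ h2; rewrite distrC.
by apply: hd; rewrite /ball/= distrC.
Qed.

Lemma measurable_jint H M : bc H M -> measurable_fun hbox (jint H).
Proof.
move=> [M0 h]; apply: cont_measurable opn_hbox _ => q hq; have [q1 q2] := hbox_qbox hq.
apply: cont_atM; last by apply: cont_at_powR2; case: hq => _ /andP[].
by apply: cont_atD; [have [] := h _ q1|apply: cont_at_refl; have [] := h _ q2].
Qed.

Lemma mu2_hbox : (mu2 hbox <= 2%:E)%E.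
Proof.
have -> : hbox = `]-1, 1[%classic `*` `]0, 1[%classic.
  by apply/seteqP; split=> -[x y]; rewrite /hbox /= !in_itv.
rewrite product_measure1E//= !lebesgue_measure_itv/= !lte_fin ltr01.
by rewrite (lt_trans (ltrN10 R) ltr01) -!EFinB -EFinM lee_fin; lra.
Qed.

Lemma int_cst_hbox (c : R) : 0 <= c -> (\int[mu2]_(q in hbox) c%:E <= (2 * c)%:E)%E.
Proof.
move=> c0; have mh := measurable_hbox; rewrite integral_cst// mulrC EFinM.
by apply: lee_wpmul2l; [rewrite lee_fin|exact: mu2_hbox].
Qed.

Lemma jint_integrable H M : bc H M -> mu2.-integrable hbox (EFin \o jint H).
Proof.
move=> bH; have mj := measurable_jint bH; apply/integrableP; split; first exact/measurable_EFinP.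
have M0 : 0 <= 2 * M by case: bH => M0 _; rewrite mulr_ge0.
apply: le_lt_trans (_ : (2 * (2 * M))%:E < +oo)%E; last exact: ltry.
apply: le_trans (int_cst_hbox M0); apply: ge0_le_integral => //.
- exact: measurable_hbox.
- by apply: measurableT_comp => //; exact/measurable_EFinP.
- by move=> q hq; rewrite lee_fin; exact: hbox_bounded.
Qed.

Lemma JE H M : bc H M -> (\int[mu2]_(q in hbox) (jint H q)%:E = (J H)%:E)%E.
Proof.
move=> bH; rewrite fineK//; apply: integrable_fin_num; first exact: measurable_hbox.
exact: jint_integrable bH.
Qed.

Lemma J_bound H M : bc H M -> `|J H| <= 4 * M.
Proof.
move=> bH; rewrite -lee_fin.
have -> : (`|J H|%:E = `|(J H)%:E|)%E by [].
have M0 : 0 <= 2 * M by case: bH => M0 _; rewrite mulr_ge0.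
have mj : measurable_fun hbox (EFin \o jint H) by apply/measurable_EFinP; exact: measurable_jint bH.
rewrite -(JE bH); apply: le_trans (le_abse_integral _ _ _) _ => //; first exact: measurable_hbox.
have -> : 4 * M = 2 * (2 * M) by ring.
apply: le_trans (int_cst_hbox M0); apply: ge0_le_integral => //.
- exact: measurable_hbox.
- exact: measurableT_comp.
- by move=> q hq; rewrite lee_fin; exact: hbox_bounded.
Qed.

Lemma bcD H K M N : bc H M -> bc K N -> bc (fun q => H q + K q) (M + N).
Proof.
move=> [M0 h] [N0 k]; split; first exact: addr_ge0.
move=> q hq; have [h1 h2] := h q hq; have [k1 k2] := k q hq; split; first exact: cont_atD.
by apply: le_trans (ler_normD _ _) _; exact: lerD.
Qed.

Lemma bcM H K M N : bc H M -> bc K N -> bc (fun q => H q * K q) (M * N).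
Proof.
move=> [M0 h] [N0 k]; split; first exact: mulr_ge0.
move=> q hq; have [h1 h2] := h q hq; have [k1 k2] := k q hq; split; first exact: cont_atM.
by rewrite normrM; exact: ler_pM.
Qed.

Lemma bc_cst (c : R) : bc (fun=> c) `|c|.
Proof. by split=> // q _; split; first exact: cont_at_cst. Qed.

Lemma bcZ c H M : bc H M -> bc (fun q => c * H q) (`|c| * M).
Proof. exact: bcM (bc_cst c). Qed.

Lemma JD H K M N : bc H M -> bc K N -> J (fun q => H q + K q) = J H + J K.
Proof.
move=> bH bK; apply: (@EFin_inj R); rewrite EFinD -(JE bH) -(JE bK) -(JE (bcD bH bK)).
rewrite -integralD//; [|exact: measurable_hbox|exact: jint_integrable bH|exact: jint_integrable bK].
by apply: eq_integral => q _; rewrite -EFinD /jint; congr (_%:E); ring.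
Qed.

Lemma JZ c H M : bc H M -> J (fun q => c * H q) = c * J H.
Proof.
move=> bH; apply: (@EFin_inj R); rewrite EFinM -(JE bH) -(JE (bcZ c bH)).
rewrite -integralZl//; [|exact: measurable_hbox|exact: jint_integrable bH].
by apply: eq_integral => q _; rewrite -EFinM /jint; congr (_%:E); ring.
Qed.

Lemma eq_J H K : (forall q, qbox q -> H q = K q) -> J H = J K.
Proof.
move=> hk; congr fine; apply: eq_integral => q; rewrite inE => hq.
by have [q1 q2] := hbox_qbox hq; rewrite /jint !hk.
Qed.

(** Gives quantitative positivity: it is enough that the folded integrand is nonnegative everywhere
    and at least m on a box away from the real axis, where the weight is at least y1^(2 lambda). *)
Lemma J_box_lower H M (m x1 x2 y1 y2 : R) : bc H M -> 0 <= m ->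
  -1 < x1 -> x1 <= x2 -> x2 < 1 -> 0 < y1 -> y1 <= y2 -> y2 < 1 ->
  (forall q, hbox q -> 0 <= H q + H (q.1, - q.2)) ->
  (forall q, x1 <= q.1 <= x2 -> y1 <= q.2 <= y2 -> m <= H q + H (q.1, - q.2)) ->
  m * y1 `^ (2 * lambda) * ((x2 - x1) * (y2 - y1)) <= J H.
Proof.
move=> bH m0 hx1 hx hx2 hy1 hy hy2 H0 Hm.
pose B : set (R * R) := `[x1, x2]%classic `*` `[y1, y2]%classic.
have mB : measurable B by apply: measurableX; exact: measurable_itv.
have BD : B `<=` hbox.
  move=> [x y] [/=]; rewrite !in_itv/= => /andP[a b] /andP[c d]; split=> /=; apply/andP; split; lra.
rewrite -lee_fin -(JE bH).
have mj := measurable_jint bH.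
apply: (@le_trans _ _ (\int[mu2]_(q in B) (m * y1 `^ (2 * lambda))%:E)%E).
  have eB : (mu2 B = ((x2 - x1) * (y2 - y1))%:E)%E.
    rewrite /B product_measure1E//= !lebesgue_measure_itv/= !lte_fin.
    have e (a b : R) : a <= b -> (if a < b then (b%:E - a%:E)%E else 0%E) = (b - a)%:E :> \bar R.
      by rewrite le_eqVlt => /predU1P[->|->]; rewrite ?ltxx ?subrr.
    by rewrite !e.
  rewrite integral_cst// [X in (_ <= _ * X)%E](_ : _ = ((x2 - x1) * (y2 - y1))%:E); last exact: eB.
  by rewrite -EFinM.
apply: (@le_trans _ _ (\int[mu2]_(q in B) (jint H q)%:E)%E).
  apply: ge0_le_integral => //.
  - by move=> q _; rewrite lee_fin mulr_ge0 ?powR_ge0.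
  - by apply/measurable_EFinP; apply: measurable_funS BD mj; exact: measurable_hbox.
  - move=> [x y] [/=]; rewrite !in_itv/= => hqx hqy; rewrite lee_fin /jint; apply: ler_pM => //.
    + exact: powR_ge0.
    + exact: Hm.
    + by case/andP: hqy => h1 h2; apply: powR_le => //; [rewrite mulr_ge0|exact: ltW].
apply: ge0_subset_integral => //.
- exact: measurable_hbox.
- exact/measurable_EFinP.
- by move=> q hq; rewrite lee_fin mulr_ge0 ?powR_ge0// H0.
Qed.

Let patched H : R * R -> \bar R := (EFin \o jint H) \_ hbox.

Let patched_integrable H M : bc H M -> mu2.-integrable setT (patched H).
Proof.
move=> bH; have := jint_integrable bH.
by have [h _] := @integrable_mkcond _ _ _ mu2 hbox (EFin \o jint H) measurable_hbox.
Qed.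

Let J_patched H M : bc H M -> (\int[mu2]_q patched H q = (J H)%:E)%E.
Proof. by move=> bH; rewrite -(JE bH) [RHS]integral_mkcond. Qed.

Lemma in_hbox x y : ((x, y) \in hbox) = (-1 < x < 1) && (0 < y < 1).
Proof. by apply/idP/idP; rewrite inE => /andP. Qed.

(** The weight does not depend on x, so on every horizontal line the integrand is an exact
    derivative of a function vanishing near the ends. *)
Lemma J_dx H K M (r0 : R) : bc H M -> 0 < r0 < 1 ->
  (forall x y : R, -1 < y < 1 -> -1 < x < 1 ->
     is_derive x 1 (fun t : R => K (t, y)) (H (x, y))) ->
  (forall x y : R, r0 <= `|x| -> H (x, y) = 0 /\ K (x, y) = 0) -> J H = 0.
Proof.
move=> bH /andP[r00 r01] dK Hout; apply: (@EFin_inj R).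
rewrite -(J_patched bH) -(integral21_prod_meas1 (patched_integrable bH)) integral0_eq// => y _.
rewrite /fubini_G.
case: (boolP (0 < y < 1)) => hy; last first.
  by rewrite integral0_eq// => x _; rewrite /patched patchE in_hbox (negbTE hy) andbF.
have y1 : -1 < y < 1 by case/andP: hy => a b; rewrite b andbT; lra.
have y2 : -1 < - y < 1 by case/andP: hy => a b; apply/andP; split; lra.
transitivity (\int[mu]_(x in `[(- r0)%R, r0]) (jint H (x, y))%:E)%E.
  rewrite [RHS]integral_mkcond; apply: eq_integral => x _.
  rewrite /patched !patchE in_hbox hy andbT mem_setE in_itv/=.
  case: ifPn => h1; case: ifPn => h2 //.
    have h3 : r0 <= `|x|.
      rewrite leNgt; apply: contra h2; rewrite ltr_norml => /andP[a b]; rewrite !ltW//.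
    by rewrite /jint/= !(Hout _ _ h3).1 addr0 mul0r.
  by exfalso; move/negP: h1; apply; case/andP: h2 => a b; apply/andP; split; lra.
pose c := y `^ (2 * lambda).
transitivity ((c * (K (r0, y) + K (r0, - y)) - c * (K (- r0, y) + K (- r0, - y)))%:E); last first.
  have h1 : r0 <= `|r0| by rewrite gtr0_norm.
  have h2 : r0 <= `|- r0| by rewrite normrN gtr0_norm.
  by rewrite !(Hout _ _ h1).2 !(Hout _ _ h2).2 subrr.
apply: (@ftc_cont R (fun x => jint H (x, y)) (fun x => c * (K (x, y) + K (x, - y)))).
- by rewrite ge0_cp// ltW.
- move=> x /andP[x1 x2]; have hq : hbox (x, y) by split=> //=; apply/andP; split; lra.
  have cj : cont_at (jint H) (x, y).
    have [q1 q2] := hbox_qbox hq; case: bH => _ h.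
    apply: cont_atM; last by apply: cont_at_powR2; case: hq => _ /andP[].
    by apply: cont_atD; [have [] := h _ q1|apply: cont_at_refl; have [] := h _ q2].
  apply/cvgrPdist_lt => e e0; have [d d0 hd] := cj e e0.
  apply/nbhs_ballP; exists d => // x' hx'; rewrite distrC; apply: hd => /=.
    by rewrite distrC.
  by rewrite subrr normr0.
- move=> x /andP[x1 x2]; have xx : -1 < x < 1 by apply/andP; split; lra.
  suff <- : c * (H (x, y) + H (x, - y)) = jint H (x, y).
    apply: is_deriveZ; apply: is_deriveD; exact: dK.
  by rewrite /jint mulrC.
Qed.

(** Across the axis the weight matters: the primitive of the folded integrand is o y^(2 lambda), and
    |o| <= M' y makes it vanish at y = 0 for every lambda >= 0. *)
Lemma J_dy H (o : R -> R -> R) M M' (r0 : R) : bc H M -> 0 < r0 < 1 ->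
  (forall x y : R, -1 < x < 1 -> 0 < y < 1 ->
     is_derive y 1 (fun t : R => o x t * t `^ (2 * lambda)) (jint H (x, y))) ->
  (forall x y : R, -1 < x < 1 -> r0 <= y -> jint H (x, y) = 0 /\ o x y = 0) ->
  (forall x y : R, -1 < x < 1 -> 0 < y < 1 -> `|o x y| <= M' * y) -> J H = 0.
Proof.
move=> bH /andP[r00 r01] dK Hout oB; apply: (@EFin_inj R).
rewrite -(J_patched bH) -(integral12_prod_meas1 (patched_integrable bH)) integral0_eq// => x _.
rewrite /fubini_F.
case: (boolP (-1 < x < 1)) => hx; last first.
  by rewrite integral0_eq// => y _; rewrite /patched patchE in_hbox (negbTE hx).
have M0 : 0 <= M by case: bH.
set g := fun y => patched H (x, y).
have cj y : 0 < y < 1 -> {for y, continuous (fun y => jint H (x, y))}.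
  move=> hy; have hq : hbox (x, y) by split.
  have c : cont_at (jint H) (x, y).
    have [q1 q2] := hbox_qbox hq; case: bH => _ h.
    apply: cont_atM; last by apply: cont_at_powR2; case: hq => _ /andP[].
    by apply: cont_atD; [have [] := h _ q1|apply: cont_at_refl; have [] := h _ q2].
  apply/cvgrPdist_lt => e e0; have [d d0 hd] := c e e0.
  apply/nbhs_ballP; exists d => // y' hy'; rewrite distrC; apply: hd => /=.
    by rewrite subrr normr0.
  by rewrite distrC.
have gb y : (`|g y| <= (2 * M)%:E)%E.
  rewrite /g /patched patchE; case: ifPn => h; last by rewrite abse0 lee_fin mulr_ge0.
  by rewrite lee_fin; apply: hbox_bounded bH _; rewrite inE in h.
have mg : measurable_fun setT g.
  have mp : measurable_fun setT (patched H).
    by have /integrableP[] := patched_integrable bH.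
  exact: measurableT_comp mp (measurable_pair1 _).
(* The strip 0 < y < d contributes at most 2 M d, and the boundary value at height d at most |M'| d;
   then d tends to 0. *)
have key d : 0 < d -> d < r0 -> (`|\int[mu]_y g y| <= ((2 * M + `|M'|) * d)%:E)%E.
  move=> d0 dr.
  have dr' := ltW dr.
  have mgs (A : set R) : measurable_fun A g by exact: measurable_funTS.
  have e1 : (\int[mu]_y g y = \int[mu]_(y in `]0%R, d[) g y + \int[mu]_(y in `[d, r0]) g y)%E.
    rewrite -integral_setU//; [|exact: mgs|]; last first.
      apply/disj_set2P; rewrite -subset0 => y [/=]; rewrite !in_itv/= => /andP[_ a] /andP[b _].
      by move: a; rewrite ltNge b.
    rewrite [RHS]integral_mkcond; apply: eq_integral => y _; rewrite patchE.
    case: ifPn => // hy; rewrite /g /patched patchE; case: ifPn => // hq.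
    move: hq; rewrite inE => -[/= _ /andP[y0 y1]]; rewrite /= (Hout _ _ hx _).1//.
    rewrite leNgt; apply: contra hy => yr; rewrite inE/= !in_itv/= y0/=.
    by case: (ltP y d) => h; [left|right; exact: ltW].
  rewrite e1; apply: le_trans (lee_abs_add _ _) _; rewrite mulrDl EFinD; apply: leeD.
    apply: le_trans (le_abse_integral _ _ _) _; [exact: measurable_itv|exact: mgs|].
    apply: (@le_trans _ _ (\int[mu]_(y in `]0%R, d[) (2 * M)%:E)%E).
      apply: ge0_le_integral => //; first by apply: measurableT_comp => //; exact: mgs.
    by rewrite integral_cst//= lebesgue_measure_itv/= lte_fin d0 -EFinB subr0.
  have -> : (\int[mu]_(y in `[d, r0]) g y = \int[mu]_(y in `[d, r0]) (jint H (x, y))%:E)%E.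
    apply: eq_integral => y; rewrite inE/= in_itv/= => /andP[a b]; rewrite /g /patched patchE in_hbox hx.
    by rewrite (lt_le_trans d0 a) (le_lt_trans b r01).
  have -> : (\int[mu]_(y in `[d, r0]) (jint H (x, y))%:E =
     (o x r0 * r0 `^ (2 * lambda) - o x d * d `^ (2 * lambda))%:E)%E.
    apply: (@ftc_cont R (fun y => jint H (x, y)) (fun y => o x y * y `^ (2 * lambda))) => //.
    - move=> y /andP[a b]; apply: cj; apply/andP; split; [exact: lt_le_trans a|exact: le_lt_trans r01].
    - move=> y /andP[a b]; apply: dK => //; apply/andP; split; [exact: lt_le_trans a|exact: le_lt_trans r01].
  rewrite (Hout _ _ hx (lexx r0)).2 mul0r sub0r lee_fin normrN normrM (ger0_norm (powR_ge0 _ _)).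
  have d1 : d < 1 by exact: lt_trans r01.
  have hd : 0 < d < 1 by rewrite d0 d1.
  rewrite -[leRHS]mulr1; apply: ler_pM => //; first exact: powR_ge0.
    by apply: le_trans (oB _ _ hx hd) _; rewrite ler_wpM2r ?ler_norm// ltW.
  by apply: powR_le1; rewrite ?mulr_ge0// ltW.
set C := 2 * M + `|M'| in key.
have C0 : 0 <= C by rewrite addr_ge0 ?mulr_ge0.
apply/eqP; rewrite -abse_eq0 eq_le abse_ge0 andbT; apply/lee_addgt0Pr => e e0; rewrite add0e.
pose d := Num.min (r0 / 2) (e / (C + 1)).
have C1 : 0 < C + 1 by rewrite ltr_wpDl.
have d0 : 0 < d by rewrite lt_min !divr_gt0.
have dr : d < r0 by rewrite gt_min ltr_pdivrMr// ltr_pMr// ltr1n.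
apply: le_trans (key d d0 dr) _; rewrite lee_fin.
apply: (@le_trans _ _ ((C + 1) * (e / (C + 1)))).
  by apply: ler_pM => //; [exact: ltW|rewrite lerDl|rewrite ge_min lexx orbT].
by rewrite mulrC mulfVK// gt_eqF.
Qed.

End WeightedMean.

(** * Complex-valued integrands *)

Section ComplexMean.
Variable R : realType.
Notation C := R[i].
Variable lambda : R.
Hypothesis l0 : 0 <= lambda.
Notation J := (J lambda).

(** Continuity on the whole plane, so that compactness bounds H on the square. Functions given on
    the disk enter after multiplication by a cut-off. *)
Definition gC (H : C -> C) := forall z (e : R), 0 < e -> exists2 d : R, 0 < d &
  forall w, normc (w - z) < d -> normc (H w - H z) < e.

Definition inbox (z : C) := (-1 < complex.Re z < 1) /\ (-1 < complex.Im z < 1).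

Lemma gC_D H K : gC H -> gC K -> gC (fun z => H z + K z).
Proof.
move=> h k z e e0; have e2 : 0 < e / 2 by rewrite divr_gt0.
have [d d0 hd] := h z _ e2; have [d' d'0 hd'] := k z _ e2.
exists (Num.min d d'); first by rewrite lt_min d0.
move=> w; rewrite lt_min => /andP[h1 h2].
have -> : H w + K w - (H z + K z) = (H w - H z) + (K w - K z) by ring.
by apply: le_lt_trans (ncD _ _) _; rewrite [e]splitr ltrD ?hd ?hd'.
Qed.

Lemma gC_cst c : gC (fun=> c).
Proof. by move=> z e e0; exists 1 => // w _; rewrite subrr nc0. Qed.

Lemma gC_id : gC id. Proof. by move=> z e e0; exists e. Qed.

Lemma gC_conj H : gC H -> gC (fun z => conjc (H z)).
Proof.
move=> h z e e0; have [d d0 hd] := h z e e0; exists d => // w hw.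
by rewrite -rmorphB ncJ hd.
Qed.

Lemma gC_refl H : gC H -> gC (fun z => H (conjc z)).
Proof.
move=> h z e e0; have [d d0 hd] := h (conjc z) e e0; exists d => // w hw.
by apply: hd; rewrite -rmorphB ncJ.
Qed.

Lemma nc_mul_close (a b a' b' : C) (n : R) : 0 <= n -> n <= 1 ->
  normc (a' - a) <= n -> normc (b' - b) <= n ->
  normc (a' * b' - a * b) <= n * (normc a + normc b + 1).
Proof.
move=> n0 n1 ha hb.
have -> : a' * b' - a * b = (a' - a) * (b' - b) + (a' - a) * b + a * (b' - b) by ring.
apply: le_trans (ncD _ _) _; apply: le_trans (lerD (ncD _ _) (lexx _)) _; rewrite !normcM.
have h1 : normc (a' - a) * normc (b' - b) <= n * 1.
  by apply: ler_pM; rewrite ?nc_ge0//; exact: le_trans hb n1.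
have h2 : normc (a' - a) * normc b <= n * normc b by rewrite ler_wpM2r ?nc_ge0.
have h3 : normc a * normc (b' - b) <= normc a * n by rewrite ler_wpM2l ?nc_ge0.
apply: le_trans (lerD (lerD h1 h2) h3) _.
by rewrite le_eqVlt; apply/orP; left; apply/eqP; ring.
Qed.

Lemma cont_mul_at (H K : C -> C) z :
  (forall e : R, 0 < e -> exists2 d : R, 0 < d & forall w, normc (w - z) < d -> normc (H w - H z) < e) ->
  (forall e : R, 0 < e -> exists2 d : R, 0 < d & forall w, normc (w - z) < d -> normc (K w - K z) < e) ->
  forall e : R, 0 < e -> exists2 d : R, 0 < d & forall w, normc (w - z) < d ->
    normc (H w * K w - H z * K z) < e.
Proof.
move=> h k e e0; pose B := normc (H z) + normc (K z) + 1.
have B0 : 0 < B by rewrite ltr_wpDl ?addr_ge0 ?nc_ge0.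
pose n := Num.min (e / (2 * B)) 1.
have n0 : 0 < n by rewrite lt_min ltr01 divr_gt0 ?mulr_gt0.
have [d d0 hd] := h _ n0; have [d' d'0 hd'] := k _ n0.
exists (Num.min d d'); first by rewrite lt_min d0.
move=> w; rewrite lt_min => /andP[h1 h2].
have n1 : n <= 1 by rewrite ge_min lexx orbT.
apply: le_lt_trans (nc_mul_close (ltW n0) n1 (ltW (hd w h1)) (ltW (hd' w h2))) _.
rewrite -/B; apply: (@le_lt_trans _ _ (e / (2 * B) * B)).
  by rewrite ler_wpM2r ?(ltW B0)// ge_min lexx.
by rewrite invfM mulrA mulfVK ?gt_eqF// ltr_pdivrMr// ltr_pMr// ltr1n.
Qed.

Lemma gC_M H K : gC H -> gC K -> gC (fun z => H z * K z).
Proof. by move=> h k z; apply: cont_mul_at; [exact: h|exact: k]. Qed.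

Lemma gC_X H n : gC H -> gC (fun z => H z ^+ n).
Proof.
move=> h; elim: n => [|n IH]; first exact: gC_cst.
have -> : (fun z => H z ^+ n.+1) = (fun z => H z * H z ^+ n) by apply/funext => z; rewrite exprS.
exact: gC_M.
Qed.

Lemma gC_sum n (F : nat -> C -> C) : (forall i, gC (F i)) -> gC (fun z => \sum_(i < n) F i z).
Proof.
move=> h; elim: n => [|n IH].
  rewrite (_ : (fun z => \sum_(i < 0) F i z) = (fun=> 0)); first exact: gC_cst.
  by apply/funext => z; rewrite big_ord0.
have -> : (fun z => \sum_(i < n.+1) F i z) = (fun z => \sum_(i < n) F i z + F n z).
  by apply/funext => z; rewrite big_ord_recr.
exact: gC_D.
Qed.

(** G may be arbitrary outside the disk: u vanishes from |z|^2 = s < 1 on, so near points with |z|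
    >= 1 the product is 0. *)
Lemma gC_cut (s : R) (G u : C -> C) : s < 1 -> continuous_on_disk G -> gC u ->
  (forall z, s <= normc z ^+ 2 -> u z = 0) -> gC (fun z => G z * u z).
Proof.
move=> s1 cG cu u0 z.
have [z1|z1] := ltP (normc z) 1.
  by apply: cont_mul_at; [exact/continuous_complexP/cG|exact: cu].
move=> e e0; pose t := Num.sqrt (Num.max s 0).
have t0 : 0 <= t by exact: sqrtr_ge0.
have t2 : t ^+ 2 = Num.max s 0 by rewrite sqr_sqrtr// le_max lexx orbT.
have t1 : t < 1.
  by rewrite -(@ltr_pXn2r _ 2) ?nnegrE// expr1n t2 gt_max s1 ltr01.
exists (1 - t); first by rewrite subr_gt0.
move=> w hw; have wt : t <= normc w.
  have := nc_lerB z (z - w); rewrite subKr nc_distC => h; move: hw z1 h.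
  by move: (normc (w - z)) (normc z) (normc w) => a b c; lra.
have hu x : t <= normc x -> u x = 0.
  move=> tx; apply: u0; apply: (@le_trans _ _ (t ^+ 2)); first by rewrite t2 le_max lexx.
  by rewrite lerXn2r ?nnegrE ?nc_ge0.
by rewrite hu// hu ?mulr0 ?subrr ?nc0// (le_trans _ z1)// ltW.
Qed.

Definition RF (H : C -> C) (q : R * R) : R := complex.Re (H (q.1 +i* q.2)).
Definition IF (H : C -> C) (q : R * R) : R := complex.Im (H (q.1 +i* q.2)).

Lemma cont_at_RF H : gC H -> forall q, cont_at (RF H) q /\ cont_at (IF H) q.
Proof.
move=> h q; split=> e e0; have [d d0 hd] := h (q.1 +i* q.2) e e0;
  (exists (d / 2); [by rewrite divr_gt0|]) => q' h1 h2; rewrite /RF /IF.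
  rewrite -cReN -cReD; apply: le_lt_trans (Re_le _) _; apply: hd.
  by apply: le_lt_trans (nc_le_ReIm _) _ => /=; apply: lt_le_trans (ltrD h1 h2) _; rewrite -splitr.
rewrite -cImN -cImD; apply: le_lt_trans (Im_le _) _; apply: hd.
by apply: le_lt_trans (nc_le_ReIm _) _ => /=; apply: lt_le_trans (ltrD h1 h2) _; rewrite -splitr.
Qed.

Lemma cont_at_continuous (F : R * R -> R) : (forall q, cont_at F q) -> continuous F.
Proof.
move=> h q; apply/cvgrPdist_lt => e e0; have [d d0 hd] := h q e e0.
exists (ball q.1 d, ball q.2 d) => /=; first by split; exact: nbhsx_ballx.
move=> q' [/= h1 h2]; rewrite distrC; apply: hd; rewrite distrC//.
Qed.

Lemma cont_at_bounded (F : R * R -> R) : (forall q, cont_at F q) ->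
  exists2 M, 0 <= M & forall q, qbox q -> `|F q| <= M.
Proof.
move=> h; have cF := cont_at_continuous h.
pose Q : set (R * R) := `[-1, 1]%classic `*` `[-1, 1]%classic.
have cQ : compact Q by apply: compact_setX; exact: segment_compact.
have cFQ : compact (F @` Q).
  by apply: continuous_compact => //; exact: continuous_subspaceT.
have [M [_ hM]] := compact_bounded cFQ.
exists (`|M| + 1) => // q [/andP[a b] /andP[c d]].
apply: (hM (`|M| + 1)); first by rewrite (le_lt_trans (ler_norm M))// ltrDl.
by exists q => //; split; rewrite /= in_itv/= !ltW.
Qed.

Lemma gC_bounded H : gC H -> exists M, bc (RF H) M /\ bc (IF H) M.
Proof.
move=> h; have [M M0 hM] := @cont_at_bounded (RF H) (fun q => (cont_at_RF h q).1).
have [N N0 hN] := @cont_at_bounded (IF H) (fun q => (cont_at_RF h q).2).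
exists (Num.max M N); split; split; rewrite ?le_max ?M0// => q hq.
  by split; [exact: (cont_at_RF h q).1|rewrite le_max hM].
by split; [exact: (cont_at_RF h q).2|rewrite le_max hN// orbT].
Qed.

Definition JC (H : C -> C) : C := J (RF H) +i* J (IF H).

Lemma JC_D H K : gC H -> gC K -> JC (fun z => H z + K z) = JC H + JC K.
Proof.
move=> /gC_bounded[M [h1 h2]] /gC_bounded[N [k1 k2]]; apply: complex_eq.
  rewrite cReD/= -(JD l0 h1 k1); apply: eq_J => q _; exact: cReD.
rewrite cImD/= -(JD l0 h2 k2); apply: eq_J => q _; exact: cImD.
Qed.

Lemma JC_Z c H : gC H -> JC (fun z => c * H z) = c * JC H.
Proof.
move=> /gC_bounded[M [h1 h2]].
have e1 := JZ l0 (complex.Re c) h1; have e2 := JZ l0 (- complex.Im c) h2.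
have e3 := JZ l0 (complex.Re c) h2; have e4 := JZ l0 (complex.Im c) h1.
apply: complex_eq.
  rewrite cReM/= -mulNr -e1 -e2 -(JD l0 (bcZ _ h1) (bcZ _ h2)).
  by apply: eq_J => q _; rewrite /RF cReM mulNr.
rewrite cImM/= -e3 -e4 -(JD l0 (bcZ _ h2) (bcZ _ h1)).
by apply: eq_J => q _; rewrite /IF cImM.
Qed.

Lemma eq_JC H K : (forall z, inbox z -> H z = K z) -> JC H = JC K.
Proof. by move=> h; apply: complex_eq; apply: eq_J => q hq; rewrite /RF /IF h. Qed.

Lemma JC_bound H M : gC H -> 0 <= M -> (forall z, inbox z -> normc (H z) <= M) ->
  normc (JC H) <= 8 * M.
Proof.
move=> h M0 hM.
have b1 : bc (RF H) M.
  split=> // q hq; split; first exact: (cont_at_RF h q).1.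
  by apply: le_trans (Re_le _) (hM _ _).
have b2 : bc (IF H) M.
  split=> // q hq; split; first exact: (cont_at_RF h q).2.
  by apply: le_trans (Im_le _) (hM _ _).
apply: le_trans (nc_le_ReIm _) _ => /=.
have -> : 8 * M = 4 * M + 4 * M by ring.
by apply: lerD; exact: J_bound.
Qed.

Lemma JC_sum n (F : nat -> C -> C) : (forall i, gC (F i)) ->
  JC (fun z => \sum_(i < n) F i z) = \sum_(i < n) JC (F i).
Proof.
move=> h; elim: n => [|n IH].
  rewrite big_ord0; transitivity (0 * JC (fun=> 0)); last by rewrite mul0r.
  by rewrite -JC_Z; [apply: eq_JC => z _; rewrite big_ord0 mul0r|exact: gC_cst].
rewrite big_ord_recr/= -IH -JC_D//; last exact: gC_sum.
by apply: eq_JC => z _; rewrite big_ord_recr.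
Qed.

Lemma JC_B H K : gC H -> gC K -> JC (fun z => H z - K z) = JC H - JC K.
Proof.
move=> h k; have k' : gC (fun z => -1 * K z) by apply: gC_M => //; exact: gC_cst.
rewrite -mulN1r -JC_Z// -JC_D//.
by apply: eq_JC => z _; rewrite mulN1r.
Qed.

Lemma JC_conj H : gC H -> JC (fun z => conjc (H z)) = conjc (JC H).
Proof.
move=> /gC_bounded[M [h1 h2]]; apply: complex_eq => /=.
  by apply: eq_J => q _; rewrite /RF; case: (H _).
rewrite -mulN1r -(JZ l0 _ h2); apply: eq_J => q _.
by rewrite /IF mulN1r; case: (H _).
Qed.

Definition isd (g : R -> C) (t : R) (l : C) :=
  is_derive t 1 (fun t => complex.Re (g t)) (complex.Re l) /\
  is_derive t 1 (fun t => complex.Im (g t)) (complex.Im l).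

Lemma isd_D g h t l m : isd g t l -> isd h t m -> isd (fun t => g t + h t) t (l + m).
Proof.
move=> [g1 g2] [h1 h2]; split.
  rewrite cReD (_ : (fun t => _) = (fun t => complex.Re (g t) + complex.Re (h t))).
    exact: is_deriveD.
  by apply/funext => x; rewrite cReD.
rewrite cImD (_ : (fun t => _) = (fun t => complex.Im (g t) + complex.Im (h t))).
  exact: is_deriveD.
by apply/funext => x; rewrite cImD.
Qed.

Lemma isd_cst c t : isd (fun=> c) t 0.
Proof. by split; exact: is_derive_cst. Qed.

Lemma is_deriveM_R (f g : R -> R) (t a b : R) : is_derive t 1 f a -> is_derive t 1 g b ->
  is_derive t 1 (fun t => f t * g t) (a * g t + f t * b).
Proof.
move=> h1 h2; have := @is_deriveM R R^o f g t 1 _ _ h1 h2.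
by congr is_derive; rewrite /GRing.scale/=; ring.
Qed.

Lemma isd_M g h t l m : isd g t l -> isd h t m ->
  isd (fun t => g t * h t) t (l * h t + g t * m).
Proof.
move=> [g1 g2] [h1 h2]; split.
  rewrite (_ : (fun t => _) = (fun t => complex.Re (g t) * complex.Re (h t) -
     complex.Im (g t) * complex.Im (h t))); last by apply/funext => x; rewrite cReM.
  have -> : complex.Re (l * h t + g t * m) =
    (complex.Re l * complex.Re (h t) + complex.Re (g t) * complex.Re m) -
    (complex.Im l * complex.Im (h t) + complex.Im (g t) * complex.Im m).
    by rewrite cReD !cReM; ring.
  by apply: is_deriveB; exact: is_deriveM_R.
rewrite (_ : (fun t => _) = (fun t => complex.Re (g t) * complex.Im (h t) +
   complex.Im (g t) * complex.Re (h t))); last by apply/funext => x; rewrite cImM.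
have -> : complex.Im (l * h t + g t * m) =
  (complex.Re l * complex.Im (h t) + complex.Re (g t) * complex.Im m) +
  (complex.Im l * complex.Re (h t) + complex.Im (g t) * complex.Re m).
  by rewrite cImD !cImM; ring.
by apply: is_deriveD; exact: is_deriveM_R.
Qed.

Lemma isd_eq g h t l (d : R) : 0 < d -> (forall t', `|t' - t| < d -> g t' = h t') ->
  isd g t l -> isd h t l.
Proof.
move=> d0 gh [g1 g2].
have nr : \forall t' \near t, g t' = h t'.
  by apply/nbhs_ballP; exists d => // t' ht'; apply: gh; rewrite distrC.
have nR : \forall t' \near t, complex.Re (g t') = complex.Re (h t') by apply: filterS nr => t' ->.
have nI : \forall t' \near t, complex.Im (g t') = complex.Im (h t') by apply: filterS nr => t' ->.
split; [move: g1|move: g2] => -[dg <-]; split.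
- by move: dg; apply: near_eq_derivable.
- by apply/esym; apply: near_eq_derive.
- by move: dg; apply: near_eq_derivable.
- by apply/esym; apply: near_eq_derive.
Qed.

End ComplexMean.

(** * The adjoint of D_zbar *)

Section DunklAdjoint.
Variable R : realType.
Notation C := R[i].
Variable lambda : R.
Hypothesis l0 : 0 <= lambda.
Notation JC := (JC lambda).

Lemma RCN (x : R) : (- x)%:C = - x%:C :> C.
Proof. exact: rmorphN. Qed.

Lemma isd_opp (g : R -> C) (t : R) l : isd g (- t) l -> isd (fun t => g (- t)) t (- l).
Proof.
have dn : is_derive t 1 (fun t : R => - t) (-1) by exact: is_deriveN.
move=> [g1 g2]; split.
  have := is_derive1_comp (f := fun t => complex.Re (g t)) (g := fun t : R => - t) g1 dn.
  by rewrite mulrN1 cReN.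
have := is_derive1_comp (f := fun t => complex.Im (g t)) (g := fun t : R => - t) g2 dn.
by rewrite mulrN1 cImN.
Qed.

Lemma JC_dx (K Kx : C -> C) (s : R) : gC Kx -> 0 < s -> s < 1 ->
  (forall x y : R, isd (fun t : R => K (t +i* y)) x (Kx (x +i* y))) ->
  (forall z, s <= normc z ^+ 2 -> Kx z = 0 /\ K z = 0) -> JC Kx = 0.
Proof.
move=> gK s0 s1 dK out; have [M [b1 b2]] := gC_bounded gK.
have r01 : 0 < Num.sqrt s < 1.
  by rewrite sqrtr_gt0 s0/= -[X in _ < X]sqrtr1 ltr_sqrt.
have sx (x y : R) : Num.sqrt s <= `|x| -> s <= normc (x +i* y) ^+ 2.
  move=> h; rewrite ncE/= -[s]sqr_sqrtr ?(ltW s0)//.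
  apply: (@le_trans _ _ (x ^+ 2)); last by rewrite lerDl sqr_ge0.
  by rewrite -[x ^+ 2]real_normK ?num_real// lerXn2r ?nnegrE ?sqrtr_ge0.
apply: complex_eq => /=.
  apply: (@J_dx _ _ l0 (RF Kx) (RF K) M _ b1 r01) => [x y _ _|x y h].
    by have [] := dK x y.
  by rewrite /RF/=; have [-> ->] := out _ (sx _ y h).
apply: (@J_dx _ _ l0 (IF Kx) (IF K) M _ b2 r01) => [x y _ _|x y h].
  by have [] := dK x y.
by rewrite /IF/=; have [-> ->] := out _ (sx _ y h).
Qed.

Lemma isd_within (g dg : R -> C) a b : (forall t, isd g t (dg t)) -> a <= b ->
  forall M, (forall t, a <= t <= b -> `|complex.Re (dg t)| <= M /\ `|complex.Im (dg t)| <= M) ->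
  `|complex.Re (g b - g a)| <= M * (b - a) /\ `|complex.Im (g b - g a)| <= M * (b - a).
Proof.
move=> hd ab M hM.
have cR : {within `[a, b], continuous (fun t => complex.Re (g t))}.
  apply: continuous_subspaceT => t; apply/differentiable_continuous/derivable1_diffP.
  by have [[]] := hd t.
have cI : {within `[a, b], continuous (fun t => complex.Im (g t))}.
  apply: continuous_subspaceT => t; apply/differentiable_continuous/derivable1_diffP.
  by have [_ []] := hd t.
have [c hc e] := MVT_segment ab (fun t _ => (hd t).1) cR.
have [c' hc' e'] := MVT_segment ab (fun t _ => (hd t).2) cI.
rewrite in_itv/= in hc; rewrite in_itv/= in hc'.
rewrite cReD cImD cReN cImN e e' !normrM (ger0_norm (_ : 0 <= b - a)) ?subr_ge0//.
by split; rewrite ler_wpM2r ?subr_ge0//; [have [] := hM c hc|have [] := hM c' hc'].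
Qed.

(** Only the fold of G matters. The bracket is y^(-2 lambda) times the y-derivative of y^(2 lambda)
    (K(x, y) - K(x, -y)), and the difference is O(y) by the mean value theorem, as [J_dy]
    requires. *)
Lemma JC_dy (G K Ky : C -> C) (s : R) : gC G -> gC Ky -> 0 < s -> s < 1 ->
  (forall x y : R, isd (fun t : R => K (x +i* t)) y (Ky (x +i* y))) ->
  (forall z, s <= normc z ^+ 2 -> G z = 0 /\ K z = 0) ->
  (forall x y : R, 0 < y -> G (x +i* y) + G (x +i* - y) =
     (0 +i* 2^-1) * (Ky (x +i* y) + Ky (x +i* - y) +
       (2 * lambda / y)%:C * (K (x +i* y) - K (x +i* - y)))) -> JC G = 0.
Proof.
move=> gG gKy s0 s1 dK out GE; have [M [b1 b2]] := gC_bounded gG.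
have [M' [k1 k2]] := gC_bounded gKy.
have r01 : 0 < Num.sqrt s < 1.
  by rewrite sqrtr_gt0 s0/= -[X in _ < X]sqrtr1 ltr_sqrt.
have sy (x y : R) : Num.sqrt s <= y -> s <= normc (x +i* y) ^+ 2 /\ s <= normc (x +i* - y) ^+ 2.
  move=> h; have : s <= x ^+ 2 + y ^+ 2.
    rewrite -[s]sqr_sqrtr ?(ltW s0)//; apply: (@le_trans _ _ (y ^+ 2)); last by rewrite lerDr sqr_ge0.
    by rewrite lerXn2r ?nnegrE ?sqrtr_ge0// (le_trans _ h) ?sqrtr_ge0.
  by rewrite !ncE/= sqrrN.
pose O (x t : R) := K (x +i* t) - K (x +i* - t).
have dO (x y : R) : isd (O x) y (Ky (x +i* y) + Ky (x +i* - y)).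
  have h := isd_opp (dK x (- y)); have h1 := isd_D (dK x y) (isd_M (isd_cst (-1) y) h).
  move: h1; rewrite mul0r add0r mulN1r opprK; apply: isd_eq ltr01 _ => t _.
  by rewrite /O mulN1r.
have Ob (x y : R) : -1 < x < 1 -> 0 < y < 1 ->
    `|complex.Re (O x y)| <= (2 * M') * y /\ `|complex.Im (O x y)| <= (2 * M') * y.
  move=> hx /andP[y0 y1]; have hy : - y <= y by lra.
  have [||h1 h2] := @isd_within (fun t => K (x +i* t)) (fun t => Ky (x +i* t)) (- y) y _ hy M'.
  - by move=> t; exact: dK.
  - move=> t /andP[t1 t2]; have q : qbox (x, t) by split=> //=; apply/andP; split; lra.
    by have [_ h1] := k1.2 _ q; have [_ h2] := k2.2 _ q.
  have e : M' * (y - - y) = 2 * M' * y by ring.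
  by rewrite e in h1 h2.
have dp (y : R) : 0 < y -> is_derive y 1 (fun t : R => t `^ (2 * lambda)) (2 * lambda / y * y `^ (2 * lambda)).
  move=> y0; have := is_derive1_powR (2 * lambda) y0.
  have -> : y `^ (2 * lambda - 1) = y `^ (2 * lambda) / y.
    by rewrite powR_add// powRN powRr1// ltW.
  by congr is_derive; ring.
have dcst (c y : R) : is_derive y 1 (fun=> c) 0 by exact: is_derive_cst.
have reh (X : C) : complex.Re ((0 +i* 2^-1) * X) = - 2^-1 * complex.Im X.
  by case: X => a b /=; rewrite mul0r sub0r mulNr.
have imh (X : C) : complex.Im ((0 +i* 2^-1) * X) = 2^-1 * complex.Re X.
  by case: X => a b /=; rewrite mul0r add0r.
have reM (y : R) (X : C) : complex.Re (y%:C * X) = y * complex.Re X.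
  by case: X => a b /=; rewrite mul0r subr0.
have imM (y : R) (X : C) : complex.Im (y%:C * X) = y * complex.Im X.
  by case: X => a b /=; rewrite mul0r addr0.
apply: complex_eq => /=.
  apply: (@J_dy _ _ l0 (RF G) (fun x t => - 2^-1 * complex.Im (O x t)) M (2 * M') _ b1 r01).
  - move=> x y hx /andP[y0 y1]; have [_ d2] := dO x y.
    have d3 := is_deriveM_R (is_deriveM_R (dcst (- 2^-1) y) d2) (dp y y0).
    move: d3; congr is_derive; rewrite /jint /RF/= -cReD GE// reh [in RHS]cImD imM /O.
    by move: (y `^ _) (complex.Im _) (complex.Im _) => A B D; ring.
  - move=> x y hx h; rewrite /jint /RF/=; have [h1 h2] := sy x y h.
    have [g1 k1'] := out _ h1; have [g2 k2'] := out _ h2.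
    by rewrite g1 g2 /O k1' k2' subrr/= addr0 mul0r mulr0.
  - move=> x y hx hy; have [_ h] := Ob x y hx hy; rewrite normrM.
    apply: le_trans h; rewrite ler_piMl// normrN ger0_norm ?invr_ge0//.
    by rewrite invf_le1// ler1n.
apply: (@J_dy _ _ l0 (IF G) (fun x t => 2^-1 * complex.Re (O x t)) M (2 * M') _ b2 r01).
- move=> x y hx /andP[y0 y1]; have [d1 _] := dO x y.
  have d3 := is_deriveM_R (is_deriveM_R (dcst (2^-1) y) d1) (dp y y0).
  move: d3; congr is_derive; rewrite /jint /IF/= -cImD GE// imh [in RHS]cReD reM /O.
  by move: (y `^ _) (complex.Re _) (complex.Re _) => A B D; ring.
- move=> x y hx h; rewrite /jint /IF/=; have [h1 h2] := sy x y h.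
  have [g1 k1'] := out _ h1; have [g2 k2'] := out _ h2.
  by rewrite g1 g2 /O k1' k2' subrr/= addr0 mul0r mulr0.
- move=> x y hx hy; have [h _] := Ob x y hx hy; rewrite normrM.
  apply: le_trans h; rewrite ler_piMl// ger0_norm ?invr_ge0//.
  by rewrite invf_le1// ler1n.
Qed.

Lemma is_derive_expn n (t : R) : is_derive t 1 (fun t => t ^+ n) (n%:R * t ^+ n.-1).
Proof.
elim: n => [|n IH]; first by rewrite mul0r; exact: is_derive_cst.
have := is_deriveM_R (is_derive_id t 1) IH.
rewrite (_ : (fun x => x * x ^+ n) = (fun x => x ^+ n.+1)); last by apply/funext => x; rewrite exprS.
congr is_derive; case: n {IH} => [|n]; first by rewrite mul0r mulr0 addr0.
by rewrite /= [in RHS]exprS -[in RHS]natr1 exprS; ring.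
Qed.

Definition posn (a : nat) (t : R) : R := Num.max t 0 ^+ a.
Definition chi (s : R) (a : nat) (z : C) : C := (posn a (s - normc z ^+ 2))%:C.

Lemma chi0 s a z : (0 < a)%N -> s <= normc z ^+ 2 -> chi s a z = 0.
Proof.
move=> a0 h; rewrite /chi /posn.
have -> : Num.max (s - normc z ^+ 2) 0 = 0 by apply/max_idPr; rewrite subr_le0.
by rewrite expr0n eqn0Ngt a0.
Qed.

(** a > 0 makes the function at most h^2 near the corner t = 0, so the derivative exists there and
    is 0. *)
Lemma posn_derive (a : nat) (t : R) : (0 < a)%N ->
  is_derive t 1 (posn a.+1) (a.+1%:R * posn a t).
Proof.
move=> a0; have [t0|t0|<-] := ltgtP 0 t.
- have dX : is_derive t 1 (fun t : R => t ^+ a.+1) (a.+1%:R * posn a t).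
    by rewrite /posn max_l ?(ltW t0)//; exact: is_derive_expn.
  move: dX => -[dX <-]; have nr : \forall t' \near t, t' ^+ a.+1 = posn a.+1 t'.
    near=> t'; rewrite /posn max_l// ltW//; near: t'; exact: lt_nbhsr.
  split; first by move: dX; apply: near_eq_derivable.
  by apply/esym; apply: near_eq_derive.
- have -> : a.+1%:R * posn a t = 0.
    by rewrite /posn max_r ?(ltW t0)// expr0n eqn0Ngt a0 mulr0.
  have [dX eX] := is_derive_cst (0 : R) t 1.
  have nr : \forall t' \near t, (0 : R) = posn a.+1 t'.
    near=> t'; rewrite /posn max_r ?expr0n//; apply: ltW; near: t'; exact: lt_nbhsl.
  split; first by move: dX; apply: near_eq_derivable.
  by rewrite -[RHS]eX; apply/esym; apply: near_eq_derive.
- have -> : a.+1%:R * posn a 0 = 0 :> R by rewrite /posn maxxx expr0n eqn0Ngt a0 mulr0.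
  apply: (@quad_derive R _ _ _ 1 1) => // h h1.
  rewrite add0r mulr0 subr0 /posn maxxx expr0n/= subr0 mul1r normrX.
  have m0 : `|Num.max h 0| <= `|h|.
    by case: (leP h 0) => h0; rewrite ?normr0.
  apply: (@le_trans _ _ (`|h| ^+ a.+1)); first by rewrite lerXn2r ?nnegrE.
  rewrite -[h ^+ 2]real_normK ?num_real//; case: a a0 => // a _.
  by rewrite -addn2 exprD ler_piMl ?sqr_ge0// exprn_ile1// ltW.
Unshelve. all: by end_near.
Qed.

Lemma gC_real (g : C -> R) : (forall z (e : R), 0 < e -> exists2 d : R, 0 < d &
    forall w, normc (w - z) < d -> `|g w - g z| < e) -> gC (fun z => (g z)%:C).
Proof.
move=> h z e e0; have [d d0 hd] := h z e e0; exists d => // w hw.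
by rewrite -rmorphB ncR hd.
Qed.

Lemma gC_chi s a : gC (chi s a).
Proof.
have h1 : gC (fun z : C => z * conjc z) by apply: gC_M; [exact: gC_id|apply: gC_conj; exact: gC_id].
have e (z : C) : z * conjc z = (normc z ^+ 2)%:C.
  by rewrite ncE; case: z => x y; apply/eqP; rewrite eq_complex/=; apply/andP; split; apply/eqP; ring.
have h2 : gC (fun z : C => (Num.max (s - normc z ^+ 2) 0)%:C).
  apply: gC_real => z d d0; have [d' d'0 hd'] := h1 z d d0; exists d' => // w hw.
  have := hd' w hw; rewrite !e -rmorphB ncR => h.
  apply: le_lt_trans h; move: (normc w ^+ 2) (normc z ^+ 2) => a1 a2.
  have mx (x y : R) : `|Num.max x 0 - Num.max y 0| <= `|x - y|.
    case: (leP x 0) => hx; case: (leP y 0) => hy.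
    - by rewrite subrr normr0.
    - by rewrite sub0r normrN gtr0_norm// ler0_norm; lra.
    - by rewrite subr0 gtr0_norm// ger0_norm; lra.
    - by [].
  apply: le_trans (mx _ _) _; rewrite (_ : _ - _ = a2 - a1); last by ring.
  by rewrite distrC.
rewrite (_ : chi s a = (fun z => (Num.max (s - normc z ^+ 2) 0)%:C ^+ a)); first exact: gC_X.
by apply/funext => z; rewrite /chi /posn RCX.
Qed.

Lemma isd_real (g : R -> R) (t l : R) : is_derive t 1 g l -> isd (fun t => (g t)%:C) t l%:C.
Proof. by move=> h; split=> //=; exact: is_derive_cst. Qed.

Lemma chi_dx s a (x y : R) : (0 < a)%N ->
  isd (fun t : R => chi s a.+1 (t +i* y)) x ((- (2 * a.+1%:R * x))%:C * chi s a (x +i* y)).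
Proof.
move=> a0; rewrite /chi -RCM; apply: isd_real.
have d1 : is_derive x 1 (fun t : R => s - normc (t +i* y) ^+ 2) (- (2 * x)).
  have -> : (fun t : R => s - normc (t +i* y) ^+ 2) = (fun t : R => (s - y ^+ 2) - t ^+ 2).
    by apply/funext => t; rewrite ncE/=; ring.
  have := is_deriveB (is_derive_cst (s - y ^+ 2) x 1) (is_derive_expn 2 x).
  by rewrite sub0r.
have := is_derive1_comp (f := posn a.+1) (g := fun t : R => s - normc (t +i* y) ^+ 2)
  (posn_derive _ a0) d1.
by congr is_derive; ring.
Qed.

Lemma chi_dy s a (x y : R) : (0 < a)%N ->
  isd (fun t : R => chi s a.+1 (x +i* t)) y ((- (2 * a.+1%:R * y))%:C * chi s a (x +i* y)).
Proof.
move=> a0; rewrite /chi -RCM; apply: isd_real.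
have d1 : is_derive y 1 (fun t : R => s - normc (x +i* t) ^+ 2) (- (2 * y)).
  have -> : (fun t : R => s - normc (x +i* t) ^+ 2) = (fun t : R => (s - x ^+ 2) - t ^+ 2).
    by apply/funext => t; rewrite ncE/=; ring.
  have := is_deriveB (is_derive_cst (s - x ^+ 2) y 1) (is_derive_expn 2 y).
  by rewrite sub0r.
have := is_derive1_comp (f := posn a.+1) (g := fun t : R => s - normc (x +i* t) ^+ 2)
  (posn_derive _ a0) d1.
by congr is_derive; ring.
Qed.

(* psix and psiy are the partial derivatives of psi, dpsi is D_zbar psi. *)
Definition PD (psi psix psiy dpsi : C -> C) :=
  [/\ [/\ gC psi, gC psix, gC psiy & gC dpsi],
   (forall x y : R, isd (fun t : R => psi (t +i* y)) x (psix (x +i* y))),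
   (forall x y : R, isd (fun t : R => psi (x +i* t)) y (psiy (x +i* y))) &
   forall z, complex.Im z != 0 -> (psix z + (0 +i* 1) * psiy z) / 2 -
     lambda%:C * ((psi z - psi (conjc z)) / (z - conjc z)) = dpsi z].

Lemma far_zero (s : R) (f u : C -> C) (z : C) : s < 1 -> 1 <= normc z ->
  (forall z, s <= normc z ^+ 2 -> u z = 0) -> exists2 d : R, 0 < d &
  forall w, normc (w - z) < d -> f w * u w = 0.
Proof.
move=> s1 z1 u0; pose t := Num.sqrt (Num.max s 0).
have t0 : 0 <= t by exact: sqrtr_ge0.
have t2 : t ^+ 2 = Num.max s 0 by rewrite sqr_sqrtr// le_max lexx orbT.
have t1 : t < 1 by rewrite -(@ltr_pXn2r _ 2) ?nnegrE// expr1n t2 gt_max s1 ltr01.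
exists (1 - t); first by rewrite subr_gt0.
move=> w hw; have wt : t <= normc w.
  have := nc_lerB z (z - w); rewrite subKr nc_distC => h; move: hw z1 h.
  by move: (normc (w - z)) (normc z) (normc w) => a b c; lra.
rewrite u0 ?mulr0//; apply: (@le_trans _ _ (t ^+ 2)); first by rewrite t2 le_max lexx.
by rewrite lerXn2r ?nnegrE ?nc_ge0.
Qed.

Lemma isd_f (f : C -> C) z : has_partials f z ->
  isd (fun t : R => f (t +i* complex.Im z)) (complex.Re z) (partial_x f z) /\
  isd (fun t : R => f (complex.Re z +i* t)) (complex.Im z) (partial_y f z).
Proof.
have dd (g : R -> R) (x : R) : derivable g x 1 -> is_derive x 1 g (derive1 g x).
  by move=> h; rewrite derive1E; exact: DeriveDef.
by move=> [h1 h2 h3 h4]; split; split; [exact: dd h1|exact: dd h2|exact: dd h3|exact: dd h4].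
Qed.

Section Star.
Variables (f : C -> C) (s : R) (a : nat).
Hypotheses (hf : lambda_analytic lambda f) (s0 : 0 < s) (s1 : s < 1) (a0 : (0 < a)%N).
Variables psi psix psiy dpsi : C -> C.
Hypothesis hpsi : PD psi psix psiy dpsi.

Let u := fun z => chi s a.+1 z * psi z.
Let c := fun x : R => (- (2 * a.+1%:R * x))%:C.
Let ux := fun z => c (complex.Re z) * chi s a z * psi z + chi s a.+1 z * psix z.
Let uy := fun z => c (complex.Im z) * chi s a z * psi z + chi s a.+1 z * psiy z.
Let K := fun z => f z * u z.
Let Kx := fun z => partial_x f z * u z + f z * ux z.
Let Ky := fun z => partial_y f z * u z + f z * uy z.

Let cf : continuous_on_disk f. Proof. by case: hf => -[]. Qed.
Let pf z : disk z -> has_partials f z. Proof. by case: hf => -[_ [h _ _]] _; exact: h. Qed.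
Let cfx : continuous_on_disk (partial_x f).
Proof. by case: hf => -[_ [_ h _]] _; case: h. Qed.
Let cfy : continuous_on_disk (partial_y f).
Proof. by case: hf => -[_ [_ _ h]] _; case: h. Qed.

Let u0 z : s <= normc z ^+ 2 -> u z = 0. Proof. by move=> h; rewrite /u chi0// mul0r. Qed.
Let ux0 z : s <= normc z ^+ 2 -> ux z = 0.
Proof. by move=> h; rewrite /ux !chi0// mulr0 !mul0r addr0. Qed.
Let uy0 z : s <= normc z ^+ 2 -> uy z = 0.
Proof. by move=> h; rewrite /uy !chi0// mulr0 !mul0r addr0. Qed.

Let gC_re : gC (fun z => c (complex.Re z)).
Proof.
have h : gC (fun z : C => (complex.Re z)%:C).
  apply: gC_real => z e e0; exists e => // w hw.
  by apply: le_lt_trans hw; rewrite -cReN -cReD Re_le.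
have := gC_M (gC_cst (- (2 * a.+1%:R))%:C) h.
rewrite (_ : (fun z => _ * _) = (fun z => c (complex.Re z)))//.
by apply/funext => z; rewrite /c -RCM mulNr.
Qed.

Let gC_im : gC (fun z => c (complex.Im z)).
Proof.
have h : gC (fun z : C => (complex.Im z)%:C).
  apply: gC_real => z e e0; exists e => // w hw.
  by apply: le_lt_trans hw; rewrite -cImN -cImD Im_le.
have := gC_M (gC_cst (- (2 * a.+1%:R))%:C) h.
rewrite (_ : (fun z => _ * _) = (fun z => c (complex.Im z)))//.
by apply/funext => z; rewrite /c -RCM mulNr.
Qed.

Let gu : gC u.
Proof. by case: hpsi => -[h _ _ _] _ _ _; apply: gC_M => //; exact: gC_chi. Qed.
Let gux : gC ux.
Proof.
case: hpsi => -[h hx _ _] _ _ _; apply: gC_D; apply: gC_M => //; last exact: gC_chi.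
by apply: gC_M => //; exact: gC_chi.
Qed.
Let guy : gC uy.
Proof.
case: hpsi => -[h _ hy _] _ _ _; apply: gC_D; apply: gC_M => //; last exact: gC_chi.
by apply: gC_M => //; exact: gC_chi.
Qed.

Let gKx : gC Kx.
Proof. by apply: gC_D; [exact: gC_cut s1 cfx gu u0|exact: gC_cut s1 cf gux ux0]. Qed.
Let gKy : gC Ky.
Proof. by apply: gC_D; [exact: gC_cut s1 cfy gu u0|exact: gC_cut s1 cf guy uy0]. Qed.

Let far (z : C) : 1 <= normc z -> s <= normc z ^+ 2.
Proof.
move=> z1; apply: le_trans (ltW s1) _; rewrite -(expr1n _ 2).
by rewrite lerXn2r ?nnegrE ?nc_ge0// ler01.
Qed.

Let dKx (x y : R) : isd (fun t : R => K (t +i* y)) x (Kx (x +i* y)).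
Proof.
have du : isd (fun t : R => u (t +i* y)) x (ux (x +i* y)).
  by case: hpsi => _ hx _ _; exact: isd_M (chi_dx s x y a0) (hx x y).
have [z1|z1] := ltP (normc (x +i* y)) 1.
  by have [h _] := isd_f (pf z1); exact: isd_M h du.
have e : Kx (x +i* y) = 0 by rewrite /Kx u0 ?ux0 ?mulr0 ?addr0//; exact: far.
rewrite e; have [d d0 hd] := @far_zero s f u _ s1 z1 u0.
apply: isd_eq d0 _ (isd_cst 0 x) => t ht; apply/esym; apply: hd.
apply: le_lt_trans (nc_le_ReIm _) _; by rewrite /= subrr normr0 addr0.
Qed.

Let dKy (x y : R) : isd (fun t : R => K (x +i* t)) y (Ky (x +i* y)).
Proof.
have du : isd (fun t : R => u (x +i* t)) y (uy (x +i* y)).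
  by case: hpsi => _ _ hy _; exact: isd_M (chi_dy s x y a0) (hy x y).
have [z1|z1] := ltP (normc (x +i* y)) 1.
  by have [_ h] := isd_f (pf z1); exact: isd_M h du.
have e : Ky (x +i* y) = 0 by rewrite /Ky u0 ?uy0 ?mulr0 ?addr0//; exact: far.
rewrite e; have [d d0 hd] := @far_zero s f u _ s1 z1 u0.
apply: isd_eq d0 _ (isd_cst 0 y) => t ht; apply/esym; apply: hd.
apply: le_lt_trans (nc_le_ReIm _) _; by rewrite /= subrr normr0 add0r.
Qed.

Let H1 := fun z => f z * (chi s a.+1 z * dpsi z).
Let H2 := fun z => f z * (z * psi z * chi s a z).

Lemma gC_star1 : gC H1.
Proof.
case: hpsi => -[_ _ _ h] _ _ _; apply: gC_cut s1 cf _ _.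
  by apply: gC_M => //; exact: gC_chi.
by move=> z hz; rewrite chi0// mul0r.
Qed.

Lemma gC_star2 : gC H2.
Proof.
case: hpsi => -[h _ _ _] _ _ _; apply: gC_cut s1 cf _ _.
  by apply: gC_M; [apply: gC_M => //; exact: gC_id|exact: gC_chi].
by move=> z hz; rewrite chi0// mulr0.
Qed.

(** The defect of the adjoint formula, less the half x-derivative of f u. Its fold is a weighted
    y-derivative, so both pieces integrate to 0. *)
Let G := fun z => (H1 z - a.+1%:R * H2 z) - 2^-1 * Kx z.

Let G_off z : complex.Im z != 0 -> G z = (0 +i* 2^-1) * (Ky z +
  (lambda / complex.Im z)%:C * (2 * K z - f (conjc z) * u z - f z * (chi s a.+1 z * psi (conjc z)))).
Proof.
move=> z0; rewrite /G /H1 /H2 /K /Kx /Ky.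
have [zs|zs] := lerP s (normc z ^+ 2).
  by rewrite ux0// uy0// u0// !chi0//; ring.
have z1 : disk z.
  have := lt_trans zs s1; rewrite -(expr1n _ 2) => h.
  by rewrite /disk/mkset -(@ltr_pXn2r _ 2) ?nnegrE ?nc_ge0.
have := hf.2 z z1; rewrite /dunkl_zbar /d_zbar /refl_quotient_ext (negbTE z0) /refl_quotient.
case: hpsi => _ _ _ /(_ z z0) <-.
rewrite /ux /uy /u /c.
have eI : (lambda / complex.Im z)%:C = lambda%:C / (complex.Im z)%:C :> C.
  by rewrite RCM; congr (_ * _); exact: (fmorphV (real_complex R)).
have ez : z - conjc z = 2 * (0 +i* 1) * (complex.Im z)%:C.
  by case: (z) => x y; apply/eqP; rewrite eq_complex/=; apply/andP; split; apply/eqP; ring.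
have eh : (0 +i* 2^-1 : C) = (0 +i* 1) / 2.
  apply: (@mulIf _ 2); rewrite ?pnatr_eq0// mulfVK ?pnatr_eq0// -(RCnat R 2).
  by apply: complex_eq; rewrite /=; field.
have eX : (- (2 * a.+1%:R * complex.Re z))%:C = - (2 * a.+1%:R * (complex.Re z)%:C) :> C.
  by rewrite RCN !RCM !RCnat.
have eY : (- (2 * a.+1%:R * complex.Im z))%:C = - (2 * a.+1%:R * (complex.Im z)%:C) :> C.
  by rewrite RCN !RCM !RCnat.
rewrite eI eX eY ez eh.
have I0 : (complex.Im z)%:C != 0 :> C by rewrite eq_complex/= eqxx andbT.
have ii : (0 +i* 1) * (0 +i* 1) = -1 :> C.
  by apply/eqP; rewrite eq_complex/=; apply/andP; split; apply/eqP; ring.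
have i0 : (0 +i* 1 : C) != 0.
  by apply/eqP => h; move: ii; rewrite h mul0r => /eqP; rewrite eq_sym oppr_eq0 oner_eq0.
have zE : z = (complex.Re z)%:C + (0 +i* 1) * (complex.Im z)%:C.
  by case: (z) => x y; apply/eqP; rewrite eq_complex/=; apply/andP; split; apply/eqP; ring.
have -> : z * psi z = ((complex.Re z)%:C + (0 +i* 1) * (complex.Im z)%:C) * psi z.
  by congr (_ * _).
move: (a.+1%:R : C) => A.
move: (partial_x f z) (partial_y f z) (f z) (f (conjc z)) (psi z) (psi (conjc z)) (psix z) (psiy z).
move: (chi s a z) (chi s a.+1 z) (complex.Re z)%:C (complex.Im z)%:C (lambda%:C) I0 (0 +i* 1 : C) ii i0.
move=> X' X x y l y0 i ii i0 fx fy F Fb P Pb Px Py E.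
(* D_zbar f = 0 eliminates the x-derivative of f; the rest is an identity of rational
   expressions. *)
have {}E : fx = - i * fy + 2 * l * ((F - Fb) / (2 * i * y)).
  move/eqP: E; rewrite subr_eq0 => /eqP E; have := congr1 (fun t => 2 * t) E.
  rewrite mulrC mulfVK ?pnatr_eq0// => E2.
  rewrite -(addrK (i * fy) fx) E2; ring.
rewrite E; have iV : i^-1 = - i by apply: (mulfI i0); rewrite divff// mulrN ii opprK.
by rewrite !invfM iV; field.
Qed.

(* The adjoint of multiplication by z under the Dunkl derivative of a cut-off test
   function: the x- and y-derivatives of f u integrate to 0. *)
Lemma star : JC H1 = a.+1%:R * JC H2.
Proof.
have gH1 := gC_star1; have gH2 := gC_star2.
have gA : gC (fun z => a.+1%:R * H2 z) by apply: gC_M => //; exact: gC_cst.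
have gB : gC (fun z => 2^-1 * Kx z) by apply: gC_M => //; exact: gC_cst.
have gAB : gC (fun z => H1 z - a.+1%:R * H2 z).
  have -> : (fun z => H1 z - a.+1%:R * H2 z) = (fun z => H1 z + -1 * (a.+1%:R * H2 z)).
    by apply/funext => z; rewrite mulN1r.
  by apply: gC_D => //; apply: gC_M => //; exact: gC_cst.
have gG : gC G.
  have -> : G = (fun z => (H1 z - a.+1%:R * H2 z) + -1 * (2^-1 * Kx z)).
    by apply/funext => z; rewrite /G mulN1r.
  by apply: gC_D => //; apply: gC_M => //; exact: gC_cst.
have K0 z : s <= normc z ^+ 2 -> K z = 0 by move=> h; rewrite /K u0// mulr0.
have eX : JC Kx = 0.
  apply: (JC_dx gKx s0 s1 dKx) => z h; split; last exact: K0.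
  by rewrite /Kx u0// ux0// !mulr0 addr0.
have eY : JC G = 0.
  apply: (JC_dy gG gKy s0 s1 dKy) => [z h|x y y0].
    split; last exact: K0.
    by rewrite /G /H1 /H2 /Kx u0// ux0// !chi0//; ring.
  have n0 : complex.Im (x +i* y) != 0 by rewrite /= gt_eqF.
  have n1 : complex.Im (x +i* - y) != 0 by rewrite /= oppr_eq0 gt_eqF.
  rewrite (G_off n0) (G_off n1) /K /u.
  have cc : chi s a.+1 (x +i* - y) = chi s a.+1 (x +i* y) :> C.
    by rewrite /chi !ncE/= sqrrN.
  have j1 : conjc (x +i* y) = x +i* - y by [].
  have j2 : conjc (x +i* - y) = x +i* y :> C by rewrite /= opprK.
  have ny : (lambda / - y)%:C = - (lambda / y)%:C :> C.
    by rewrite invrN mulrN RCN.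
  rewrite j1 j2 cc [complex.Im _]/= [complex.Im (x +i* - y)]/= ny.
  have -> : (2 * lambda / y)%:C = 2 * (lambda / y)%:C :> C by rewrite -mulrA RCM RCnat.
  move: (lambda / y)%:C (chi s a.+1 _) (f _) (f _) (psi _) (psi _) (Ky _) (Ky _) (0 +i* 2^-1 : C).
  by move=> l X F F' P P' k k' i; ring.
have : JC G = JC H1 - a.+1%:R * JC H2 - 2^-1 * JC Kx.
  by rewrite -!JC_Z// -JC_B// -JC_B//.
by rewrite eY eX mulr0 subr0 => /esym/eqP; rewrite subr_eq0 => /eqP.
Qed.

End Star.

End DunklAdjoint.

(** * Polynomial test functions *)

Section Smooth.
Variable R : realType.
Notation C := R[i].
Variable lambda : R.
Hypothesis l0 : 0 <= lambda.
Notation JC := (JC lambda).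
Implicit Types (psi L M : C -> C).

(* L and M are the Wirtinger derivatives d_z psi and d_zbar psi. *)
Definition sm psi L M :=
  [/\ [/\ gC psi, gC L & gC M],
   (forall x y : R, isd (fun t : R => psi (t +i* y)) x (L (x +i* y) + M (x +i* y))) &
   (forall x y : R, isd (fun t : R => psi (x +i* t)) y
      ((0 +i* 1) * (L (x +i* y) - M (x +i* y))))].

Lemma isd_val (g : R -> C) t l l' : l = l' -> isd g t l -> isd g t l'.
Proof. by move=> ->. Qed.

Lemma iiC : (0 +i* 1) * (0 +i* 1) = -1 :> C.
Proof. by apply: complex_eq => /=; ring. Qed.

Lemma gC_B (H K : C -> C) : gC H -> gC K -> gC (fun z => H z - K z).
Proof.
move=> h k; rewrite (_ : (fun z => _) = (fun z => H z + -1 * K z)).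
  by apply: gC_D => //; apply: gC_M => //; exact: gC_cst.
by apply/funext => z; rewrite mulN1r.
Qed.

Lemma sm_PD psi L M dpsi : sm psi L M -> gC dpsi ->
  (forall z, complex.Im z != 0 ->
     M z - lambda%:C * ((psi z - psi (conjc z)) / (z - conjc z)) = dpsi z) ->
  PD lambda psi (fun z => L z + M z) (fun z => (0 +i* 1) * (L z - M z)) dpsi.
Proof.
move=> [[h1 h2 h3] hx hy] hd E; split=> //.
  split=> //; first exact: gC_D.
  by apply: gC_M; [exact: gC_cst|exact: gC_B].
move=> z z0; rewrite -E// mulrA iiC; congr (_ - _).
by field.
Qed.

Lemma eq_sm psi psi' L L' M M' : psi =1 psi' -> L =1 L' -> M =1 M' ->
  sm psi L M -> sm psi' L' M'.
Proof. by move=> /funext -> /funext -> /funext ->. Qed.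

Lemma sm_cst c : sm (fun=> c) (fun=> 0) (fun=> 0).
Proof.
split; first by split; exact: gC_cst.
  by move=> x y; rewrite addr0; exact: isd_cst.
by move=> x y; rewrite subr0 mulr0; exact: isd_cst.
Qed.

Lemma sm_id : sm id (fun=> 1) (fun=> 0).
Proof.
split; first by split; [exact: gC_id|exact: gC_cst|exact: gC_cst].
  move=> x y; rewrite addr0; split=> /=; [exact: is_derive_id|exact: is_derive_cst].
move=> x y; rewrite subr0 mulr1; split=> /=; [exact: is_derive_cst|exact: is_derive_id].
Qed.

Lemma sm_conjc : sm (@conjc R) (fun=> 0) (fun=> 1).
Proof.
split; first by split; [apply: gC_conj; exact: gC_id|exact: gC_cst|exact: gC_cst].
  move=> x y; rewrite add0r; split=> /=; [exact: is_derive_id|exact: is_derive_cst].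
move=> x y; rewrite sub0r mulrN1; split=> /=.
  by rewrite oppr0; exact: is_derive_cst.
exact: is_deriveN.
Qed.

Lemma sm_D psi psi' L L' M M' : sm psi L M -> sm psi' L' M' ->
  sm (fun z => psi z + psi' z) (fun z => L z + L' z) (fun z => M z + M' z).
Proof.
move=> [[a1 a2 a3] ax ay] [[b1 b2 b3] bx by_]; split; first by split; exact: gC_D.
  move=> x y; rewrite addrACA; exact: isd_D.
by move=> x y; rewrite opprD addrACA mulrDr; exact: isd_D.
Qed.

Lemma sm_M psi psi' L L' M M' : sm psi L M -> sm psi' L' M' ->
  sm (fun z => psi z * psi' z) (fun z => L z * psi' z + psi z * L' z)
     (fun z => M z * psi' z + psi z * M' z).
Proof.
move=> [[a1 a2 a3] ax ay] [[b1 b2 b3] bx by_]; split.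
  by split; [exact: gC_M|apply: gC_D; exact: gC_M|apply: gC_D; exact: gC_M].
  move=> x y; apply: isd_val (isd_M (ax x y) (bx x y)).
  by move: (L _) (M _) (L' _) (M' _) (psi _) (psi' _) => ? ? ? ? ? ?; ring.
move=> x y; apply: isd_val (isd_M (ay x y) (by_ x y)).
by move: (0 +i* 1 : C) (L _) (M _) (L' _) (M' _) (psi _) (psi' _) => ? ? ? ? ? ? ?; ring.
Qed.

Lemma sm_Z c psi L M : sm psi L M ->
  sm (fun z => c * psi z) (fun z => c * L z) (fun z => c * M z).
Proof.
by move=> h; apply: eq_sm (sm_M (sm_cst c) h) => z //=; rewrite mul0r add0r.
Qed.

Lemma sm_X n psi L M : sm psi L M -> sm (fun z => psi z ^+ n)
  (fun z => n%:R * psi z ^+ n.-1 * L z) (fun z => n%:R * psi z ^+ n.-1 * M z).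
Proof.
move=> h; elim: n => [|n IH].
  by apply: eq_sm (sm_cst 1) => z //=; rewrite !mul0r.
have e (x y : C) : y * x ^+ n + x * (n%:R * x ^+ n.-1 * y) = n.+1%:R * x ^+ n * y.
  clear IH; case: n => [|n]; first by rewrite /= expr0; ring.
  by rewrite /= -[n.+2%:R]natr1 exprS; ring.
by apply: eq_sm (sm_M h IH) => z //=; rewrite ?exprS ?e.
Qed.

Lemma sm_sum n (F L M : nat -> C -> C) : (forall j, sm (F j) (L j) (M j)) ->
  sm (fun z => \sum_(j < n) F j z) (fun z => \sum_(j < n) L j z) (fun z => \sum_(j < n) M j z).
Proof.
move=> h; elim: n => [|n IH].
  by apply: eq_sm (sm_cst 0) => z /=; rewrite big_ord0.
by apply: eq_sm (sm_D IH (h n)) => z /=; rewrite big_ord_recr.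
Qed.

Lemma sm_refl psi L M : sm psi L M ->
  sm (fun z => psi (conjc z)) (fun z => M (conjc z)) (fun z => L (conjc z)).
Proof.
move=> [[h1 h2 h3] hx hy]; split; first by split; exact: gC_refl.
  by move=> x y; rewrite addrC; exact: hx.
move=> x y; have := isd_opp (hy x (- y)).
by rewrite -mulrN opprB.
Qed.

Lemma sm_mon i j : sm (fun z => conjc z ^+ j * z ^+ i)
  (fun z => conjc z ^+ j * (i%:R * z ^+ i.-1)) (fun z => j%:R * conjc z ^+ j.-1 * z ^+ i).
Proof.
apply: eq_sm (sm_M (sm_X j sm_conjc) (sm_X i sm_id)) => z //=.
  by rewrite mulr0 mul0r add0r mulr1.
by rewrite mulr1 mulr0 mulr0 addr0.
Qed.

Lemma gC_mon i j : gC (fun z : C => conjc z ^+ j * z ^+ i).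
Proof. by have [[]] := sm_mon i j. Qed.

Lemma gC_hterm c n : gC (hterm c n : C -> C).
Proof.
have h j : gC (fun z : C => c n j * (conjc z ^+ j * z ^+ (n - j))).
  by apply: gC_M; [exact: gC_cst|exact: gC_mon].
rewrite (_ : hterm c n = fun z => \sum_(j < n.+1) c n j * (conjc z ^+ j * z ^+ (n - j))).
  exact: gC_sum h.
by apply/funext => z; apply: eq_bigr => j _; rewrite mulrA.
Qed.

Lemma sm_hterm c n : sm (hterm c n.+1) (hterm (dzc c) n) (hterm (dzbc c) n).
Proof.
apply: eq_sm (sm_sum n.+2 (fun j => sm_Z (c n.+1 j) (sm_mon (n.+1 - j) j))) => z.
- by apply: eq_bigr => j _; rewrite mulrA.
- rewrite big_ord_recr/= subnn mul0r !mulr0 addr0; apply: eq_bigr => j _.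
  by rewrite /dzc subSn ?leq_ord//=; ring.
- rewrite big_ord_recl/= !mul0r mulr0 add0r; apply: eq_bigr => j _.
  by rewrite /dzbc /bump add1n subSS/=; ring.
Qed.

Lemma euler_hterm (c : nat -> nat -> C) n z :
  z * hterm (dzc c) n z + conjc z * hterm (dzbc c) n z = n.+1%:R * hterm c n.+1 z.
Proof.
rewrite /hterm !mulr_sumr.
transitivity (\sum_(j < n.+2) (n.+1 - j)%:R * (c n.+1 j * conjc z ^+ j * z ^+ (n.+1 - j)) +
  \sum_(j < n.+2) j%:R * (c n.+1 j * conjc z ^+ j * z ^+ (n.+1 - j))).
  congr (_ + _).
    rewrite [RHS]big_ord_recr/= subnn mul0r addr0; apply: eq_bigr => j _.
    by rewrite /dzc subSn ?leq_ord// exprS; ring.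
  rewrite [RHS]big_ord_recl/= mul0r add0r; apply: eq_bigr => j _.
  by rewrite /dzbc /bump add1n subSS exprS; ring.
rewrite -big_split/=; apply: eq_bigr => j _.
by rewrite -mulrDl natrB ?leq_ord// subrK.
Qed.

Let kc n j : C := (kap lambda n j)%:C.

Lemma subC_conj_neq0 (z : C) : complex.Im z != 0 -> z - conjc z != 0.
Proof.
move=> h; apply/eqP => /(congr1 (@complex.Im R)); rewrite cImD cImN /=; case: z h => a c /= h.
by rewrite opprK => /eqP; rewrite -mulr2n mulrn_eq0/=; exact/negP.
Qed.

(** Conjugation exchanges D_z and D_zbar, so this is the conjugate of the eigenvalue relation of D_z
    o z on phi_k. *)
Lemma PD_SS k : exists px py, PD lambda (fun z => conjc z * SS lambda k (conjc z)) px py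
  (fun z => (k.+1%:R + lambda%:C) * SS lambda k (conjc z)).
Proof.
have gS : gC (fun z => (k.+1%:R + lambda%:C) * SS lambda k (conjc z)).
  by apply: gC_M; [exact: gC_cst|apply: gC_refl; exact: gC_hterm].
case: k gS => [|k] gS.
  do 2 eexists; apply: sm_PD gS _.
    apply: eq_sm (sm_conjc) => //= z.
    by rewrite /SS /hterm big_ord1 /kap !pf0 mulr1 !expr0 !mulr1.
  move=> z /subC_conj_neq0 z0; rewrite conjcK /SS /hterm !big_ord1 /kap subnn !pf0 !expr0 !mulr1.
  by rewrite -[in X in X / _]opprB mulNr divff//; ring.
do 2 eexists; apply: sm_PD gS _.
  exact: (sm_M sm_conjc (sm_refl (sm_hterm kc k))).
move=> z z0'; have z0 := subC_conj_neq0 z0'; rewrite /= conjcK mul1r.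
have E1 := dzb_SS lambda k (conjc z); have E2 := euler_hterm kc k (conjc z).
rewrite conjcK -/kc in E1; rewrite conjcK in E2.
rewrite -/(SS lambda k.+1 (conjc z)) -/(SS lambda k.+1 z).
rewrite -/(SS lambda k.+1 (conjc z)) in E2.
move: (SS lambda k.+1 z) (SS lambda k.+1 (conjc z)) (hterm _ _ _) (hterm _ _ _) E1 E2 z0.
move: (conjc z) (lambda%:C) => w l S S' A B; rewrite /= => E1 E2 z0.
apply: (mulIf z0); rewrite mulrBl mulrA mulfVK//.
rewrite -[k.+2%:R]natr1.
have -> : w * A = k.+1%:R * S' - z * B by rewrite -E2; ring.
have E3 : z * ((w - z) * B) = z * (l * (S' - S)) by rewrite E1.
transitivity ((k.+1%:R + 1) * S' * (z - w) + z * ((w - z) * B) - l * (w * S' - z * S)).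
  by ring.
by rewrite E3; ring.
Qed.

Lemma subrXX_conj (n m : nat) (x y : C) : (m <= n)%N ->
  y ^+ m * x ^+ n - x ^+ m * y ^+ n =
  (x - y) * \sum_(l < n - m) y ^+ (m + l) * x ^+ (n.-1 - l).
Proof.
move=> mn.
have -> : y ^+ m * x ^+ n - x ^+ m * y ^+ n = (x * y) ^+ m * (x ^+ (n - m) - y ^+ (n - m)).
  by rewrite -{1 2}(subnKC mn) !exprD exprMn; ring.
rewrite subrXX mulrCA; congr (_ * _); rewrite mulr_sumr; apply: eq_bigr => l _.
have hl := ltn_ord l.
have -> : (n.-1 - l = m + ((n - m).-1 - l))%N by lia.
by rewrite exprMn !exprD; ring.
Qed.

(** D_zbar lowers the degree of a monomial by one, since the difference quotient is a polynomial.
    For j = 0 the term of d_zbar keeps its degree on paper, as [j.-1] is 0, but has coefficient 0;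
    hence the alternative. *)
Lemma PD_mon i j : exists px py (t : nat) (a : nat -> C) (e e' : nat -> nat),
  PD lambda (fun z => conjc z ^+ j * z ^+ i) px py
     (fun z => \sum_(l < t) a l * (conjc z ^+ e l * z ^+ e' l)) /\
  forall l, (l < t)%N -> a l = 0 \/ (e l + e' l < i + j)%N.
Proof.
have gS t (a : nat -> C) (e e' : nat -> nat) : gC (fun z : C => \sum_(l < t) a l * (conjc z ^+ e l * z ^+ e' l)).
  have h l : gC (fun z : C => a l * (conjc z ^+ e l * z ^+ e' l)).
    by apply: gC_M; [exact: gC_cst|exact: gC_mon].
  exact: (gC_sum t h).
have [ji|ij] := leqP j i.
  pose a (l : nat) : C := if l is l'.+1 then - lambda%:C else j%:R.
  pose e l := if l is l'.+1 then (j + l')%N else j.-1.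
  pose e' l := if l is l'.+1 then (i.-1 - l')%N else i.
  do 2 eexists; exists (i - j).+1, a, e, e'; split.
    apply: sm_PD (sm_mon i j) (gS _ a e e') _ => z /subC_conj_neq0 z0.
    rewrite conjcK subrXX_conj// [(z - conjc z) * _]mulrC mulfK// big_ord_recl/= mulrA; congr (_ + _).
    by rewrite -mulNr mulr_sumr.
  move=> [|l]; last by rewrite ltnS => hl; right; rewrite /e /e'; lia.
  by move=> _; rewrite /a /e /e'; case: j {ji gS a e e'} => [|j]; [left|right; rewrite /=; lia].
have ji := ltnW ij.
pose a (l : nat) : C := if l is l'.+1 then lambda%:C else j%:R.
pose e l := if l is l'.+1 then (j.-1 - l')%N else j.-1.
pose e' l := if l is l'.+1 then (i + l')%N else i.
do 2 eexists; exists (j - i).+1, a, e, e'; split.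
  apply: sm_PD (sm_mon i j) (gS _ a e e') _ => z /subC_conj_neq0 z0.
  rewrite conjcK.
  have -> : conjc z ^+ j * z ^+ i - z ^+ j * conjc z ^+ i =
     (z - conjc z) * - \sum_(l < j - i) z ^+ (i + l) * conjc z ^+ (j.-1 - l).
    have := @subrXX_conj j i (conjc z) z ji; rewrite mulrN -mulNr opprB => <-.
    by ring.
  rewrite [(z - conjc z) * _]mulrC mulfK// big_ord_recl/= mulrN opprK mulrA; congr (_ + _).
  by rewrite mulr_sumr; apply: eq_bigr => l _; rewrite [z ^+ _ * _]mulrC.
move=> [|l]; last by rewrite ltnS => hl; right; rewrite /e /e'; lia.
by move=> _; rewrite /a /e /e'; case: j {ij ji gS a e e'} => [|j]; [left|right; rewrite /=; lia].
Qed.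

End Smooth.

(** * Moments against cut-offs *)

Section Moments.
Variable R : realType.
Notation C := R[i].
Variable lambda : R.
Hypothesis l0 : 0 <= lambda.
Notation JC := (JC lambda).
Implicit Types (f g H K : C -> C) (s : R).

Definition mom f a s H : C := JC (fun z => f z * (chi s a z * H z)).

Lemma gC_mom f a s H : continuous_on_disk f -> s < 1 -> (0 < a)%N -> gC H ->
  gC (fun z => f z * (chi s a z * H z)).
Proof.
move=> cf s1 a0 gH; apply: gC_cut s1 cf _ _; first by apply: gC_M => //; exact: gC_chi.
by move=> z hz; rewrite chi0// mul0r.
Qed.

Lemma eq_mom f a s H K : H =1 K -> mom f a s H = mom f a s K.
Proof. by move=> /funext ->. Qed.

Section Linear.
Variables (f : C -> C) (a : nat) (s : R).
Hypotheses (cf : continuous_on_disk f) (s1 : s < 1) (a0 : (0 < a)%N).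

Lemma mom_D H K : gC H -> gC K -> mom f a s (fun z => H z + K z) = mom f a s H + mom f a s K.
Proof.
move=> gH gK; rewrite /mom -JC_D; [|exact: l0|exact: gC_mom|exact: gC_mom].
by congr JC; apply/funext => z; rewrite !mulrDr.
Qed.

Lemma mom_Z c H : gC H -> mom f a s (fun z => c * H z) = c * mom f a s H.
Proof.
move=> gH; rewrite /mom -JC_Z; [|exact: l0|exact: gC_mom].
congr JC; apply/funext => z.
by move: (f z) (chi s a z) (H z) => ? ? ?; ring.
Qed.

Lemma mom_sum n (H : nat -> C -> C) : (forall i, gC (H i)) ->
  mom f a s (fun z => \sum_(i < n) H i z) = \sum_(i < n) mom f a s (H i).
Proof.
move=> gH; rewrite /mom -(JC_sum l0 n (F := fun i z => f z * (chi s a z * H i z))); last first.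
  by move=> i; exact: gC_mom.
by congr JC; apply/funext => z; rewrite !mulr_sumr.
Qed.

End Linear.

Lemma star_mom f a s psi px py dpsi : lambda_analytic lambda f -> 0 < s -> s < 1 ->
  (0 < a)%N -> PD lambda psi px py dpsi ->
  mom f a.+1 s dpsi = a.+1%:R * mom f a s (fun z => z * psi z).
Proof.
move=> hf s0 s1 a0 hp; rewrite /mom (star l0 hf s0 s1 a0 hp); congr (_ * JC _).
by apply/funext => z; rewrite [_ * chi s a z]mulrC.
Qed.

Lemma posnS a (t : R) : (0 < a)%N -> posn a.+1 t = t * posn a t.
Proof.
move=> a0; rewrite /posn exprS; case: (leP t 0) => // t0.
by rewrite expr0n eqn0Ngt a0 !mulr0.
Qed.

Lemma chiS s a z : (0 < a)%N -> chi s a.+1 z = (s%:C - z * conjc z) * chi s a z.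
Proof.
move=> a0; rewrite /chi posnS// RCM; congr (_ * _).
rewrite ncE; apply: complex_eq; case: z => x y /=; ring.
Qed.

(** The pairing of f with SS_k, weighted by (s - |z|^2)_+^a: the conjugate of SS_k is SS_k at
    conj(z). *)
Definition T f k a s := mom f a s (fun z => SS lambda k (conjc z)).

Lemma gC_SSc k : gC (fun z => SS lambda k (conjc z)).
Proof. by apply: gC_refl; exact: gC_hterm. Qed.

(** [star_mom] with conj(z SS_k) as test function produces the moment with the extra factor |z|^2 at
    level a; the identity chi_(a+1) = (s - |z|^2) chi_a rewrites it through levels a and a + 1. *)
Lemma T_rec f k a s : lambda_analytic lambda f -> 0 < s -> s < 1 -> (0 < a)%N ->
  ((a.+1 + k.+1)%:R + lambda%:C) * T f k a.+1 s = a.+1%:R * s%:C * T f k a s.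
Proof.
move=> hf s0 s1 a0; have cf : continuous_on_disk f by case: hf => -[].
have [px [py hp]] := PD_SS lambda k.
have := star_mom hf s0 s1 a0 hp; have gS := gC_SSc k.
rewrite mom_Z// -/(T f k a.+1 s) => E.
have E2 : mom f a s (fun z => z * (conjc z * SS lambda k (conjc z))) =
   s%:C * T f k a s - T f k a.+1 s.
  rewrite /T -mom_Z// /mom -(JC_B l0); [|apply: gC_mom => //..]; last first.
    by apply: gC_M => //; exact: gC_cst.
  congr JC; apply/funext => z; rewrite chiS//.
  move: (SS _ _ _) => S; by move: (conjc z) (chi s a z) (f z) => ? ? ?; ring.
by rewrite natrD -addrA mulrDl E E2; ring.
Qed.

Section Nullity.
Variables (f g : C -> C) (s : R).
Hypotheses (hf : lambda_analytic lambda f) (hg : lambda_analytic lambda g).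
Hypotheses (s0 : 0 < s) (s1 : s < 1).
Hypothesis hT : forall k a, (1 < a)%N -> T f k a s = T g k a s.

Let cf : continuous_on_disk f. Proof. by case: hf => -[]. Qed.
Let cg : continuous_on_disk g. Proof. by case: hg => -[]. Qed.
Let nul H := forall a, (1 < a)%N -> mom f a s H = mom g a s H.
Let mon (i j : nat) (z : C) := conjc z ^+ j * z ^+ i.

Let nulD H K : gC H -> gC K -> nul H -> nul K -> nul (fun z => H z + K z).
Proof. by move=> gH gK h k a a1; rewrite !mom_D ?(ltnW a1)// h// k. Qed.

Let nulZ c H : gC H -> nul H -> nul (fun z => c * H z).
Proof. by move=> gH h a a1; rewrite !mom_Z ?(ltnW a1)// h. Qed.

Let nul_sum n (H : nat -> C -> C) : (forall i, gC (H i)) ->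
  (forall i, (i < n)%N -> nul (H i)) -> nul (fun z => \sum_(i < n) H i z).
Proof.
move=> gH h a a1; rewrite !mom_sum ?(ltnW a1)//; apply: eq_bigr => i _.
exact: h.
Qed.

(** A moment containing a factor z equals, by [star_mom], the moment of D_zbar of the remaining
    monomial at level a + 1. Its degree is lower, so the induction hypothesis applies. *)
Let nul_mon_z i j : (forall i' j', (i' + j' < i + j)%N -> nul (mon i' j')) -> nul (mon i.+1 j).
Proof.
move=> IH a a1; have a0 := ltnW a1.
have [px [py [t [b [e [e' [hp he]]]]]]] := PD_mon l0 i j.
have E1 := star_mom hf s0 s1 a0 hp; have E2 := star_mom hg s0 s1 a0 hp.
have gH l : gC (fun z : C => b l * (conjc z ^+ e l * z ^+ e' l)).
  by apply: gC_M; [exact: gC_cst|exact: gC_mon].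
have nH : nul (fun z => \sum_(l < t) b l * (conjc z ^+ e l * z ^+ e' l)).
  apply: (@nul_sum t (fun l z => b l * (conjc z ^+ e l * z ^+ e' l))) => // l lt.
  have gm := gC_mon (R := R) (e' l) (e l).
  have [b0 c c0|h] := he l lt; last by apply: nulZ => //; apply: IH; rewrite addnC.
  by rewrite !mom_Z ?(ltnW c0)// b0 !mul0r.
have : a.+1%:R * mom f a s (fun z => z * (conjc z ^+ j * z ^+ i)) =
       a.+1%:R * mom g a s (fun z => z * (conjc z ^+ j * z ^+ i)).
  by rewrite -E1 -E2 nH// ltnW.
move/(mulfI _) => h.
rewrite (_ : mon i.+1 j = fun z => z * (conjc z ^+ j * z ^+ i)); last first.
  by apply/funext => z; rewrite /mon exprS mulrCA.
by apply: h; rewrite pnatr_eq0.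
Qed.

(** Induction on the degree. Monomials containing z are settled by [nul_mon_z]; the remaining
    conj(z)^j is recovered from SS_j(conj(z)), where its coefficient [kap j 0] is positive. *)
Lemma nul_mon i j a : (1 < a)%N -> mom f a s (mon i j) = mom g a s (mon i j).
Proof.
move: a; suff : forall n i j, (i + j < n)%N -> nul (mon i j) by apply; exact: leqnn.
elim=> [|n IH] {}i {}j // ijn.
have pos i' j' : (i' + j' < n)%N -> nul (mon i'.+1 j').
  by move=> h; apply: nul_mon_z => u v uv; apply: IH; exact: leq_trans uv (ltnW h).
case: i ijn => [|i] ijn; last by apply: pos; rewrite addSn in ijn.
have gm l : gC (fun z : C => (kap lambda j l)%:C * mon l (j - l) z).
  by apply: gC_M; [exact: gC_cst|exact: gC_mon].
have SE z : SS lambda j (conjc z) = \sum_(l < j.+1) (kap lambda j l)%:C * mon l (j - l) z.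
  by apply: eq_bigr => l _; rewrite conjcK /mon -mulrA [z ^+ _ * _]mulrC.
have k0 : (kap lambda j 0)%:C != 0 :> C.
  rewrite -nc_eq0 ncR normr_eq0 gt_eqF// /kap pf0 mul1r pf_gt0// ltr_wpDl//.
have nS : nul (fun z => \sum_(l < j.+1) (kap lambda j l)%:C * mon l (j - l) z).
  move=> a a1; have := hT j a1; rewrite /T.
  by rewrite (eq_mom _ _ _ SE) (eq_mom _ _ _ SE).
have nR : nul (fun z => \sum_(l < j) (kap lambda j l.+1)%:C * mon l.+1 (j - l.+1) z).
  apply: (@nul_sum j (fun l z => (kap lambda j l.+1)%:C * mon l.+1 (j - l.+1) z)) => // l lj.
  apply: nulZ; first exact: gC_mon.
  by apply: pos; move: ijn lj; rewrite add0n; lia.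
have -> : mon 0 j = (fun z => (kap lambda j 0)%:C^-1 *
   (\sum_(l < j.+1) (kap lambda j l)%:C * mon l (j - l) z +
     -1 * \sum_(l < j) (kap lambda j l.+1)%:C * mon l.+1 (j - l.+1) z)).
  apply/funext => z; rewrite big_ord_recl/= subn0 mulN1r addrK mulrA mulVf// mul1r.
  by [].
have g1 := @gC_sum R j.+1 _ gm; have g2 := @gC_sum R j _ (fun l => gm l.+1).
have gN : gC (fun z => -1 * \sum_(l < j) (kap lambda j l.+1)%:C * mon l.+1 (j - l.+1) z).
  by apply: gC_M => //; exact: gC_cst.
by apply: nulZ; [exact: gC_D|apply: nulD => //; exact: nulZ].
Qed.

End Nullity.

End Moments.

(** * Expansion of lambda-analytic functions *)

Section Coefficients.
Variable R : realType.
Notation C := R[i].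
Variable lambda : R.
Hypothesis l0 : 0 <= lambda.
Notation JC := (JC lambda).
Notation T := (T lambda).
Notation F b := (PS (phic lambda b)).
Implicit Types (f g H K : C -> C) (s : R).

Lemma inbox_of_nc (z : C) : normc z < 1 -> inbox z.
Proof.
move=> z1; split; rewrite -ltr_norml; [exact: le_lt_trans (Re_le z) z1|exact: le_lt_trans (Im_le z) z1].
Qed.

(** The cut-off product at s' = (1 + s) / 2 is continuous on the plane, hence bounded, and the
    cut-off is at least s' - s on |z|^2 <= s. *)
Lemma local_bound f g s : continuous_on_disk f -> gC g -> 0 <= s -> s < 1 ->
  exists2 M : R, 0 <= M & forall z, normc z ^+ 2 <= s -> normc (f z * g z) <= M.
Proof.
move=> cf gg s0 s1; pose s' := (1 + s) / 2.
have s'1 : s' < 1 by rewrite /s'; lra.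
have ss' : 0 < s' - s by rewrite /s'; lra.
have [M [[M0 b1] [_ b2]]] := gC_bounded (gC_mom cf s'1 (isT : 0 < 1)%N gg).
exists (2 * M / (s' - s)); first by rewrite divr_ge0 ?mulr_ge0// ltW.
move=> z zs; have z1 : normc z < 1.
  by rewrite -(@ltr_pXn2r _ 2) ?nnegrE ?nc_ge0// expr1n; exact: le_lt_trans zs s1.
have [q1 q2] := inbox_of_nc z1.
have [_ h1] := b1 (complex.Re z, complex.Im z) (conj q1 q2).
have [_ h2] := b2 (complex.Re z, complex.Im z) (conj q1 q2).
have := le_trans (nc_le_ReIm _) (lerD h1 h2); rewrite /RF /IF /=.
have -> : complex.Re z +i* complex.Im z = z by case: (z).
rewrite mulrCA normcM /chi ncR => h; rewrite ler_pdivlMr//.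
have d0 : s' - s <= s' - normc z ^+ 2 by rewrite lerD2l lerN2.
have -> : 2 * M = M + M by ring.
apply: le_trans h; rewrite mulrC ler_wpM2r ?nc_ge0//.
by rewrite /posn (expr1 (Num.max _ _)) ger0_norm ?le_max ?lexx ?orbT// d0.
Qed.

Lemma posn2_taylor (t h : R) : `|posn 2 (t + h) - posn 2 t - h * (2 * posn 1 t)| <= h ^+ 2.
Proof.
rewrite /posn expr1 ler_norml; case: (leP (t + h) 0) => a; case: (leP t 0) => b; apply/andP; split; nra.
Qed.

(** The expansion of (s - |z|^2)_+^2 in s has remainder at most h^2, and [local_bound] at s' > s
    bounds the other factors on all supports that occur. *)
Lemma T_deriv f k s : continuous_on_disk f -> 0 < s -> s < 1 ->
  isd (fun t => T f k 2 t) s (2 * T f k 1 s).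
Proof.
move=> cf s0 s1; have gS := gC_SSc lambda k.
pose s' := (1 + s) / 2.
have s'1 : s' < 1 by rewrite /s'; lra.
have ss' : 0 < s' - s by rewrite /s'; lra.
have s'0 : 0 <= s' by rewrite /s'; lra.
have [M M0 hM] := local_bound cf gS s'0 s'1.
have key (h : R) : `|h| < s' - s ->
    normc (T f k 2 (s + h) - T f k 2 s - h%:C * (2 * T f k 1 s)) <= 8 * M * h ^+ 2.
  rewrite ltr_norml => /andP[h1 h2]; have sh1 : s + h < 1 by lra.
  pose c := h%:C * 2.
  have g1 := gC_mom cf sh1 (isT : 0 < 2)%N gS; have g2 := gC_mom cf s1 (isT : 0 < 2)%N gS.
  have g3 := gC_mom cf s1 (isT : 0 < 1)%N gS.
  have g4 : gC (fun z => c * (f z * (chi s 1 z * SS lambda k (conjc z)))).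
    by apply: gC_M => //; exact: gC_cst.
  have g5 := gC_B g1 g2.
  rewrite mulrA -/c /T /mom -(JC_Z l0 c g3) -(JC_B l0 g1 g2) -(JC_B l0 g5 g4) -mulrA.
  apply: JC_bound => //; [exact: gC_B|by rewrite mulr_ge0 ?sqr_ge0|].
  move=> z _; set S := SS _ _ _.
  have -> : f z * (chi (s + h) 2 z * S) - f z * (chi s 2 z * S) - c * (f z * (chi s 1 z * S)) =
    (f z * S) * (chi (s + h) 2 z - chi s 2 z - c * chi s 1 z).
    by move: (chi _ _ _) (chi _ _ _) (chi _ _ _) (c) (f z) (S) => ? ? ? ? ? ?; ring.
  have [zs|zs] := leP (normc z ^+ 2) s'; last first.
    have z1 : s + h <= normc z ^+ 2 by lra.
    have z2 : s <= normc z ^+ 2 by lra.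
    rewrite !chi0//.
    by rewrite mulr0 !subr0 mulr0 nc0 mulr_ge0 ?sqr_ge0.
  rewrite normcM; apply: ler_pM; rewrite ?nc_ge0//; first exact: hM.
  have -> : chi (s + h) 2 z - chi s 2 z - c * chi s 1 z =
    (posn 2 ((s - normc z ^+ 2) + h) - posn 2 (s - normc z ^+ 2) -
      h * (2 * posn 1 (s - normc z ^+ 2)))%:C.
    rewrite /chi (_ : s + h - _ = (s - normc z ^+ 2) + h); last by ring.
    by rewrite !rmorphB/= /c !RCM RCnat mulrA.
  by rewrite ncR; exact: posn2_taylor.
have re (h : R) (X : C) : complex.Re (h%:C * X) = h * complex.Re X.
  by case: X => a b /=; rewrite mul0r subr0.
have im (h : R) (X : C) : complex.Im (h%:C * X) = h * complex.Im X.
  by case: X => a b /=; rewrite mul0r addr0.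
split; apply: (@quad_derive R _ _ _ (8 * M) (s' - s)) => // h hh;
  apply: le_trans (key h hh).
  by rewrite -re -!cReN -!cReD; exact: Re_le.
by rewrite -im -!cImN -!cImD; exact: Im_le.
Qed.

Lemma eq_of_derive0 (g : R -> R) (s t : R) : s <= t ->
  (forall u, s <= u <= t -> is_derive u 1 g 0) -> g s = g t.
Proof.
move=> st h; have c : {within `[s, t], continuous g}.
  apply: continuous_in_subspaceT => u; rewrite inE/= in_itv/= => hu.
  by apply/differentiable_continuous/derivable1_diffP; have [] := h u hu.
have [u hu e] := MVT_segment st (fun u hu => h u (subset_itv_oo_cc hu)) c.
by apply/eqP; rewrite eq_sym -subr_eq0 e mul0r.
Qed.

(** The degree of homogeneity in s: half of the degree in |z|, to which the two functions give 2 k,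
    the cut-off 4 and the weighted area 2 + 2 lambda. *)
Definition kexp (k : nat) : R := (2 + k.+1)%:R + lambda.

(* T_2 is homogeneous in s, as s T_2' = 2 s T_1 = kexp k T_2. *)
Lemma T_homog f k s t : lambda_analytic lambda f -> 0 < s -> s <= t -> t < 1 ->
  T f k 2 s * (s `^ (- kexp k))%:C = T f k 2 t * (t `^ (- kexp k))%:C.
Proof.
move=> hf s0 st t1; have cf : continuous_on_disk f by case: hf => -[].
have hd u : s <= u <= t -> isd (fun u => T f k 2 u * (u `^ (- kexp k))%:C) u 0.
  move=> /andP[su ut]; have u0 : 0 < u by exact: lt_le_trans su.
  have u1 : u < 1 by exact: le_lt_trans t1.
  have dp := isd_real (is_derive1_powR (- kexp k) u0).
  apply: isd_val (isd_M (T_deriv k cf u0 u1) dp).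
  have E : ((2 + k.+1)%:R + lambda%:C) * T f k 2 u = 2 * u%:C * T f k 1 u.
    exact: (T_rec l0 k hf u0 u1 (isT : 0 < 1)%N).
  have -> : - kexp k - 1 = - kexp k + -1 by [].
  have eu : u `^ (- kexp k + -1) * u = u `^ (- kexp k).
    have e1 : u `^ (- 1) = u^-1 by rewrite powRN powRr1// ltW.
    by rewrite powR_add// e1 mulfVK// gt_eqF.
  rewrite -{1}eu RCM RCM RCN.
  have -> : (kexp k)%:C = (2 + k.+1)%:R + lambda%:C :> C by rewrite /kexp rmorphD/= RCnat.
  move: E; move: (T f k 2 u) (T f k 1 u) ((2 + k.+1)%:R + lambda%:C : C) => T2 T1 c E.
  transitivity ((u `^ (- kexp k + -1))%:C * (2 * u%:C * T1 - c * T2)); last by rewrite E subrr mulr0.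
  by ring.
apply: complex_eq; apply: (@eq_of_derive0 (fun u => _ (T f k 2 u * (u `^ (- kexp k))%:C)) s t st) => u hu.
  by have [] := hd u hu.
by have [] := hd u hu.
Qed.

End Coefficients.

(** * Orthogonality and moments of series *)

Section Expansion.
Variable R : realType.
Notation C := R[i].
Variable lambda : R.
Hypothesis l0 : 0 <= lambda.
Notation JC := (JC lambda).
Notation T := (T lambda).
Notation SS := (SS lambda).
Notation F b := (PS (phic lambda b)).
Implicit Types (f g H K : C -> C) (s : R).

Let pn0 k : 0 <= pn lambda k. Proof. exact: ltW (pn_gt0 l0 k). Qed.

Let conjM (x y : C) : conjc (x * y) = conjc x * conjc y. Proof. exact: rmorphM. Qed.
Let conjD (x y : C) : conjc (x + y) = conjc x + conjc y. Proof. exact: rmorphD. Qed.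

Lemma eps_neq0 k : (eps lambda k)%:C != 0 :> C.
Proof. by rewrite -nc_eq0 ncR normr_eq0 gt_eqF// eps_gt0. Qed.

Lemma analytic_SS k : lambda_analytic lambda (SS k).
Proof.
have [K h] := geoB_trunc l0 (fun n => (eps lambda k)%:C^-1 * dlt R k n) k.+1.
apply: lambda_analytic_eq (lambda_analytic_PS l0 (geoB_subexp l0 h)) => z _.
rewrite F_trunc big_ord_recr/= big1 ?add0r => [|i _]; last first.
  by rewrite /dlt (ltn_eqF (ltn_ord i)) mulr0 mul0r.
by rewrite /dlt eqxx mulr1 phiE mulrA mulVf ?mul1r// eps_neq0.
Qed.

Lemma SS_le k z : normc z <= 1 -> normc (SS k z) <= pn lambda k.
Proof.
move=> z1; have := phi_le l0 k z; rewrite phiE normcM ncR (ger0_norm (ltW (eps_gt0 l0 k))) => h.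
apply: (@le_trans _ _ (\sum_(j < k.+1) kap lambda k j)); last by rewrite sum_kap.
apply: le_trans (nc_sum _ _ _) _; apply: ler_sum => j _.
rewrite !normcM ncR (ger0_norm (kap_ge0 l0 _ _)) !ncX ncJ -mulrA -exprD.
by rewrite ler_piMr ?kap_ge0// exprn_ile1// nc_ge0.
Qed.

Lemma T_conj j k a s : 0 < s -> s < 1 -> (0 < a)%N -> T (SS j) k a s = conjc (T (SS k) j a s).
Proof.
move=> s0 s1 a0; rewrite /T /mom -JC_conj//; last first.
  by apply: gC_mom => //; [case: (analytic_SS k) => -[]|exact: gC_SSc].
congr (JC); apply/funext => z; rewrite !SS_conj !conjM conjcK /chi conjcR.
by move: (conjc _) (SS j z) (_%:C) => ? ? ?; ring.
Qed.

(** [T_rec] for the pair (j, k) and the conjugate of [T_rec] for (k, j) have the same right side but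
    factors differing by k - j, so the moment vanishes without any angular integration. *)
Lemma T_orth j k a s : j != k -> 0 < s -> s < 1 -> (0 < a)%N -> T (SS j) k a.+1 s = 0.
Proof.
move=> jk s0 s1 a0.
have E1 := T_rec l0 k (analytic_SS j) s0 s1 a0.
have := congr1 (@conjc R) (T_rec l0 j (analytic_SS k) s0 s1 a0).
rewrite !conjM conjD -!T_conj// -!(RCnat R) !conjcR => E2.
apply/eqP; move/eqP: E1; rewrite -!(RCnat R) -E2 -subr_eq0 -mulrBl mulf_eq0 => /orP[|//].
have -> : ((a.+1 + k.+1)%:R)%:C + lambda%:C - (((a.+1 + j.+1)%:R)%:C + lambda%:C) =
  ((a.+1 + k.+1)%:R - (a.+1 + j.+1)%:R : R)%:C :> C by rewrite rmorphB/=; ring.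
have e0 (x : R) : (x%:C == 0 :> C) = (x == 0) by rewrite -nc_eq0 ncR normr_eq0.
rewrite e0 subr_eq0 eqr_nat.
by rewrite eqn_add2l eqSS eq_sym (negbTE jk).
Qed.

(** On the support of the cut-off the partial sums converge uniformly; beyond N > k they have the
    same moment by orthogonality, and the tail contributes O(q^N). *)
Lemma T_PS b k s : subexp (fun n => normc (b n)) -> 0 < s -> s < 1 ->
  T (F b) k 2 s = b k * (eps lambda k)%:C * T (SS k) k 2 s.
Proof.
move=> hb s0 s1; have sc := subc_phic l0 hb.
have cF : continuous_on_disk (F b) by exact: PS_continuous.
have r0 : 0 <= Num.sqrt s by exact: sqrtr_ge0.
have r1 : Num.sqrt s < 1 by rewrite -sqrtr1 ltr_sqrt.
have [K [q [K0 q0 q1 hq]]] := subc_geom sc r0 r1.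
have gS := gC_SSc lambda k.
have cS j : continuous_on_disk (SS j) by case: (analytic_SS j) => -[].
apply/eqP; rewrite -subr_eq0 -nc_eq0 eq_le nc_ge0 andbT; apply/ler_addgt0Pr => e e0; rewrite add0r.
pose A := 8 * (2 * K / (1 - q) * pn lambda k).
have A0 : 0 <= A.
  by rewrite /A mulr_ge0// mulr_ge0 ?pn0// divr_ge0 ?mulr_ge0// subr_ge0 ltW.
have key N : (k < N)%N ->
    normc (T (F b) k 2 s - b k * (eps lambda k)%:C * T (SS k) k 2 s) <= A * q ^+ N.
  move=> kN.
  pose P z := \sum_(n < N) (b n * (eps lambda n)%:C) * (SS n z * (chi s 2 z * SS k (conjc z))).
  have gM n := gC_mom (cS n) s1 (isT : 0 < 2)%N gS.
  have gP n : gC (fun z => (b n * (eps lambda n)%:C) * (SS n z * (chi s 2 z * SS k (conjc z)))).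
    exact: (gC_M (gC_cst (b n * (eps lambda n)%:C)) (gM n)).
  have -> : b k * (eps lambda k)%:C * T (SS k) k 2 s = JC P.
    rewrite /P (JC_sum l0 N gP) (bigD1 (Ordinal kN))//= big1 ?addr0 => [|n nk].
      by rewrite (JC_Z l0 _ (gM k)).
    rewrite (JC_Z l0 _ (gM n)).
    by have := @T_orth n k 1 s nk s0 s1 isT; rewrite /T /mom => ->; rewrite mulr0.
  have g1 := gC_mom cF s1 (isT : 0 < 2)%N gS; have g2 := gC_sum N gP.
  rewrite /T /mom -(JC_B l0 g1 g2) /A -mulrA; apply: JC_bound => //; first exact: gC_B.
    by rewrite mulr_ge0 ?exprn_ge0// mulr_ge0 ?pn0// divr_ge0 ?mulr_ge0// subr_ge0 ltW.
  move=> z _.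
  have -> : F b z * (chi s 2 z * SS k (conjc z)) - P z =
     (F b z - \sum_(0 <= n < N) hterm (phic lambda b) n z) * (chi s 2 z * SS k (conjc z)).
    rewrite mulrBl; congr (_ - _); rewrite /P big_mkord mulr_suml; apply: eq_bigr => n _.
    by rewrite hterm_phic phiE !mulrA.
  have [zs|zs] := leP s (normc z ^+ 2).
    rewrite chi0// mul0r mulr0 nc0 mulr_ge0 ?exprn_ge0// mulr_ge0 ?pn0// divr_ge0 ?mulr_ge0//.
    by rewrite subr_ge0 ltW.
  have zr : normc z <= Num.sqrt s.
    by rewrite -(@ler_pXn2r _ 2) ?nnegrE ?nc_ge0// sqr_sqrtr ltW.
  have gl : geom_le (fun n => hterm (phic lambda b) n z) K q by split=> // n; exact: hq.
  have -> : 2 * K / (1 - q) * pn lambda k * q ^+ N = (2 * K / (1 - q) * q ^+ N) * (1 * pn lambda k).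
    by ring.
  rewrite normcM; apply: ler_pM; rewrite ?nc_ge0//; first exact: csum_tail.
  rewrite normcM; apply: ler_pM; rewrite ?nc_ge0//.
    rewrite /chi ncR /posn normrX ger0_norm ?le_max ?lexx ?orbT//.
    rewrite exprn_ile1// ?le_max ?lexx ?orbT// ge_max ler01 andbT.
    by have := sqr_ge0 (normc z); lra.
  by apply: SS_le; rewrite ncJ (le_trans zr)// ltW.
have [N hN] : exists N, A * q ^+ N <= e.
  have c : (fun N => A * q ^+ N) @ \oo --> A * 0.
    by apply: cvgMr; apply: cvg_expr; rewrite ger0_norm.
  rewrite mulr0 in c; move/cvgrPdist_le: c => /(_ e e0)[N _ hN]; exists N.
  by have := hN N (leqnn N); rewrite sub0r normrN ger0_norm// mulr_ge0// exprn_ge0.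
pose N' := maxn N k.+1; apply: le_trans (key N' _) _; first by rewrite leq_max leqnn orbT.
apply: le_trans hN; rewrite ler_wpM2l// ler_wiXn2l ?leq_maxl// ltW//.
Qed.

End Expansion.

(** * Continuous functions with vanishing polynomial moments *)

Section Determinacy.
Variable R : realType.
Notation C := R[i].
Variable lambda : R.
Hypothesis l0 : 0 <= lambda.
Notation JC := (JC lambda).
Variable G : C -> C.
Hypothesis gG : gC G.
Hypothesis G0 : forall i j, JC (fun z => G z * (conjc z ^+ j * z ^+ i)) = 0.

Let nul H := forall i j, JC (fun z => G z * (H z * (conjc z ^+ j * z ^+ i))) = 0.

(** A polynomial in z and conj(z) that peaks at z0 with value 1. Two points of the square are at
    squared distance at most 8, so it stays between 0 and 1 there. *)
Let Q (z0 z : C) : R := 1 - normc (z - z0) ^+ 2 / 8.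

Let QE z0 z : (Q z0 z)%:C = 1 - 8^-1 * ((z - z0) * (conjc z - conjc z0)).
Proof.
have e8 : (8^-1)%:C = 8^-1 :> C.
  by rewrite (fmorphV (real_complex R)); congr (_^-1); exact: RCnat.
rewrite /Q ncE -e8.
by apply: complex_eq; case: z => x y; case: z0 => a b /=; ring.
Qed.

Let gQ z0 : gC (fun z => (Q z0 z)%:C).
Proof.
have -> : (fun z => (Q z0 z)%:C) = fun z => 1 - 8^-1 * ((z - z0) * (conjc z - conjc z0)).
  by apply/funext => z; exact: QE.
apply: gC_B; first exact: gC_cst.
apply: gC_M; first exact: gC_cst.
by apply: gC_M; apply: gC_B; [exact: gC_id|exact: gC_cst|apply: gC_conj; exact: gC_id|exact: gC_cst].
Qed.

Let nulQ z0 H : gC H -> nul H -> nul (fun z => (Q z0 z)%:C * H z).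
Proof.
move=> gH nH i j.
pose m (i j : nat) := fun z => G z * (H z * (conjc z ^+ j * z ^+ i)).
have gm i' j' : gC (m i' j') by apply: gC_M => //; apply: gC_M => //; exact: gC_mon.
have gZ c i' j' : gC (fun z => c * m i' j' z) by apply: gC_M => //; exact: gC_cst.
have h i' j' : JC (m i' j') = 0 by exact: nH.
pose k : C := 8^-1.
have -> : (fun z => G z * ((Q z0 z)%:C * H z * (conjc z ^+ j * z ^+ i))) =
   (fun z => (((1 - k * (z0 * conjc z0)) * m i j z + (k * conjc z0) * m i.+1 j z) +
      ((k * z0) * m i j.+1 z + (- k) * m i.+1 j.+1 z))).
  apply/funext => z; rewrite QE /m -/k !exprS.
  by move: (conjc z) (conjc z0) (G z) (H z) => ? ? ? ?; ring.
have g1 := gC_D (gZ (1 - k * (z0 * conjc z0)) i j) (gZ (k * conjc z0) i.+1 j).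
have g2 := gC_D (gZ (k * z0) i j.+1) (gZ (- k) i.+1 j.+1).
rewrite (JC_D l0 g1 g2) (JC_D l0 (gZ _ _ _) (gZ _ _ _)) (JC_D l0 (gZ _ _ _) (gZ _ _ _)).
by rewrite !(JC_Z l0 _ (gm _ _)) !h !mulr0 !addr0.
Qed.

Let gQX z0 N : gC (fun z => (Q z0 z)%:C ^+ N).
Proof. exact: gC_X. Qed.

Let JQX z0 N : JC (fun z => G z * (Q z0 z)%:C ^+ N) = 0.
Proof.
have h : nul (fun z => (Q z0 z)%:C ^+ N).
  elim: N => [|N IH].
    move=> i j; rewrite -[RHS](G0 i j); congr JC; apply/funext => z.
    by rewrite expr0 mul1r.
  have -> : (fun z => (Q z0 z)%:C ^+ N.+1) = (fun z => (Q z0 z)%:C * (Q z0 z)%:C ^+ N).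
    by apply/funext => z; rewrite exprS.
  by apply: nulQ.
rewrite -[RHS](h 0%N 0%N); congr JC; apply/funext => z.
by rewrite !expr0 !mulr1.
Qed.

Local Ltac keep_section := clear - l0 G0 gG QE gQ nulQ gQX JQX.

(* Testing against powers of a polynomial that peaks at z0. *)
Let det_off z0 : normc z0 < 1 -> complex.Im z0 != 0 -> G z0 = 0.
Proof.
move=> z01 y0; apply/eqP; apply: contraT => Gz.
(* Rotating by conj(G z0) makes the real part positive at z0, hence at least eta / 2 nearby. *)
pose h z := complex.Re (conjc (G z0) * G z).
have hz0 : h z0 = normc (G z0) ^+ 2 by rewrite /h ncE; case: (G z0) => a b /=; ring.
have e0 : 0 < normc (G z0) ^+ 2 by rewrite exprn_gt0// lt_def nc_eq0 Gz nc_ge0.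
set eta := normc (G z0) ^+ 2 in hz0 e0.
have gh : gC (fun z => conjc (G z0) * G z) by apply: gC_M => //; exact: gC_cst.
have [d1 d10 hd1] := gh z0 (eta / 2) (divr_gt0 e0 (ltr0Sn R 1)).
have hlow z : normc (z - z0) < d1 -> eta / 2 <= h z.
  move=> /hd1/(le_lt_trans (Re_le _)); rewrite cReD cReN -/(h z) -/(h z0) hz0 ltr_norml => /andP[a _].
  lra.
have [M [[M0 hM] _]] := gC_bounded gh.
have hM' z : inbox z -> `|h z| <= M.
  move=> [i1 i2]; have [_ ] := hM (complex.Re z, complex.Im z) (conj i1 i2).
  by rewrite /RF/= /h; case: (z).
pose x0 := complex.Re z0; pose y1 := `|complex.Im z0|.
have y10 : 0 < y1 by rewrite normr_gt0.
have [bx by_] := inbox_of_nc z01.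
have {}bx : -1 < x0 < 1 by [].
have y11 : y1 < 1 by rewrite /y1 ltr_norml.
pose d := Num.min d1 1.
have d0 : 0 < d by rewrite lt_min d10 ltr01.
have dd1 : d <= d1 by rewrite ge_min lexx.
have dle1 : d <= 1 by rewrite ge_min lexx orbT.
pose ep := Num.min (d / 4) (Num.min ((1 - `|x0|) / 2) (Num.min (y1 / 2) ((1 - y1) / 2))).
have x01 : `|x0| < 1 by rewrite ltr_norml.
have ep0 : 0 < ep by rewrite !lt_min !divr_gt0//= subr_gt0.
have ed : ep <= d / 4 by rewrite !ge_min lexx.
have ex : ep <= (1 - `|x0|) / 2 by rewrite !ge_min lexx !orbT.
have ey : ep <= y1 / 2 by rewrite !ge_min lexx !orbT.
have ey' : ep <= (1 - y1) / 2 by rewrite !ge_min lexx !orbT.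
clearbody ep.
have [g1 g2] : -1 < x0 - ep /\ x0 + ep < 1.
  have /andP[a b] : - `|x0| <= x0 <= `|x0| by rewrite -ler_norml.
  by move: a b ex x01; keep_section => *; split; lra.
have [g3 g4] : 0 < y1 - ep /\ y1 + ep < 1 by move: ey ey' y10 y11; keep_section => *; split; lra.
have [g5 g6] : x0 - ep <= x0 + ep /\ y1 - ep <= y1 + ep by move: ep0; keep_section => *; split; lra.
(* [th] bounds Q from above beyond distance d, and [th'] bounds it from below within d / 2. Since th
   < th', the peak wins as N grows. *)
pose th := 1 - d ^+ 2 / 8; pose th' := 1 - (d / 2) ^+ 2 / 8.
have d2 : d ^+ 2 <= 1 by rewrite expr_le1// ltW.
have d20 : 0 < d ^+ 2 by rewrite exprn_gt0.
have th0 : 0 < th by rewrite /th; lra.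
have thth : th < th' by rewrite /th /th' expr_div_n; lra.
have Q01 z : inbox z -> 0 <= Q z0 z <= 1.
  move=> [/andP[a1 a2] /andP[b1 b2]]; rewrite /Q ncE cReD cImD cReN cImN -/x0.
  move/andP: bx => [c1 c2]; move/andP: by_ => [c3 c4].
  move: (complex.Re z) (complex.Im z) (complex.Im z0) a1 a2 b1 b2 c3 c4 => x y y' a1 a2 b1 b2 c3 c4.
  have e1 : (x - x0) ^+ 2 <= 4 by move: a1 a2 c1 c2; keep_section => *; nra.
  have e2 : (y - y') ^+ 2 <= 4 by move: b1 b2 c3 c4; keep_section => *; nra.
  have := sqr_ge0 (x - x0); have := sqr_ge0 (y - y'); move: e1 e2; keep_section => *; apply/andP; split; lra.
have far z : inbox z -> d <= normc (z - z0) -> Q z0 z <= th.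
  move=> _ dz; rewrite /Q /th lerD2l lerN2 ler_pM2r ?invr_gt0//.
  by rewrite lerXn2r ?nnegrE ?nc_ge0// ltW.
have near z : normc (z - z0) <= d / 2 -> th' <= Q z0 z.
  move=> dz; rewrite /Q /th' lerD2l lerN2 ler_pM2r ?invr_gt0//.
  by rewrite lerXn2r ?nnegrE ?nc_ge0// divr_ge0// ltW.
pose A := y1 / 2; pose c := (eta / 2) * (y1 - ep) `^ (2 * lambda) * ((x0 + ep - (x0 - ep)) * (y1 + ep - (y1 - ep))).
have c0 : 0 < c.
  rewrite /c mulr_gt0//; last by rewrite mulr_gt0//; move: ep0; keep_section => *; lra.
  by rewrite mulr_gt0 ?divr_gt0// powR_gt0.
have key N : c * th' ^+ N <= 4 * M * th ^+ N.
  (* Away from z0 the integrand is at least -M th^N; adding this constant makes H nonnegative, and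
     by the vanishing moments its integral is that of the constant. *)
  pose H (q : R * R) := RF (fun z => conjc (G z0) * (G z * (Q z0 z)%:C ^+ N)) q + M * th ^+ N.
  have gH : gC (fun z => conjc (G z0) * (G z * (Q z0 z)%:C ^+ N)).
    by apply: gC_M; [exact: gC_cst|exact: gC_M].
  have [M' [bH _]] := gC_bounded gH.
  have bc2 := bc_cst (M * th ^+ N).
  have Mt0 : 0 <= M * th ^+ N by rewrite mulr_ge0// exprn_ge0// ltW.
  have HE x y : H (x, y) = h (x +i* y) * Q z0 (x +i* y) ^+ N + M * th ^+ N.
    have reM (X : C) (a : R) : complex.Re (X * a%:C) = complex.Re X * a.
      by case: X => a' b' /=; rewrite mulr0 subr0.
    by rewrite /H /RF /h mulrA -RCX reM.
  have EJ : J lambda H = J lambda (fun=> M * th ^+ N).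
    rewrite /H (JD l0 bH bc2).
    have -> : J lambda (RF (fun z => conjc (G z0) * (G z * (Q z0 z)%:C ^+ N))) =
       complex.Re (JC (fun z => conjc (G z0) * (G z * (Q z0 z)%:C ^+ N))) by [].
    by rewrite (JC_Z l0 _ (gC_M gG (gQX z0 N))) JQX mulr0 add0r.
  have Hb : `|J lambda (fun=> M * th ^+ N)| <= 4 * (M * th ^+ N).
    by have := J_bound l0 bc2; rewrite (ger0_norm Mt0).
  have H0 x y : inbox (x +i* y) -> 0 <= H (x, y).
    move=> hb; rewrite HE; have /andP[q1 q2] := Q01 _ hb.
    have [near'|far'] := ltP (normc (x +i* y - z0)) d.
      apply: addr_ge0 => //; apply: mulr_ge0; last exact: exprn_ge0.
      by apply: le_trans (hlow _ (lt_le_trans near' dd1)); rewrite divr_ge0// ltW.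
    have hm := hM' _ hb; have qt := far _ hb far'.
    rewrite -lerBlDr sub0r; apply: le_trans (_ : - `|h (x +i* y) * Q z0 (x +i* y) ^+ N| <= _).
      rewrite lerN2 normrM; apply: ler_pM => //; rewrite normrX ger0_norm//.
      by rewrite lerXn2r ?nnegrE// ltW.
    by rewrite lerNl; apply: le_trans (ler_norm _) _; rewrite normrN.
  have H1 x y : inbox (x +i* y) -> normc (x +i* y - z0) <= d / 2 -> eta / 2 * th' ^+ N <= H (x, y).
    move=> hb dz; rewrite HE; apply: ler_wpDr => //; apply: ler_pM.
    - by rewrite divr_ge0// ltW.
    - by rewrite exprn_ge0// (le_trans (ltW th0)) ?ltW.
    - apply: hlow; apply: le_lt_trans dz _; apply: lt_le_trans dd1.
      by rewrite ltr_pdivrMr// ltr_pMr// ltr1n.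
    - rewrite lerXn2r ?nnegrE ?near//; first by rewrite (le_trans (ltW th0)) ?ltW.
      by have /andP[] := Q01 _ hb.
  have bHc : bc H (M' + `|M * th ^+ N|) by exact: (bcD bH bc2).
  have mm0 : 0 <= eta / 2 * th' ^+ N.
    by rewrite mulr_ge0 ?divr_ge0 ?(ltW e0)// exprn_ge0// (le_trans (ltW th0)) ?ltW.
  have ibx (x y : R) : -1 < x < 1 -> -1 < y < 1 -> inbox (x +i* y) by [].
  have := @J_box_lower R lambda l0 H _ (eta / 2 * th' ^+ N) (x0 - ep) (x0 + ep) (y1 - ep) (y1 + ep) bHc mm0.
  have -> : c * th' ^+ N = eta / 2 * th' ^+ N * (y1 - ep) `^ (2 * lambda) *
      ((x0 + ep - (x0 - ep)) * (y1 + ep - (y1 - ep))) by rewrite /c; ring.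
  move=> K; apply: le_trans (K g1 g5 g2 g3 g6 g4 _ _) _.
  - move=> [x y] [/= hx /andP[ya yb]]; apply: addr_ge0; apply: H0; apply: ibx => //;
      apply/andP; split; move: ya yb; keep_section => *; lra.
  - move=> [x y] /= /andP[xa xb] /andP[ya yb].
    have hx : -1 < x < 1 by rewrite (lt_le_trans g1 xa) (le_lt_trans xb g2).
    have hy : -1 < y < 1.
      by move: g3 g4 ya yb; keep_section => *; apply/andP; split; lra.
    have hy' : -1 < - y < 1.
      by move: g3 g4 ya yb; keep_section => *; apply/andP; split; lra.
    have dx : `|x - x0| <= ep by rewrite ler_norml; move: xa xb; keep_section => *; apply/andP; split; lra.
    have dy : `|y - y1| <= ep by rewrite ler_norml; move: ya yb; keep_section => *; apply/andP; split; lra.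
    (* The box is taken in the upper half at height |Im z0|. If z0 lies below the axis, the
       reflected term of the fold carries the lower bound. *)
    have [z0p|z0n] := leP 0 (complex.Im z0).
      have ye : y1 = complex.Im z0 by rewrite /y1 ger0_norm.
      apply: ler_wpDr; first exact: H0 (ibx _ _ hx hy').
      apply: H1 (ibx _ _ hx hy) _; apply: le_trans (nc_le_ReIm _) _.
      by rewrite cReD cImD cReN cImN /= -/x0 -ye; move: ed dx dy; keep_section => *; lra.
    have ye : y1 = - complex.Im z0 by rewrite /y1 ltr0_norm.
    apply: ler_wpDl; first exact: H0 (ibx _ _ hx hy).
    apply: H1 (ibx _ _ hx hy') _; apply: le_trans (nc_le_ReIm _) _.
    rewrite cReD cImD cReN cImN /= -/x0.
    have -> : - y - complex.Im z0 = - (y - y1) by rewrite ye; ring.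
    by rewrite normrN; move: ed dx dy; keep_section => *; lra.
  - by rewrite EJ; apply: le_trans (ler_norm _) _; rewrite -mulrA.
have th'0 : 0 < th' by exact: lt_trans thth.
pose r := th / th'.
have r0 : 0 <= r by rewrite divr_ge0 ?(ltW th0)// ltW.
have r1 : r < 1 by rewrite /r ltr_pdivrMr// mul1r.
have key2 N : c <= 4 * M * r ^+ N.
  by rewrite /r expr_div_n mulrA ler_pdivlMr ?exprn_gt0//; exact: key.
have cv : (fun N => 4 * M * r ^+ N) @ \oo --> 4 * M * 0.
  by apply: cvgMr; apply: cvg_expr; rewrite ger0_norm.
rewrite mulr0 in cv; move/cvgrPdist_lt: cv => /(_ c c0)[N _ hN].
have := hN N (leqnn N); rewrite sub0r normrN ger0_norm => [|].
  by rewrite ltNge key2.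
by rewrite mulr_ge0 ?exprn_ge0// mulr_ge0.
Qed.

(** The weight may vanish on the real axis, so real points are reached by continuity from z0 + i
    t. *)
Lemma determinacy z0 : normc z0 < 1 -> G z0 = 0.
Proof.
move=> z1; have [y0|] := eqVneq (complex.Im z0) 0; last exact: det_off.
apply/eqP; rewrite -nc_eq0 eq_le nc_ge0 andbT; apply/ler_addgt0Pr => e e0; rewrite add0r.
have [d d0 hd] := gG z0 e0; have [d' d'0 hd'] := disk_nbhs (z1 : disk z0).
pose t := Num.min (d / 2) (d' / 2); have t0 : 0 < t by rewrite lt_min !divr_gt0.
have td : t < d by rewrite (le_lt_trans (_ : t <= d / 2))// ?ge_min ?lexx//; lra.
have td' : t < d' by rewrite (le_lt_trans (_ : t <= d' / 2))// ?ge_min ?lexx ?orbT//; lra.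
pose w := complex.Re z0 +i* t.
have wz : normc (w - z0) <= t.
  apply: le_trans (nc_le_ReIm _) _; rewrite cReD cImD cReN cImN y0 /= subrr normr0 add0r subr0.
  by rewrite gtr0_norm.
have w0 : G w = 0.
  by apply: det_off; [apply: hd'; exact: le_lt_trans wz td'|rewrite /= gt_eqF].
by have := hd w (le_lt_trans wz td); rewrite w0 sub0r ncN => /ltW.
Qed.

End Determinacy.

(** * Growth of the coefficients and the expansion *)

Section Series.
Variable R : realType.
Notation C := R[i].
Variable lambda : R.
Hypothesis l0 : 0 <= lambda.
Notation JC := (JC lambda).
Notation T := (T lambda).
Notation SS := (SS lambda).
Notation pn := (pn lambda).
Notation eps := (eps lambda).
Notation kexp := (kexp lambda).
Notation F b := (PS (phic lambda b)).
Implicit Types (f g H K : C -> C) (s x y : R).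

Let pn0 k : 0 <= pn k. Proof. exact: ltW (pn_gt0 l0 k). Qed.

Lemma pow_diff (u v : C) n : normc u <= 1 -> normc v <= 1 ->
  normc (u ^+ n - v ^+ n) <= n%:R * normc (u - v).
Proof.
move=> u1 v1; elim: n => [|n IH]; first by rewrite subrr nc0 mul0r.
have -> : u ^+ n.+1 - v ^+ n.+1 = u * (u ^+ n - v ^+ n) + (u - v) * v ^+ n.
  by rewrite !exprS; ring.
apply: le_trans (ncD _ _) _; rewrite !normcM -natr1 mulrDl mul1r; apply: lerD.
  by apply: le_trans IH; rewrite ler_piMl// nc_ge0.
by rewrite ler_piMr ?nc_ge0// ncX exprn_ile1// nc_ge0.
Qed.

(** SS_k is known exactly at real points; a Lipschitz constant k pn k carries the lower bound to
    nearby points. *)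
Lemma SS_lip k (z : C) x : normc z <= 1 -> 0 <= x -> x <= 1 ->
  pn k * x ^+ k - pn k * (k%:R * normc (z - x%:C)) <= normc (SS k z).
Proof.
move=> z1 x0 x1; rewrite lerBlDl -lerBlDr.
have -> : pn k * x ^+ k = normc (SS k x%:C).
  by rewrite (SS_real lambda) ncR ger0_norm// mulr_ge0 ?pn0// exprn_ge0.
apply: le_trans (nc_lerB _ _) _; rewrite nc_distC.
rewrite /SS /hterm -sumrB -(sum_kap lambda) mulr_suml.
apply: le_trans (nc_sum _ _ _) _; apply: ler_sum => j _.
have xc : normc x%:C <= 1 by rewrite ncR ger0_norm.
have -> : (kap lambda k j)%:C * conjc z ^+ j * z ^+ (k - j) -
    (kap lambda k j)%:C * conjc x%:C ^+ j * x%:C ^+ (k - j) =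
  (kap lambda k j)%:C * (conjc z ^+ j * (z ^+ (k - j) - x%:C ^+ (k - j)) +
    (conjc z ^+ j - conjc x%:C ^+ j) * x%:C ^+ (k - j)).
  by ring.
rewrite normcM ncR (ger0_norm (kap_ge0 l0 _ _)); apply: ler_wpM2l; first exact: kap_ge0.
apply: le_trans (ncD _ _) _; rewrite !normcM !ncX ncJ.
have h1 := pow_diff (k - j) z1 xc.
have h2 := @pow_diff (conjc z) (conjc x%:C) j _ _.
rewrite !ncJ -rmorphB ncJ in h2.
have -> : k%:R = (k - j)%:R + j%:R :> R by rewrite -natrD subnK ?leq_ord.
rewrite mulrDl; apply: lerD.
  by apply: le_trans h1; rewrite ler_piMl ?nc_ge0// exprn_ile1// nc_ge0.
by apply: le_trans (h2 z1 xc); rewrite ler_piMr ?nc_ge0// exprn_ile1// nc_ge0.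
Qed.

(** The scale, up to a constant, of a box next to the real point x on which SS_k keeps half of its
    value pn k x^k there. *)
Definition tau (x : R) (k : nat) : R := x ^+ k / k.+1%:R.

Lemma tau_bound x k : 0 < x -> x < 1 -> 0 < tau x k <= x ^+ k.
Proof.
move=> x0 x1; rewrite divr_gt0 ?exprn_gt0//= ler_piMr ?exprn_ge0 ?(ltW x0)//.
by rewrite invf_le1// ler1n.
Qed.

(** No closed form of the norm of SS_k is needed: since m does not depend on x, which may be close
    to 1, a lower bound by powers of x^k / (k + 1) still gives subexponential coefficients. *)
Lemma T_SS_lower : exists m, forall x : R, 0 < x -> x < 1 ->
  exists s c, [/\ 0 < s, s < 1, 0 < c &
    forall k, pn k ^+ 2 * c * tau x k ^+ m <= complex.Re (T (SS k) k 2 s)].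
Proof.
pose m0 := Num.bound (2 * lambda).
have m0b : 2 * lambda <= m0%:R by rewrite ltW// archi_boundP// mulr_ge0.
(* m0 powers of the scale pay for the weight y^(2 lambda), two for the area of the box and two for
   the square of x^k. *)
exists (m0 + 4)%N => x x0 x1.
(* The box [x, x + d] x [d / 2, d] with d <= e lies in |z| <= x + 2 e = s, where the cut-off base s
   - |z|^2 is at least [gap]. *)
pose s := x + (1 - x) / 4; pose gap := s - s ^+ 2; pose e := (1 - x) / 8.
have s0 : 0 < s by rewrite /s; lra.
have s1 : s < 1 by rewrite /s; lra.
have gap0 : 0 < gap by rewrite /gap subr_gt0 expr2 gtr_pMl.
have e0 : 0 < e by rewrite /e; lra.
exists s, (gap ^+ 2 / 4 * ((e / 2) ^+ m0 * (e ^+ 2 / 2))); split=> //.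
  apply: mulr_gt0; first by rewrite divr_gt0// exprn_gt0.
  by apply: mulr_gt0; [rewrite exprn_gt0// divr_gt0|rewrite divr_gt0// exprn_gt0].
move=> k; have /andP[t0 tx] := tau_bound k x0 x1; set t := tau x k in t0 tx *.
have xk1 : x ^+ k <= 1 by rewrite exprn_ile1// ltW.
have t1 : t <= 1 by exact: le_trans xk1.
pose d := t * e; have d0 : 0 < d by rewrite mulr_gt0.
have de : d <= e by rewrite ler_piMl// ltW.
have kd : k%:R * d <= x ^+ k / 8.
  have h1 : k%:R * t <= x ^+ k.
    rewrite /t /tau mulrCA ler_piMr ?exprn_ge0 ?(ltW x0)// ler_pdivrMr// mul1r ler_nat//.
  have h2 : k%:R * t * e <= x ^+ k * 8^-1.
    by apply: ler_pM => //; [rewrite mulr_ge0// ltW|exact: ltW|rewrite /e; lra].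
  by rewrite /d mulrA.
pose H (z : C) := SS k z * (chi s 2 z * SS k (conjc z)).
have cS : continuous_on_disk (SS k) by case: (analytic_SS l0 k) => -[].
have gH : gC H := gC_mom cS s1 (isT : 0 < 2)%N (gC_SSc lambda k).
have [M [bH _]] := gC_bounded gH.
have HE u v : RF H (u, v) = posn 2 (s - normc (u +i* v) ^+ 2) * normc (SS k (u +i* v)) ^+ 2.
  rewrite /RF -[(u, v).1]/u -[(u, v).2]/v /H SS_conj (ncE (SS k _)) /chi.
  by move: (posn _ _) (SS k _) => pp [a b] /=; ring.
have pos q : 0 <= RF H q.
  by case: q => a b; rewrite HE mulr_ge0 ?sqr_ge0// /posn sqr_ge0.
have low a b : x <= a -> a <= x + d -> d / 2 <= b -> b <= d ->
    gap ^+ 2 * (pn k * x ^+ k / 2) ^+ 2 <= RF H (a, b).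
  move=> a1 a2 b1 b2; rewrite HE.
  have nz : normc (a +i* b) <= s.
    apply: le_trans (nc_le_ReIm _) _; rewrite /= !ger0_norm; [|lra|lra].
    by move: a2 b2 de; rewrite /e /s; lra.
  have nz1 : normc (a +i* b) <= 1 by exact: le_trans (ltW s1).
  have a0 : 0 <= a by lra.
  have a11 : a <= 1.
    by apply: le_trans nz1; apply: le_trans (Re_le (a +i* b)); exact: ler_norm.
  have hl := SS_lip k nz1 a0 a11.
  have nzx : normc (a +i* b - a%:C) <= d.
    apply: le_trans (nc_le_ReIm _) _; rewrite cReD cImD cReN cImN /= subrr normr0 add0r subr0 ger0_norm//.
    lra.
  have xa : x ^+ k <= a ^+ k by rewrite lerXn2r ?nnegrE// ltW.
  have hS : pn k * x ^+ k / 2 <= normc (SS k (a +i* b)).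
    apply: le_trans hl; rewrite -mulrBr -mulrA ler_wpM2l//.
    have h1 : k%:R * normc (a +i* b - a%:C) <= k%:R * d by rewrite ler_wpM2l.
    move: h1 kd xa; have := exprn_ge0 k (ltW x0).
    move: (k%:R * normc _) (k%:R * d) (x ^+ k) (a ^+ k) => p1 p2 p3 p4; clear; lra.
  apply: ler_pM; rewrite ?sqr_ge0//.
    have h : gap <= s - normc (a +i* b) ^+ 2.
      by rewrite /gap lerD2l lerN2 lerXn2r ?nnegrE ?nc_ge0// ltW.
    rewrite /posn lerXn2r ?nnegrE ?(ltW gap0) ?le_max ?h//.
    by rewrite lexx orbT.
  by rewrite lerXn2r ?nnegrE ?nc_ge0// divr_ge0// mulr_ge0// exprn_ge0// ltW.
have m0' : 0 <= gap ^+ 2 * (pn k * x ^+ k / 2) ^+ 2 by rewrite mulr_ge0 ?sqr_ge0.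
have Hd : x + d < 1 by move: de; rewrite /e; lra.
have Hd1 : d < 1 by lra.
apply: le_trans (_ : gap ^+ 2 * (pn k * x ^+ k / 2) ^+ 2 * (d / 2) `^ (2 * lambda) *
    ((x + d - x) * (d - d / 2)) <= _); last first.
  apply: (J_box_lower l0 bH m0'); try lra.
  - by move=> q _; rewrite addr_ge0.
  - by move=> [a b] /= /andP[a1 a2] /andP[b1 b2]; apply: ler_wpDr => //; exact: low.
have hp : (d / 2) ^+ m0 <= (d / 2) `^ (2 * lambda).
  rewrite -powR_mulrn ?divr_ge0 ?(ltW d0)//; apply: ger_powR => //.
  by apply/andP; split; lra.
have -> : gap ^+ 2 * (pn k * x ^+ k / 2) ^+ 2 * (d / 2) `^ (2 * lambda) *
    ((x + d - x) * (d - d / 2)) =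
   (pn k ^+ 2 * (gap ^+ 2 / 4) * (d ^+ 2 / 2)) * ((x ^+ k) ^+ 2 * (d / 2) `^ (2 * lambda)).
  by move: (x ^+ k) (_ `^ _) => ? ?; field.
have -> : pn k ^+ 2 * (gap ^+ 2 / 4 * ((e / 2) ^+ m0 * (e ^+ 2 / 2))) * t ^+ (m0 + 4) =
   (pn k ^+ 2 * (gap ^+ 2 / 4) * (d ^+ 2 / 2)) * (t ^+ 2 * (d / 2) ^+ m0).
  have -> : d / 2 = t * (e / 2) by rewrite (mulrA t e).
  rewrite (exprMn m0 t) (exprD t) /d.
  by move: (t ^+ m0) ((e / 2) ^+ m0) => ? ?; field.
apply: ler_wpM2l.
  by rewrite mulr_ge0 ?divr_ge0 ?sqr_ge0// mulr_ge0 ?sqr_ge0// divr_ge0 ?sqr_ge0.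
apply: ler_pM => //; rewrite ?sqr_ge0//; first by rewrite exprn_ge0// divr_ge0// ltW.
by rewrite lerXn2r ?nnegrE ?exprn_ge0 ?(ltW t0) ?(ltW x0).
Qed.

Lemma T_homog2 f k s s' : lambda_analytic lambda f -> 0 < s -> s < 1 -> 0 < s' -> s' < 1 ->
  T f k 2 s * (s `^ (- kexp k))%:C = T f k 2 s' * (s' `^ (- kexp k))%:C.
Proof.
move=> hf s0 s1 s0' s1'; have [h|h] := leP s s'; first exact: T_homog.
by apply/esym; apply: T_homog => //; exact: ltW.
Qed.

Let pw_neq0 s (a : R) : 0 < s -> (s `^ a)%:C != 0 :> C.
Proof. by move=> s0; rewrite -nc_eq0 ncR normr_eq0 gt_eqF// powR_gt0. Qed.

Lemma T_SS_neq0 k s : 0 < s -> s < 1 -> T (SS k) k 2 s != 0.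
Proof.
move=> s0 s1; have [m h] := T_SS_lower.
have x0 : 0 < 2^-1 :> R by rewrite invr_gt0.
have x1 : 2^-1 < 1 :> R by rewrite invf_lt1// ltr1n.
have [s' [c [s0' s1' c0 hc]]] := h _ x0 x1; have /andP[t0 _] := tau_bound k x0 x1.
have := T_homog2 k (analytic_SS l0 k) s0 s1 s0' s1'; apply: contra_eqN => /eqP ->.
rewrite mul0r eq_sym mulf_neq0 ?pw_neq0//; apply/eqP => E; have := hc k; rewrite E /= leNgt => /negP; apply.
by apply: mulr_gt0; [apply: mulr_gt0 => //; apply: exprn_gt0; exact: pn_gt0|exact: exprn_gt0].
Qed.

(** The choice s = 1/2 is immaterial: numerator and denominator have the same homogeneity in s,
    which is [coefE]. Level a = 2 is the first one at which orthogonality is available from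
    [T_orth]. *)
Definition coef f k : C := T f k 2 2^-1 / ((eps k)%:C * T (SS k) k 2 2^-1).

Lemma coefE f k s : lambda_analytic lambda f -> 0 < s -> s < 1 ->
  T f k 2 s = coef f k * (eps k)%:C * T (SS k) k 2 s.
Proof.
move=> hf s0 s1.
have x0 : 0 < 2^-1 :> R by rewrite invr_gt0.
have x1 : 2^-1 < 1 :> R by rewrite invf_lt1// ltr1n.
have E1 := T_homog2 k hf s0 s1 x0 x1.
have E2 := T_homog2 k (analytic_SS l0 k) s0 s1 x0 x1.
apply: (mulIf (pw_neq0 (- kexp k) s0)); rewrite -[RHS]mulrA E2 E1 /coef.
have n1 := T_SS_neq0 k x0 x1; have n2 := eps_neq0 l0 k.
by move: (T _ _ _ _) (T _ _ _ _) (eps k)%:C (_ `^ _)%:C n1 n2 => a b c d *; field; apply/andP.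
Qed.

Lemma subexp_coef f : lambda_analytic lambda f -> subexp (fun k => normc (coef f k)).
Proof.
move=> hf q q0 q1; have cf : continuous_on_disk f by case: hf => -[].
have [m hm] := T_SS_lower.
(* With x^(m+1) = q one has q^k = tau^m (k+1)^m x^k: the first factor meets the lower bound of
   [T_SS_lower], and the rest stays bounded. *)
pose x := q `^ (m.+1%:R)^-1.
have x0 : 0 < x by exact: powR_gt0.
have xq : x ^+ m.+1 = q by rewrite -powR_mulrn ?(ltW x0)// /x -powRrM mulVf ?pnatr_eq0// powRr1// ltW.
have x1 : x < 1.
  rewrite ltNge; apply/negP => h; have := exprn_ege1 m.+1 h; rewrite xq leNgt q1//.
have [s [c [s0 s1 c0 hc]]] := hm x x0 x1.
have [M M0 hM] := local_bound cf (gC_cst 1) (ltW s0) s1.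
have [K K0 hK] := subexpX m (@subexp_nat R) x0 x1.
exists (8 * M / c * K); first by rewrite mulr_ge0// divr_ge0 ?mulr_ge0// ltW.
move=> k; rewrite ger0_norm ?nc_ge0//; move: (coef f k) (coefE k hf s0 s1) => ck E.
have e0 := eps_gt0 l0 k; have p0 := pn_gt0 l0 k.
have /andP[t0 _] := tau_bound k x0 x1.
have hT : normc (T f k 2 s) <= 8 * (M * pn k).
  apply: JC_bound => //; [exact: gC_mom cf s1 _ (gC_SSc lambda k)|by rewrite mulr_ge0|move=> z _].
  have [zs|zs] := leP s (normc z ^+ 2).
    by rewrite chi0// mul0r mulr0 nc0 mulr_ge0.
  rewrite normcM; apply: ler_pM; rewrite ?nc_ge0//.
    by have := hM z (ltW zs); rewrite mulr1.
  rewrite normcM -[leRHS]mul1r; apply: ler_pM; rewrite ?nc_ge0//.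
    rewrite /chi ncR /posn normrX ger0_norm ?le_max ?lexx ?orbT//.
    rewrite exprn_ile1// ?le_max ?lexx ?orbT// ge_max ler01 andbT.
    by have := sqr_ge0 (normc z); lra.
  apply: SS_le => //; rewrite ncJ -(@ler_pXn2r _ 2) ?nnegrE ?nc_ge0// expr1n.
  by rewrite ltW// (lt_trans zs).
have hN : pn k ^+ 2 * c * tau x k ^+ m <= normc (T (SS k) k 2 s).
  by apply: le_trans (hc k) _; apply: le_trans (ler_norm _) (Re_le _).
move/(congr1 (@normc R)): E.
rewrite !normcM ncR gtr0_norm// => E.
have es := eps_sqr l0 k; have el := eps_le1 l0 k.
have ep : 1 <= eps k * pn k.
  by rewrite -es expr2 -mulrA ler_piMl// mulr_ge0// ltW.
set X := normc ck in E *; have X0 : 0 <= X by exact: nc_ge0.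
have h1 : X * (pn k * c * tau x k ^+ m) <= 8 * M * pn k.
  apply: le_trans (_ : X * (eps k * (pn k ^+ 2 * c * tau x k ^+ m)) <= _).
    rewrite ler_wpM2l//.
    have -> : eps k * (pn k ^+ 2 * c * tau x k ^+ m) = (eps k * pn k) * (pn k * c * tau x k ^+ m) by ring.
    by rewrite ler_peMl// mulr_ge0 ?exprn_ge0 ?(ltW t0)// mulr_ge0// ltW.
  rewrite -(mulrA 8); apply: le_trans hT; rewrite E -[leRHS]mulrA ler_wpM2l// ler_wpM2l//.
  exact: ltW.
have h2 : X * tau x k ^+ m <= 8 * M / c.
  rewrite ler_pdivlMr// -(ler_pM2r p0); apply: le_trans h1.
  by rewrite le_eqVlt; apply/orP; left; apply/eqP; ring.
have kq : q ^+ k = tau x k ^+ m * (k.+1%:R ^+ m * x ^+ k).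
  rewrite -xq /tau expr_div_n mulrA divfK ?expf_neq0 ?pnatr_eq0// -!exprM -exprD.
  by rewrite mulSn addnC [(k * m)%N]mulnC.
rewrite kq (mulrA X); apply: ler_pM => //.
- by rewrite mulr_ge0// exprn_ge0// ltW.
- by rewrite mulr_ge0// exprn_ge0// ltW.
- by have := hK k; rewrite ger0_norm// exprn_ge0.
Qed.

Lemma expansion f z : lambda_analytic lambda f -> disk z -> f z = F (coef f) z.
Proof.
move=> hf Dz; have hb := subexp_coef hf.
have hg := lambda_analytic_PS l0 hb; set g := F _ in hg *.
have cf : continuous_on_disk f by case: hf => -[].
have cg : continuous_on_disk g by case: hg => -[].
have [s /andP[s0 s1] zs] : exists2 s : R, 0 < s < 1 & normc z ^+ 2 < s.
  by apply: between_lt1; [exact: sqr_ge0|rewrite expr_lt1 ?nc_ge0].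
(* Level 2 holds by the choice of the coefficients, and [T_rec] lifts it to all higher levels. *)
have hT k a : (1 < a)%N -> T f k a s = T g k a s.
  elim: a => // a IH; rewrite ltnS leq_eqVlt => /predU1P[<-|a1].
    by rewrite coefE// T_PS.
  have c0 : (a.+1 + k.+1)%:R + lambda%:C != 0 :> C.
    rewrite -(RCnat R) -rmorphD -nc_eq0 ncR normr_eq0 gt_eqF// ltr_wpDr//.
  apply: (mulfI c0); rewrite !T_rec// ?(ltnW a1)//; by rewrite IH.
have gS1 := gC_chi s 2.
have gf : gC (fun z => f z * chi s 2 z) by apply: gC_cut s1 cf gS1 _ => w; exact: chi0.
have gg : gC (fun z => g z * chi s 2 z) by apply: gC_cut s1 cg gS1 _ => w; exact: chi0.
have c0 : chi s 2 z != 0 :> C.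
  by rewrite -nc_eq0 /chi ncR normr_eq0 /posn expf_neq0// gt_eqF// lt_max subr_gt0 zs.
apply: (mulIf c0); apply/eqP; rewrite -subr_eq0; apply/eqP.
apply: (@determinacy R lambda l0 (fun z => f z * chi s 2 z - g z * chi s 2 z) (gC_B gf gg) _ z Dz).
move=> i j; have E := nul_mon l0 hf hg s0 s1 hT i j (isT : 1 < 2)%N.
have g1 := gC_mom cf s1 (isT : 0 < 2)%N (gC_mon (R := R) i j).
have g2 := gC_mom cg s1 (isT : 0 < 2)%N (gC_mon (R := R) i j).
transitivity (JC (fun z => f z * (chi s 2 z * (conjc z ^+ j * z ^+ i)) -
    g z * (chi s 2 z * (conjc z ^+ j * z ^+ i)))).
  by congr JC; apply/funext => w; rewrite mulrBl !mulrA.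
by rewrite (JC_B l0 g1 g2); apply/eqP; rewrite subr_eq0; apply/eqP; exact: E.
Qed.

End Series.

(** * Density of the dilates *)

Section PlaneMeasure.
Variable R : realType.
Notation mu := (@lebesgue_measure R).
Notation mu2 := (@lebesgue_measure R \x @lebesgue_measure R)%E.

Lemma plane_sigma_finite : sigma_finite setT mu2.
Proof.
have /sigma_finiteP[F [TF ndF Foo]] := @sigma_finiteT _ _ _ mu.
exists (fun n => F n `*` F n).
  rewrite -setXTT TF predeqE => -[x y]; split.
    move=> [/= [n _ Fnx] [k _ Gky]]; exists (maxn n k) => //; split.
      by move: x Fnx; exact/subsetPset/ndF/leq_maxl.
    by move: y Gky; exact/subsetPset/ndF/leq_maxr.
  by move=> [n _ []/= ? ?]; split; exists n.
move=> k; have [? ?] := Foo k.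
split; first exact: measurableX.
by rewrite product_measure1E// lte_mul_pinfty// ge0_fin_numE.
Qed.

(* The library has this sigma-finiteness only as a local fact, hence the alias. *)
Definition plane_measure := mu2.
HB.instance Definition _ := Measure.on plane_measure.
HB.instance Definition _ :=
  Measure_isSigmaFinite.Build _ _ _ plane_measure plane_sigma_finite.

Variable f : R * (R * R) -> \bar R.
Hypotheses (mf : measurable_fun setT f) (f0 : forall z, (0 <= f z)%E).

Lemma line_plane_tonelli :
  (\int[mu]_x \int[mu2]_q f (x, q) = \int[mu2]_q \int[mu]_x f (x, q))%E.
Proof. exact: (@fubini_tonelli _ _ _ _ R mu plane_measure f mf f0). Qed.

Lemma measurable_plane_section : measurable_fun setT (fun x => \int[mu2]_q f (x, q))%E.
Proof. exact: (@measurable_fun_fubini_tonelli_F _ _ _ _ R plane_measure f mf f0). Qed.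

Lemma measurable_line_section : measurable_fun setT (fun q => \int[mu]_x f (x, q))%E.
Proof. exact: (@measurable_fun_fubini_tonelli_G _ _ _ _ R mu f mf f0). Qed.

End PlaneMeasure.

(** * Scaling, and averages over the radius of dilation *)

Section Averaging.
Variable R : realType.
Notation C := R[i].
Notation mu := (@lebesgue_measure R).
Notation mu2 := (@lebesgue_measure R \x @lebesgue_measure R)%E.
Variable alpha : R.
Hypothesis a0 : 0 < alpha.

Lemma scale_plane (r : R) (G : R * R -> \bar R) : 0 < r -> measurable_fun setT G ->
  (forall q, 0 <= G q)%E ->
  (\int[mu2]_q G (r * q.1, r * q.2)%R = (r^-1 * r^-1)%:E * \int[mu2]_q G q)%E.
Proof.
move=> r0 mG G0.
have ms : measurable_fun setT (fun q : R * R => (r * q.1, r * q.2)).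
  have h1 : measurable_fun setT (fst : R * R -> R) := measurable_fst.
  have h2 : measurable_fun setT (snd : R * R -> R) := measurable_snd.
  by apply: measurable_fun_pair; [exact: (measurable_funM (measurable_cst r) h1)
    |exact: (measurable_funM (measurable_cst r) h2)].
rewrite fubini_tonelli1//; last exact: (measurableT_comp mG ms).
rewrite fubini_tonelli1// EFinM -muleA.
have mF := @measurable_fun_fubini_tonelli_F _ _ _ _ R mu G mG G0.
have F0 x : (0 <= fubini_F mu G x)%E by apply: integral_ge0.
have := ge0_integral_affine 0 r0 mF F0.
under [X in X = _ -> _]eq_integral do rewrite addr0.
move=> <-.
rewrite -ge0_integralZl//; first last.
- by rewrite lee_fin invr_ge0 ltW.
- apply: (measurableT_comp mF); exact: measurable_funM.
apply: eq_integral => x _; rewrite /fubini_F.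
have mGx : measurable_fun setT (fun y => G (r * x, y)) by exact: (measurableT_comp mG (measurable_pair1 _)).
have := @ge0_integral_affine R r 0 (fun y => G (r * x, y)) r0 mGx (fun y => G0 _).
by under [X in X = _ -> _]eq_integral do rewrite addr0.
Qed.

(** Truncated at 0, so that kk (r - |q|) is the radial weight of the disk of radius r, extended by
    0. *)
Definition kk (u : R) : R := if 0 < u then u `^ (alpha - 1) else 0.

Lemma kk_ge0 u : 0 <= kk u. Proof. by rewrite /kk; case: ifP => // _; exact: powR_ge0. Qed.

Lemma measurable_kk : measurable_fun setT kk.
Proof.
rewrite (_ : kk = (fun u : R => u `^ (alpha - 1)) \_ `]0, +oo[).
  apply/(measurable_restrictT _ _).1; first exact: measurable_itv.
  by apply: measurable_funTS; exact: measurable_powR.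
by apply/funext => u; rewrite /kk patchE mem_setE in_itv/= andbT.
Qed.

Definition Kavg : R := 2 / alpha + 2 `^ `|alpha - 1|.

Lemma Kavg_gt0 : 0 < Kavg.
Proof. by rewrite addr_gt0 ?divr_gt0// powR_gt0. Qed.

(** Let d = 1 - w. If d <= 2 (1 - rho), the power is integrated over all of (0, d). Otherwise r - w
    stays between d / 2 and d, and the integrand is comparable to d^(alpha-1). [Kavg] adds the two
    constants. *)
Lemma int_kk (rho w : R) : rho < 1 -> w < 1 ->
  (\int[mu]_(r in `]rho, 1%R[) (kk (r - w))%:E <= (Kavg * (1 - rho) * (1 - w) `^ (alpha - 1))%:E)%E.
Proof.
move=> r1 w1; pose d := 1 - w; have d0 : 0 < d by rewrite subr_gt0.
have mk : measurable_fun setT (fun r : R => (kk (r - w))%:E).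
  by apply/measurable_EFinP; apply: (measurableT_comp measurable_kk); exact: measurable_funB.
have p0 : 0 <= 2 `^ `|alpha - 1| :> R by exact: powR_ge0.
have rr : 0 <= 1 - rho by rewrite subr_ge0 ltW.
have [dl|dg] := leP d (2 * (1 - rho)).
  pose F := ((fun u : R => (u `^ (alpha - 1))%:E) \_ `]0%R, d[)%classic.
  have mF : measurable_fun setT F.
    apply/(measurable_restrictT _ _).1; first exact: measurable_itv.
    exact: measurable_powRe.
  have F0 u : (0 <= F u)%E by rewrite /F patchE; case: ifP => // _; rewrite lee_fin powR_ge0.
  have e := @ge0_integral_affine R 1 (- w) F ltr01 mF F0.
  apply: (@le_trans _ _ (\int[mu]_r F (1 * r + - w)%R)%E).
    rewrite integral_mkcond; apply: ge0_le_integral => //.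
    - by move=> r _; rewrite patchE; case: ifP => // _; rewrite lee_fin kk_ge0.
    - by apply/(measurable_restrictT _ _).1; [exact: measurable_itv|exact: measurable_funTS].
    - apply: (measurableT_comp mF); apply: measurable_funD => //.
    move=> r _; rewrite patchE; case: ifP => // h; rewrite mul1r /F patchE.
    move: h; rewrite inE/= in_itv/= => /andP[h1 h2]; rewrite /kk.
    case: ifP => u0; last by case: ifP => // _; rewrite lee_fin powR_ge0.
    by rewrite ifT// inE/= in_itv/= u0/= /d ltrD2r.
  rewrite e invr1 mul1e /F -integral_mkcond; apply: le_trans (int_powR0 a0 d0) _.
  rewrite lee_fin -/d.
  have -> : d `^ alpha = d * d `^ (alpha - 1).
    by rewrite -{2}(powRr1 (ltW d0)) -powR_add// addrC subrK.
  have -> : d * d `^ (alpha - 1) / alpha = d / alpha * d `^ (alpha - 1) by ring.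
  apply: ler_wpM2r; first exact: powR_ge0.
  apply: (@le_trans _ _ (2 / alpha * (1 - rho))).
    by rewrite mulrAC ler_wpM2r// invr_ge0 ltW.
  by rewrite ler_wpM2r// lerDl.
pose c := 2 `^ `|alpha - 1| * d `^ (alpha - 1).
have c0 : 0 <= c by rewrite mulr_ge0// powR_ge0.
apply: (@le_trans _ _ (\int[mu]_(r in `]rho, 1%R[) c%:E)%E).
  apply: ge0_le_integral => //.
  - by move=> r _; rewrite lee_fin kk_ge0.
  - exact: measurable_funTS.
  move=> r; rewrite /= in_itv/= => /andP[h1 h2]; rewrite lee_fin /kk; case: ifP => // u0.
  apply: powR_comparable => //; [by rewrite ler1n|rewrite ler_pdivrMr//|]; rewrite /d in dg *; lra.
rewrite integral_cst//= lebesgue_measure_itv/= lte_fin r1 -EFinB -EFinM lee_fin -/d /c.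
rewrite mulrAC; apply: ler_wpM2r; first exact: powR_ge0.
by rewrite ler_wpM2r// lerDr divr_ge0// ltW.
Qed.

Notation rad q := (normc (q.1 +i* q.2)).

Lemma measurable_rad : measurable_fun setT (fun q : R * R => rad q).
Proof.
apply: cont_measurable => [q _|q _ e e0]; first by exists 1.
exists (e / 2); first by rewrite divr_gt0.
move=> q' h1 h2; apply: le_lt_trans (_ : normc ((q'.1 +i* q'.2) - (q.1 +i* q.2)) < e).
  rewrite ler_norml; apply/andP; split.
    rewrite lerNl opprB nc_distC; exact: nc_lerB.
  exact: nc_lerB.
by apply: le_lt_trans (nc_le_ReIm _) _ => /=; rewrite [e]splitr ltrD.
Qed.

(* When alpha < 1 the weight (r - |q|)^(alpha - 1) of a single dilate is not controlled near
   |q| = r; its mean over r is at most a multiple of (1 - |q|)^(alpha - 1). *)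
Lemma average_bound (g : R * R -> R) (rho B : R) : rho < 1 ->
  measurable_fun setT g -> (forall q, 0 <= g q) -> (forall q, g q != 0 -> rad q < 1) ->
  (\int[mu2]_q (g q * (1 - rad q) `^ (alpha - 1))%:E < B%:E)%E ->
  exists2 r, rho < r < 1 & (\int[mu2]_q (kk (r - rad q) * g q)%:E <= (Kavg * B)%:E)%E.
Proof.
move=> r1 mg g0 gs hB.
have mk : measurable_fun setT (fun z : R * (R * R) => (kk (z.1 - rad z.2) * g z.2)%:E).
  apply/measurable_EFinP; apply: measurable_funM.
    apply: (measurableT_comp measurable_kk); apply: measurable_funB; first exact: measurable_fst.
    by apply: (measurableT_comp measurable_rad); exact: measurable_snd.
  by apply: (measurableT_comp mg); exact: measurable_snd.
pose f (z : R * (R * R)) : \bar R := (\1_(`]rho, 1[%classic) z.1 * (kk (z.1 - rad z.2) * g z.2))%:E.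
have mf : measurable_fun setT f.
  apply/measurable_EFinP; apply: measurable_funM; last exact/measurable_EFinP.
  apply: (measurableT_comp (f := \1_(`]rho, 1[%classic) : R -> R)); last exact: measurable_fst.
  by apply: measurable_indic; exact: measurable_itv.
have f0 z : (0 <= f z)%E by rewrite lee_fin !mulr_ge0 ?kk_ge0.
have B0 : (0 <= \int[mu2]_q (g q * (1 - rad q) `^ (alpha - 1))%:E)%E.
  by apply: integral_ge0 => q _; rewrite lee_fin mulr_ge0 ?powR_ge0.
have B1 : 0 < B by rewrite -lte_fin; exact: le_lt_trans hB.
have up : (\int[mu]_r \int[mu2]_q f (r, q) < (Kavg * (1 - rho) * B)%:E)%E.
  have kr0 : 0 < Kavg * (1 - rho) by rewrite mulr_gt0 ?Kavg_gt0// subr_gt0.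
  rewrite (line_plane_tonelli mf f0).
  apply: (@le_lt_trans _ _ ((Kavg * (1 - rho))%:E * \int[mu2]_q (g q * (1 - rad q) `^ (alpha - 1))%:E)%E).
    rewrite -ge0_integralZl//; first last.
    - by rewrite lee_fin ltW.
    - by move=> q _; rewrite lee_fin mulr_ge0 ?powR_ge0.
    - apply/measurable_EFinP; apply: measurable_funM => //.
      apply: (@measurableT_comp _ _ _ _ _ _ (fun t : R => t `^ (alpha - 1))).
        exact: measurable_powR.
      by apply: measurable_funB => //; exact: measurable_rad.
    apply: ge0_le_integral => //.
    - by move=> q _; apply: integral_ge0.
    - exact: (measurable_line_section mf f0).
    - apply/measurable_EFinP; apply: measurable_funM => //; apply: measurable_funM => //.
      apply: (@measurableT_comp _ _ _ _ _ _ (fun t : R => t `^ (alpha - 1))).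
        exact: measurable_powR.
      by apply: measurable_funB => //; exact: measurable_rad.
    move=> q _; have [gq|gq] := eqVneq (g q) 0.
      rewrite integral0_eq => [|r _]; last by rewrite /f /= gq !mulr0.
      by rewrite gq mul0r mule0.
    have w1 := gs q gq.
    have -> : (\int[mu]_r f (r, q) = (g q)%:E * \int[mu]_(r in `]rho, 1%R[) (kk (r - rad q))%:E)%E.
      rewrite [in RHS]integral_mkcond -ge0_integralZl//; last 3 first.
      - apply/(measurable_restrictT _ _).1; first exact: measurable_itv.
        apply: measurable_funTS; apply/measurable_EFinP; apply: (measurableT_comp measurable_kk).
        exact: measurable_funB.
      - by move=> r _; rewrite patchE; case: ifP => // _; rewrite lee_fin kk_ge0.
      - by rewrite lee_fin.
      apply: eq_integral => r _; rewrite /f /= patchE indicE.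
      by case: ifP => _; rewrite ?mul1r ?mul0r ?mule0// -EFinM mulrC.
    apply: (@le_trans _ _ ((g q)%:E * (Kavg * (1 - rho) * (1 - rad q) `^ (alpha - 1))%:E)%E).
      by apply: lee_wpmul2l; [rewrite lee_fin|exact: int_kk].
    by rewrite -!EFinM lee_fin le_eqVlt; apply/orP; left; apply/eqP; ring.
  by rewrite [X in (_ < X)%E]EFinM lte_pmul2l// ?lte_fin.
(* If every r in (rho, 1) violated the bound, integrating over r would contradict the strict bound
   [up]. *)
apply: contrapT => hn.
have big r : rho < r < 1 -> ((Kavg * B)%:E < \int[mu2]_q (kk (r - rad q) * g q)%:E)%E.
  by move=> hr; rewrite ltNge; apply/negP => h; apply: hn; exists r.
have KB : 0 <= Kavg * B by rewrite mulr_ge0 ?(ltW Kavg_gt0)// ltW.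
suff : ((Kavg * (1 - rho) * B)%:E <= \int[mu]_r \int[mu2]_q f (r, q))%E by rewrite leNgt up.
apply: (@le_trans _ _ (\int[mu]_(r in `]rho, 1%R[) (Kavg * B)%:E)%E).
  rewrite integral_cst//= lebesgue_measure_itv/= lte_fin r1 -EFinB -EFinM lee_fin.
  by rewrite le_eqVlt; apply/orP; left; apply/eqP; ring.
rewrite integral_mkcond; apply: ge0_le_integral => //.
- by move=> r _; rewrite patchE; case: ifP => // _; rewrite lee_fin.
- by apply/(measurable_restrictT _ _).1; [exact: measurable_itv|exact: measurable_cst].
- exact: (measurable_plane_section mf f0).
move=> r _; rewrite patchE; case: ifP => hr; last by apply: integral_ge0.
move: (hr); rewrite inE/= in_itv/= => hr'; apply: le_trans (ltW (big r hr')) _.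
rewrite le_eqVlt; apply/orP; left; apply/eqP; apply: eq_integral => q _.
by rewrite /f /= indicE hr mul1r.
Qed.

End Averaging.

(** * Approximation by dilates *)

Section Density.
Variable R : realType.
Notation C := R[i].
Notation mu2 := (@lebesgue_measure R \x @lebesgue_measure R)%E.
Variables (p lambda alpha : R).
Hypotheses (l0 : 0 <= lambda) (p0 : 0 < p) (a0 : 0 < alpha).
Notation cc := (c_const lambda).
Notation BI := (bergman_integral p lambda alpha).
Notation bi := (bint p lambda alpha).
Notation F b := (PS (phic lambda b)).
Notation rad q := (normc (q.1 +i* q.2)).
Notation dil b r := (fun k : nat => b k * (r ^+ k)%:C).

Let pn0 k : 0 <= pn lambda k. Proof. exact: ltW (pn_gt0 l0 k). Qed.

Lemma phi_scale n (r : R) z : phi lambda n (r%:C * z) = (r ^+ n)%:C * phi lambda n z.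
Proof.
rewrite !phiE mulrCA; congr (_ * _); rewrite /SS /hterm mulr_sumr; apply: eq_bigr => j _.
have -> : conjc (r%:C * z) = r%:C * conjc z by case: (z) => x y; apply: complex_eq => /=; ring.
have -> : (r ^+ n)%:C = r%:C ^+ j * r%:C ^+ (n - j) :> C by rewrite RCX -exprD subnKC ?leq_ord.
rewrite !exprMn.
by move: (conjc z) => w; ring.
Qed.

Section Dilation.
Variable b : nat -> C.
Hypothesis hb : subexp (fun k => normc (b k)).

Lemma dil_geoB r : 0 <= r -> r < 1 -> exists K q, geoB lambda (dil b r) K q.
Proof.
move=> r0 r1; have [K [q [K0 q0 q1 h]]] := subexp_geom (subexpM hb (subexp_pn l0)) r0 r1.
exists K, q; split=> // n; apply: le_trans (h n).
rewrite normcM ncR (ger0_norm (exprn_ge0 n r0)) ger0_norm; first by rewrite mulrAC.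
by apply: mulr_ge0; [exact: nc_ge0|exact: pn0].
Qed.

Lemma dil_eq r z : F (dil b r) z = F b (r%:C * z).
Proof.
by rewrite !PS_phic; apply: eq_csum => n; rewrite phi_scale mulrA.
Qed.

Lemma dil_close s : 0 <= s -> s < 1 -> exists2 K, 0 <= K & forall r z, 0 <= r -> r < 1 ->
  normc z <= s -> normc (F (dil b r) z - F b z) <= K * (1 - r).
Proof.
move=> s0 s1; have sn := subexpM (@subexp_nat R) (subexpM hb (subexp_pn l0)).
have [K [q [K0 q0 q1 h]]] := subexp_geom sn s0 s1.
exists (2 * K / (1 - q)); first by rewrite divr_ge0 ?mulr_ge0// subr_ge0 ltW.
move=> r z r0 r1 zs; have Dz : disk z by exact: le_lt_trans s1.
have [K' [q' hg]] := dil_geoB r0 r1.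
have g1 : geom (fun n => b n * (r ^+ n)%:C * phi lambda n z) by exists K', q'; exact: geoB_geom_le hg Dz.
have g2 : geom (fun n => b n * phi lambda n z).
  have [K2 [q2 h2]] := geom_hterm (subc_phic l0 hb) Dz; exists K2, q2.
  by case: h2 => k1 k2 k3 k4; split=> // n; rewrite -hterm_phic.
rewrite !PS_phic -csumB//.
have -> : 2 * K / (1 - q) * (1 - r) = 2 * (K * (1 - r)) / (1 - q) by ring.
apply: csum_le; split=> //; first by rewrite mulr_ge0// subr_ge0 ltW.
move=> n.
have -> : b n * (r ^+ n)%:C * phi lambda n z - b n * phi lambda n z =
   b n * (r%:C ^+ n - 1 ^+ n) * phi lambda n z.
  by rewrite RCX expr1n; ring.
have rr : normc (r%:C - 1 : C) = 1 - r.
  have -> : r%:C - 1 = (r - 1)%:C :> C by rewrite rmorphB.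
  by rewrite ncR ler0_norm ?opprB// subr_le0 ltW.
have h1 : normc (r%:C ^+ n - 1 ^+ n : C) <= n.+1%:R * (1 - r).
  apply: le_trans (pow_diff _ _ _) _; rewrite ?nc1 ?ncR ?ger0_norm ?(ltW r1)//.
  by rewrite rr ler_wpM2r ?subr_ge0 ?(ltW r1)// ler_nat.
rewrite (normcM _ (phi _ _ _)) (normcM (b n)); apply: (@le_trans _ _ (normc (b n) * (n.+1%:R * (1 - r)) * (pn lambda n * s ^+ n))).
  apply: ler_pM; [apply: mulr_ge0; exact: nc_ge0|exact: nc_ge0|by rewrite ler_wpM2l ?nc_ge0|].
  by apply: le_trans (phi_le l0 n z) _; rewrite ler_wpM2l// lerXn2r ?nnegrE ?nc_ge0.
have -> : normc (b n) * (n.+1%:R * (1 - r)) * (pn lambda n * s ^+ n) =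
   (n.+1%:R * (normc (b n) * pn lambda n) * s ^+ n) * (1 - r) by ring.
rewrite [leRHS]mulrAC; apply: ler_wpM2r; first by rewrite subr_ge0 ltW.
by apply: le_trans (h n); rewrite ler_wpM2r ?exprn_ge0// ler_norm.
Qed.

End Dilation.

Definition tailf (s : R) (h : R * R -> R) (q : R * R) : R := if s < rad q then h q else 0.

Lemma measurable_tailf s h : measurable_fun (@diskR R) h -> measurable_fun (@diskR R) (tailf s h).
Proof.
move=> mh; have mU : measurable [set q : R * R | s < rad q].
  apply: opn_measurable => q; rewrite /mkset => sq.
  exists ((rad q - s) / 2); first by rewrite divr_gt0// subr_gt0.
  move=> q' h1 h2; rewrite /mkset.
  have : normc ((q'.1 +i* q'.2) - (q.1 +i* q.2)) < rad q - s.
    by apply: le_lt_trans (nc_le_ReIm _) _ => /=; rewrite [ltRHS]splitr ltrD.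
  have := nc_lerB (q.1 +i* q.2) ((q.1 +i* q.2) - (q'.1 +i* q'.2)).
  rewrite subKr nc_distC; lra.
rewrite (_ : tailf s h = h \_ [set q : R * R | s < rad q]); last first.
  by apply/funext => q; rewrite /tailf patchE; case: ifPn => hq; [rewrite ifT// inE|rewrite ifF//; apply/negP; rewrite inE/=; exact/negP].
apply/(measurable_restrict _ mU); first exact: measurable_diskR.
by apply: measurable_funS mh; [exact: measurable_diskR|exact: subIsetl].
Qed.

Lemma tailf_ge0 s h q : (forall q, 0 <= h q) -> 0 <= tailf s h q.
Proof. by move=> h0; rewrite /tailf; case: ifP. Qed.

Lemma tail_small (h : R * R -> R) (e : R) : (forall q, 0 <= h q) -> measurable_fun (@diskR R) h ->
  (\int[mu2]_(q in @diskR R) (h q)%:E < +oo)%E -> 0 < e ->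
  exists2 s, 0 <= s < 1 & (\int[mu2]_(q in @diskR R) (tailf s h q)%:E < e%:E)%E.
Proof.
move=> h0 mh hfin e0.
pose sn (n : nat) : R := 1 - n.+1%:R^-1.
have mD := @measurable_diskR R.
have ih : mu2.-integrable (@diskR R) (EFin \o h).
  apply/integrableP; split; first exact/measurable_EFinP.
  by under eq_integral => q _ do rewrite /= ger0_norm//.
have [||||] := @dominated_convergence _ _ R mu2 (@diskR R) mD
   (fun n q => (tailf (sn n) h q)%:E) (fun=> 0%E) (EFin \o h) _ _ _ ih _.
- by move=> n; apply/measurable_EFinP; exact: measurable_tailf.
- exact: measurable_cst.
- apply: aeW => q Dq; apply: cvg_near_cst.
  have d0 : 0 < 1 - rad q by rewrite subr_gt0.
  near=> n; rewrite /tailf ifF//; apply/negbTE; rewrite -leNgt /sn.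
  have : n.+1%:R^-1 < (PosNum d0)%:num by near: n; exact: near_infty_natSinv_lt.
  by move=> /= hn; rewrite lerBrDr addrC -lerBrDr ltW.
- apply: aeW => q n Dq; rewrite lee_fin ger0_norm ?tailf_ge0// /tailf.
  by case: ifP.
move=> _ _; rewrite integral0 => /fine_cvgP[h1 /cvgrPdist_lt/(_ e e0) h2].
have [N [hN1 hN2]] := filter_ex (filterI h1 h2).
exists (sn N).
  by rewrite subr_ge0 invf_le1// ler1n/= ltrBlDr ltrDl invr_gt0.
rewrite -[X in (X < _)%E]fineK// lte_fin; move: hN2; rewrite sub0r normrN /=.
by apply: le_lt_trans; exact: ler_norm.
Unshelve. all: by end_near.
Qed.

Section Approximation.
Variable f : C -> C.
Variable b : nat -> C.
Hypotheses (cf : continuous_on_disk f) (hb : subexp (fun k => normc (b k))).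
Hypothesis fE : forall z, disk z -> f z = F b z.
Hypothesis fin : (BI f < +oo)%E.

(** The tail of the integrand of f without its radial weight, extended by 0 to the plane: the form
    [average_bound] takes. *)
Let gw (s : R) (q : R * R) : R := if (rad q < 1) && (s < rad q)
  then normc (f (q.1 +i* q.2)) `^ p * (cc * `|q.2| `^ (2 * lambda)) else 0.

Let gw_ge0 s q : 0 <= gw s q.
Proof.
rewrite /gw; case: ifP => // _; apply: mulr_ge0; first exact: powR_ge0.
by apply: mulr_ge0; [exact: c_const_ge0|exact: powR_ge0].
Qed.

Let measurable_gw s : measurable_fun setT (gw s).
Proof.
pose h := tailf s (fun q => normc (f (q.1 +i* q.2)) `^ p * (cc * `|q.2| `^ (2 * lambda))).
have mh : measurable_fun (@diskR R) h.
  apply: measurable_tailf; apply: measurable_funM; first exact: measurable_modp.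
  by apply: measurable_funM => //; exact: measurable_height.
rewrite (_ : gw s = h \_ (@diskR R)).
  by apply/(measurable_restrictT _ _).1 => //; exact: measurable_diskR.
apply/funext => q; rewrite patchE /gw /h /tailf.
case: ifPn => [/andP[q1 q2]|]; first by rewrite ifT ?q2// inE.
case: ifPn => // /set_mem q1; rewrite negb_and (_ : rad q < 1 = true)//= => /negbTE -> //.
Qed.

Let gw_int s : (\int[mu2]_q (gw s q * (1 - rad q) `^ (alpha - 1))%:E =
  \int[mu2]_(q in @diskR R) (tailf s (bi f) q)%:E)%E.
Proof.
rewrite [RHS]integral_mkcond; apply: eq_integral => q _; rewrite patchE /gw /tailf.
case: ifPn => [/andP[q1 q2]|].
  by rewrite ifT ?q2 ?inE// /bint; congr (_%:E); ring.
rewrite mul0r; case: ifPn => // /set_mem q1; rewrite negb_and (_ : rad q < 1 = true)//=.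
by move=> /negbTE ->.
Qed.

(** The power of 2 bounds the powers of r from the two weights and 4 bounds the Jacobian r^(-2),
    both for 1/2 <= r < 1. *)
Let Cd : R := 2 `^ `|- (alpha - 1 + 2 * lambda)| * 4 * Kavg alpha.

(** Substituting r q for q sends the tail of the dilate into that of f, since r |q| > s1^2 >= s0.
    The weight becomes a power of r - |r q| = r (1 - |q|), the one averaged in [average_bound]. *)
Let dil_average s0 s1 rho (e : R) : s0 <= s1 ^+ 2 -> 0 <= s1 -> s1 <= rho -> 2^-1 <= rho -> rho < 1 ->
  (\int[mu2]_(q in @diskR R) (tailf s0 (bi f) q)%:E < e%:E)%E ->
  exists2 r, rho < r < 1 &
    (\int[mu2]_(q in @diskR R) (tailf s1 (bi (F (dil b r))) q)%:E <= (Cd * e)%:E)%E.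
Proof.
move=> s01 s10 s1r r2 r1; rewrite -gw_int => he.
have gs q : gw s0 q != 0 -> rad q < 1.
  by rewrite /gw; case: ifP => [/andP[]//|]; rewrite eqxx.
have [r /andP[rr r11] hr] := average_bound a0 r1 (measurable_gw s0) (gw_ge0 s0) gs he.
exists r; first by rewrite rr r11.
have r0 : 0 < r by apply: lt_trans rr; apply: lt_le_trans r2; rewrite invr_gt0.
pose G (q : R * R) : \bar R := (kk alpha (r - rad q) * gw s0 q)%:E.
have mG : measurable_fun setT G.
  apply/measurable_EFinP; apply: measurable_funM => //.
  apply: (measurableT_comp (measurable_kk alpha)); apply: measurable_funB => //.
  exact: measurable_rad.
have G0 q : (0 <= G q)%E by rewrite lee_fin mulr_ge0 ?kk_ge0 ?gw_ge0.
pose D : R := 2 `^ `|- (alpha - 1 + 2 * lambda)|.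
have D0 : 0 <= D by exact: powR_ge0.
have ms : measurable_fun setT (fun q : R * R => (r * q.1, r * q.2)).
  have h1 : measurable_fun setT (fst : R * R -> R) := measurable_fst.
  have h2 : measurable_fun setT (snd : R * R -> R) := measurable_snd.
  by apply: measurable_fun_pair; [exact: (measurable_funM (measurable_cst r) h1)
    |exact: (measurable_funM (measurable_cst r) h2)].
apply: (@le_trans _ _ (\int[mu2]_q (D%:E * G (r * q.1, r * q.2)%R))%E).
  rewrite integral_mkcond; apply: ge0_le_integral => //.
  - move=> q _; rewrite patchE; case: ifP => // _; rewrite lee_fin; apply: tailf_ge0 => {}q.
    exact: bint_ge0.
  - apply/(measurable_restrictT _ _).1; first exact: measurable_diskR.
    apply/measurable_EFinP; apply: measurable_tailf; apply: measurable_bint.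
    by have [K [q hq]] := dil_geoB hb (ltW r0) r11; exact: PS_cont hq.
  - apply: emeasurable_funM => //; exact: (measurableT_comp mG ms).
  move=> q _; rewrite patchE; case: ifPn => [/set_mem Dq|_]; last first.
    by rewrite mule_ge0// lee_fin.
  rewrite /tailf; case: ifPn => q1; last by rewrite mule_ge0// lee_fin.
  have radr : rad (r * q.1, r * q.2) = r * rad q.
    have -> : (r * q.1, r * q.2).1 +i* (r * q.1, r * q.2).2 = r%:C * (q.1 +i* q.2).
      by apply: complex_eq => /=; ring.
    by rewrite normcM ncR gtr0_norm.
  have q0 : 0 < rad q by exact: le_lt_trans q1.
  have Dq' : rad q < 1 by [].
  have rq1 : r * rad q < r by rewrite gtr_pMr.
  have rq2 : r * rad q < 1 by exact: lt_trans rq1 r11.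
  rewrite /G /gw radr rq2 /=.
  have -> : s0 < r * rad q.
    apply: le_lt_trans s01 _; rewrite expr2; apply: ltr_pM => //.
    exact: le_lt_trans s1r rr.
  rewrite /kk subr_gt0 rq1.
  have -> : r - r * rad q = r * (1 - rad q) by ring.
  have d0 : 0 < 1 - rad q by rewrite subr_gt0.
  have rc : (r * q.1) +i* (r * q.2) = r%:C * (q.1 +i* q.2) by apply: complex_eq => /=; ring.
  rewrite rc -EFinM lee_fin /bint dil_eq.
  have Drz : disk (r%:C * (q.1 +i* q.2)) by rewrite /disk/mkset normcM ncR gtr0_norm.
  rewrite (fE Drz) normrM (gtr0_norm r0) !powRM ?(ltW r0) ?(ltW d0)//.
  set X := normc _ `^ p.
  have dD : 1 <= D * (r `^ (alpha - 1) * r `^ (2 * lambda)).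
    rewrite -powR_add// -ler_pdivrMr ?powR_gt0// mul1r -powRN.
    have hc : r `^ (- (alpha - 1 + 2 * lambda)) <= D * 1 `^ (- (alpha - 1 + 2 * lambda)).
      apply: powR_comparable => //; first by rewrite ler1n.
        by rewrite mul1r ltW// (le_lt_trans r2).
      by apply: le_trans (ltW r11) _; rewrite mulr1 ler1n.
    by rewrite powR1 mulr1 in hc.
  have Y0 : 0 <= X * (1 - rad q) `^ (alpha - 1) * (cc * `|q.2| `^ (2 * lambda)).
    apply: mulr_ge0; first by apply: mulr_ge0; exact: powR_ge0.
    by apply: mulr_ge0; [exact: c_const_ge0|exact: powR_ge0].
  apply: le_trans (ler_peMl Y0 dD) _; rewrite le_eqVlt; apply/orP; left; apply/eqP.
  clear Y0; clearbody X D.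
  by move: (r `^ (alpha - 1)) (r `^ (2 * lambda)) ((1 - rad q) `^ _) (`|q.2| `^ _) cc => ? ? ? ? ?; ring.
rewrite ge0_integralZl_EFin//; last exact: (measurableT_comp mG ms).
rewrite (scale_plane r0 mG G0) /Cd -/D.
have e0 : 0 <= Kavg alpha * e.
  by rewrite -lee_fin; apply: le_trans hr; apply: integral_ge0 => q _; exact: G0.
apply: (@le_trans _ _ (D%:E * (4%:E * (Kavg alpha * e)%:E))%E).
  apply: lee_wpmul2l; first by rewrite lee_fin.
  apply: lee_pmul => //.
  - by rewrite lee_fin mulr_ge0 ?invr_ge0 ?(ltW r0).
  - by apply: integral_ge0.
  have hi : r^-1 <= 2.
    by rewrite -[leRHS]invrK lef_pV2 ?posrE ?invr_gt0// ltW// (le_lt_trans r2).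
  rewrite lee_fin (_ : 4 = 2 * 2); last by ring.
  by apply: ler_pM => //; rewrite invr_ge0 ltW.
by rewrite -!EFinM lee_fin le_eqVlt; apply/orP; left; apply/eqP; ring.
Qed.

Lemma dilation_dense (e : R) : 0 < e -> exists K q b', geoB lambda b' K q /\
  (BI (fun z => (F b' z - f z)%R) <= e%:E)%E.
Proof.
move=> e0.
have [W W0 hW] := @BI_bounded R p lambda alpha l0 p0 a0.
have Cd0 : 0 <= Cd.
  by rewrite /Cd mulr_ge0 ?(ltW (Kavg_gt0 a0))// mulr_ge0// powR_ge0.
have P0 : 0 < 2 `^ p :> R by exact: powR_gt0.
pose e1 := e / (4 * (2 `^ p) * (Cd + 1)).
have e10 : 0 < e1 by rewrite divr_gt0// !mulr_gt0// ltr_wpDl.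
have [s0 /andP[s00 s01] ht] := tail_small (bint_ge0 p lambda alpha f) (measurable_bint p lambda alpha cf) fin e10.
(* A square root, so that r > s1 and |q| > s1 together force r |q| > s0. *)
pose s1 := Num.sqrt s0.
have s10 : 0 <= s1 by exact: sqrtr_ge0.
have s12 : s1 ^+ 2 = s0 by rewrite sqr_sqrtr.
have s11 : s1 < 1 by rewrite -sqrtr1 ltr_sqrt.
have s0s1 : s0 <= s1 by rewrite -s12 expr2 ler_piMl// ltW.
pose eta := (e / (2 * (2 `^ p) * W)) `^ p^-1.
have q0 : 0 < e / (2 * (2 `^ p) * W) by rewrite divr_gt0// !mulr_gt0.
have eta0 : 0 < eta by exact: powR_gt0.
have etaE : 2 `^ p * (eta `^ p * W) = e / 2.
  rewrite /eta -powRrM mulVf ?gt_eqF// powRr1 ?(ltW q0)//.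
  by field; rewrite !gt_eqF.
have [K K0 hK] := dil_close hb s10 s11.
pose rho := Num.max (Num.max s1 2^-1) (1 - eta / (K + 1)).
have K1 : 0 < K + 1 by rewrite ltr_wpDl.
have rho1 : rho < 1 by rewrite !gt_max s11 invf_lt1 ?ltr1n//= gtrBl divr_gt0.
have g1 : s1 <= rho by rewrite !le_max lexx.
have g2 : 2^-1 <= rho by rewrite !le_max lexx orbT.
have g3 : 1 - eta / (K + 1) <= rho by rewrite !le_max lexx !orbT.
have s02 : s0 <= s1 ^+ 2 by rewrite s12.
have [r /andP[rr r1] hr] := dil_average s02 s10 g1 g2 rho1 ht.
have r0 : 0 <= r by apply: le_trans (ltW rr); apply: le_trans g2; rewrite invr_ge0.
have [Kq [q hq]] := dil_geoB hb r0 r1.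
exists Kq, q, (dil b r); split=> //.
set h := F (dil b r).
have ch : continuous_on_disk h by exact: PS_cont hq.
have cd : continuous_on_disk (fun z => h z - f z).
  move=> z Dz; apply/continuous_complexP => d d0; have d2 : 0 < d / 2 by rewrite divr_gt0.
  have /continuous_complexP/(_ _ d2)[x x0 hx] := ch z Dz.
  have /continuous_complexP/(_ _ d2)[y y0 hy] := cf Dz.
  exists (Num.min x y); first by rewrite lt_min x0.
  move=> w; rewrite lt_min => /andP[w1 w2].
  have -> : h w - f w - (h z - f z) = (h w - h z) - (f w - f z).
    by move: (h w) (h z) (f w) (f z) => ? ? ? ?; ring.
  by apply: le_lt_trans (ncB _ _) _; rewrite [d]splitr ltrD ?hx ?hy.
pose k1 := bi (fun=> eta%:C); pose k2 := tailf s1 (bi h); pose k3 := tailf s1 (bi f).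
have ce : continuous_on_disk (fun=> eta%:C : C).
  by move=> z _; apply/continuous_complexP => d d0; exists 1 => // w _; rewrite subrr nc0.
have m1 : measurable_fun (@diskR R) k1 by exact: measurable_bint.
have m2 : measurable_fun (@diskR R) k2 by apply: measurable_tailf; exact: measurable_bint.
have m3 : measurable_fun (@diskR R) k3 by apply: measurable_tailf; exact: measurable_bint.
have n1 q' : 0 <= k1 q' by exact: bint_ge0.
have n2 q' : 0 <= k2 q' by apply: tailf_ge0 => ?; exact: bint_ge0.
have n3 q' : 0 <= k3 q' by apply: tailf_ge0 => ?; exact: bint_ge0.
have m23 : measurable_fun (@diskR R) (fun q => k2 q + k3 q) by exact: measurable_funD.
have n23 q' : 0 <= k2 q' + k3 q' by exact: addr_ge0.
have m123 : measurable_fun (@diskR R) (fun q => k1 q + (k2 q + k3 q)) by exact: measurable_funD.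
have n123 q' : 0 <= k1 q' + (k2 q' + k3 q') by exact: addr_ge0.
apply: (@le_trans _ _ (\int[mu2]_(q in @diskR R) (2 `^ p * (k1 q + (k2 q + k3 q)))%:E)%E).
  apply: BI_le_int => //; first by apply: measurable_funM => //; exact: measurable_cst.
  move=> q' Dq; have Dz : disk (q'.1 +i* q'.2) by [].
  pose wt := (1 - rad q') `^ (alpha - 1) * (cc * `|q'.2| `^ (2 * lambda)).
  have wt0 : 0 <= wt.
    by apply: mulr_ge0; [exact: powR_ge0|apply: mulr_ge0; [exact: c_const_ge0|exact: powR_ge0]].
  have bE g : bi g q' = normc (g (q'.1 +i* q'.2)) `^ p * wt by rewrite /bint /wt -!mulrA.
  (* Inside radius s1 the dilate is uniformly within eta of f; outside, both are tails, and |u -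
     v|^p <= 2^p (|u|^p + |v|^p) holds for every p > 0. *)
  have [near|far] := leP (rad q') s1.
    apply: (@le_trans _ _ (k1 q')).
      rewrite /k1 !bE; apply: ler_wpM2r => //; apply: powR_le; rewrite ?(ltW p0) ?nc_ge0//.
      rewrite ncR gtr0_norm// (fE Dz); apply: le_trans (hK r _ r0 r1 near) _.
      apply: (@le_trans _ _ ((K + 1) * (eta / (K + 1)))).
        apply: ler_pM => //; [by rewrite subr_ge0 ltW|by rewrite lerDl|].
        by rewrite lerBlDr -lerBlDl (le_trans g3)// ltW.
      by rewrite mulrC mulfVK// gt_eqF.
    apply: (@le_trans _ _ (k1 q' + (k2 q' + k3 q'))); first by rewrite lerDl.
    rewrite ler_peMl//; have h12 : 1 <= 2 :> R by rewrite ler1n.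
    by have := powR_le (ltW p0) ler01 h12; rewrite powR1.
  apply: (@le_trans _ _ (2 `^ p * (k2 q' + k3 q'))); last first.
    by rewrite ler_wpM2l ?(ltW P0)// lerDr.
  rewrite /k2 /k3 /tailf far !bE -mulrDl mulrA; apply: ler_wpM2r => //.
  set u := normc (h _); set v := normc (f _).
  have u0 : 0 <= u by exact: nc_ge0.
  have v0 : 0 <= v by exact: nc_ge0.
  apply: (@le_trans _ _ ((2 * Num.max u v) `^ p)).
    apply: powR_le; rewrite ?(ltW p0) ?nc_ge0//; apply: le_trans (ncB _ _) _.
    have : u <= Num.max u v by rewrite le_max lexx.
    have : v <= Num.max u v by rewrite le_max lexx orbT.
    by rewrite /u /v; lra.
  rewrite powRM ?le_max ?u0// ler_wpM2l ?(ltW P0)//.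
  by case: (leP u v) => _; rewrite ?lerDr ?lerDl powR_ge0.
rewrite dint_scale ?(ltW P0)// dint_add// dint_add//.
apply: (@le_trans _ _ ((2 `^ p)%:E * ((eta `^ p * W)%:E + ((Cd * e1)%:E + e1%:E)))%E).
  apply: lee_wpmul2l; first by rewrite lee_fin ltW.
  apply: leeD.
    rewrite -BIE; apply: hW => //; first exact: ltW.
    by move=> z _; rewrite ncR gtr0_norm.
  apply: leeD => //; apply: le_trans (ltW ht).
  apply: ge0_le_integral => //.
  - exact: measurable_diskR.
  - by move=> q' _; rewrite lee_fin.
  - exact/measurable_EFinP.
  - by apply/measurable_EFinP; apply: measurable_tailf; exact: measurable_bint.
  move=> q' _; rewrite lee_fin /k3 /tailf; case: ifPn => h1.
    by rewrite (le_lt_trans s0s1 h1).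
  by case: ifP => // _; exact: bint_ge0.
rewrite -!EFinD -EFinM lee_fin mulrDr etaE.
have -> : 2 `^ p * (Cd * e1 + e1) = e / 4.
  by rewrite /e1; field; rewrite !gt_eqF// ltr_wpDl.
by rewrite [leRHS]splitr lerD2l ler_pM2l// lef_pV2 ?posrE// ler_nat.
Qed.

End Approximation.

End Density.

(** * Functionals and functions determined by their coefficients *)

Section Determined.
Variable R : realType.
Notation C := R[i].
Variables (p lambda alpha : R).
Hypotheses (l0 : 0 <= lambda) (p0 : 0 < p) (a0 : 0 < alpha).
Notation BI := (bergman_integral p lambda alpha).
Notation F b := (PS (phic lambda b)).

Lemma dual_approx L f (e : R) : bergman_dual p lambda alpha L -> bergman p lambda alpha f ->
  0 < e -> exists2 d : R, 0 < d & forall b K q, geoB lambda b K q ->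
    (BI (fun z => (F b z - f z)%R) <= d%:E)%E -> normc (L (F b) - L f) < e.
Proof.
move=> hL hf e0; have [d d0 hd] := hL.2 f hf e e0.
exists ((d / 2) `^ p); first by rewrite powR_gt0 ?divr_gt0.
move=> b K q hb h; apply: hd; first exact: bergman_geoB hb.
have B0 := @BI_ge0 R p lambda alpha (fun z => F b z - f z).
have h' : fine (BI (fun z => (F b z - f z)%R)) <= (d / 2) `^ p.
  rewrite -lee_fin fineK// ge0_fin_numE//; exact: le_lt_trans h (ltry _).
rewrite /bergman_norm; apply: (@le_lt_trans _ _ (((d / 2) `^ p) `^ p^-1)).
  by apply: powR_le => //; [rewrite invr_ge0 ltW|rewrite fine_ge0].
rewrite -powRrM mulfV ?gt_eqF// powRr1 ?divr_ge0 ?ltW//.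
by rewrite ltr_pdivrMr// ltr_pMr// ltr1n.
Qed.

(** One approximant must serve both functionals: it is taken within the smaller of the two
    tolerances, and on it [ell_csum] expresses both functionals through the same numbers. *)
Lemma dual_determined L1 L2 f : bergman_dual p lambda alpha L1 -> bergman_dual p lambda alpha L2 ->
  (forall k, L1 (F (dlt R k)) = L2 (F (dlt R k))) -> bergman p lambda alpha f -> L1 f = L2 f.
Proof.
move=> h1 h2 E hf; apply/eqP; rewrite -subr_eq0 -nc_eq0 eq_le nc_ge0 andbT.
apply/ler_addgt0Pr => e e0; rewrite add0r; have e2 : 0 < e / 2 by rewrite divr_gt0.
have [d1 d10 hd1] := dual_approx h1 hf e2; have [d2 d20 hd2] := dual_approx h2 hf e2.
have [ha fin] := hf; have cf : continuous_on_disk f by case: ha => -[].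
have d0 : 0 < Num.min d1 d2 by rewrite lt_min d10.
have [K [q [b [hb hB]]]] := dilation_dense l0 p0 a0 cf (subexp_coef l0 ha)
  (fun z Dz => expansion l0 ha Dz) fin d0.
have b1 : (BI (fun z => (F b z - f z)%R) <= d1%:E)%E.
  by apply: le_trans hB _; rewrite lee_fin ge_min lexx.
have b2 : (BI (fun z => (F b z - f z)%R) <= d2%:E)%E.
  by apply: le_trans hB _; rewrite lee_fin ge_min lexx orbT.
have Eb : L1 (F b) = L2 (F b).
  rewrite (ell_csum l0 p0 a0 h1 hb) (ell_csum l0 p0 a0 h2 hb).
  by apply: eq_csum => n; rewrite E.
have -> : L1 f - L2 f = (L2 (F b) - L2 f) - (L1 (F b) - L1 f) by rewrite Eb; ring.
by rewrite ltW// (le_lt_trans (ncB _ _))// [e]splitr ltrD ?(hd1 _ _ _ hb)// (hd2 _ _ _ hb).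
Qed.

(** The terms of the convergent series at the real point q are bounded, and phi_n(q) = eps n pn n
    q^n with eps n pn n >= 1. *)
Lemma phi_expansion_subexp g b : phi_expansion lambda g b -> subexp (fun k => normc (b k)).
Proof.
move=> hg q q0 q1; have Dq : disk q%:C by rewrite /disk/mkset ncR gtr0_norm.
have /cvg_complexP h := hg _ Dq; have [N hN] := h 1 ltr01.
pose u n := b n * phi lambda n q%:C.
have small n : (N <= n)%N -> normc (u n) <= 2.
  move=> Nn; have a1 := hN n Nn; have a2 := hN n.+1 (leqW Nn).
  have -> : u n = (g q%:C - \sum_(0 <= k < n) b k * phi lambda k q%:C) -
      (g q%:C - \sum_(0 <= k < n.+1) b k * phi lambda k q%:C).
    by rewrite big_nat_recr//= /u; ring.
  by apply: le_trans (ncB _ _) _; rewrite (_ : 2 = 1 + 1); [rewrite lerD// ltW|].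
exists (2 + \sum_(k < N) normc (u k)); first by rewrite addr_ge0// sumr_ge0// => k _; exact: nc_ge0.
move=> n; rewrite ger0_norm ?nc_ge0//; apply: (@le_trans _ _ (normc (u n))).
  have e0 := eps_gt0 l0 n; have n0 := pn_gt0 l0 n.
  rewrite /u phi_real normcM ncR ler_wpM2l ?nc_ge0//.
  have ep : 1 <= eps lambda n * pn lambda n.
    have := eps_le1 l0 n; rewrite -{1}(eps_sqr l0 n) expr2 => h'.
    by rewrite -(ler_pM2l e0) mulr1 mulrA -expr2 eps_sqr ?eps_le1.
  rewrite ger0_norm; first by rewrite ler_peMl// exprn_ge0// ltW.
  by apply: mulr_ge0; [exact: le_trans ler01 ep|rewrite exprn_ge0// ltW].
have [Nn|nN] := leqP N n.
  by apply: le_trans (small n Nn) _; rewrite lerDl sumr_ge0// => k _; exact: nc_ge0.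
rewrite (bigD1 (Ordinal nN))//= ler_wpDl// lerDl sumr_ge0// => k _; exact: nc_ge0.
Qed.

Lemma phi_expansion_sum g b z : phi_expansion lambda g b -> disk z -> g z = F b z.
Proof.
move=> hg Dz; have hb := phi_expansion_subexp hg.
have h1 := hg z Dz; have h2 := phi_expansion_PS l0 hb Dz.
move/cvg_complexP: h1 => h1; move/cvg_complexP: h2 => h2.
apply/eqP; rewrite -subr_eq0 -nc_eq0 eq_le nc_ge0 andbT.
apply/ler_addgt0Pr => e e0; rewrite add0r; have e2 : 0 < e / 2 by rewrite divr_gt0.
have [N hN] := h1 _ e2; have [M hM] := h2 _ e2.
have a1 := hN (maxn N M) (leq_maxl _ _); have a2 := hM (maxn N M) (leq_maxr _ _).
move: a1 a2; move: (\sum_(0 <= k < _) _) => S a1 a2.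
have -> : g z - F b z = (g z - S) - (F b z - S) by ring.
by rewrite ltW// (le_lt_trans (ncB _ _))// [e]splitr ltrD.
Qed.

(** Two instances of [represents] bring their own coefficients for the same g; the moment [T]
    isolates the k-th one, so they agree. *)
Lemma phi_expansion_unique g b b' : phi_expansion lambda g b -> phi_expansion lambda g b' -> b =1 b'.
Proof.
move=> h h' k; have hb := phi_expansion_subexp h; have hb' := phi_expansion_subexp h'.
have x0 : 0 < 2^-1 :> R by rewrite invr_gt0.
have x1 : 2^-1 < 1 :> R by rewrite invf_lt1// ltr1n.
have : T lambda (F b) k 2 2^-1 = T lambda (F b') k 2 2^-1.
  apply: eq_JC => z _; have [z1|z1] := ltP (normc z) 1.
    by rewrite -(phi_expansion_sum h z1) (phi_expansion_sum h' z1).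
  rewrite chi0 ?mul0r ?mulr0//; apply: le_trans (ltW x1) _.
  by rewrite exprn_ege1.
rewrite !T_PS// => /(mulIf (T_SS_neq0 l0 k x0 x1)) /mulIf; apply.
exact: eps_neq0.
Qed.

End Determined.

Local Close Scope complex_scope.
Local Close Scope classical_set_scope.

Theorem theorem8p4 (R : realType) (lambda p alpha : R)
    (hlambda : 0 <= lambda) (hp0 : 0 < p)
    (hp : 2 * lambda / (2 * lambda + 1) <= p) (hp1 : p <= 1)
    (halpha : 0 < alpha) :
  (forall L : (R[i] -> R[i]) -> R[i], bergman_dual p lambda alpha L ->
     exists2 g : R[i] -> R[i], represents p lambda alpha L g &
       forall h : R[i] -> R[i], represents p lambda alpha L h ->
         forall z : R[i], disk z -> h z = g z) /\
  (forall (L1 L2 : (R[i] -> R[i]) -> R[i]) (g : R[i] -> R[i]),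
     bergman_dual p lambda alpha L1 -> bergman_dual p lambda alpha L2 ->
     represents p lambda alpha L1 g -> represents p lambda alpha L2 g ->
     forall f : R[i] -> R[i], bergman p lambda alpha f -> L1 f = L2 f).
Proof.
split=> [L hL|L1 L2 g h1 h2 [_ _ [b1 e1 r1]] [_ _ [b2 e2 r2]] f hf].
  exists (PS (phic lambda (fun k => L (PS (phic lambda (dlt R k)))))).
    exact: represents_dual.
  by move=> h hh z Dz; apply: represents_unique hh Dz.
apply: (dual_determined hlambda hp0 halpha h1 h2 _ hf) => k.
rewrite -(represents_coef hlambda hp0 halpha h1 e1 r1) -(represents_coef hlambda hp0 halpha h2 e2 r2).
exact: phi_expansion_unique e1 e2 k.
Qed.
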